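(* Let $\psi\in A^2$ with $\|\psi\|_{A^2}=1$, let $\psi^\alpha=V^\alpha\psi$ for $\alpha>-1$, and let $1\le p<\infty$. For every $f\in L^p(\mathbb D,d\lambda)$ we have $$\lim_{\alpha\to\infty}\|B_\alpha^{\psi^\alpha}f-f\|_{L^p(\mathbb T\times\mathbb D)}=0,$$ where $f$ is regarded as a function on $\mathbb T\times\mathbb D$ via $f(e^{i\theta},z)=f(z)$, and $L^p(\mathbb T\times\mathbb D)=L^p(\mathbb T\times\mathbb D,\frac{d\theta}{2\pi}\,d\lambda)$.
   Context: $\mathbb D$ is the open unit disc, $\mathbb T=\partial\mathbb D$, $dA$ is area measure, $d\lambda(z)=\frac{dA(z)}{\pi(1-|z|^2)^2}$ on $\mathbb D$. For $\alpha>-1$, $A_\alpha^2$ is the Hilbert space of analytic functions $u$ on $\mathbb D$ with $\|u\|_{A^2_\alpha}^2=\int_{\mathbb D}|u|^2\,dA_\alpha<\infty$, where $dA_\alpha(z)=\frac{\alpha+1}{\pi}(1-|z|^2)^\alpha dA(z)$; $A^2=A_0^2$. The unitary operator $V^\alpha:A^2\to A_\alpha^2$ is $$V^\alpha\Big(\sum_{n\ge0}a_nz^n\Big)=\sum_{n\ge0}\frac{a_n}{\sqrt{n+1}}\sqrt{\frac{\Gamma(n+\alpha+2)}{n!\,\Gamma(\alpha+2)}}\,z^n.$$ For $z\in\mathbb D$, the unitary operator $U_z^\alpha$ on $A_\alpha^2$ is $$U_z^\alpha u(\zeta)=u(\varphi_z(\zeta))\frac{(1-|z|^2)^{(2+\alpha)/2}}{(1-\bar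 z\zeta)^{2+\alpha}},\qquad\varphi_z(\zeta)=\frac{\zeta-z}{1-\bar z\zeta}$$ (principal branch). Write $u_\theta(\zeta)=u(e^{i\theta}\zeta)$. For $\psi\in A_\alpha^2$, the windowed Berezin transform of a function $f$ on $\mathbb T\times\mathbb D$ is $$B_\alpha^\psi f(e^{i\theta},z)=(\alpha+1)\int_0^{2\pi}\frac{dt}{2\pi}\int_{\mathbb D}f(e^{it},w)\left|\langle U_z^\alpha\psi_\theta,U_w^\alpha\psi_t\rangle_{A_\alpha^2}\right|^2d\lambda(w).$$ *)

(* Defs.v *)
From HB Require Import structures.
From mathcomp Require Import all_boot all_order all_algebra.
From mathcomp Require Import complex.
From mathcomp Require Import all_classical all_reals all_analysis.
From mathcomp Require Import measurable_realfun.

Set Implicit Arguments.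
Unset Strict Implicit.
Unset Printing Implicit Defensive.

Import Order.TTheory GRing.Theory Num.Theory.
Import numFieldNormedType.Exports.
Import Normc.

Local Open Scope classical_set_scope.
Local Open Scope complex_scope.
Local Open Scope ring_scope.

(** [complex_of_pair] identifies R * R, which carries planar Lebesgue measure,
    with R[i]. *)

Section complex_prelude.
Variable R : realType.
Implicit Types (z w : R[i]) (t a : R).

Definition complex_of_pair (p : R * R) : R[i] := p.1 +i* p.2.

Definition expi t : R[i] := cos t +i* sin t.

(** Principal argument, in ]-pi, pi] for w != 0. *)
Definition Arg w : R :=
  let c := acos (complex.Re w / normc w) in if 0 <= complex.Im w then c else - c.

(** Principal branch of w ^ a for a real exponent a. *)
Definition cpow w a : R[i] := (normc w `^ a)%:C * expi (a * Arg w).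

(** Euler's Gamma function, for x > 0. *)
Definition Gamma (x : R) : R :=
  \int[lebesgue_measure]_(t in `]0, +oo[) (t `^ (x - 1) * expR (- t)).

(** [R[i]^o] is R[i] with the topology of its norm. *)
Definition power_series (a : nat -> R[i]) z : nat -> R[i]^o :=
  series (fun n => a n * z ^+ n : R[i]^o).

End complex_prelude.

Section complex_integration.
Context d (T : measurableType d) (R : realType).
Variables (mu : {measure set T -> \bar R}) (D : set T).
Implicit Type f : T -> R[i].

Definition Cmeasurable_fun f :=
  measurable_fun D (fun x => complex.Re (f x)) /\ measurable_fun D (fun x => complex.Im (f x)).

Definition Cintegral f : R[i] :=
  (\int[mu]_(x in D) complex.Re (f x)) +i* (\int[mu]_(x in D) complex.Im (f x)).

Definition CLnorm (p : R) f : \bar R :=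
  'N[mu]_(p%:E)[(fun x => (normc (f x))%:E) \_ D]%E.

Definition in_CLp (p : R) f := Cmeasurable_fun f /\ (CLnorm p f < +oo)%E.

End complex_integration.

Section disc.
Variable R : realType.

Definition unit_disc : set R[i] := [set z | normc z < 1].

Definition disc : set (R * R) := [set p | unit_disc (complex_of_pair p)].

Definition area := (@lebesgue_measure R \x @lebesgue_measure R)%E.

Lemma two_pi_gt0 : 0 < 2 * pi :> R.
Proof. by rewrite mulr_gt0// pi_gt0. Qed.

(** dt / (2 pi) on [0, 2 pi], the circle being parametrized by [expi]. *)
Definition circle_measure : probability _ R := uniform_prob two_pi_gt0.

Definition hyperbolic_density (p : R * R) : R :=
  if p \in disc then
    (pi * (1 - normc (complex_of_pair p) ^+ 2) ^+ 2)^-1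
  else 0.

(** The measure d\lambda, extended by 0 outside the disc. *)
Definition hyperbolic_measure (A : set (R * R)) : \bar R :=
  (\int[area]_(p in A) (hyperbolic_density p)%:E)%E.

End disc.

Section hyperbolic_measure_instance.
Variable R : realType.
Local Notation lambda := (@hyperbolic_measure R).
Local Notation h := (@hyperbolic_density R).

Lemma hyperbolic_density_ge0 p : 0 <= h p.
Proof.
rewrite /hyperbolic_density; case: ifPn => // _.
by rewrite invr_ge0 mulr_ge0 ?pi_ge0// sqr_ge0.
Qed.

Lemma measurable_normc_of_pair :
  measurable_fun setT (fun p : R * R => normc (complex_of_pair p)).
Proof.
rewrite /complex_of_pair /=.
apply: (@measurableT_comp _ _ _ _ _ _ (@Num.sqrt R)).
  by apply: continuous_measurable_fun; exact: sqrt_continuous.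
apply: measurable_funD; apply: measurable_funX;
  [exact: measurable_fst|exact: measurable_snd].
Qed.

Lemma measurable_disc : measurable (@disc R).
Proof.
rewrite -(setTI (@disc R)).
pose g (p : R * R) := normc (complex_of_pair p).
rewrite (_ : @disc R = g @^-1` `]-oo, 1[%classic).
  exact: measurable_normc_of_pair.
by apply/seteqP; split => p /=; rewrite in_itv.
Qed.

Lemma measurable_hyperbolic_density : measurable_fun setT h.
Proof.
rewrite (_ : h = fun p => if p \in @disc R then
    (pi * (1 - normc (complex_of_pair p) ^+ 2) ^+ 2) `^ (-1) else 0); last first.
  by apply/funext => p; rewrite powR_inv1// mulr_ge0 ?pi_ge0// sqr_ge0.
apply: measurable_fun_ifT => //.
  apply: (measurable_fun_bool true); rewrite setTI.
  rewrite (_ : _ @^-1` _ = @disc R); first exact: measurable_disc.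
  by apply/seteqP; split => p /=; [move/set_mem|move/mem_set].
apply: (@measurableT_comp _ _ _ _ _ _ (@powR R ^~ (-1))).
  exact: measurable_powR.
apply: measurable_funM => //; apply: measurable_funX.
apply: measurable_funB => //; apply: measurable_funX.
exact: measurable_normc_of_pair.
Qed.

Let area_sigma_finite : exists2 G : nat -> set (R * R),
  setT = \bigcup_i G i & forall i, measurable (G i) /\ (@area R (G i) < +oo)%E.
Proof.
have /sigma_finiteP[F [TF ndF Foo]] := sigma_finiteT (@lebesgue_measure R).
exists (fun n => F n `*` F n).
  rewrite -setXTT TF predeqE => -[x y]; split.
    move=> [/= [n _ Fnx] [k _ Fky]]; exists (maxn n k) => //; split.
    - by move: x Fnx; exact/subsetPset/ndF/leq_maxl.
    - by move: y Fky; exact/subsetPset/ndF/leq_maxr.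
  by move=> [n _ []/= ? ?]; split; exists n.
move=> k; have [? ?] := Foo k.
split; first exact: measurableX.
by rewrite /area product_measure1E// lte_mul_pinfty// ge0_fin_numE.
Qed.

HB.instance Definition _ := Measure.on (@area R).
HB.instance Definition _ := Measure_isSigmaFinite.Build _ _ _ (@area R)
  area_sigma_finite.

Let lambda0 : lambda set0 = 0%E.
Proof. by rewrite /hyperbolic_measure integral_set0. Qed.

Let lambda_ge0 A : (0 <= lambda A)%E.
Proof.
by apply: integral_ge0 => p _; rewrite lee_fin hyperbolic_density_ge0.
Qed.

Let lambda_sigma_additive : semi_sigma_additive lambda.
Proof.
move=> /= F mF tF mUF; rewrite /hyperbolic_measure; apply: cvg_toP.
  apply: ereal_nondecreasing_is_cvgn => m n mn.
  apply: lee_sum_nneg_natr => // k _ _.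
  by apply: integral_ge0 => p _; rewrite lee_fin hyperbolic_density_ge0.
rewrite ge0_integral_bigcup//=.
- apply: measurable_funTS; apply: measurableT_comp => //.
  exact: measurable_hyperbolic_density.
- by move=> p _; rewrite lee_fin hyperbolic_density_ge0.
Qed.

HB.instance Definition _ := isMeasure.Build _ _ _ lambda
  lambda0 lambda_ge0 lambda_sigma_additive.

Let lambda_sigma_finite : sigma_finite setT lambda.
Proof.
have [G TG Goo] := sigma_finiteT (@area R).
pose E n := h @^-1` `]-oo, n%:R]%classic.
have mE n : measurable (E n).
  by rewrite -[E n]setTI; exact: measurable_hyperbolic_density.
exists (fun k => let: (i, n) := odflt (0, 0)%N (unpickle k) in G i `&` E n).
  apply/esym/seteqP; split => // p _.
  have : [set: R * R] p by [].
  rewrite TG => -[i _ Gip].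
  exists (pickle (i, Num.bound (h p))) => //=.
  rewrite pickleK/=; split => //; rewrite /E/= in_itv/=.
  by rewrite ltW// archi_boundP// hyperbolic_density_ge0.
move=> k; case: (odflt _ _) => i n; have [mG Gioo] := Goo i.
have mGE : measurable (G i `&` E n) := measurableI _ _ mG (mE n).
split=> //.
rewrite /hyperbolic_measure.
apply: (@le_lt_trans _ _ (\int[@area R]_(p in G i `&` E n) (n%:R)%:E)%E).
  apply: ge0_le_integral => //=.
  - by move=> p _; rewrite lee_fin hyperbolic_density_ge0.
  - apply: measurable_funTS; apply: measurableT_comp => //.
    exact: measurable_hyperbolic_density.
  - by move=> p [_]; rewrite /E/= in_itv/= lee_fin.
rewrite integral_cst// lte_mul_pinfty//.
rewrite (le_lt_trans _ Gioo)// le_measure// ?inE//.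
Qed.

HB.instance Definition _ := Measure_isSigmaFinite.Build _ _ _ lambda
  lambda_sigma_finite.

End hyperbolic_measure_instance.

Section bergman.
Variable R : realType.
Implicit Types (u v psi : R[i] -> R[i]) (z w xi zeta : R[i]) (alpha : R).

(** The density of dA_alpha with respect to area measure. *)
Definition bergman_weight alpha z : R :=
  (alpha + 1) / pi * (1 - normc z ^+ 2) `^ alpha.

Definition bergman_inner alpha u v : R[i] :=
  Cintegral (@area R) (@disc R) (fun p => let z := complex_of_pair p in
    u z * (v z)^* * (bergman_weight alpha z)%:C).

Definition bergman_norm alpha u : \bar R :=
  ((\int[@area R]_(p in @disc R) (let z := complex_of_pair p in
      normc (u z) ^+ 2 * bergman_weight alpha z)%:E) `^ 2^-1)%E.

Definition analytic_on_disc u :=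
  forall z0, unit_disc z0 -> exists a : nat -> R[i], exists2 r : R, 0 < r &
    forall z, normc (z - z0) < r ->
      power_series a (z - z0) @ \oo --> (u z : R[i]^o).

Definition in_bergman alpha u :=
  analytic_on_disc u /\ (bergman_norm alpha u < +oo)%E.

(** The sequence (a_n) such that u z = \sum_n a_n z ^ n on the unit disc. *)
Definition taylor_coef u : nat -> R[i] :=
  xget (fun=> 0) [set a : nat -> R[i] |
    forall z, unit_disc z -> power_series a z @ \oo --> (u z : R[i]^o)].

Definition V_multiplier alpha (n : nat) : R :=
  (Num.sqrt n.+1%:R)^-1 *
  Num.sqrt (Gamma (n%:R + alpha + 2) / (n`!%:R * Gamma (alpha + 2))).

Definition V alpha u z : R[i] :=
  limn (power_series (fun n => taylor_coef u n * (V_multiplier alpha n)%:C) z).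

Definition mobius z zeta : R[i] := (zeta - z) / (1 - z^* * zeta).

Definition U alpha z u zeta : R[i] :=
  u (mobius z zeta) * ((1 - normc z ^+ 2) `^ ((2 + alpha) / 2))%:C
    / cpow (1 - z^* * zeta) (2 + alpha).

(** u_theta, with xi = e^{i theta}. *)
Definition rotate xi u zeta : R[i] := u (xi * zeta).

(** f is a function on T x D, both seen as subsets of R[i]. *)
Definition windowed_berezin alpha psi (f : R[i] -> R[i] -> R[i]) xi z : R[i] :=
  (alpha + 1)%:C *
  Cintegral (@circle_measure R) setT (fun t =>
    Cintegral (@hyperbolic_measure R) (@disc R) (fun p =>
      let w := complex_of_pair p in
      f (expi t) w *
      (normc (bergman_inner alpha (U alpha z (rotate xi psi))
                                  (U alpha w (rotate (expi t) psi))) ^+ 2)%:C)).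

(** The norm of L^p(T x D, dtheta/(2 pi) dlambda). *)
Definition Lp_norm_TD (p : R) (F : R[i] -> R[i] -> R[i]) : \bar R :=
  CLnorm (@circle_measure R \x @hyperbolic_measure R)%E (setT `*` @disc R) p
    (fun q => F (expi q.1) (complex_of_pair q.2)).

End bergman.

(* Main.v *)
(** Put s = alpha + 2, let gam_n be the coefficient of x^n in (1 - x)^(-s), and write
    u = V^alpha psi = sum_n b_n sqrt(gam_n) z^n with sum_n |b_n|^2 = 1.  By covariance
    of U under Moebius maps and rotations, the kernel of the Berezin transform is
    (alpha + 1) |<u, U_x u_tau>|^2 with x = xi phi_z(w).

    Let q_mn(rho) be the integral of (alpha + 1) |<e_m, U_x e_n>|^2 over |x| >= rho,
    for the orthonormal monomials e_n = sqrt(gam_n) z^n.  For m = 0 it is explicit.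
    Replacing e_0 = 1 by U_z 1 = (1 - |z|^2)^(s/2) sum_m gam_m (conj z)^m zeta^m only
    translates the integrand, while Parseval over the rotations of x separates the
    monomials; hence sum_m gam_m |z|^(2m) (1 - |z|^2)^s q_mn(0) = 1, which forces
    q_mn(0) = 1, and a similar comparison shows q_mn(rho) --> 0 as alpha --> oo.
    Parseval over x and tau, with Fatou for the tails of u, then shows that the kernel,
    averaged over rotations, is a radial function K_alpha of phi_z(w) of mass 1 that
    concentrates at 0.

    Finally |B f - f|^p (z) is at most 4^p times an average of |f(w) - f(z)|^p against
    the kernel, so the L^p norm is controlled by the double integral of
    |f(w) - f(z)|^p K_alpha(phi_z(w)).  The sets A whose intersections with small discs
    are asymptotically not separated by K_alpha form a sigma-algebra containing the open
    sets; this gives the limit 0 for simple functions, and for f by density. *)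

From HB Require Import structures.
Require Import Defs.
From mathcomp Require Import all_boot all_order all_algebra.
From mathcomp Require Import complex.
From mathcomp Require Import all_classical all_reals all_analysis.
From mathcomp Require Import measurable_realfun gauss_integral.
From mathcomp Require Import ring lra.
Import Order.TTheory GRing.Theory Num.Theory.
Import numFieldNormedType.Exports.
Import Normc.
Set Implicit Arguments.
Unset Strict Implicit.
Unset Printing Implicit Defensive.
Local Open Scope classical_set_scope.
Local Open Scope complex_scope.
Local Open Scope ring_scope.

(** The b_n are the coordinates of psi in the basis sqrt(n + 1) z^n and do not depend on alpha:
    V^alpha is made for this. So the cut-off of the window is chosen from psi and the tolerance
    alone, and only finitely many q_mn have to decay. The decay is exponential: with |z| = rho / 4
    and x = |z|^2, the explicit case m = 0 contributes (1 - 4 x)^alpha, isolating one term of the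
    series in z and normalizing e_n cost a factor (1 - x)^(-alpha) each, and 1 - 4 x < (1 - x)^2.
    For non-integer alpha the U_z compose only up to a unimodular factor made of principal powers.
    All bases have positive real part, which keeps sums of two arguments in ]-pi, pi[; the factor
    disappears in the modulus. The relation q_mn(0) = 1 takes the place of the orthogonality
    relations of a square integrable representation. Integrals over circles that would isolate
    coefficients are replaced by averages over roots of unity. The constant 4^p comes from adding
    real and imaginary parts and from a Jensen inequality with a loss of a factor 2. *)

Section complex_modulus.
Variable R : realType.
Implicit Types (z w x y : R[i]) (t a b : R).

Lemma normc_ge0 z : 0 <= normc z.
Proof. by case: z => a b; exact: sqrtr_ge0. Qed.

Lemma normcE z : `|z| = (normc z)%:C.
Proof. by case: z. Qed.

Lemma sqr_normcE z : normc z ^+ 2 = complex.Re z ^+ 2 + complex.Im z ^+ 2.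
Proof. by case: z => a b /=; rewrite sqr_sqrtr// addr_ge0// sqr_ge0. Qed.

Lemma mul_conjc z : z * z^*%C = (normc z ^+ 2)%:C.
Proof. by rewrite -sqr_normc normcE rmorphXn. Qed.

Lemma normc_conj z : normc z^*%C = normc z.
Proof. by case: z => a b /=; rewrite sqrrN. Qed.

Lemma normc_eq0 z : (normc z == 0) = (z == 0).
Proof.
apply/eqP/eqP => [/eq0_normc//|->]; exact: normc0.
Qed.

Lemma normc_gt0 z : (0 < normc z) = (z != 0).
Proof. by rewrite lt_neqAle normc_ge0 andbT eq_sym normc_eq0. Qed.

Lemma normcX z n : normc (z ^+ n) = normc z ^+ n.
Proof. by elim: n => [|n ih]; rewrite ?expr0 ?normc1// !exprS normcM ih. Qed.

Lemma normc_real a : normc (a%:C) = `|a|.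
Proof. by rewrite /= expr0n addr0 sqrtr_sqr. Qed.

Lemma normcB x y : normc (x - y) = normc (y - x).
Proof. by rewrite -normcN opprB. Qed.

Lemma ler_normc_sub x y : normc x - normc y <= normc (x - y).
Proof. by rewrite lerBlDr; apply: le_trans (le_normcD _ _); rewrite subrK. Qed.

Lemma ler_dist_normc x y : `|normc x - normc y| <= normc (x - y).
Proof.
by rewrite ler_norml ler_normc_sub andbT lerNl opprB normcB ler_normc_sub.
Qed.

Lemma le_Re_normc z : `|complex.Re z| <= normc z.
Proof.
rewrite -(@ler_pXn2r _ 2) ?nnegrE ?normc_ge0// real_normK ?num_real//.
by rewrite sqr_normcE lerDl sqr_ge0.
Qed.

Lemma le_Im_normc z : `|complex.Im z| <= normc z.
Proof.
rewrite -(@ler_pXn2r _ 2) ?nnegrE ?normc_ge0// real_normK ?num_real//.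
by rewrite sqr_normcE lerDr sqr_ge0.
Qed.

Lemma le_normc_ReIm z : normc z <= `|complex.Re z| + `|complex.Im z|.
Proof.
rewrite -(@ler_pXn2r _ 2) ?nnegrE ?normc_ge0 ?addr_ge0// sqr_normcE.
rewrite sqrrD !real_normK ?num_real//.
by rewrite -addrA lerD2l lerDr mulrn_wge0// mulr_ge0.
Qed.

Lemma normc_sum I (r : seq I) (P : pred I) (F : I -> R[i]) :
  normc (\sum_(i <- r | P i) F i) <= \sum_(i <- r | P i) normc (F i).
Proof.
elim/big_ind2 : _ => [|x1 x2 y1 y2 h1 h2|//]; first by rewrite normc0.
exact: le_trans (le_normcD _ _) (lerD h1 h2).
Qed.

Lemma normc_expi t : normc (expi t) = 1.
Proof. by rewrite /= cos2Dsin2 sqrtr1. Qed.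

Lemma expiD a b : expi (a + b) = expi a * expi b.
Proof.
by apply/eqP; rewrite eq_complex /= cosD sinD eqxx/= [X in _ == X]addrC.
Qed.

Lemma expi0 : expi 0 = 1 :> R[i].
Proof. by rewrite /expi cos0 sin0. Qed.

Lemma expiN a : expi (- a) = (expi a)^*%C.
Proof. by rewrite /expi cosN sinN. Qed.

Lemma expi_conjK a : expi a * (expi a)^*%C = 1.
Proof. by rewrite mul_conjc normc_expi expr1n. Qed.

Lemma expi_neq0 a : expi a != 0.
Proof. by rewrite -normc_eq0 normc_expi oner_eq0. Qed.

Lemma expiMn a n : expi (a *+ n) = expi a ^+ n.
Proof. by elim: n => [|n ih]; rewrite ?mulr0n ?expi0// mulrS exprS expiD ih. Qed.

Lemma conjcM x y : (x * y)^*%C = x^*%C * y^*%C.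
Proof. exact: rmorphM. Qed.

Lemma conjcD x y : (x + y)^*%C = x^*%C + y^*%C.
Proof. exact: rmorphD. Qed.

Lemma conjcB x y : (x - y)^*%C = x^*%C - y^*%C.
Proof. exact: rmorphB. Qed.

Lemma conjcX x n : (x ^+ n)^*%C = x^*%C ^+ n.
Proof. exact: rmorphXn. Qed.

Lemma expi_2pi n : (0 < n)%N -> expi (2 * pi / n%:R) ^+ n = 1 :> R[i].
Proof.
move=> n0; rewrite -expiMn -(mulr_natr (_ / _)) divfK ?pnatr_eq0 -?lt0n//.
by rewrite /expi mulrC mulr_natr cos2pi sin2pi.
Qed.

(* cos is injective on [0, pi], hence expi x = 1 forces x = 0 in [0, 2 pi[. *)
Lemma expi_eq1 (x : R) : 0 <= x < 2 * (pi : R) -> expi x = 1 -> x = 0.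
Proof.
move=> /andP[x0 x2] [cx sx].
have [xpi|xpi] := leP x pi.
  apply: cos_inj; rewrite ?in_itv/= ?x0 ?xpi ?lexx ?pi_ge0//.
  by rewrite cos0.
have: 2 * pi - x = 0.
  apply: cos_inj; rewrite ?in_itv/= ?lexx ?pi_ge0//.
    by apply/andP; split; lra.
  by rewrite cosB mulr_natl cos2pi sin2pi mul1r mul0r addr0 cx cos0.
by move: x2; lra.
Qed.

Lemma prim_expi n : (0 < n)%N -> n.-primitive_root (expi (2 * pi / n%:R) : R[i]).
Proof.
move=> n0; apply/andP; split=> //; apply/forallP => i.
rewrite unity_rootE; have [->|ni] := eqVneq i.+1 n; first by rewrite expi_2pi// eqxx.
rewrite eqbF_neg; apply/negP => /eqP; rewrite -expiMn => e1.
have h : (i.+1 < n)%N by rewrite ltn_neqAle ni ltn_ord.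
have hb : 0 <= 2 * (pi : R) / n%:R *+ i.+1 < 2 * (pi : R).
  rewrite -(mulr_natr (2 * pi / n%:R)); apply/andP; split.
    by rewrite !mulr_ge0 ?invr_ge0 ?pi_ge0.
  rewrite mulrAC.
  by rewrite ltr_pdivrMr ?ltr0n// ltr_pM2l ?ltr_nat// mulr_gt0 ?pi_gt0.
move/eqP: (expi_eq1 hb e1); rewrite mulrn_eq0/= mulf_eq0 invr_eq0 pnatr_eq0.
by rewrite eqn0Ngt n0 orbF mulf_eq0 pnatr_eq0/= gt_eqF ?pi_gt0.
Qed.

(** Orthogonality of the characters of Z/n. It stands in for integration over a circle, both in the
    Cauchy estimates and in every Parseval identity. *)
Lemma sum_prim_root n (w : R[i]) k l : n.-primitive_root w -> (k < n)%N -> (l < n)%N ->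
  \sum_(j < n) (w ^+ j) ^+ k * ((w ^+ j) ^- l) = (k == l)%:R * n%:R.
Proof.
move=> pw kn ln; have n0 := prim_order_gt0 pw.
have w0 : w != 0.
  by apply/eqP => w0; move/prim_expr_order : pw; rewrite w0 expr0n gtn_eqF//= => /eqP;
    rewrite eq_sym oner_eq0.
have [<-|kl] := eqVneq k l.
  rewrite mul1r -[X in X%:R](card_ord n) -sumr_const; apply: eq_bigr => j _.
  by rewrite divff// !expf_neq0.
rewrite mul0r; pose q := w ^+ k / w ^+ l.
rewrite (eq_bigr (fun j : 'I_n => q ^+ j)); last first.
  by move=> j _; rewrite /q exprMn exprVn -!exprM mulnC (mulnC l).
have q1 : q != 1.
  apply/eqP => /(congr1 ( *%R^~ (w ^+ l))).
  rewrite divfK ?expf_neq0// mul1r => /eqP; rewrite (eq_prim_root_expr pw).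
  by rewrite !modn_small// (negbTE kl).
have : (q - 1) * \sum_(j < n) q ^+ j = 0.
  rewrite -subrX1 /q exprMn exprVn -!exprM mulnC (mulnC l) !exprM.
  by rewrite (prim_expr_order pw) !expr1n invr1 mulr1 subrr.
by move/eqP; rewrite mulf_eq0 subr_eq0 (negbTE q1)/= => /eqP.
Qed.

End complex_modulus.

Arguments complex_of_pair : simpl never.
Arguments expi : simpl never.
Arguments normc : simpl never.

(** * Power series of analytic functions *)

Section local_power_series.
Variable R : realType.
Implicit Types (z w x y : R[i]) (h g : R[i] -> R[i]) (a b : nat -> R[i]).

(** Convergence with a real tolerance; the norm of [R[i]^o] takes values in [R[i]], hence so do the
    tolerances of its topology. [cvgCP] relates the two. *)
Definition cvgC (s : nat -> R[i]) (l : R[i]) :=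
  forall e : R, 0 < e -> exists N : nat, forall n, (N <= n)%N -> normc (s n - l) < e.

Definition psum a x (n : nat) := \sum_(k < n) a k * x ^+ k.

Lemma power_seriesE a x : power_series a x = psum a x.
Proof. by apply/funext => n; rewrite /power_series /series/= big_mkord. Qed.

Lemma cvgCP (s : nat -> R[i]) (l : R[i]) :
  (s : nat -> R[i]^o) @ \oo --> (l : R[i]^o) <-> cvgC s l.
Proof.
split=> [/cvgrPdist_lt sl e e0|sl].
  have [|N _ NP] := sl e%:C; first by rewrite ltcR.
  by exists N => n /NP; rewrite /= normcE normcB ltcR.
apply/cvgrPdist_lt => e e0.
have er : e = (complex.Re e)%:C by rewrite RRe_real// gtr0_real.
move: e0; rewrite er ltcR => /sl[N NP]; exists N => // n /= /NP.
by rewrite normcE normcB ltcR.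
Qed.

Lemma psumS a x n : psum a x n.+1 = psum a x n + a n * x ^+ n.
Proof. by rewrite /psum big_ord_recr. Qed.

Lemma psum_rec a x n : psum a x n.+1 = a 0%N + x * psum (fun k => a k.+1) x n.
Proof.
rewrite /psum big_ord_recl expr0 mulr1; congr (_ + _).
by rewrite mulr_sumr; apply: eq_bigr => i _; rewrite /bump/= exprS mulrCA.
Qed.

Lemma cvgC_uniq s l m : cvgC s l -> cvgC s m -> l = m.
Proof.
move=> sl sm; apply/eqP; rewrite -subr_eq0 -normc_eq0 eq_le normc_ge0 andbT.
apply/ler_addgt0Pr => e e0; rewrite add0r.
have e20 : 0 < e / 2 by rewrite divr_gt0.
have [N NP] := sl _ e20; have [M MP] := sm _ e20.
rewrite (_ : l - m = (s (maxn N M) - m) - (s (maxn N M) - l)); last by ring.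
rewrite (le_trans (le_normcD _ _))// normcN.
by rewrite ltW// [ltRHS]splitr ltrD ?MP ?NP ?leq_maxl ?leq_maxr.
Qed.

Lemma cvgC_cst l s N : (forall n, (N <= n)%N -> s n = l) -> cvgC s l.
Proof. by move=> sl e e0; exists N => n /sl ->; rewrite subrr normc0. Qed.

Lemma cvgC_le s l (M : R) N : (forall n, (N <= n)%N -> normc (s n) <= M) ->
  cvgC s l -> normc l <= M.
Proof.
move=> sM sl; apply/ler_addgt0Pr => e e0; have [K KP] := sl _ e0.
rewrite (_ : l = s (maxn N K) - (s (maxn N K) - l)); last by ring.
rewrite (le_trans (le_normcD _ _))// normcN lerD ?sM ?leq_maxl//.
by rewrite ltW// KP// leq_maxr.
Qed.

Lemma cvgCD s t l m : cvgC s l -> cvgC t m -> cvgC (fun n => s n + t n) (l + m).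
Proof.
move=> sl tm e e0; have e20 : 0 < e / 2 by rewrite divr_gt0.
have [N NP] := sl _ e20; have [M MP] := tm _ e20.
exists (maxn N M) => n; rewrite geq_max => /andP[Nn Mn].
rewrite opprD addrACA (le_lt_trans (le_normcD _ _))// [ltRHS]splitr.
by rewrite ltrD ?MP ?NP.
Qed.

Lemma cvgCZ c s l : cvgC s l -> cvgC (fun n => c * s n) (c * l).
Proof.
move=> sl e e0; have c0 : 0 < normc c + 1 by rewrite ltr_wpDl ?normc_ge0.
have [|N NP] := sl (e / (normc c + 1)); first by rewrite divr_gt0.
exists N => n /NP; rewrite -mulrBr normcM ltr_pdivlMr// mulrC => h.
by rewrite (le_lt_trans _ h)// ler_wpM2r ?normc_ge0// lerDl.
Qed.

Lemma cvgC_ext s t l : s =1 t -> cvgC s l -> cvgC t l.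
Proof. by move=> st; rewrite (_ : t = s)//; apply/funext => n; rewrite st. Qed.

Lemma cvgC_shift s l k : cvgC (fun n => s (n + k)%N) l -> cvgC s l.
Proof.
move=> sl e e0; have [N NP] := sl _ e0; exists (N + k)%N => n Nn.
by rewrite -(@subnK k n) ?(leq_trans _ Nn) ?leq_addl// NP// leq_subRL ?(leq_trans _ Nn)
  ?leq_addl// addnC.
Qed.

Lemma cvgC_sub s l k : cvgC s l -> cvgC (fun n => s (n + k)%N) l.
Proof.
move=> sl e e0; have [N NP] := sl _ e0; exists N => n Nn.
by rewrite NP// (leq_trans Nn)// leq_addr.
Qed.

Lemma psum_term_bounded a x l : cvgC (psum a x) l ->
  exists2 C : R, 0 <= C & forall k, normc (a k) * normc x ^+ k <= C.
Proof.
move=> al; have [//|N NP] := al 1.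
pose F k := normc (a k) * normc x ^+ k.
have F0 k : 0 <= F k by rewrite mulr_ge0 ?exprn_ge0 ?normc_ge0.
exists (2 + \sum_(k < N) F k); first by rewrite addr_ge0// sumr_ge0.
move=> k; have [kN|Nk] := ltnP k N.
  rewrite -/(F k) (bigD1 (Ordinal kN))//= addrCA lerDl addr_ge0// sumr_ge0//.
rewrite ler_wpDr ?sumr_ge0// -normcX -normcM.
rewrite (_ : a k * _ = (psum a x k.+1 - l) - (psum a x k - l)); last first.
  by rewrite psumS; ring.
rewrite (le_trans (le_normcD _ _))// normcN ltW// (_ : 2 = 1 + 1 :> R)//.
by rewrite ltrD ?NP// (leq_trans Nk).
Qed.

Lemma psum_tail a x l (rho C : R) : 0 < rho ->
  (forall k, normc (a k) * rho ^+ k <= C) -> normc x <= rho / 2 ->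
  cvgC (psum a x) l ->
  forall m, normc (l - psum a x m) <= 2 * C * (normc x / rho) ^+ m.
Proof.
move=> rho0 aC xrho al m; set q := normc x / rho.
have q0 : 0 <= q by rewrite divr_ge0 ?normc_ge0// ltW.
have q1 : q <= 1 / 2 by rewrite ler_pdivrMr// mulrC mul1r.
have C0 : 0 <= C by apply: le_trans (aC 0%N); rewrite mulr_ge0 ?exprn_ge0 ?normc_ge0 ?ltW.
(* The telescoping difference [q ^+ m - q ^+ (m + d)] makes the induction on d close; the factor 2
   absorbs 1 / (1 - q), since q <= 1 / 2. *)
have bnd d : normc (psum a x (m + d) - psum a x m) <= 2 * C * (q ^+ m - q ^+ (m + d)).
  elim: d => [|d ih]; first by rewrite addn0 !subrr normc0 mulr0.
  rewrite addnS psumS addrAC (le_trans (le_normcD _ _))//.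
  have -> : 2 * C * (q ^+ m - q ^+ (m + d).+1) =
    2 * C * (q ^+ m - q ^+ (m + d)) + 2 * C * (1 - q) * q ^+ (m + d).
    by rewrite exprS; ring.
  apply: lerD => //; rewrite normcM normcX.
  have -> : normc x = q * rho by rewrite divfK// gt_eqF.
  rewrite exprMn mulrCA mulrC; apply: ler_wpM2r; first exact: exprn_ge0.
  apply: le_trans (aC _) _; nra.
have q' d : 2 * C * (q ^+ m - q ^+ (m + d)) <= 2 * C * q ^+ m.
  by apply: ler_wpM2l; rewrite ?mulr_ge0// gerBl exprn_ge0.
apply: (@cvgC_le (fun n => psum a x n - psum a x m) _ _ m).
  by move=> n mn; rewrite -(subnKC mn); apply: le_trans (bnd _) (q' _).
by apply: cvgCD => //; apply: (@cvgC_cst _ _ 0%N).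
Qed.

Definition ps_at h z0 (r : R) b :=
  0 < r /\ forall x, normc x < r -> cvgC (psum b x) (h (z0 + x)).

Definition analytic_at h z0 := exists r b, ps_at h z0 r b.

Lemma ps_at0 h z0 r b : ps_at h z0 r b -> b 0%N = h z0.
Proof.
move=> [r0 hb]; have := hb 0; rewrite normc0 addr0 => /(_ r0).
apply: cvgC_uniq; apply: (@cvgC_cst _ _ 1%N) => -[//|n] _.
by rewrite psum_rec mul0r addr0.
Qed.

Lemma ps_at_tail h z0 r b : ps_at h z0 r b ->
  exists C rho : R, [/\ 0 <= C, 0 < rho, rho < r & forall x, normc x <= rho / 2 ->
    forall m, normc (h (z0 + x) - psum b x m) <= C * (normc x / rho) ^+ m].
Proof.
move=> [r0 hb]; have r2 : 0 < r / 2 by rewrite divr_gt0.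
have nr : normc (r / 2)%:C = r / 2 by rewrite normc_real ger0_norm// ltW.
have r2r : r / 2 < r by rewrite ltr_pdivrMr// ltr_pMr// ltr1n.
have [|C C0 CP] := @psum_term_bounded b (r / 2)%:C _ (hb _ _); first by rewrite nr.
exists (2 * C), (r / 2); split=> // [|x xr m]; first by rewrite mulr_ge0.
apply: psum_tail => //; first by move=> k; have := CP k; rewrite nr.
by apply: hb; rewrite (le_lt_trans xr)// ltr_pdivrMr// (lt_le_trans r2r)// ler_pMr// ler1n.
Qed.

Lemma analytic_at_continuous h z0 : analytic_at h z0 ->
  forall e : R, 0 < e -> exists2 d : R, 0 < d &
    forall z, normc (z - z0) < d -> normc (h z - h z0) < e.
Proof.
move=> [r [b hb]] e e0; have [C [rho [C0 rho0 _ tl]]] := ps_at_tail hb.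
exists (Num.min (rho / 2) (e * rho / (C + 1))).
  by rewrite lt_min !divr_gt0 ?mulr_gt0// ltr_wpDl.
move=> z; rewrite lt_min => /andP[z1 z2].
have := tl _ (ltW z1) 1%N; rewrite subrKC expr1 /psum big_ord1 expr0 mulr1.
rewrite (ps_at0 hb) => /le_lt_trans; apply.
move: z2; rewrite ltr_pdivlMr ?ltr_wpDl// => z2.
rewrite mulrA ltr_pdivrMr//; apply: le_lt_trans z2.
by rewrite mulrC ler_wpM2l ?normc_ge0// lerDl.
Qed.

(** At the first nonzero coefficient after b_0, say of order k + 1, there is a direction in which
    |h| grows like t^(k+1), and a remainder of order t^(k+2) cannot compensate this for small t. *)
Lemma local_max_principle h z0 r b : ps_at h z0 r b ->
  (forall x, normc x < r -> normc (h (z0 + x)) <= normc (h z0)) ->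
  forall x, normc x < r -> h (z0 + x) = h z0.
Proof.
move=> hb hmax x xr.
have [h0|h0] := eqVneq (h z0) 0.
  apply/eqP; rewrite h0 -normc_eq0 eq_le normc_ge0 andbT.
  by have := hmax _ xr; rewrite h0 normc0.
suff b0 k : b k.+1 = 0.
  apply: (cvgC_uniq (hb.2 _ xr)); apply: (@cvgC_cst _ _ 1%N) => -[//|n] _.
  rewrite psum_rec (ps_at0 hb) /psum big1 ?mulr0 ?addr0// => i _.
  by rewrite b0 mul0r.
have [C [rho [C0 rho0 rhor tl]]] := ps_at_tail hb.
elim/ltn_ind : k => k ih; apply/eqP; apply: contraT => bk0.
(* In this direction b_(k+1) x^(k+1) is a positive multiple of h(z0). *)
pose y := k.+1.-root (h z0 / b k.+1).
have yk : y ^+ k.+1 = h z0 / b k.+1 by rewrite rootCK.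
pose C' := C * (normc y / rho) ^+ k.+2.
have C'0 : 0 <= C' by rewrite mulr_ge0// exprn_ge0// divr_ge0 ?normc_ge0// ltW.
have nh0 : 0 < normc (h z0) by rewrite normc_gt0.
have y0 : 0 < normc y.
  rewrite normc_gt0; apply: contra_neq bk0 => y0; move/esym/eqP: yk.
  by rewrite y0 expr0n/= mulf_eq0 (negbTE h0)/= invr_eq0 => /eqP.
(* The first bound keeps t y inside the range of the tail estimate, the second makes the remainder
   C' t^(k+2) smaller than the gain |h(z0)| t^(k+1). *)
pose t := Num.min (rho / 2 / normc y) (normc (h z0) / (C' + 1)).
have t0 : 0 < t by rewrite lt_min !divr_gt0// ltr_wpDl.
have nty : normc (t%:C * y) <= rho / 2.
  rewrite normcM normc_real ger0_norm ?(ltW t0)// -ler_pdivlMr//.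
  by rewrite /t ge_min lexx.
have := tl _ nty k.+2.
have -> : psum b (t%:C * y) k.+2 = h z0 * (1 + t ^+ k.+1)%:C.
  rewrite psumS psum_rec (ps_at0 hb) (_ : psum _ _ k = 0) ?mulr0 ?addr0; last first.
    by rewrite /psum big1// => i _; rewrite ih// mul0r.
  by rewrite exprMn yk -rmorphXn rmorphD rmorph1; field.
set H := h (z0 + _) => le1.
have le2 : normc (h z0) * (1 + t ^+ k.+1) - normc H <= C' * t ^+ k.+2.
  apply: le_trans (_ : _ <= normc (H - h z0 * (1 + t ^+ k.+1)%:C)) _.
    rewrite normcB; apply: le_trans (ler_normc_sub _ _).
    by rewrite normcM normc_real ger0_norm// addr_ge0// exprn_ge0// ltW.
  apply: le_trans le1 _; rewrite normcM normc_real ger0_norm ?(ltW t0)//.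
  by rewrite -mulrA exprMn /C' [leRHS]mulrAC mulrA.
have le3 : normc H <= normc (h z0).
  apply: hmax; apply: le_lt_trans nty _; apply: lt_trans rhor.
  by rewrite ltr_pdivrMr// ltr_pMr// ltr1n.
have : normc (h z0) * t ^+ k.+1 <= C' * t * t ^+ k.+1.
  rewrite -mulrA -exprS; apply: le_trans le2.
  rewrite mulrDr mulr1; lra.
rewrite ler_pM2r ?exprn_gt0// => le4.
have : C' * t < normc (h z0).
  have tl2 : t <= normc (h z0) / (C' + 1) by rewrite /t ge_min lexx orbT.
  move: tl2; rewrite ler_pdivlMr ?ltr_wpDl// mulrDr mulr1 => tl2.
  rewrite mulrC; lra.
by rewrite ltNge le4.
Qed.

Lemma geometric_small (q K e : R) : 0 <= q < 1 -> 0 < e ->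
  exists N, forall n, (N <= n)%N -> K * q ^+ n < e.
Proof.
move=> /andP[q0 q1] e0; have q1' : `|q| < 1 by rewrite ger0_norm.
have /cvgrPdist_lt /(_ _ e0)[N _ NP] := @cvg_geometric R K q q1'.
exists N => n /NP /=; rewrite sub0r normrN; exact/le_lt_trans/ler_norm.
Qed.

Lemma psumD a b x n : psum (fun k => a k + b k) x n = psum a x n + psum b x n.
Proof. by rewrite /psum -big_split; apply: eq_bigr => i _; rewrite mulrDl. Qed.

Lemma psumZ c a x n : psum (fun k => c * a k) x n = c * psum a x n.
Proof. by rewrite /psum mulr_sumr; apply: eq_bigr => i _; rewrite mulrA. Qed.

Lemma ps_at_eq h g z0 r r' b : ps_at h z0 r b -> 0 < r' ->
  (forall x, normc x < r' -> h (z0 + x) = g (z0 + x)) ->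
  ps_at g z0 (Num.min r r') b.
Proof.
move=> [r0 hb] r'0 hg; split; first by rewrite lt_min r0.
by move=> x; rewrite lt_min => /andP[xr xr']; rewrite -hg//; exact: hb.
Qed.

Lemma ps_atD h g z0 r b b' : ps_at h z0 r b -> ps_at g z0 r b' ->
  ps_at (fun z => h z + g z) z0 r (fun k => b k + b' k).
Proof.
move=> [r0 hb] [_ gb]; split=> // x xr.
apply: cvgC_ext (cvgCD (hb _ xr) (gb _ xr)) => n.
by rewrite psumD.
Qed.

Lemma ps_atZ c h z0 r b : ps_at h z0 r b ->
  ps_at (fun z => c * h z) z0 r (fun k => c * b k).
Proof.
move=> [r0 hb]; split=> // x xr; apply: cvgC_ext (cvgCZ c (hb _ xr)) => n.
by rewrite psumZ.
Qed.

Lemma ps_at_le h z0 r r' b : 0 < r' <= r -> ps_at h z0 r b -> ps_at h z0 r' b.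
Proof.
by move=> /andP[r'0 r'r] [r0 hb]; split=> // x xr; exact/hb/(lt_le_trans xr).
Qed.

Lemma analytic_atD h g z0 : analytic_at h z0 -> analytic_at g z0 ->
  analytic_at (fun z => h z + g z) z0.
Proof.
move=> [r [b hb]] [r' [b' gb]]; exists (Num.min r r'), (fun k => b k + b' k).
have m0 : 0 < Num.min r r' by rewrite lt_min hb.1 gb.1.
by apply: ps_atD; [apply: ps_at_le hb|apply: ps_at_le gb];
  rewrite m0 ge_min lexx ?orbT.
Qed.

Lemma analytic_atZ c h z0 : analytic_at h z0 -> analytic_at (fun z => c * h z) z0.
Proof. by move=> [r [b hb]]; exists r, (fun k => c * b k); exact: ps_atZ. Qed.

Lemma ps_at_cst c z0 r : 0 < r -> ps_at (fun=> c) z0 r (fun k => c * (k == 0%N)%:R).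
Proof.
move=> r0; split=> // x xr; apply: (@cvgC_cst _ _ 1%N) => -[//|n] _.
rewrite psum_rec mulr1 /psum big1 ?mulr0 ?addr0// => i _.
by rewrite mulr0 mul0r.
Qed.

Lemma ps_at_sum n (h : nat -> R[i] -> R[i]) z0 r (b : nat -> nat -> R[i]) : 0 < r ->
  (forall j, (j < n)%N -> ps_at (h j) z0 r (b j)) ->
  ps_at (fun z => \sum_(j < n) h j z) z0 r (fun k => \sum_(j < n) b j k).
Proof.
move=> r0; elim: n => [|n ih] hb.
  have := ps_at_cst 0 z0 r0; rewrite /ps_at => -[_ H]; split => // x xr.
  rewrite big_ord0; apply: cvgC_ext (H _ xr) => m; congr (psum _ x m).
  by apply/funext => k; rewrite mul0r big_ord0.
have := ps_atD (ih _) (hb _ (ltnSn n)).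
move=> /(_ (fun j jn => hb j (ltn_trans jn (ltnSn _))))[_ H].
split=> // x xr; rewrite big_ord_recr; apply: cvgC_ext (H _ xr) => m.
by congr (psum _ x m); apply/funext => k; rewrite big_ord_recr.
Qed.

Lemma analytic_at_sum n (h : nat -> R[i] -> R[i]) z0 :
  (forall j, (j < n)%N -> analytic_at (h j) z0) ->
  analytic_at (fun z => \sum_(j < n) h j z) z0.
Proof.
elim: n => [|n ih] ha.
  exists 1, (fun k => 0 * (k == 0%N)%:R); have := ps_at_cst 0 z0 (@ltr01 R).
  rewrite /ps_at => -[? H]; split=> // x xr; rewrite big_ord0; exact: H.
have := analytic_atD (ih _) (ha _ (ltnSn n)).
move=> /(_ (fun j jn => ha j (ltn_trans jn (ltnSn _))))[r [b [r0 H]]].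
by exists r, b; split=> // x xr; rewrite big_ord_recr; exact: H.
Qed.

Lemma ps_at_rot h w z0 r b : normc w = 1 -> ps_at h (w * z0) r b ->
  ps_at (fun z => h (w * z)) z0 r (fun k => b k * w ^+ k).
Proof.
move=> w1 [r0 hb]; split=> // x xr; rewrite mulrDr.
have := hb (w * x); rewrite normcM w1 mul1r => /(_ xr).
apply: cvgC_ext => n; apply: eq_bigr => i _.
by rewrite exprMn mulrA.
Qed.

Lemma analytic_at_exp k z0 : analytic_at (fun z => z ^+ k) z0.
Proof.
elim: k => [|k [r [b [r0 hb]]]].
  by exists 1, (fun k => 1 * (k == 0%N)%:R); exact: ps_at_cst.
exists r, (fun k => z0 * b k + (if k is k'.+1 then b k' else 0)); split=> // x xr.
apply: (@cvgC_shift _ _ 1%N).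
rewrite exprS mulrDl.
apply: cvgC_ext (cvgCD (cvgCZ z0 (cvgC_sub 1 (hb _ xr))) (cvgCZ x (hb _ xr))) => n.
by rewrite /= psumD psumZ addn1 [psum (fun k => if k is _.+1 then _ else _) _ _]psum_rec add0r.
Qed.

Lemma ps_at_exp0 k r : 0 < r -> ps_at (fun z => z ^+ k) 0 r (fun j => (j == k)%:R).
Proof.
move=> r0; split=> // x xr; apply: (@cvgC_cst _ _ k.+1) => n kn.
rewrite add0r /psum (bigD1 (Ordinal kn))//= eqxx mul1r big1 ?addr0// => i.
by rewrite -val_eqE/= => /negbTE ->; rewrite mul0r.
Qed.

Lemma analytic_at_divz h z0 : z0 != 0 -> analytic_at h z0 ->
  analytic_at (fun z => h z / z) z0.
Proof.
move=> z00 [r [b [r0 hb]]].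
have nz0 : 0 < normc z0 by rewrite normc_gt0.
pose s := Num.min r (normc z0) / 2.
have m0 : 0 < Num.min r (normc z0) by rewrite lt_min r0 nz0.
have s0 : 0 < s by rewrite divr_gt0.
have sm : s < Num.min r (normc z0) by rewrite ltr_pdivrMr// ltr_pMr// ltr1n.
have [sr sz] : s < r /\ s < normc z0 by move: sm; rewrite lt_min => /andP.
have ns : normc s%:C = s by rewrite normc_real ger0_norm// ltW.
have [|B B0 BP] := @psum_term_bounded b s%:C _ (hb _ _); first by rewrite ns.
rewrite ns in BP.
(* Matching coefficients in (z0 + x) sum c_k x^k = sum b_k x^k gives z0 c_k + c_(k-1) = b_k. *)
pose c := fix c k := if k is k'.+1 then (b k'.+1 - c k') / z0 else b 0%N / z0.
have cE k : c k.+1 = (b k.+1 - c k) / z0 by [].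
(* K solves B + s K = K |z0|, so that the bound |c_k| s^k <= K is preserved by the recursion. *)
pose K := B / (normc z0 - s).
have zs0 : 0 < normc z0 - s by rewrite subr_gt0.
have KE : B + s * K = K * normc z0.
  by rewrite /K; field; rewrite gt_eqF.
have K0 : 0 <= K by rewrite divr_ge0// ltW.
have cK k : normc (c k) * s ^+ k <= K.
  elim: k => [|k ih].
    have := BP 0%N; rewrite !expr0 !mulr1 /= normcM normcV => b0.
    rewrite ler_pdivrMr// -KE; apply: le_trans b0 _.
    by rewrite lerDl mulr_ge0// ltW.
  rewrite cE normcM normcV mulrAC ler_pdivrMr// -KE.
  apply: le_trans (_ : _ <= (normc (b k.+1) + normc (c k)) * s ^+ k.+1) _.
    apply: ler_wpM2r; first by rewrite exprn_ge0// ltW.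
    by rewrite (le_trans (le_normcD _ _))// normcN.
  rewrite mulrDl; apply: lerD; first exact: BP.
  by rewrite exprS mulrCA ler_pM2l.
exists s, c; split=> // x xs.
have zx : z0 + x != 0.
  apply: contraTneq xs => /eqP; rewrite addrC addr_eq0 => /eqP ->.
  by rewrite normcN -leNgt ltW.
have pc n : psum c x n.+1 = (z0 + x)^-1 * (psum b x n.+1 + c n * x ^+ n.+1).
  apply: (mulfI zx); rewrite mulVKf//; elim: n => [|n ih].
    by rewrite /psum !big_ord1/=; field.
  rewrite psumS mulrDr ih [psum b x n.+2]psumS cE !exprS; field.
  exact: z00.
apply: (@cvgC_shift _ _ 1%N).
rewrite [h _ / _]mulrC -[h _]addr0.
apply: cvgC_ext; last first.
  apply: cvgCZ; apply: cvgCD; first exact: (cvgC_sub 1 (hb _ (lt_trans xs sr))).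
  move=> e e0; have qq : 0 <= normc x / s < 1.
    by rewrite divr_ge0 ?normc_ge0 ?ltW//= ltr_pdivrMr// mul1r.
  have [N NP] := geometric_small (K * normc x) qq e0.
  exists N => n /NP; apply: le_lt_trans.
  rewrite subr0; instantiate (1 := fun n => c n * x ^+ n.+1).
  rewrite normcM normcX exprS mulrA mulrAC expr_div_n [leRHS]mulrAC ler_wpM2r ?normc_ge0//.
  by rewrite mulrA ler_pdivlMr ?exprn_gt0// mulrAC ler_wpM2r ?exprn_ge0 ?normc_ge0.
by move=> n; rewrite addn1 pc.
Qed.

Lemma analytic_at_divX n h z0 : z0 != 0 -> analytic_at h z0 ->
  analytic_at (fun z => h z / z ^+ n) z0.
Proof.
move=> z00 ha; elim: n => [|n ih].
  by rewrite (_ : (fun z => _) = h)//; apply/funext => z; rewrite expr0 divr1.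
rewrite (_ : (fun z => _) = fun z => h z / z ^+ n / z).
  exact: analytic_at_divz.
by apply/funext => z; rewrite exprSr invfM mulrA.
Qed.

(** Division by z^n with the removable singularity filled in; c will be the coefficient b_n. With it
    the maximum principle yields estimates of Schwarz type. *)
Definition quotX h n c z := if z == 0 then c else h z / z ^+ n.

Lemma analytic_quotX h n r b z0 : ps_at h 0 r b -> (forall k, (k < n)%N -> b k = 0) ->
  analytic_at h z0 -> analytic_at (quotX h n (b n)) z0.
Proof.
move=> [r0 hb] b0 ha; have [->|z00] := eqVneq z0 0.
  exists r, (fun k => b (n + k)%N); split=> // x xr; rewrite add0r /quotX.
  have [->|x0] := eqVneq x 0.
    apply: (@cvgC_cst _ _ 1%N) => -[//|m] _.
    by rewrite psum_rec mul0r addr0 addn0.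
  have := cvgC_sub n (hb x xr); rewrite add0r => /(cvgCZ (x ^+ n)^-1).
  rewrite mulrC; apply: cvgC_ext => m.
  rewrite /psum addnC big_split_ord/= big1 ?add0r; last first.
    by move=> i _; rewrite b0// mul0r.
  rewrite mulr_sumr; apply: eq_bigr => i _.
  by rewrite exprD mulrCA mulKf// expf_neq0.
have [r' [b' hb']] := analytic_at_divX n z00 ha.
have nz0 : 0 < normc z0 by rewrite normc_gt0.
exists (Num.min r' (normc z0)), b'; apply: ps_at_eq hb' nz0 _ => x xz.
rewrite /quotX ifF//; apply/negbTE; apply: contraTneq xz => /eqP.
by rewrite addrC addr_eq0 => /eqP ->; rewrite normcN ltxx.
Qed.

End local_power_series.

(** * Maximum principle, Cauchy estimates and Taylor expansion on the whole disc *)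

Section taylor_expansion.
Variable R : realType.
Implicit Types (z w x y : R[i]) (h u : R[i] -> R[i]) (a b : nat -> R[i]).
Local Notation c := (@complex_of_pair R).

Lemma continuous_of_pair (F : R[i] -> R) (p : R * R) :
  (forall e : R, 0 < e -> exists2 d : R, 0 < d &
    forall z, normc (z - c p) < d -> `|F z - F (c p)| < e) ->
  {for p, continuous (fun q => F (c q))}.
Proof.
move=> H; apply/cvgrPdist_lt => e e0; have [d d0 dP] := H _ e0.
exists (ball p.1 (d / 2), ball p.2 (d / 2)).
  by split; apply: nbhsx_ballx; rewrite divr_gt0.
move=> q [/= q1 q2]; rewrite distrC; apply: dP.
apply: le_lt_trans (le_normc_ReIm _) _ => /=.
by rewrite [ltRHS]splitr ltrD// distrC.
Qed.

Lemma compact_closed_disc {r : R} : compact [set p : R * R | normc (c p) <= r].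
Proof.
have cK : compact (`[- r, r]%classic `*` `[- r, r]%classic : set (R * R)).
  by apply: compact_setX; exact: segment_compact.
apply: subclosed_compact cK _.
  rewrite (_ : [set p | _] = (fun p => normc (c p)) @^-1` [set x | x <= r])//.
  apply: closed_comp; last exact: closed_le.
  move=> p _; apply: (@continuous_of_pair (fun z => normc z)) => e e0; exists e => // z.
  exact: le_lt_trans (ler_dist_normc _ _).
move=> [x y] /= pr; rewrite !in_itv/= -!ler_norml; split.
  exact: le_trans (le_Re_normc (c (x, y))) pr.
exact: le_trans (le_Im_normc (c (x, y))) pr.
Qed.

Lemma c_surj z : exists p, c p = z.
Proof. by case: z => x y; exists (x, y). Qed.

Lemma max_on_disc (r : R) h : 0 <= r ->
  (forall z, normc z <= r -> analytic_at h z) ->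
  exists2 z, normc z <= r & forall x, normc x <= r -> normc (h x) <= normc (h z).
Proof.
move=> r0 ha; have n0 : [set p : R * R | normc (c p) <= r] !=set0.
  by exists (0, 0) => /=; change (normc (0 : R[i]) <= r); rewrite normc0.
have [|p pA pmax] := @compact_EVT_max _ _ (fun p =>
  normc (h (c p))) _ n0 (compact_closed_disc (r := r)).
  apply: continuous_in_subspaceT => p /set_mem /= pr.
  apply: (@continuous_of_pair (fun z => normc (h z))) => e e0.
  have [d d0 dP] := analytic_at_continuous (ha _ pr) e0.
  by exists d => // z /dP; exact: le_lt_trans (ler_dist_normc _ _).
exists (c p); first by move: pA => /set_mem.
move=> x xr; have [q qx] := c_surj x; rewrite -qx; apply: pmax.
by apply/mem_set; rewrite /= qx.
Qed.

(* Among the points of the disc where |h| is maximal, one of largest modulus lies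
   on the circle, since h is constant near a maximum in the open disc. *)
Lemma max_principle (r : R) h (M : R) : 0 < r ->
  (forall z, normc z <= r -> analytic_at h z) ->
  (forall z, normc z = r -> normc (h z) <= M) ->
  forall z, normc z <= r -> normc (h z) <= M.
Proof.
move=> r0 ha hM z zr.
have [z0 z0r z0max] := max_on_disc (ltW r0) ha.
pose A := [set p : R * R | normc (c p) <= r].
pose E := A `&` [set p | normc (h (c p)) = normc (h z0)].
have cA : compact A by exact: (compact_closed_disc (r := r)).
have gc p : A p -> {for p, continuous (fun q => normc (h (c q)))}.
  move=> pr; apply: (@continuous_of_pair (fun z => normc (h z))) => e e0.
  have [d d0 dP] := analytic_at_continuous (ha _ pr) e0.
  by exists d => // y /dP; exact: le_lt_trans (ler_dist_normc _ _).
have cE : compact E.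
  apply: (subclosed_compact _ cA); last by move=> p [].
  have clA := compact_closed (@norm_hausdorff _ _) cA.
  move=> p pE; have Ap : A p by apply: clA => B /pE[q [[Aq _] Bq]]; exists q.
  split=> //=; apply: contrapT => /eqP ne.
  have /pE[q [[_ /= qE] /=]] : nbhs p [set q | normc (h (c q)) != normc (h z0)].
    have d0 : 0 < `|normc (h (c p)) - normc (h z0)| by rewrite normr_gt0 subr_eq0.
    move: (gc _ Ap) => /cvgrPdist_lt /(_ _ d0); apply: filterS => q /=.
    by apply: contraTneq => ->; rewrite ltxx.
  by rewrite qE eqxx.
have E0 : E !=set0.
  by have [p pz] := c_surj z0; exists p; split; rewrite /A /mkset pz.
have [|p /set_mem [Ap hp] pmax] := @compact_EVT_max _ _ (fun p => normc (c p)) _ E0 cE.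
  apply: continuous_subspaceT => q; apply: (@continuous_of_pair (fun z => normc z)) => e e0;
    exists e => // y.
  exact: le_lt_trans (ler_dist_normc _ _).
have [pr|pr] := eqVneq (normc (c p)) r.
  by apply: le_trans (z0max _ zr) _; rewrite -hp; exact: hM.
have plt : normc (c p) < r by rewrite lt_neqAle pr.
have [s [b hb]] := ha _ Ap.
pose s' := Num.min s (r - normc (c p)).
have s'0 : 0 < s' by rewrite lt_min hb.1 subr_gt0.
have hb' : ps_at h (c p) s' b by apply: ps_at_le hb; rewrite s'0 ge_min lexx.
have inr x : normc x < s' -> normc (c p + x) <= r.
  rewrite lt_min => /andP[_ xs]; rewrite (le_trans (le_normcD _ _))//.
  by rewrite -lerBrDl ltW.
have cst : forall x, normc x < s' -> h (c p + x) = h (c p).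
  apply: (local_max_principle hb') => x xs'; rewrite hp; exact/z0max/inr.
(* A small step outwards along the radius stays where h is constant; at the origin any direction
   will do. *)
have [x xs' xp] : exists2 x, normc x < s' & normc (c p) < normc (c p + x).
  have s2 : s' / 2 < s' by rewrite ltr_pdivrMr// ltr_pMr// ltr1n.
  have s20 : 0 < s' / 2 by rewrite divr_gt0.
  have [->|p0] := eqVneq (c p) 0.
    by exists (s' / 2)%:C; rewrite ?add0r ?normc0 normc_real ger0_norm ?(ltW s20).
  have np0 : 0 < normc (c p) by rewrite normc_gt0.
  exists ((s' / 2 / normc (c p))%:C * c p).
    by rewrite normcM normc_real ger0_norm ?divfK ?gt_eqF// ltW// divr_gt0.
  rewrite -{2}(mul1r (c p)) -mulrDl normcM -(rmorph1 (real_complex R)) -rmorphD.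
  have q0 : 0 < s' / 2 / normc (c p) by rewrite divr_gt0.
  by rewrite normc_real ger0_norm ?addr_ge0 ?ltW// ltr_pMl// ltrDl.
have [q qx] := c_surj (c p + x).
have : normc (c q) <= normc (c p).
  apply: pmax; apply/mem_set; split; rewrite /A/= qx; first exact: inr.
  by rewrite cst.
by rewrite qx leNgt xp.
Qed.

(** The Schwarz lemma of order n: on |z| = r the quotient u / z^n is at most M / r^n, and the
    maximum principle carries this bound inside. *)
Lemma Cauchy_quotX u (r M : R) n b s : 0 < r -> 0 <= M ->
  (forall z, normc z <= r -> analytic_at u z) ->
  (forall z, normc z <= r -> normc (u z) <= M) ->
  ps_at u 0 s b -> (forall k, (k < n)%N -> b k = 0) ->
  forall z, normc z <= r -> normc (quotX u n (b n) z) <= M / r ^+ n.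
Proof.
move=> r0 M0 ua uM ub b0; apply: max_principle => // z zr.
  exact: analytic_quotX ub b0 (ua _ zr).
rewrite /quotX ifF; last first.
  by apply/negbTE; rewrite -normc_gt0 zr.
rewrite normcM normcV normcX zr; apply: ler_wpM2r; last by rewrite uM// zr.
by rewrite invr_ge0 exprn_ge0// ltW.
Qed.

(* Averaging u over the rotations by the (n+1)-th roots of unity, with weights
   w^(-jn), kills the coefficients b_0, ..., b_(n-1). *)
Lemma Cauchy_estimate u (r M : R) n b s : 0 < r -> 0 <= M ->
  (forall z, normc z <= r -> analytic_at u z) ->
  (forall z, normc z <= r -> normc (u z) <= M) ->
  ps_at u 0 s b -> normc (b n) * r ^+ n <= M.
Proof.
move=> r0 M0 ua uM ub; set N := n.+1.
pose w : R[i] := expi (2 * pi / N%:R).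
have pw : N.-primitive_root w by exact: prim_expi.
have w1 j : normc (w ^+ j) = 1 by rewrite normcX normc_expi expr1n.
pose wt j : R[i] := N%:R^-1 * (w ^+ j) ^- n.
pose v z := \sum_(j < N) wt j * u (w ^+ j * z).
pose bb k := \sum_(j < N) wt j * (b k * (w ^+ j) ^+ k).
have bbE k : (k < N)%N -> bb k = (k == n)%:R * b k.
  move=> kN; rewrite /bb (eq_bigr (fun j : 'I_N => N%:R^-1 * b k *
    ((w ^+ j) ^+ k * (w ^+ j) ^- n))); last by move=> j _; rewrite /wt; ring.
  rewrite -mulr_sumr sum_prim_root//; field.
  by rewrite pnatr_eq0.
have vb : ps_at v 0 s bb.
  apply: (@ps_at_sum _ N (fun j z => wt j * u (w ^+ j * z)) 0 s (fun j k =>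
    wt j * (b k * (w ^+ j) ^+ k)) ub.1) => j jN; apply: ps_atZ; apply: ps_at_rot => //.
  by rewrite mulr0.
have va z : normc z <= r -> analytic_at v z.
  move=> zr; apply: (@analytic_at_sum _ N (fun j z => wt j * u (w ^+ j * z))) => j jN.
  apply: analytic_atZ; have [|r' [b' ub']] := ua (w ^+ j * z); first by rewrite normcM w1 mul1r.
  by exists r', (fun k => b' k * (w ^+ j) ^+ k); exact: ps_at_rot.
have nwt j : normc (wt j) = N%:R^-1.
  rewrite /wt normcM !normcV normcX w1 expr1n invr1 mulr1.
  by rewrite -(rmorph_nat (real_complex R)) normc_real ger0_norm.
have vM z : normc z <= r -> normc (v z) <= M.
  move=> zr; apply: le_trans (normc_sum _ _ _) _.
  apply: le_trans (_ : _ <= \sum_(j < N) N%:R^-1 * M) _.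
    apply: ler_sum => j _; rewrite normcM nwt ler_wpM2l ?invr_ge0// uM//.
    by rewrite normcM w1 mul1r.
  by rewrite sumr_const card_ord -(mulr_natl (_ * _)) mulrA divff ?mul1r// pnatr_eq0.
have bb0 k : (k < n)%N -> bb k = 0.
  by move=> kn; rewrite bbE ?(ltn_trans kn)// ltn_eqF// mul0r.
have := @Cauchy_quotX v r M n bb s r0 M0 va vM vb bb0 0.
rewrite normc0 ltW// => /(_ isT).
by rewrite /quotX eqxx bbE// eqxx mul1r ler_pdivlMr ?exprn_gt0.
Qed.

(** The remainder after n terms vanishes to order n at 0 and is at most (n + 1) M on |z| <= r by the
    Cauchy estimates, hence at most (n + 1) M (|z| / r)^n by the Schwarz estimate. *)
Lemma taylor_on_disc u (r M : R) b s : 0 < r -> 0 <= M ->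
  (forall z, normc z <= r -> analytic_at u z) ->
  (forall z, normc z <= r -> normc (u z) <= M) ->
  ps_at u 0 s b -> forall z, normc z < r -> cvgC (psum b z) (u z).
Proof.
move=> r0 M0 ua uM ub z zr e e0.
have bM := Cauchy_estimate _ r0 M0 ua uM ub.
have rem n x : normc x <= r -> normc (u x - psum b x n) <= n.+1%:R * M.
  move=> xr; rewrite (le_trans (le_normcD _ _))// normcN mulrS mulrDl mul1r.
  apply: lerD; first exact: uM.
  apply: le_trans (normc_sum _ _ _) _.
  apply: le_trans (_ : _ <= \sum_(k < n) M) _.
    apply: ler_sum => k _; apply: le_trans (bM k); rewrite normcM normcX.
    by rewrite ler_wpM2l ?normc_ge0// lerXn2r// nnegrE ?normc_ge0 ?ltW.
  by rewrite sumr_const card_ord mulr_natl.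
have [->|z0] := eqVneq z 0.
  exists 1%N => -[//|n] _; rewrite psum_rec mul0r addr0 (ps_at0 ub) subrr normc0//.
have nz0 : 0 < normc z by rewrite normc_gt0.
have key n : normc (u z - psum b z n) <= n.+1%:R * M * (normc z / r) ^+ n.
  pose v x := u x + -1 * (\sum_(k < n) b k * x ^+ k).
  pose bb k := b k + -1 * \sum_(j < n) b j * (k == j)%:R.
  have vb : ps_at v 0 s bb.
    apply: ps_atD => //; apply: ps_atZ; apply: (@ps_at_sum _ n (fun j x =>
      b j * x ^+ j) 0 s (fun j k => b j * (k == j)%:R)) => //; first exact: ub.1.
    by move=> j _; apply: ps_atZ; exact: (ps_at_exp0 _ ub.1).
  have bb0 k : (k < n)%N -> bb k = 0.
    move=> kn; rewrite /bb (bigD1 (Ordinal kn))//= eqxx mulr1 big1 ?addr0 ?mulN1r ?subrr// => i.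
    by rewrite -val_eqE/= eq_sym => /negbTE ->; rewrite mulr0.
  have va x : normc x <= r -> analytic_at v x.
    move=> xr; apply: analytic_atD; first exact: ua.
    apply: analytic_atZ; apply: (@analytic_at_sum _ n (fun j x => b j * x ^+ j)) => j _.
    by apply: analytic_atZ; exact: analytic_at_exp.
  have vM x : normc x <= r -> normc (v x) <= n.+1%:R * M.
    by move=> xr; rewrite /v mulN1r; exact: rem.
  have nM : 0 <= n.+1%:R * M by rewrite mulr_ge0.
  have := Cauchy_quotX r0 nM va vM vb bb0 (ltW zr).
  rewrite /quotX (negbTE z0) normcM normcV normcX /v mulN1r.
  rewrite ler_pdivrMr ?exprn_gt0// => /le_trans; apply.
  by rewrite expr_div_n mulrAC mulrA.
pose q := normc z / r.
have q0 : 0 <= q by rewrite divr_ge0 ?ltW.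
have q1 : q < 1 by rewrite ltr_pdivrMr// mul1r.
(* (n+1) q^n <= (1 - sqrt q)^-1 (sqrt q)^n by Bernoulli *)
pose t := Num.sqrt q.
have t0 : 0 <= t by exact: sqrtr_ge0.
have t1 : t < 1 by rewrite -sqrtr1 ltr_sqrt.
have tq : t ^+ 2 = q by rewrite sqr_sqrtr.
have bern n : n.+1%:R * t ^+ n <= (1 - t)^-1.
  rewrite -[leRHS]mul1r ler_pdivlMr ?subr_gt0//.
  have -> : n.+1%:R * t ^+ n = \sum_(k < n.+1) t ^+ n.
    by rewrite sumr_const card_ord mulr_natl.
  apply: (@le_trans _ _ ((\sum_(k < n.+1) t ^+ k) * (1 - t))).
    apply: ler_wpM2r; first by rewrite subr_ge0 ltW.
    apply: ler_sum => k _.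
    by rewrite ler_wiXn2l// ?ltW// -ltnS.
  rewrite mulrC -opprB mulNr -subrX1 opprB gerBl exprn_ge0//.
have [|N NP] := @geometric_small R t (M / (1 - t)) e _ e0; first by rewrite t0.
exists N => n /NP; rewrite normcB; apply: le_lt_trans; apply: le_trans (key n) _.
rewrite -/q -tq -exprM mulnC exprM expr2 -/t.
rewrite (_ : n.+1%:R * M * _ = (n.+1%:R * t ^+ n) * (M * t ^+ n)); last first.
  by ring.
rewrite mulrC mulrAC ler_wpM2r ?exprn_ge0// ler_wpM2l//.
Qed.

(** The hypothesis only provides an expansion near each point. The one at 0 is shown to represent u
    on every disc of radius r < 1, where u is bounded by compactness. *)
Lemma analytic_on_discP u : analytic_on_disc u -> exists a,
  forall z, unit_disc z -> power_series a z @ \oo --> (u z : R[i]^o).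
Proof.
move=> ud; have ua z : normc z < 1 -> analytic_at u z.
  move=> z1; have [a [r r0 H]] := ud _ z1; exists r, a; split=> // x xr.
  have := H (z + x); rewrite (addrC z) addrK => /(_ xr).
  by rewrite power_seriesE => /cvgCP.
have [s [b ub]] : analytic_at u 0 by apply: ua; rewrite normc0 ltr01.
exists b => z z1; rewrite power_seriesE; apply/cvgCP.
pose r := (normc z + 1) / 2.
have zr : normc z < r by rewrite /r; move: z1; rewrite /unit_disc/=; lra.
have r1 : r < 1 by rewrite /r; move: z1; rewrite /unit_disc/=; lra.
have r0 : 0 < r by exact: le_lt_trans (normc_ge0 _) zr.
have ua' x : normc x <= r -> analytic_at u x by move=> xr; exact/ua/(le_lt_trans xr).
have [x0 _ x0max] := max_on_disc (ltW r0) ua'.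
exact: (taylor_on_disc r0 (normc_ge0 _) ua' x0max ub).
Qed.

Lemma taylor_coefP u z : analytic_on_disc u -> unit_disc z ->
  cvgC (psum (taylor_coef u) z) (u z).
Proof.
move=> /analytic_on_discP[a aP] z1; apply/cvgCP; rewrite -power_seriesE.
rewrite /taylor_coef; case: xgetP => [b _ /(_ _ z1)//|/(_ a)]; by [].
Qed.

End taylor_expansion.

(** * Area measure and changes of variables *)

Section density.
Local Open Scope ereal_scope.
Context d (T : measurableType d) (R : realType).
Variables (mu : {measure set T -> \bar R}) (g : T -> R).
Hypotheses (g0 : forall x, (0 <= g x)%R) (mg : measurable_fun setT g).

Definition mdensity (A : set T) : \bar R := \int[mu]_(x in A) (g x)%:E.

Let mdensity0 : mdensity set0 = 0.
Proof. by rewrite /mdensity integral_set0. Qed.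

Let mdensity_ge0 A : 0 <= mdensity A.
Proof. by apply: integral_ge0 => x _; rewrite lee_fin. Qed.

Let mdensity_sigma_additive : semi_sigma_additive mdensity.
Proof.
move=> /= F mF tF mUF; rewrite /mdensity; apply: cvg_toP.
  apply: ereal_nondecreasing_is_cvgn => m n mn.
  apply: lee_sum_nneg_natr => // k _ _.
  by apply: integral_ge0 => x _; rewrite lee_fin.
rewrite ge0_integral_bigcup//=; last by move=> x _; rewrite lee_fin.
by apply: measurable_funTS; exact: measurableT_comp.
Qed.

HB.instance Definition _ := isMeasure.Build _ _ _ mdensity
  mdensity0 mdensity_ge0 mdensity_sigma_additive.

Definition mdensity_measure : {measure set T -> \bar R} := mdensity.

Import HBNNSimple.

(** Monotone convergence along simple functions. [nu] is known only through its values, so that the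
    lemma serves both [mdensity_measure] and [hyperbolic_measure]. *)
Lemma ge0_integral_density (nu : {measure set T -> \bar R}) (D : set T) (f : T -> \bar R) :
  (forall A, measurable A -> nu A = \int[mu]_(x in A) (g x)%:E) ->
  measurable D -> measurable_fun D f -> (forall x, D x -> 0 <= f x) ->
  \int[nu]_(x in D) f x = \int[mu]_(x in D) (f x * (g x)%:E).
Proof.
move=> nuE mD mf f0; pose f_ := nnsfun_approx mD mf.
have mgD : measurable_fun D (EFin \o g) by apply: measurable_funTS; exact: measurableT_comp.
have fE x : D x -> f x = lim ((EFin \o f_ n) x @[n --> \oo]).
  by move=> Dx; apply/esym/cvg_lim => //; exact: cvg_nnsfun_approx.
transitivity (lim (\int[nu]_(x in D) (f_ n x)%:E @[n --> \oo])).
  rewrite -monotone_convergence//=.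
  - by apply: eq_integral => x /[!inE] /fE.
  - by move=> n; exact/measurable_EFinP/measurable_funTS.
  - by move=> n x _; rewrite lee_fin.
  - by move=> x _ a b ab; rewrite lee_fin; exact/lefP/nd_nnsfun_approx.
transitivity (lim (\int[mu]_(x in D) ((f_ n x)%:E * (g x)%:E) @[n --> \oo])); last first.
  rewrite -monotone_convergence//=.
  - apply: eq_integral => x /[!inE] Dx; apply/cvg_lim => //.
    by apply: cvgeZr => //; exact: cvg_nnsfun_approx.
  - move=> n; apply: emeasurable_funM => //.
    exact/measurable_EFinP/measurable_funTS.
  - by move=> n x _; rewrite mule_ge0 ?lee_fin.
  - move=> x _ a b ab; rewrite lee_wpmul2r ?lee_fin//.
    exact/lefP/nd_nnsfun_approx.
apply: congr_lim; apply/funext => n.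
under eq_integral do rewrite fimfunE -fsumEFin//.
rewrite ge0_integral_fsum//; last 2 first.
  - by move=> r; apply/measurable_EFinP; exact: measurableT_comp.
  - by move=> r x _; rewrite EFinM nnfun_muleindic_ge0.
under [RHS]eq_integral.
  move=> x xD; rewrite fimfunE -fsumEFin// ge0_mule_fsuml; last first.
    by move=> r; rewrite EFinM nnfun_muleindic_ge0.
  over.
rewrite [RHS]ge0_integral_fsum//; last 2 first.
  - move=> r; apply: emeasurable_funM => //.
    by apply/measurable_EFinP; exact: measurableT_comp.
  - by move=> r x _; rewrite mule_ge0 ?lee_fin// -lee_fin EFinM nnfun_muleindic_ge0.
apply: eq_fsbigr => r rf.
have r0 : (0 <= r)%R by move: rf; rewrite inE => -[x _ <-].
transitivity (r%:E * nu (f_ n @^-1` [set r] `&` D)).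
  rewrite integralZl_indic_nnsfun// integral_indic//.
rewrite nuE; last by apply: measurableI.
under [RHS]eq_integral do rewrite EFinM -muleA.
rewrite ge0_integralZl//; last 2 first.
  - by apply: emeasurable_funM => //; exact/measurable_EFinP.
  - by move=> x _; rewrite mule_ge0 ?lee_fin.
congr (_ * _); rewrite integral_mkcondl.
apply: eq_integral => x _; rewrite patchE indicE.
by case: (x \in _); rewrite ?mul1e ?mul0e.
Qed.

End density.

Section image_measure.
Context d1 d2 (T1 : measurableType d1) (T2 : measurableType d2) (R : realType).
Variables (mu : {measure set T1 -> \bar R}) (f : T1 -> T2).
Hypothesis mf : measurable_fun setT f.

Definition image_measure : {measure set T2 -> \bar R} :=
  measure_function_pushforward__canonical__measure_function_Measure mu mf.

Lemma ge0_integral_image_measure (F : T2 -> \bar R) :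
  measurable_fun setT F -> (forall y, 0 <= F y)%E ->
  (\int[image_measure]_y F y = \int[mu]_x F (f x))%E.
Proof.
by move=> mF F0; rewrite [LHS](ge0_integral_pushforward mf)// preimage_setT.
Qed.

End image_measure.

(** * Affine substitutions and uniqueness of measures on the line *)

Section affine.
Variable R : realType.
Local Notation leb := (@lebesgue_measure R).

(** Uniqueness of Lebesgue measure reduces this to half-open intervals; a negative a exchanges their
    end points. *)
Lemma pushforward_affine (a b : R) (A : set R) : a != 0 -> measurable A ->
  (`|a|%:E * leb ((fun x => a * x + b)%R @^-1` A))%E = leb A.
Proof.
move=> a0 mA.
pose phi : R -> measurableTypeR R := fun x => a * x + b.
have mphi : measurable_fun setT phi by apply: measurable_funD => //; exact: measurable_funM.
pose na : {nonneg R} := NngNum (normr_ge0 a).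
pose m' : {measure set (measurableTypeR R) -> \bar R} := mscale na (image_measure leb mphi).
apply/esym; rewrite (@lebesgue_measure_unique _ m')// => _ [[u v] _ <-].
rewrite /m' /= /mscale/= /pushforward.
have [a_gt0|a_lt0|/eqP] := ltgtP 0 a; last by rewrite eq_sym (negbTE a0).
- rewrite (_ : _ @^-1` _ = `](u - b) / a, (v - b) / a]%classic); last first.
    apply/seteqP; split => x /=; rewrite !in_itv/= /phi => /andP[h1 h2].
      by rewrite ltr_pdivrMr// ler_pdivlMr// mulrC; apply/andP; split; lra.
    by move: h1 h2; rewrite ltr_pdivrMr// ler_pdivlMr// mulrC => h1 h2; apply/andP; split; lra.
  rewrite !lebesgue_measure_itv/= !lte_fin ltr_pM2r ?invr_gt0// ltrD2r.
  case: ifPn => _; last by rewrite mule0.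
  rewrite -EFinD -EFinM gtr0_norm//; congr (_%:E); field.
  by rewrite gt_eqF.
- rewrite (_ : _ @^-1` _ = `[(v - b) / a, (u - b) / a[%classic); last first.
    apply/seteqP; split => x /=; rewrite !in_itv/= /phi => /andP[h1 h2].
      by rewrite ler_ndivrMr// ltr_ndivlMr// mulrC; apply/andP; split; lra.
    by move: h1 h2; rewrite ler_ndivrMr// ltr_ndivlMr// mulrC => h1 h2; apply/andP; split; lra.
  rewrite !lebesgue_measure_itv/= !lte_fin ltr_nM2r ?invr_lt0// ltrD2r.
  case: ifPn => _; last by rewrite mule0.
  rewrite -EFinD -EFinM ltr0_norm//; congr (_%:E); field.
  by rewrite lt_eqF.
Qed.

Lemma integral_affine (a b : R) (F : R -> \bar R) : a != 0 ->
  (forall x, 0 <= F x)%E -> measurable_fun setT F ->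
  (\int[leb]_x (F (a * x + b)%R * `|a|%:E) = \int[leb]_x F x)%E.
Proof.
move=> a0 F0 mF.
pose phi : R -> measurableTypeR R := fun x => a * x + b.
have mphi : measurable_fun setT phi by apply: measurable_funD => //; exact: measurable_funM.
pose na : {nonneg R} := NngNum (normr_ge0 a).
pose m' : {measure set (measurableTypeR R) -> \bar R} := mscale na (image_measure leb mphi).
rewrite [RHS](eq_measure_integral m'); last first.
  by move=> A mA _; rewrite /m' /mscale/= /pushforward -(pushforward_affine b a0 mA).
rewrite /m' ge0_integral_mscale//= ge0_integral_image_measure//.
rewrite -ge0_integralZl//; first by apply: eq_integral => x _; rewrite muleC.
exact: measurableT_comp.
Qed.

(** The rays form a generating class stable under intersection. The measures compared below live on
    the half-line [0, +oo[, hence are finite on these rays. *)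
Lemma measure_unique_infty (m1 m2 : {measure set (measurableTypeR R) -> \bar R}) :
  (forall x : R, m1 `]-oo, x[%classic = m2 `]-oo, x[%classic) ->
  (forall x : R, m1 `]-oo, x[%classic < +oo)%E ->
  forall A, measurable A -> m1 A = m2 A.
Proof.
move=> m12 m1fin A mA.
apply: (@measure_unique _ R (measurableTypeR R) (@RGenInftyO.G R) (fun n =>
  `]-oo, n%:R[%classic)) => //.
- exact: RGenInftyO.measurableE.
- move=> _ _ [x ->] [y ->]; exists (Num.min x y).
  by apply/seteqP; split => t /=; rewrite !in_itv/= lt_min; [move=> [-> ->]|move=> /andP[]].
- by move=> n; exists n%:R.
- apply/seteqP; split => // x _; exists (Num.bound `|x : R|) => //=.
  by rewrite in_itv/= (le_lt_trans (ler_norm (x : R)))// archi_boundP// normr_ge0.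
- by move=> _ [x ->]; exact: m12.
Qed.

End affine.

(** * Measurability of complex-valued functions *)

Section complex_measurability.
Context d (T : measurableType d) (R : realType) (D : set T).
Implicit Types f g : T -> R[i].
Local Notation mC := (@Cmeasurable_fun _ _ R D).

Lemma CmeasurableD f g : mC f -> mC g -> mC (fun x => f x + g x).
Proof.
move=> [f1 f2] [g1 g2]; split.
  rewrite (_ : (fun x => _) = (fun x => complex.Re (f x) + complex.Re (g x))).
    exact: measurable_funD.
  by apply/funext => x; case: (f x) => ? ?; case: (g x).
rewrite (_ : (fun x => _) = (fun x => complex.Im (f x) + complex.Im (g x))).
  exact: measurable_funD.
by apply/funext => x; case: (f x) => ? ?; case: (g x).
Qed.

Lemma CmeasurableN f : mC f -> mC (fun x => - f x).
Proof.
move=> [f1 f2]; split.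
  rewrite (_ : (fun x => _) = (fun x => - complex.Re (f x))).
    exact: measurableT_comp.
  by apply/funext => x; case: (f x).
rewrite (_ : (fun x => _) = (fun x => - complex.Im (f x))).
  exact: measurableT_comp.
by apply/funext => x; case: (f x).
Qed.

Lemma CmeasurableB f g : mC f -> mC g -> mC (fun x => f x - g x).
Proof. by move=> mf mg; apply: CmeasurableD => //; exact: CmeasurableN. Qed.

Lemma Cmeasurable_conj f : mC f -> mC (fun x => (f x)^*%C).
Proof.
move=> [f1 f2]; split.
  rewrite (_ : (fun x => _) = (fun x => complex.Re (f x)))//.
  by apply/funext => x; case: (f x).
rewrite (_ : (fun x => _) = (fun x => - complex.Im (f x))).
  exact: measurableT_comp.
by apply/funext => x; case: (f x).
Qed.

Lemma CmeasurableM f g : mC f -> mC g -> mC (fun x => f x * g x).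
Proof.
move=> [f1 f2] [g1 g2]; split.
  rewrite (_ : (fun x => _) = (fun x => complex.Re (f x) * complex.Re (g x) -
    complex.Im (f x) * complex.Im (g x))).
    by apply: measurable_funB; exact: measurable_funM.
  by apply/funext => x; case: (f x) => ? ?; case: (g x).
rewrite (_ : (fun x => _) = (fun x => complex.Re (f x) * complex.Im (g x) +
    complex.Im (f x) * complex.Re (g x))).
  by apply: measurable_funD; exact: measurable_funM.
by apply/funext => x; case: (f x) => ? ?; case: (g x).
Qed.

Lemma Cmeasurable_cst (a : R[i]) : mC (fun=> a).
Proof. by split; exact: measurable_cst. Qed.

Lemma Cmeasurable_real (f : T -> R) : measurable_fun D f -> mC (fun x => (f x)%:C).
Proof. by move=> mf; split => //; exact: measurable_cst. Qed.

Lemma CmeasurableX f n : mC f -> mC (fun x => f x ^+ n).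
Proof.
move=> mf; elim: n => [|n ih]; first exact: (Cmeasurable_cst 1).
rewrite (_ : (fun x => _) = (fun x => f x * f x ^+ n)).
  exact: CmeasurableM.
by apply/funext => x; rewrite exprS.
Qed.

Lemma Cmeasurable_sum n (F : nat -> T -> R[i]) : (forall k, mC (F k)) ->
  mC (fun x => \sum_(k < n) F k x).
Proof.
move=> mF; elim: n => [|n ih].
  rewrite (_ : (fun x => _) = (fun=> 0)); first exact: Cmeasurable_cst.
  by apply/funext => x; rewrite big_ord0.
rewrite (_ : (fun x => _) = (fun x => \sum_(k < n) F k x + F n x)).
  exact: CmeasurableD.
by apply/funext => x; rewrite big_ord_recr.
Qed.

Lemma measurable_normc_sqr f : mC f -> measurable_fun D (fun x => normc (f x) ^+ 2).
Proof.
move=> [f1 f2]; under eq_fun do rewrite sqr_normcE.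
by apply: measurable_funD; exact: measurable_funX.
Qed.

Lemma measurable_normc f : mC f -> measurable_fun D (fun x => normc (f x)).
Proof.
move=> mf; rewrite (_ : (fun x => _) = (fun x => Num.sqrt (normc (f x) ^+ 2))).
  apply: measurableT_comp; last exact: measurable_normc_sqr.
  by apply: continuous_measurable_fun; exact: sqrt_continuous.
by apply/funext => x; rewrite sqrtr_sqr ger0_norm// normc_ge0.
Qed.

Lemma measurable_inv_ge0 (f : T -> R) : (forall x, 0 <= f x) -> measurable_fun D f ->
  measurable_fun D (fun x => (f x)^-1).
Proof.
move=> f0 mf; under eq_fun do rewrite -powR_inv1//.
by apply: (measurableT_comp (measurable_powR _)).
Qed.

Lemma CmeasurableV f : mC f -> mC (fun x => (f x)^-1).
Proof.
move=> mf; rewrite (_ : (fun x => _) = (fun x => (f x)^*%C * ((normc (f x) ^+ 2)^-1)%:C)).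
  apply: CmeasurableM; first exact: Cmeasurable_conj.
  apply: Cmeasurable_real; apply: measurable_inv_ge0.
    by move=> x; rewrite sqr_ge0.
  exact: measurable_normc_sqr.
apply/funext => x; have [->|f0] := eqVneq (f x) 0.
  by rewrite invr0 conjc0 mul0r.
by rewrite rmorphV/= ?unitfE ?sqrf_eq0 ?normc_eq0// -mul_conjc invfM mulrCA divff ?mulr1//
  conjc_eq0.
Qed.

Lemma Cmeasurable_div f g : mC f -> mC g -> mC (fun x => f x / g x).
Proof. by move=> mf mg; apply: CmeasurableM => //; exact: CmeasurableV. Qed.

End complex_measurability.

Definition pair_of_complex (R : realType) (z : R[i]) : R * R := (complex.Re z, complex.Im z).

Section complex_pair.
Variable R : realType.
Local Notation c := (@complex_of_pair R).
Local Notation pr := (@pair_of_complex R).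

Lemma complex_of_pairK : cancel c pr. Proof. by case. Qed.

Lemma pair_of_complexK : cancel pr c. Proof. by case. Qed.

Lemma Cmeasurable_of_pair : Cmeasurable_fun setT c.
Proof. by split; [exact: measurable_fst|exact: measurable_snd]. Qed.

Lemma measurable_pair_of_complex d (T : measurableType d) (f : T -> R[i]) :
  Cmeasurable_fun setT f -> measurable_fun setT (pr \o f).
Proof. by move=> [f1 f2]; exact: measurable_fun_pair. Qed.

Lemma measurable_comp_complex d d' (T : measurableType d) (T' : measurableType d')
    (F : R[i] -> T') (f : T -> R[i]) :
  measurable_fun setT (F \o c) -> Cmeasurable_fun setT f -> measurable_fun setT (F \o f).
Proof.
move=> mF mf; rewrite (_ : F \o f = (F \o c) \o (pr \o f)).
  by apply: measurableT_comp => //; exact: measurable_pair_of_complex.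
by apply/funext => x /=; rewrite pair_of_complexK.
Qed.

Lemma Cmeasurable_comp d (T : measurableType d) (F : R[i] -> R[i]) (f : T -> R[i]) :
  Cmeasurable_fun setT (F \o c) -> Cmeasurable_fun setT f -> Cmeasurable_fun setT (F \o f).
Proof.
move=> [F1 F2] mf; split.
  exact: (measurable_comp_complex (F := fun z => complex.Re (F z))).
exact: (measurable_comp_complex (F := fun z => complex.Im (F z))).
Qed.

Lemma Cmeasurable_precomp d d' (T : measurableType d) (T' : measurableType d')
    (g : T' -> R[i]) (h : T -> T') :
  Cmeasurable_fun setT g -> measurable_fun setT h -> Cmeasurable_fun setT (g \o h).
Proof. by move=> [g1 g2] mh; split; [exact: (measurableT_comp g1)|exact: (measurableT_comp g2)].
  Qed.

Lemma measurable_invr : measurable_fun setT (fun s : R => s^-1).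
Proof.
rewrite (_ : (fun s => _) = (fun s : R => s * (s ^+ 2)^-1)).
  apply: measurable_funM => //; apply: measurable_inv_ge0 => [s|]; first exact: sqr_ge0.
  exact: measurable_funX.
apply/funext => s; have [->|s0] := eqVneq s 0; first by rewrite invr0 mul0r.
by rewrite expr2 invfM mulrA divff ?mul1r.
Qed.

Lemma Cmeasurable_expi : Cmeasurable_fun setT (@expi R).
Proof.
split; apply: continuous_measurable_fun; [exact: continuous_cos|exact: continuous_sin].
Qed.

End complex_pair.

(** * Changes of variables in the plane *)

Section change_of_variables.
Local Open Scope ereal_scope.
Variable R : realType.
Local Notation leb := (@lebesgue_measure R).
Local Notation area := (@area R).
Local Notation c := (@complex_of_pair R).
Local Notation pr := (@pair_of_complex R).

(** A substitution with Jacobian J, expressed by the integral identity alone. Such pairs compose by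
    the chain rule ([area_cv_comp]), and Moebius maps are assembled from shears and one
    inversion. *)
Definition area_cv (phi : R * R -> R * R) (J : R * R -> R) :=
  [/\ measurable_fun setT phi, measurable_fun setT J, forall p, (0 <= J p)%R &
   forall F : R * R -> \bar R, (forall p, 0 <= F p) -> measurable_fun setT F ->
   \int[area]_p (F (phi p) * (J p)%:E) = \int[area]_p F p].

Lemma area_tonelli1 (F : R * R -> \bar R) : (forall p, 0 <= F p) ->
  measurable_fun setT F -> \int[area]_p F p = \int[leb]_x \int[leb]_y F (x, y).
Proof. by move=> F0 mF; exact: (@fubini_tonelli1 _ _ _ _ _ leb leb F). Qed.

Lemma area_tonelli2 (F : R * R -> \bar R) : (forall p, 0 <= F p) ->
  measurable_fun setT F -> \int[area]_p F p = \int[leb]_y \int[leb]_x F (x, y).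
Proof. by move=> F0 mF; exact: (@fubini_tonelli2 _ _ _ _ _ leb leb F). Qed.

Lemma area_cv_ext phi phi' J J' : phi =1 phi' -> J =1 J' -> area_cv phi J -> area_cv phi' J'.
Proof. by move=> /funext -> /funext ->. Qed.

Lemma area_cv_comp phi J phi' J' : area_cv phi J -> area_cv phi' J' ->
  area_cv (phi' \o phi) (fun p => J' (phi p) * J p)%R.
Proof.
move=> [mphi mJ J0 H] [mphi' mJ' J'0 H']; split.
- exact: measurableT_comp.
- by apply: measurable_funM => //; exact: measurableT_comp.
- by move=> p; rewrite mulr_ge0.
- move=> F F0 mF; rewrite -(H' F F0 mF) -(H (fun p => F (phi' p) * (J' p)%:E)).
  + by apply: eq_integral => p _; rewrite EFinM muleA.
  + by move=> p; rewrite mule_ge0 ?lee_fin.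
  + apply: emeasurable_funM; first exact: measurableT_comp.
    exact: measurableT_comp.
Qed.

Lemma area_cv_shear1 (a b k : R) : a != 0%R ->
  area_cv (fun p => (a * p.1 + b * p.2 + k, p.2)%R) (fun=> `|a|%R).
Proof.
move=> a0.
have mphi : measurable_fun [set: R * R] (fun p => (a * p.1 + b * p.2 + k, p.2)%R).
  apply: measurable_fun_pair; last exact: measurable_snd.
  apply: measurable_funD => //; apply: measurable_funD; apply: measurable_funM => //.
split => //.
move=> F F0 mF.
have mF1 : measurable_fun setT (fun p : R * R => F (a * p.1 + b * p.2 + k, p.2)%R * `|a|%:E).
  by apply: emeasurable_funM => //; apply: (measurableT_comp mF mphi).
rewrite area_tonelli2//; last by move=> p; rewrite mule_ge0 ?lee_fin.
rewrite (area_tonelli2 F0 mF); apply: eq_integral => y _ /=.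
rewrite -(@integral_affine R a (b * y + k)%R (fun x => F (x, y)))//.
  by apply: eq_integral => x _; rewrite addrA.
exact: measurableT_comp.
Qed.

Lemma area_cv_shear2 (a b k : R) : a != 0%R ->
  area_cv (fun p => (p.1, a * p.2 + b * p.1 + k)%R) (fun=> `|a|%R).
Proof.
move=> a0.
have mphi : measurable_fun [set: R * R] (fun p => (p.1, a * p.2 + b * p.1 + k)%R).
  apply: measurable_fun_pair; first exact: measurable_fst.
  apply: measurable_funD => //; apply: measurable_funD; apply: measurable_funM => //.
split => //.
move=> F F0 mF.
have mF1 : measurable_fun setT (fun p : R * R => F (p.1, a * p.2 + b * p.1 + k)%R * `|a|%:E).
  by apply: emeasurable_funM => //; apply: (measurableT_comp mF mphi).
rewrite area_tonelli1//; last by move=> p; rewrite mule_ge0 ?lee_fin.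
rewrite (area_tonelli1 F0 mF); apply: eq_integral => x _ /=.
rewrite -(@integral_affine R a (b * x + k)%R (fun y => F (x, y)))//.
  by apply: eq_integral => y _; rewrite addrA.
exact: measurableT_comp.
Qed.

Lemma area_cv_add (w : R[i]) : area_cv (fun p => pr (c p + w)%R) (fun=> 1%R).
Proof.
have := area_cv_comp (@area_cv_shear1 1 0 (complex.Re w) (oner_neq0 _))
  (@area_cv_shear2 1 0 (complex.Im w) (oner_neq0 _)).
apply: area_cv_ext => [[x y]|p]; last by rewrite normr1 mulr1.
by rewrite /pr /= !mul1r !mul0r !addr0; case: w.
Qed.

(** Multiplication by a + i b with a != 0 is a product of two shears. If the real part vanishes, w
    is written as (w / (1 + i)) (1 + i), where both factors have nonzero real part. *)
Lemma area_cv_mul (w : R[i]) : w != 0%R ->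
  area_cv (fun p => pr (w * c p)%R) (fun=> normc w ^+ 2)%R.
Proof.
have H (v : R[i]) : (complex.Re v != 0)%R ->
    area_cv (fun p => pr (v * c p)%R) (fun=> normc v ^+ 2)%R.
  case: v => a b /= a0.
  have k0 : ((a ^+ 2 + b ^+ 2) / a != 0)%R.
    rewrite mulf_neq0 ?invr_eq0// gt_eqF// ltr_pwDl ?sqr_ge0//.
    by rewrite lt_neqAle sqr_ge0 andbT eq_sym sqrf_eq0.
  have := area_cv_comp (@area_cv_shear1 a (- b) 0 a0) (@area_cv_shear2 ((a ^+ 2 + b ^+ 2) / a) (b
    / a) 0 k0).
  apply: area_cv_ext => [[x y]|p].
    rewrite /pr /=; congr pair; first by ring.
    by field.
  rewrite -normrM divfK// sqr_normcE/= ger0_norm// addr_ge0// sqr_ge0//.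
move=> w0; have [w1|] := eqVneq (complex.Re w) 0%R; last exact: H.
pose v : R[i] := Complex (1%R : R) 1%R.
have v0 : v != 0%R by rewrite eq_complex/= oner_eq0.
have hv : complex.Re v != 0%R by rewrite /= oner_neq0.
have hw : complex.Re (w / v)%R != 0%R.
  move: w0 w1; case: w => x y /= w0 w1; move: w0; rewrite {}w1 eq_complex/= eqxx/= => y0.
  rewrite !expr1n mul0r sub0r mulrN opprK mul1r mulf_neq0//.
have := area_cv_comp (H _ hv) (H _ hw).
apply: area_cv_ext => [p /=|p]; first by rewrite pair_of_complexK mulrA divfK.
by rewrite -exprMn -normcM divfK.
Qed.

Lemma area_cv_conj : area_cv (fun p => pr (c p)^*%C) (fun=> 1%R).
Proof.
have := @area_cv_shear2 (-1) 0 0; rewrite oppr_eq0 oner_eq0 => /(_ isT).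
apply: area_cv_ext => [[x y]|p]; last by rewrite normrN normr1.
by rewrite /pr /= mul0r !addr0 mulN1r.
Qed.

End change_of_variables.

(** * Rotation invariance of the measure on the circle *)

Section circle.
Local Open Scope ereal_scope.
Variable R : realType.
Local Notation leb := (@lebesgue_measure R).
Local Notation circ := (@circle_measure R).
Local Notation c := (@complex_of_pair R).
Local Notation pr := (@pair_of_complex R).

Lemma measurable_expi_comp (F : R[i] -> \bar R) : measurable_fun setT (F \o c) ->
  measurable_fun setT (fun t => F (expi t)).
Proof. by move=> mF; exact: (measurable_comp_complex mF (Cmeasurable_expi R)). Qed.

Lemma integral_circle (F : R -> \bar R) : measurable_fun setT F -> (forall t, 0 <= F t) ->
  \int[circ]_t F t = ((2 * pi)^-1)%:E * \int[leb]_(t in `[0%R, (2 * pi)%R]) F t.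
Proof.
move=> mF F0; rewrite [LHS](@integral_uniform R 0 (2 * pi) (two_pi_gt0 R) F mF F0).
by rewrite subr0.
Qed.

Lemma integral_shift_itv (a b k : R) (F : R -> \bar R) : measurable_fun setT F ->
  (forall t, 0 <= F t) ->
  \int[leb]_(t in `[a, b]) F (t + k)%R = \int[leb]_(t in `[(a + k)%R, (b + k)%R]) F t.
Proof.
move=> mF F0; rewrite integral_mkcond [RHS]integral_mkcond.
rewrite -[RHS](@integral_affine R 1 k)//; last 2 first.
- by move=> t; rewrite patchE; case: ifP.
- apply/(measurable_restrictT _ _).1 => //; exact: measurable_funTS.
apply: eq_integral => t _; rewrite normr1 mule1 mul1r !patchE.
have -> // : (t \in `[a, b]%classic) = ((t + k)%R \in `[(a + k)%R, (b + k)%R]%classic).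
by apply/idP/idP; rewrite !inE/= !in_itv/= !lerD2r.
Qed.

Lemma ge0_integral_itv_split (a b d : R) (F : R -> \bar R) : (a <= b <= d)%R ->
  measurable_fun setT F -> (forall t, 0 <= F t) ->
  \int[leb]_(t in `[a, d]) F t = \int[leb]_(t in `[a, b]) F t + \int[leb]_(t in `[b, d]) F t.
Proof.
move=> /andP[ab bd] mF F0.
rewrite -[X in _ + X]integral_itv_obnd_cbnd; last exact: measurable_funTS.
rewrite -ge0_integral_setU//=; first last.
- apply/disj_setPS => t /= []; rewrite !in_itv/= => /andP[_ h] /andP[h' _].
  by move: h; rewrite leNgt h'.
- exact: measurable_funTS.
congr integral; apply/seteqP; split => t /=; rewrite !in_itv/=.
  by move=> /andP[-> ->]/=; rewrite andbT; case: (leP t b) => h; [left|right].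
by move=> [/andP[-> tb]|/andP[bt ->]]; rewrite ?(le_trans tb bd)// (le_trans ab) ?ltW.
Qed.

Lemma expi_surj (w : R[i]) : normc w = 1%R -> exists2 t : R, (0 <= t <= 2 * pi)%R & expi t = w.
Proof.
case: w => a b w1; have ab : (a ^+ 2 + b ^+ 2 = 1)%R.
  by have := sqr_normcE (Complex a b); rewrite w1 expr1n => <-.
have a1 : (-1 <= a <= 1)%R by nra.
have acosb := acos_ge0 a1; have acosp := acos_lepi a1.
have p0 : (0 <= pi :> R)%R := pi_ge0 R.
have sq : (Num.sqrt (1 - a ^+ 2) = `|b|)%R by rewrite -ab addrC addKr sqrtr_sqr.
have [b0|b0] := leP 0%R b.
  exists (acos a); first by apply/andP; split; lra.
  by rewrite /expi acosK// sin_acos// sq ger0_norm.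
exists (2 * pi - acos a)%R; first by apply/andP; split; lra.
rewrite /expi cosB sinB mulr_natl cos2pi sin2pi mul1r !mul0r addr0 sub0r acosK//.
by rewrite sin_acos// sq ltr0_norm// mul1r opprK.
Qed.

Lemma expi_add2pi (t : R) : expi (t + 2 * pi) = expi t.
Proof. by rewrite expiD /expi mulr_natl cos2pi sin2pi mulr1. Qed.

(** With w = e^(ik) the rotation shifts the period to [k, 2 pi + k]; the part beyond 2 pi is moved
    back to [0, k] by periodicity. *)
Lemma circle_rotate (F : R[i] -> \bar R) (w : R[i]) : normc w = 1%R ->
  (forall z, 0 <= F z) -> measurable_fun setT (F \o c) ->
  \int[circ]_t F (w * expi t)%R = \int[circ]_t F (expi t).
Proof.
move=> w1 F0 mF; have [k /andP[k0 k2] <-] := expi_surj w1.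
pose G t := F (expi t).
have mG : measurable_fun setT G by exact: measurable_expi_comp.
have mGk : measurable_fun setT (fun t : R => G (t + k)%R).
  by apply: (measurableT_comp mG); exact: measurable_funD.
transitivity (\int[circ]_t G (t + k)%R).
  by apply: eq_integral => t _; rewrite /G addrC expiD.
rewrite [RHS](integral_circle mG (fun=> F0 _)).
rewrite [LHS](integral_circle mGk (fun=> F0 _)); congr (_ * _).
rewrite (@integral_shift_itv 0 (2 * pi) k G mG (fun=> F0 _)) add0r.
have p0 : (0 <= pi :> R)%R := pi_ge0 R.
rewrite (@ge0_integral_itv_split k (2 * pi)%R (2 * pi + k)%R G _ mG (fun=> F0 _)); last first.
  by apply/andP; split => //; lra.
rewrite [RHS](@ge0_integral_itv_split 0%R k (2 * pi)%R G _ mG (fun=> F0 _)); last by rewrite k0.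
rewrite addeC; congr (_ + _).
have := @integral_shift_itv 0 k (2 * pi) G mG (fun=> F0 _).
rewrite add0r addrC => <-.
by apply: eq_integral => t _; rewrite /G expi_add2pi.
Qed.

End circle.

(** * Polar integration and the inversion of the plane *)

Section radial.
Local Open Scope ereal_scope.
Variable R : realType.
Local Notation leb := (@lebesgue_measure R).
Local Notation area := (@area R).
Local Notation circ := (@circle_measure R).
Local Notation c := (@complex_of_pair R).
Local Notation pr := (@pair_of_complex R).

Let rho (p : R * R) : R := (normc (c p) ^+ 2)%R.

Let mrho : measurable_fun setT rho.
Proof. exact/measurable_normc_sqr/Cmeasurable_of_pair. Qed.

Let rho0 p : (0 <= rho p)%R. Proof. by rewrite /rho sqr_ge0. Qed.

Lemma area_disc_lty : area (@disc R) < +oo.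
Proof.
apply: (@le_lt_trans _ _ (area (`[-1, 1]%classic `*` `[-1, 1]%classic)%R)).
  apply: le_measure; rewrite ?inE; first exact: measurable_disc.
    by apply: measurableX; exact: measurable_itv.
  move=> [x y]; rewrite /disc /unit_disc /mkset => h; split => /=.
    by rewrite in_itv/= -ler_norml (le_trans (le_Re_normc (c (x, y))))// ltW.
  by rewrite in_itv/= -ler_norml (le_trans (le_Im_normc (c (x, y))))// ltW.
rewrite /area product_measure1E; [|exact: measurable_itv..].
have L : leb `[(-1)%R, 1%R]%classic = 2%:E.
  by rewrite lebesgue_measure_itv/= lte_fin ifT ?EFinN ?oppeK -?EFinD//; lra.
change (leb `[(-1)%R, 1%R]%classic * leb `[(-1)%R, 1%R]%classic < +oo).
by rewrite L -EFinM ltry.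
Qed.

Lemma area_rho_lt (x : R) : (0 < x)%R ->
  area [set p | (rho p < x)%R] = x%:E * area (@disc R).
Proof.
move=> x0; have sx0 : (0 < Num.sqrt x)%R by rewrite sqrtr_gt0.
have mA : measurable [set p | (rho p < x)%R].
  rewrite (_ : [set p | _] = rho @^-1` `]-oo, x[%classic).
    by rewrite -[X in measurable X]setTI; exact: mrho.
  by apply/seteqP; split => p /=; rewrite in_itv.
have w0 : ((Num.sqrt x)%:C != 0)%R by rewrite -normc_eq0 normc_real gtr0_norm// gt_eqF.
have [_ _ _ H] := area_cv_mul w0.
have := H (fun p => (\1_[set p | (rho p < x)%R] p)%:E).
rewrite integral_indic// setIT => <-//; last exact/measurable_EFinP.
rewrite normc_real gtr0_norm// sqr_sqrtr ?ltW//.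
under eq_integral do rewrite muleC.
rewrite ge0_integralZl//; last 2 first.
- have mI : measurable_fun setT (\1_[set p | (rho p < x)%R] : R * R ->
  R) by exact: measurable_indic.
  have mpr : measurable_fun setT (fun p : R * R => pr ((Num.sqrt x)%:C * c p)%R).
    apply: measurable_pair_of_complex; apply: CmeasurableM; first exact: Cmeasurable_cst.
    exact: Cmeasurable_of_pair.
  by apply/measurable_EFinP; exact: (measurableT_comp mI mpr).
- by rewrite lee_fin ltW.
congr (_ * _).
rewrite -[X in _ = area X](setIT (@disc R)) -integral_indic//; last exact: measurable_disc.
apply: eq_integral => p _; congr (_%:E); rewrite !indicE; congr ((nat_of_bool _)%:R)%R.
apply/idP/idP; rewrite !inE /disc /unit_disc /rho /mkset pair_of_complexK normcM normc_real
  gtr0_norm//.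
  by rewrite exprMn sqr_sqrtr ?ltW// gtr_pMr// expr_lt1// normc_ge0.
by rewrite exprMn sqr_sqrtr ?ltW// gtr_pMr// expr_lt1// normc_ge0.
Qed.

(** The area of the unit disc, kept as an unknown constant until [kappa_pi] identifies it. *)
Let kappa : R := fine (area (@disc R)).

Let kappaE : area (@disc R) = kappa%:E.
Proof. by rewrite fineK// ge0_fin_numE// area_disc_lty. Qed.

Let kappa0 : (0 <= kappa)%R.
Proof. by rewrite fine_ge0. Qed.

Let pos := `[0%R, +oo[%classic : set R.

(** The image of area measure under |z|^2 is kappa times Lebesgue measure on [0, +oo[: the disc
    |z|^2 < x is the unit disc scaled by sqrt x, of area kappa x. *)
Let radial_kappa (F : R -> \bar R) : measurable_fun setT F -> (forall s, 0 <= F s) ->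
  \int[area]_p F (rho p) = kappa%:E * \int[leb]_(s in pos) F s.
Proof.
move=> mF F0.
have mrho' : measurable_fun setT (rho : R * R -> measurableTypeR R) by exact: mrho.
have mpos : measurable pos by exact: measurable_itv.
pose m1 : {measure set (measurableTypeR R) -> \bar R} := image_measure area mrho'.
have mg : measurable_fun setT (\1_pos : R -> R) by exact: measurable_indic.
have g0 s : (0 <= \1_pos s :> R)%R by [].
pose m2 : {measure set (measurableTypeR R) -> \bar R} :=
  mscale (NngNum kappa0) (mdensity_measure leb g0 mg).
have m2E (A : set R) : measurable A -> m2 A = kappa%:E * leb (A `&` pos).
  move=> mA; rewrite /m2/= /mscale/= /mdensity_measure/= /mdensity integral_indic//.
  by rewrite setIC.
have m1E (A : set R) : m1 A = area (rho @^-1` A) by [].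
have eqm A : measurable A -> m1 A = m2 A.
  apply: measure_unique_infty => x.
    rewrite m1E m2E//; have [x0|x0] := leP x 0%R.
      rewrite (_ : _ @^-1` _ = set0) ?measure0; last first.
        apply/seteqP; split => p //=; rewrite in_itv/= => h.
        by have := rho0 p; rewrite leNgt (lt_le_trans h x0).
      rewrite (_ : _ `&` _ = set0) ?measure0 ?mule0//.
      apply/seteqP; split => p // -[]; rewrite /pos /mkset !in_itv/= andbT => h h'.
      by move: h'; rewrite leNgt (lt_le_trans h x0).
    rewrite (_ : _ @^-1` _ = [set p | (rho p < x)%R]); last first.
      by apply/seteqP; split => p /=; rewrite in_itv.
    rewrite area_rho_lt// kappaE muleC; congr (_ * _).
    rewrite (_ : _ `&` _ = `[0%R, x[%classic); last first.
      by apply/seteqP; split => s; rewrite /pos /setI /mkset !in_itv/= andbT;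
        [move=> [-> ->]|move=> /andP[-> ->]].
    by rewrite lebesgue_measure_itv/= lte_fin x0 oppr0 adde0.
  apply: (@le_lt_trans _ _ (m1 `]-oo, (Num.max x 1%R)[%classic)).
    apply: le_measure; rewrite ?inE//.
    by apply: subset_itvl; rewrite bnd_simp le_max lexx.
  rewrite m1E (_ : _ @^-1` _ = [set p | (rho p < Num.max x 1%R)%R]); last first.
    by apply/seteqP; split => p /=; rewrite in_itv.
  rewrite area_rho_lt ?lt_max ?ltr01 ?orbT// kappaE -EFinM ltry//.
rewrite -(ge0_integral_image_measure area mrho')//.
rewrite (eq_measure_integral m2); last by move=> A mA _; exact: eqm.
rewrite /m2 ge0_integral_mscale//; congr (_ * _).
rewrite (@ge0_integral_density _ _ _ leb _ g0 mg)//.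
rewrite [RHS]integral_mkcond; apply: eq_integral => s _.
by rewrite patchE indicE; case: ifP => _; rewrite ?mule1 ?mule0.
Qed.

(** The integral of exp (- |z|^2) is kappa in the radial form and the square of the Gaussian
    integral, pi, in Cartesian coordinates. *)
Let kappa_pi : kappa = pi.
Proof.
have mE : measurable_fun setT (fun s : R => (expR (- s))%:E).
  by apply/measurable_EFinP; apply: measurableT_comp => //; exact: measurableT_comp.
have := radial_kappa mE (fun s => expR_ge0 _).
have -> : \int[leb]_(s in pos) (expR (- s))%:E = 1%:E.
  rewrite -(@integral_exponential_pdf R 1 ltr01)// integral_mkcond.
  apply: eq_integral => s _; rewrite /exponential_pdf restrict_EFin /= !patchE -/pos.
  by case: ifP => // _; rewrite mul1r mulN1r.
rewrite mule1 => hk; apply: EFin_inj; rewrite -hk.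
have mG : measurable_fun setT (fun p : R * R => (expR (- rho p))%:E).
  apply/measurable_EFinP; apply: measurableT_comp => //; exact: measurableT_comp.
have mg : measurable_fun setT (fun y : R => (gauss_fun y)%:E).
  by apply/measurable_EFinP; exact: measurable_gauss_fun.
rewrite area_tonelli1//.
transitivity (\int[leb]_x ((Num.sqrt pi)%:E * (gauss_fun x)%:E)).
  apply: eq_integral => x _; rewrite -(@integralT_gauss R).
  rewrite -ge0_integralZr//; try by [move=> ? _;
    rewrite lee_fin gauss_fun_ge0 | rewrite lee_fin gauss_fun_ge0].
  apply: eq_integral => y _; rewrite /rho sqr_normcE/= -EFinM /gauss_fun -expRD.
  by rewrite opprD addrC.
rewrite ge0_integralZl ?integralT_gauss//; last by move=> x _; rewrite lee_fin gauss_fun_ge0.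
by rewrite -EFinM -expr2 sqr_sqrtr// pi_ge0.
Qed.

Lemma area_radial (F : R -> \bar R) : measurable_fun setT F -> (forall s, 0 <= F s) ->
  \int[area]_p F (normc (c p) ^+ 2)%R = pi%:E * \int[leb]_(s in `[0%R, +oo[) F s.
Proof. by move=> mF F0; rewrite radial_kappa// kappa_pi. Qed.

(** The image under s -> 1 / s of the measure with density s^(-2) on [0, +oo[ is compared with
    Lebesgue measure on rays: the integral of s^(-2) over ]1/x, +oo[ is x. *)
Lemma integral_inverse (F : R -> \bar R) : measurable_fun setT F -> (forall s, 0 <= F s) ->
  \int[leb]_(s in `[0%R, +oo[) (F s^-1%R * ((s ^+ 2)^-1)%:E) = \int[leb]_(s in `[0%R, +oo[) F s.
Proof.
move=> mF F0.
have mpos : measurable pos by exact: measurable_itv.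
pose g (s : R) : R := (\1_pos s * (s ^+ 2)^-1)%R.
have mi2 : measurable_fun setT (fun s : R => ((s ^+ 2)^-1)%R).
  by apply: measurable_inv_ge0 => [s|]; [rewrite sqr_ge0|exact: measurable_funX].
have mg : measurable_fun setT g by apply: measurable_funM => //; exact: measurable_indic.
have g0 s : (0 <= g s)%R by rewrite mulr_ge0 ?invr_ge0 ?sqr_ge0.
have mi : measurable_fun setT (fun s : R => s^-1%R : measurableTypeR R) by exact: measurable_invr.
pose m1 : {measure set (measurableTypeR R) ->
  \bar R} := image_measure (mdensity_measure leb g0 mg) mi.
have m1g : measurable_fun setT (\1_pos : R -> R) by exact: measurable_indic.
have g1 s : (0 <= \1_pos s :> R)%R by [].
pose m2 : {measure set (measurableTypeR R) -> \bar R} := mdensity_measure leb g1 m1g.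
have m2E (A : set R) : measurable A -> m2 A = leb (A `&` pos).
  move=> mA; rewrite /m2/= /mdensity_measure/= /mdensity integral_indic//.
  by rewrite setIC.
have m1E (A : set R) : m1 A = \int[leb]_(s in (fun s : R => s^-1%R) @^-1` A) (g s)%:E by [].
have m2x x : m2 `]-oo, x[%classic = (Num.max x 0)%:E.
  rewrite m2E//; have [x0|x0] := leP x 0%R.
    rewrite (_ : _ `&` _ = set0) ?measure0//.
    apply/seteqP; split => p // -[]; rewrite /pos /mkset !in_itv/= andbT => h h'.
    by move: h'; rewrite leNgt (lt_le_trans h x0).
  rewrite (_ : _ `&` _ = `[0%R, x[%classic); last first.
    by apply/seteqP; split => s; rewrite /pos /setI /mkset !in_itv/= andbT;
      [move=> [-> ->]|move=> /andP[-> ->]].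
  by rewrite lebesgue_measure_itv/= lte_fin x0 oppr0 adde0.
have m12 (x : R) : m1 `]-oo, x[%classic = m2 `]-oo, x[%classic.
  rewrite m2x m1E; have [x0|x0] := leP x 0%R.
    apply: integral0_eq => s /=; rewrite in_itv/= => h.
    rewrite /g indicE memNset ?mul0r//= /pos/= in_itv/= andbT; apply/negP; rewrite -ltNge.
    by rewrite -invr_lt0 (lt_le_trans h x0).
  have xV0 : (0 < x^-1)%R by rewrite invr_gt0.
  transitivity (\int[leb]_(s in `]x^-1%R, +oo[) ((s ^+ 2)^-1)%:E).
    rewrite integral_mkcond [RHS]integral_mkcond; apply: eq_integral => s _.
    rewrite !patchE; case: ifPn => h1; case: ifPn => h2 //.
    - move: h2; rewrite inE/= in_itv/= andbT => h2.
      by rewrite /g indicE mem_set ?mul1r//= /pos/= in_itv/= andbT ltW// (lt_trans xV0).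
    - rewrite /g indicE; have [s0|s0] := boolP (s \in pos); last by rewrite mul0r.
      (* Since the inverse of 0 is 0, the point 0 belongs to the preimage of the ray, but the
         density vanishes there. *)
      have [->|sn0] := eqVneq s 0%R; first by rewrite expr0n/= invr0 mulr0.
      move: s0 h1 h2; rewrite !inE /pos /mkset /= !in_itv/= !andbT => s0 h1 /negP[].
      by rewrite inE/= in_itv/= andbT invf_plt ?posrE// lt_neqAle eq_sym sn0.
    - move: h1 h2; rewrite notin_setE !inE/= !in_itv/= andbT => h1 h2; exfalso; apply: h1.
      by rewrite invf_plt ?posrE// (lt_trans xV0).
  rewrite integral_itv_obnd_cbnd; last by apply/measurable_EFinP; exact: measurable_funTS.
  have ds (y : R) : (x^-1 <= y -> y != 0)%R by move=> h; rewrite gt_eqF// (lt_le_trans xV0 h).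
  have dv (y : R) : (y != 0)%R -> is_derive y (1%R : R) (fun s : R => - s^-1)%R (y ^- 2)%R.
    move=> y0; rewrite -[X in is_derive _ _ _ X]opprK; apply: is_deriveN.
    have := is_deriveV y0 (is_derive_id y 1%R). by rewrite /GRing.scale/= mulr1.
  rewrite (@ge0_continuous_FTC2y _ _ (fun s => - s^-1)%R _ 0)//.
  - by rewrite sub0e -EFinN opprK invrK.
  - by move=> s _; rewrite invr_ge0 sqr_ge0.
  - apply: continuous_in_subspaceT => s /set_mem /=; rewrite in_itv/= andbT => h.
    apply: cvgV; first by rewrite expf_neq0// ds.
    exact: exprn_continuous.
  - by rewrite -oppr0; apply: cvgN; apply/gtr0_cvgV0; [exact: nbhs_pinfty_gt|exact: cvg_id].
  - by move=> s h; apply: (@ex_derive _ _ _ _ _ _ _ (dv s (ds _ (ltW h)))).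
  - apply: cvg_at_right_filter; apply: cvgN; apply: cvgV => //; exact: ds.
  - move=> s; rewrite in_itv/= andbT => h; rewrite derive1E.
    by rewrite (@derive_val _ _ _ _ _ _ _ (dv s (ds _ (ltW h)))).
have eqm A : measurable A -> m1 A = m2 A.
  by apply: measure_unique_infty => // x; rewrite m12 m2x ltry.
transitivity (\int[m1]_s F s).
  rewrite /m1 (ge0_integral_image_measure (mdensity_measure leb g0 mg) mi mF F0).
  rewrite (@ge0_integral_density _ _ _ leb _ g0 mg)//; last exact: (measurableT_comp mF mi).
  rewrite [LHS]integral_mkcond; apply: eq_integral => s _; rewrite patchE /g indicE -/pos.
  by case: (s \in pos); rewrite ?mul1r// mul0r mule0.
rewrite (eq_measure_integral m2); last by move=> A mA _; exact: eqm.
rewrite (@ge0_integral_density _ _ _ leb _ g1 m1g)// [RHS]integral_mkcond.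
apply: eq_integral => s _; rewrite patchE indicE -/pos.
by case: (s \in pos); rewrite ?mule1// mule0.
Qed.

Lemma area_rotate (F : R * R -> \bar R) (w : R[i]) : normc w = 1%R ->
  (forall p, 0 <= F p) -> measurable_fun setT F ->
  \int[area]_p F (pr (w * c p)%R) = \int[area]_p F p.
Proof.
move=> w1 F0 mF; have w0 : w != 0%R by rewrite -normc_eq0 w1 oner_eq0.
have [_ _ _ H] := area_cv_mul w0; rewrite -(H F)//.
by apply: eq_integral => p _; rewrite w1 expr1n mule1.
Qed.

Definition circle_average (F : R * R -> \bar R) (p : R * R) : \bar R :=
  \int[circ]_t F (pr (expi t * c p)%R).

Lemma circle_average_ge0 F p : (forall p, 0 <= F p) -> 0 <= circle_average F p.
Proof. by move=> F0; exact: integral_ge0. Qed.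

Let mrotate F : measurable_fun setT F ->
  measurable_fun [set: (R * R) * R] (fun q => F (pr (expi q.2 * c q.1)%R) : \bar R).
Proof.
move=> mF; apply: (measurableT_comp mF); apply: measurable_pair_of_complex.
apply: CmeasurableM.
  exact: (Cmeasurable_precomp (Cmeasurable_expi R) measurable_snd).
exact: (Cmeasurable_precomp (Cmeasurable_of_pair R) measurable_fst).
Qed.

Lemma measurable_circle_average F : (forall p, 0 <= F p) -> measurable_fun setT F ->
  measurable_fun setT (circle_average F).
Proof.
move=> F0 mF.
by apply: (@measurable_fun_fubini_tonelli_F _ _ _ _ _ circ _ (mrotate mF)) => q; exact: F0.
Qed.

Lemma area_circle_average (F : R * R -> \bar R) : (forall p, 0 <= F p) ->
  measurable_fun setT F -> \int[area]_p circle_average F p = \int[area]_p F p.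
Proof.
move=> F0 mF; rewrite /circle_average.
rewrite (@fubini_tonelli _ _ _ _ _ area circ (fun q => F (pr (expi q.2 * c q.1)%R)) (mrotate mF))//.
rewrite (eq_integral (fun=> \int[area]_p F p)); last first.
  by move=> t _; exact: (area_rotate (normc_expi t) F0 mF).
by rewrite integral_cst// [X in _ * X]probability_setT mule1.
Qed.

Lemma circle_average_radial F p : (forall p, 0 <= F p) -> measurable_fun setT F ->
  circle_average F p = circle_average F (pr (normc (c p))%:C).
Proof.
move=> F0 mF; have [p0|p0] := eqVneq (c p) 0%R.
  have -> : (normc (c p))%:C = c p by rewrite p0 normc0.
  by rewrite complex_of_pairK.
have n0 : (normc (c p))%:C != 0%R :> R[i] by rewrite -normc_eq0 normc_real normr_eq0 normc_eq0.
pose w := (c p / (normc (c p))%:C)%R.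
have w1 : normc w = 1%R.
  by rewrite /w normcM normcV normc_real ger0_norm ?normc_ge0// divff// normc_eq0.
rewrite /circle_average !pair_of_complexK.
rewrite -[RHS](@circle_rotate R (fun z => F (pr (z * (normc (c p))%:C)%R)) w)//; last first.
  apply: (measurableT_comp mF); apply: measurable_pair_of_complex.
  by apply: CmeasurableM; [exact: Cmeasurable_of_pair|exact: Cmeasurable_cst].
by apply: eq_integral => t _; rewrite /w mulrAC divfK// mulrC.
Qed.

(* Averaging over rotations reduces the claim to radial functions, for which it
   is the substitution s = 1/|z|^2 in the radial formula. *)
Lemma area_cv_inv : area_cv (fun p => pr (c p)^-1%R) (fun p => ((normc (c p) ^+ 2) ^+ 2)^-1)%R.
Proof.
have mi : measurable_fun setT (fun p : R * R => pr (c p)^-1%R).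
  by apply: measurable_pair_of_complex; apply: CmeasurableV; exact: Cmeasurable_of_pair.
have mJ : measurable_fun setT (fun p : R * R => ((normc (c p) ^+ 2) ^+ 2)^-1)%R.
  by apply: measurable_inv_ge0 => [p|]; [rewrite sqr_ge0|exact: measurable_funX].
split => // [p|F F0 mF]; first by rewrite invr_ge0 sqr_ge0.
pose G p := F (pr (c p)^-1%R) * (((normc (c p) ^+ 2) ^+ 2)^-1)%:E.
have G0 p : 0 <= G p by rewrite mule_ge0// lee_fin invr_ge0 sqr_ge0.
have mG : measurable_fun setT G.
  by apply: emeasurable_funM; [exact: measurableT_comp|exact/measurable_EFinP].
(* Rotating z by e^(it) rotates 1 / z by e^(-it); composing F with conjugation restores the sense of
   rotation. *)
pose F' p := F (pr (c p)^*%C).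
have F'0 p : 0 <= F' p by exact: F0.
have mF' : measurable_fun setT F'.
  apply: (measurableT_comp mF); apply: measurable_pair_of_complex.
  by apply: Cmeasurable_conj; exact: Cmeasurable_of_pair.
pose Phi s := circle_average F' (pr (Num.sqrt s)%:C).
have Phi0 s : 0 <= Phi s by exact: circle_average_ge0.
have mPhi : measurable_fun setT Phi.
  apply: (measurableT_comp (measurable_circle_average F'0 mF')).
  apply: measurable_pair_of_complex; apply: Cmeasurable_real.
  by apply: continuous_measurable_fun; exact: sqrt_continuous.
have avF' p : circle_average F' p = Phi (rho p).
  by rewrite (circle_average_radial p F'0 mF') /Phi /rho sqrtr_sqr ger0_norm ?normc_ge0.
have avG p : circle_average G p = Phi (rho p)^-1%R * ((rho p ^+ 2)^-1)%:E.
  have -> : Phi (rho p)^-1%R = circle_average F' (pr (c p)^-1^*%C)%R.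
    by rewrite avF' /rho pair_of_complexK normc_conj normcV exprVn.
  rewrite /circle_average -ge0_integralZr//; last 2 first.
  - apply: (measurable_expi_comp (F := fun z => F' (pr (z * c (pr ((c p)^-1)^*%C))%R))).
    apply: (measurableT_comp mF'); apply: measurable_pair_of_complex.
    by apply: CmeasurableM; [exact: Cmeasurable_of_pair|exact: Cmeasurable_cst].
  - by rewrite lee_fin invr_ge0 sqr_ge0.
  apply: eq_integral => t _; rewrite /G /F' !pair_of_complexK normcM normc_expi mul1r.
  congr (F (pr _) * _); rewrite conjcM conjcK invfM; congr (_ * _)%R.
  apply: (mulfI (expi_neq0 t)); rewrite divff ?expi_neq0//.
  by rewrite expi_conjK.
transitivity (\int[area]_p F' p); last first.
  have [_ _ _ H] := area_cv_conj R; rewrite -(H F F0 mF).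
  by apply: eq_integral => p _; rewrite mule1.
rewrite -/G -(area_circle_average G0 mG) -(area_circle_average F'0 mF').
under eq_integral do rewrite avG.
under [RHS]eq_integral do rewrite avF'.
rewrite (area_radial (F := fun s => Phi s^-1%R * ((s ^+ 2)^-1)%:E))//; last 2 first.
- apply: emeasurable_funM.
    exact: (measurableT_comp mPhi (@measurable_invr R)).
  apply/measurable_EFinP; apply: measurable_inv_ge0 => [s|];
    [by rewrite sqr_ge0|exact: measurable_funX].
- by move=> s; rewrite mule_ge0// lee_fin invr_ge0 sqr_ge0.
by rewrite integral_inverse// -area_radial.
Qed.

End radial.

(** * Invariance of the hyperbolic measure *)

Section mobius_maps.
Variable R : realType.
Implicit Types z w x y zeta : R[i].
Local Notation area := (@area R).
Local Notation c := (@complex_of_pair R).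
Local Notation pr := (@pair_of_complex R).

Lemma conj_conjc z : Num.conj z = z^*%C.
Proof. by []. Qed.

Lemma mobiusE z w : mobius z w = (w - z) / (1 - z^*%C * w).
Proof. by []. Qed.

Lemma sub_sqr_normc_gt0 z : unit_disc z -> 0 < 1 - normc z ^+ 2.
Proof. by move=> z1; rewrite subr_gt0 expr_lt1// normc_ge0. Qed.

Lemma Re1B_gt0 x : normc x < 1 -> 0 < complex.Re (1 - x).
Proof.
move=> x1; have : complex.Re x < 1.
  by rewrite (le_lt_trans _ x1)// (le_trans (ler_norm _))// le_Re_normc.
by case: x x1 => a b _ /=; rewrite subr_gt0.
Qed.

Lemma Re_gt0_neq0 x : 0 < complex.Re x -> x != 0.
Proof. by apply: contraTneq => ->; rewrite ltxx. Qed.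

Lemma normc_conjM_lt1 z w : unit_disc z -> unit_disc w -> normc (z^*%C * w) < 1.
Proof.
rewrite /unit_disc/= => z1 w1; rewrite normcM normc_conj.
by rewrite mulr_ilt1 ?normc_ge0.
Qed.

Lemma one_sub_neq0 x : normc x < 1 -> 1 - x != 0.
Proof. by move=> /Re1B_gt0/Re_gt0_neq0. Qed.

Lemma denom_neq0 z w : unit_disc z -> unit_disc w -> 1 - z^*%C * w != 0.
Proof. by move=> z1 w1; exact/one_sub_neq0/normc_conjM_lt1. Qed.

Lemma normc_sqr_complex x : ((normc x ^+ 2)%:C)%C = x * x^*%C.
Proof. by rewrite mul_conjc. Qed.

Lemma one_sub_sqr_complex x : ((1 - normc x ^+ 2)%:C)%C = 1 - x * x^*%C.
Proof. by rewrite -normc_sqr_complex rmorphB rmorph1. Qed.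

Lemma real_complex_mul_div (a b k : R) : ((a * b / k)%:C)%C = a%:C * b%:C / k%:C :> R[i].
Proof. by rewrite fmorph_div rmorphM. Qed.

Lemma one_sub_normc_mobius z w : 1 - z^*%C * w != 0 ->
  1 - normc (mobius z w) ^+ 2 =
  (1 - normc z ^+ 2) * (1 - normc w ^+ 2) / normc (1 - z^*%C * w) ^+ 2.
Proof.
move=> d0; apply: (@complexI R).
have d0' : 1 - z * w^*%C != 0.
  by rewrite -conjc_eq0 conjcB conjcM conjcK conjc1.
rewrite real_complex_mul_div normc_sqr_complex !one_sub_sqr_complex mobiusE.
rewrite !(conjcB, conjcM, conjcK, conjc1, conjc_inv).
by field; rewrite d0 d0'.
Qed.

Lemma mobius_disc z w : unit_disc z -> unit_disc w -> unit_disc (mobius z w).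
Proof.
move=> z1 w1; have := one_sub_normc_mobius (denom_neq0 z1 w1).
have : 0 < (1 - normc z ^+ 2) * (1 - normc w ^+ 2) / normc (1 - z^*%C * w) ^+ 2.
  by rewrite !mulr_gt0 ?sub_sqr_normc_gt0// invr_gt0 exprn_gt0// normc_gt0 denom_neq0.
by move=> + e; rewrite -e subr_gt0 /unit_disc/= expr_lt1// normc_ge0.
Qed.

Lemma mobius_disc_iff z w : unit_disc z -> 1 - z^*%C * w != 0 ->
  unit_disc (mobius z w) <-> unit_disc w.
Proof.
move=> z1 d0; have := one_sub_normc_mobius d0.
have k0 : 0 < (1 - normc z ^+ 2) / normc (1 - z^*%C * w) ^+ 2.
  by rewrite divr_gt0 ?sub_sqr_normc_gt0 ?exprn_gt0 ?normc_gt0.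
have H x : unit_disc x <-> 0 < 1 - normc x ^+ 2.
  by rewrite subr_gt0 /unit_disc/= expr_lt1// normc_ge0.
by move=> e; rewrite !H e mulrAC pmulr_rgt0.
Qed.

(** The square of |phi_z'(w)|, where phi_z'(w) = (1 - |z|^2) / (1 - conj z w)^2. *)
Definition mobius_jacobian z w : R := ((1 - normc z ^+ 2) / normc (1 - z^*%C * w) ^+ 2) ^+ 2.

Lemma Cmeasurable_mobius d (T : measurableType d) (f g : T -> R[i]) :
  Cmeasurable_fun setT f -> Cmeasurable_fun setT g ->
  Cmeasurable_fun setT (fun t : T => mobius (f t) (g t)).
Proof.
move=> mf mg; apply: Cmeasurable_div; first exact: CmeasurableB.
apply: CmeasurableB; first exact: Cmeasurable_cst.
by apply: CmeasurableM => //; exact: Cmeasurable_conj.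
Qed.

Lemma measurable_mobius_jacobian z :
  measurable_fun setT (fun p => mobius_jacobian z (c p)).
Proof.
apply: measurable_funX; apply: measurable_funM => //.
apply: measurable_inv_ge0 => [p|]; first exact: sqr_ge0.
apply: measurable_normc_sqr; apply: CmeasurableB; first exact: Cmeasurable_cst.
by apply: CmeasurableM; [exact: Cmeasurable_cst|exact: Cmeasurable_of_pair].
Qed.

(** With a = 1 / conj z one has phi_z(w) = (a - z) / (1 - conj z w) - a, a composite of affine maps
    and one inversion. For z = 0 the map is the identity. *)
Lemma area_cv_mobius z : unit_disc z ->
  area_cv (fun p => pr (mobius z (c p))) (fun p => mobius_jacobian z (c p)).
Proof.
move=> z1; have mmob : measurable_fun setT (fun p : R * R => pr (mobius z (c p))).
  apply: measurable_pair_of_complex; apply: Cmeasurable_mobius.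
    exact: Cmeasurable_cst.
  exact: Cmeasurable_of_pair.
split => //; [exact: measurable_mobius_jacobian|by move=> p; exact: sqr_ge0|].
move=> F F0 mF; have [z0|z0] := eqVneq z 0.
  apply: eq_integral => p _; rewrite z0.
  have -> : mobius 0 (c p) = c p by rewrite mobiusE conjc0 mul0r !subr0 divr1.
  have -> : mobius_jacobian 0 (c p) = 1.
    by rewrite /mobius_jacobian conjc0 mul0r !subr0 normc0 normc1 expr0n subr0 expr1n divr1 expr1n.
  by rewrite mule1 complex_of_pairK.
have zc0 : z^*%C != 0 by rewrite conjc_eq0.
pose a := (z^*%C)^-1.
have az0 : a - z != 0.
  apply/eqP => /(congr1 ( *%R z^*%C)); rewrite mulr0 mulrBr divff// mulrC => h.
  have := sub_sqr_normc_gt0 z1.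
  have -> : 1 - normc z ^+ 2 = 0 by apply: (@complexI R); rewrite one_sub_sqr_complex.
  by rewrite ltxx.
have := area_cv_comp (area_cv_comp (area_cv_comp (area_cv_comp
  (@area_cv_mul R (- z^*%C) _) (area_cv_add 1)) (@area_cv_inv R))
  (area_cv_mul az0)) (area_cv_add (- a)).
rewrite oppr_eq0 => /(_ zc0) [_ _ _ H]; rewrite -[RHS](H F F0 mF).
apply: eq_integral => p _ /=; rewrite !pair_of_complexK.
have -> : - z^*%C * c p + 1 = 1 - z^*%C * c p by rewrite mulNr addrC.
rewrite /mobius_jacobian.
have [d0|d0] := eqVneq (1 - z^*%C * c p) 0.
  have e0 : (0 : R) ^+ 2 = 0 by rewrite expr0n.
  by rewrite d0 normc0 !e0 invr0 mulr0 e0 invr0 !(mulr0, mul0r) !mule0.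
have zE : normc (a - z) = (1 - normc z ^+ 2) / normc z.
  have -> : a - z = ((1 - normc z ^+ 2)%:C)%C / z^*%C.
    by rewrite one_sub_sqr_complex /a; field.
  by rewrite normcM normcV normc_conj normc_real ger0_norm// ltW// sub_sqr_normc_gt0.
congr (F (pr _) * _%:E)%E.
  by rewrite mobiusE /a; field; rewrite zc0 d0.
rewrite normcN normc_conj zE; field.
by rewrite !normc_eq0 z0 d0.
Qed.

Lemma hyperbolic_density_mobius z p : unit_disc z ->
  hyperbolic_density (pr (mobius z (c p))) * mobius_jacobian z (c p) = hyperbolic_density p.
Proof.
move=> z1; rewrite /hyperbolic_density /mobius_jacobian.
have dE q : (q \in @disc R) = (normc (c q) < 1).
  by apply/idP/idP; rewrite inE.
rewrite !dE pair_of_complexK.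
have [d0|d0] := eqVneq (1 - z^*%C * c p) 0.
  rewrite d0 normc0 expr0n/= invr0 mulr0 expr0n/= mulr0; case: ifPn => // p1.
  by have := denom_neq0 z1 p1; rewrite d0 eqxx.
have [_ H2] := mobius_disc_iff z1 d0; have [H1 _] := mobius_disc_iff z1 d0.
case: ifPn => p1; last first.
  by rewrite mul0r ifF//; apply/negbTE; apply: contra p1 => /H2.
rewrite ifT; last exact: H1.
rewrite one_sub_normc_mobius//; have := pi_gt0 R; move: (pi : R) => q q0; field.
have [p2 z2] := (sub_sqr_normc_gt0 (H1 p1), sub_sqr_normc_gt0 z1).
by rewrite normc_eq0 d0 (gt_eqF q0) (gt_eqF p2) (gt_eqF z2).
Qed.

(* [area] is a measure for the display of [measurableTypeR], [hyperbolic_measure]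
   for the default display on [R]; the image under the identity relates the two. *)
Let mid : @measurable_fun _ _ (measurableTypeR R * measurableTypeR R)%type
  (R * R)%type setT id.
Proof. by move=> mD A mA; rewrite setTI. Qed.

Let area_std : {measure set (R * R) -> \bar R} := image_measure area mid.

Lemma ge0_integral_hyperbolic (F : R * R -> \bar R) (D : set (R * R)) : measurable D ->
  measurable_fun D F -> (forall p, D p -> 0 <= F p)%E ->
  (\int[@hyperbolic_measure R]_(p in D) F p =
   \int[area]_(p in D) (F p * (hyperbolic_density p)%:E))%E.
Proof.
move=> mD mF F0.
have std G A : measurable A -> measurable_fun A G -> (forall p, A p -> 0 <= G p)%E ->
    (\int[area_std]_(p in A) G p = \int[area]_(p in A) G p)%E.
  move=> mA mG G0; rewrite [LHS](@ge0_integral_pushforward _ _ _ _ _ _ mid)//.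
  by move=> p /set_mem; exact: G0.
have mh := @measurable_hyperbolic_density R; have h0 := @hyperbolic_density_ge0 R.
rewrite (@ge0_integral_density _ _ _ area_std _ h0 mh (@hyperbolic_measure R) D F)//.
  rewrite std// => [|p Dp]; last by rewrite mule_ge0 ?lee_fin// F0.
  apply: emeasurable_funM => //; apply: measurable_funTS; exact/measurable_EFinP.
move=> A mA.
have mhA : measurable_fun A (EFin \o @hyperbolic_density R).
  by apply: measurable_funTS; exact/measurable_EFinP.
by rewrite (std _ A mA mhA (fun p _ => h0 p)).
Qed.

Lemma hyperbolic_mobius (F : R * R -> \bar R) z : unit_disc z ->
  (forall p, 0 <= F p)%E -> measurable_fun setT F ->
  (\int[@hyperbolic_measure R]_p F (pr (mobius z (c p))) =
   \int[@hyperbolic_measure R]_p F p)%E.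
Proof.
move=> z1 F0 mF; have [mphi _ _ H] := area_cv_mobius z1.
have h0 := @hyperbolic_density_ge0 R; have mh := @measurable_hyperbolic_density R.
rewrite ge0_integral_hyperbolic//; last exact: (measurableT_comp mF mphi).
rewrite ge0_integral_hyperbolic//.
rewrite -(H (fun p => F p * (hyperbolic_density p)%:E)%E).
- by apply: eq_integral => p _; rewrite -muleA -EFinM hyperbolic_density_mobius.
- by move=> p; rewrite mule_ge0// lee_fin.
- by apply: emeasurable_funM => //; exact/measurable_EFinP.
Qed.

Lemma hyperbolic_rotate (F : R * R -> \bar R) w : normc w = 1 ->
  (forall p, 0 <= F p)%E -> measurable_fun setT F ->
  (\int[@hyperbolic_measure R]_p F (pr (w * c p)%R) =
   \int[@hyperbolic_measure R]_p F p)%E.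
Proof.
move=> w1 F0 mF.
have mphi : measurable_fun setT (fun p : R * R => pr (w * c p)).
  apply: measurable_pair_of_complex; apply: CmeasurableM; first exact: Cmeasurable_cst.
  exact: Cmeasurable_of_pair.
have h0 := @hyperbolic_density_ge0 R; have mh := @measurable_hyperbolic_density R.
rewrite ge0_integral_hyperbolic//; last exact: (measurableT_comp mF mphi).
rewrite ge0_integral_hyperbolic//.
rewrite -(@area_rotate _ (fun p => F p * (hyperbolic_density p)%:E)%E w w1).
- apply: eq_integral => p _; congr (_ * _%:E)%E; rewrite /hyperbolic_density.
  have dE q : (q \in @disc R) = (normc (c q) < 1) by apply/idP/idP; rewrite inE.
  by rewrite !dE pair_of_complexK normcM w1 mul1r.
- by move=> p; rewrite mule_ge0// lee_fin.
- by apply: emeasurable_funM => //; exact/measurable_EFinP.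
Qed.

Lemma area_cv_EFin phi J (g : R * R -> R) : area_cv phi J -> measurable_fun setT g ->
  (\int[area]_p (g (phi p) * J p)%:E = \int[area]_p (g p)%:E)%E.
Proof.
move=> [mphi mJ J0 H] mg; rewrite integralE [RHS]integralE.
have mg' : measurable_fun setT (EFin \o g) by exact/measurable_EFinP.
congr (_ - _)%E.
  rewrite -(H _ (funepos_ge0 _) (measurable_funepos mg')).
  apply: eq_integral => p _; rewrite !funeposE /= -!EFin_max -EFinM; congr (_%:E).
  by rewrite maxr_pMl// mul0r.
rewrite -(H _ (funeneg_ge0 _) (measurable_funeneg mg')).
apply: eq_integral => p _; rewrite !funenegE /= -!EFin_max -EFinM; congr (_%:E).
by rewrite maxr_pMl// mul0r mulNr.
Qed.

Lemma area_cv_Cintegral phi J (g : R * R -> R[i]) : area_cv phi J ->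
  Cmeasurable_fun setT g ->
  Cintegral area setT (fun p => g (phi p) * (J p)%:C) = Cintegral area setT g.
Proof.
move=> cv [g1 g2]; rewrite /Cintegral; congr (_ +i* _); rewrite /Rintegral; congr fine.
  rewrite -(area_cv_EFin cv g1); apply: eq_integral => p _; congr (_%:E).
  by case: (g _) => a b /=; rewrite mulr0 subr0.
rewrite -(area_cv_EFin cv g2); apply: eq_integral => p _; congr (_%:E).
by case: (g _) => a b /=; rewrite mulr0 add0r.
Qed.

End mobius_maps.

(** * Principal powers and the binomial series *)

Section complex_power.
Variable R : realType.
Implicit Types (w x y : R[i]) (a s : R).

Lemma expi_inj (a b : R) : `|a - b| < 2 * pi -> expi a = expi b -> a = b.
Proof.
wlog : a b / b <= a => [H|ba] ab e.
  have [ba|/ltW ab'] := leP b a; first exact: H.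
  by symmetry; apply: H => //; rewrite distrC.
apply/eqP; rewrite -subr_eq0; apply/eqP; apply: expi_eq1.
  by rewrite subr_ge0 ba/= -(ger0_norm (x := a - b)) ?subr_ge0.
by rewrite expiD expiN e expi_conjK.
Qed.

Lemma expi_atan_Re_gt0 w : 0 < complex.Re w ->
  expi (atan (complex.Im w / complex.Re w)) = w / (normc w)%:C.
Proof.
case: w => a b /= a0; set q := b / a.
have n0 : 0 < normc (a +i* b) by rewrite normc_gt0; apply: Re_gt0_neq0.
have nE : normc (a +i* b) = a * Num.sqrt (1 + q ^+ 2).
  apply: (@pexpIrn _ 2) => //; rewrite ?nnegrE ?normc_ge0 ?mulr_ge0 ?sqrtr_ge0 ?ltW//.
  rewrite sqr_normcE/= exprMn sqr_sqrtr ?addr_ge0 ?sqr_ge0// /q; field.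
  by rewrite gt_eqF.
have cE : cos (atan q) = (Num.sqrt (1 + q ^+ 2))^-1 by exact: cos_atan.
have s0 : 0 < Num.sqrt (1 + q ^+ 2) by rewrite sqrtr_gt0 ltr_pwDl// sqr_ge0.
have c0 : cos (atan q) != 0 by rewrite cE invr_eq0 gt_eqF.
have sE : sin (atan q) = q * (Num.sqrt (1 + q ^+ 2))^-1.
  have tq : sin (atan q) / cos (atan q) = q by exact: atanK.
  by rewrite -cE -{2}tq divfK.
have e : (normc (a +i* b))%:C^-1 = (normc (a +i* b))^-1%:C :> R[i] by rewrite fmorphV.
rewrite e /expi cE sE nE; apply/eqP; rewrite eq_complex/= !mulr0 subr0 add0r /q.
move: s0; set S := Num.sqrt _ => s0.
by apply/andP; split; apply/eqP; field; rewrite ?gt_eqF.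
Qed.

(** On the right half-plane, where all bases 1 - x with |x| < 1 lie, the principal argument has this
    form, which is easier to bound, differentiate and measure. *)
Lemma Arg_atan w : 0 < complex.Re w -> Arg w = atan (complex.Im w / complex.Re w).
Proof.
move=> w0; have n0 : 0 < normc w by rewrite normc_gt0 Re_gt0_neq0.
have eA := expi_atan_Re_gt0 w0.
set t := atan _ in eA *.
have [t1 t2] : - (pi / 2) < t /\ t < pi / 2 by rewrite atan_gtNpi2 atan_ltpi2.
have ct : cos t = complex.Re w / normc w.
  have := congr1 (@complex.Re R) eA; rewrite /expi/= => ->.
  by rewrite -fmorphV; case: (w) => a b /=; rewrite mulr0 subr0.
have st : sin t = complex.Im w / normc w.
  have := congr1 (@complex.Im R) eA; rewrite /expi/= => ->.
  by rewrite -fmorphV; case: (w) => a b /=; rewrite mulr0 add0r.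
have p0 : 0 < pi :> R := pi_gt0 R.
have sgn : (0 <= complex.Im w) = (0 <= t).
  rewrite /t; have [i0|i0] := leP 0 (complex.Im w).
    by rewrite -atan0; apply/esym; apply: le_atan; rewrite divr_ge0// ltW.
  apply/esym/negbTE; rewrite -ltNge -atan0; apply: lt_atan.
  by rewrite pmulr_llt0// invr_gt0.
rewrite /Arg -ct sgn; case: ifPn => t0; first by rewrite cosK// in_itv/= t0/=; lra.
rewrite -ltNge in t0; rewrite cosKN ?opprK//; apply/andP; split; lra.
Qed.

Lemma Arg_bound w : 0 < complex.Re w -> `|Arg w| < pi / 2.
Proof. by move=> w0; rewrite (Arg_atan w0) ltr_norml atan_gtNpi2 atan_ltpi2. Qed.

Lemma expi_Arg w : 0 < complex.Re w -> expi (Arg w) = w / (normc w)%:C.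
Proof. by move=> w0; rewrite (Arg_atan w0) expi_atan_Re_gt0. Qed.

Lemma normc_cpow w s : normc (cpow w s) = normc w `^ s.
Proof. by rewrite /cpow normcM normc_expi mulr1 normc_real ger0_norm// powR_ge0. Qed.

Lemma cpow_neq0 w s : 0 < complex.Re w -> cpow w s != 0.
Proof.
move=> w0; rewrite -normc_eq0 normc_cpow gt_eqF// powR_gt0// normc_gt0.
exact: Re_gt0_neq0.
Qed.

(* All four arguments lie in ]-pi/2, pi/2[, so the two sums agree exactly and not
   only modulo 2 pi. *)
Lemma cpow_mul4 w x y z s : 0 < complex.Re w -> 0 < complex.Re x ->
  0 < complex.Re y -> 0 < complex.Re z -> w * x = y * z ->
  cpow w s * cpow x s = cpow y s * cpow z s.
Proof.
move=> w0 x0 y0 z0 e.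
have ne : normc w * normc x = normc y * normc z by rewrite -!normcM e.
have ae : Arg w + Arg x = Arg y + Arg z.
  apply: expi_inj.
    have := Arg_bound w0; have := Arg_bound x0; have := Arg_bound y0; have := Arg_bound z0.
    by rewrite !ltr_norml => /andP[? ?] /andP[? ?] /andP[? ?] /andP[? ?]; apply/andP; split; lra.
  rewrite !expiD !expi_Arg//.
  have E (u v : R[i]) : (u / (normc u)%:C) * (v / (normc v)%:C) = u * v / (normc u * normc v)%:C.
    by rewrite rmorphM invfM mulrACA.
  by rewrite !E e ne.
rewrite /cpow mulrACA -expiD -mulrDr ae -rmorphM -powRM ?normc_ge0// ne.
by rewrite [RHS]mulrACA -expiD -mulrDr -rmorphM -powRM ?normc_ge0.
Qed.

Lemma cpow1 s : cpow (1 : R[i]) s = 1.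
Proof.
have h1 : 0 < complex.Re (1 : R[i]) by rewrite /= ltr01.
by rewrite /cpow (Arg_atan h1) /= mul0r atan0 mulr0 expi0 normc1 powR1 mulr1.
Qed.

Lemma Re_inv_gt0 w : 0 < complex.Re w -> 0 < complex.Re w^-1.
Proof.
case: w => a b /= a0; rewrite divr_gt0// ltr_pwDl ?sqr_ge0//.
by rewrite exprn_gt0.
Qed.

Lemma Re_mulr_gt0 (k : R) w : 0 < k -> 0 < complex.Re w -> 0 < complex.Re (k%:C * w).
Proof. by case: w => a b k0 /= a0; rewrite mul0r subr0 mulr_gt0. Qed.

Lemma cpowV w s : 0 < complex.Re w -> cpow w^-1 s = (cpow w s)^-1.
Proof.
move=> w0; apply: (mulfI (cpow_neq0 s w0)); rewrite divff ?cpow_neq0//.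
have h1 : 0 < complex.Re (1 : R[i]) by rewrite /= ltr01.
rewrite (@cpow_mul4 _ _ 1 1)// ?cpow1 ?mulr1//; first exact: Re_inv_gt0.
by rewrite divff ?Re_gt0_neq0.
Qed.

Lemma cpow_realM (k : R) w s : 0 < k -> 0 < complex.Re w ->
  cpow (k%:C * w) s = (k `^ s)%:C * cpow w s.
Proof.
move=> k0 w0; have hk := Re_mulr_gt0 k0 w0.
rewrite /cpow normcM normc_real gtr0_norm// powRM ?normc_ge0 ?ltW// rmorphM -mulrA.
congr (_ * (_ * expi (s * _))); rewrite !Arg_atan//; congr (atan _).
case: (w) w0 => a b /= a0; rewrite !mul0r subr0 addr0; field.
by rewrite !gt_eqF.
Qed.

End complex_power.

(** * Coefficients of the binomial series *)

Section binomial_coefficients.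
Variable R : realType.
Implicit Types (s x r q : R).

(* The coefficient of x ^ n in the expansion of (1 - x) ^ (- s). *)
Definition gam s n : R := \prod_(j < n) ((s + j%:R) / j.+1%:R).

Lemma gam0 s : gam s 0 = 1. Proof. by rewrite /gam big_ord0. Qed.

Lemma gamS s n : gam s n.+1 = gam s n * ((s + n%:R) / n.+1%:R).
Proof. by rewrite /gam big_ord_recr. Qed.

Lemma gam_gt0 s n : 0 < s -> 0 < gam s n.
Proof. by move=> s0; apply: prodr_gt0 => j _; rewrite divr_gt0// ltr_pwDl. Qed.

(** The coefficients of d/dx (1 - x)^(-s) = s (1 - x)^(-s-1). *)
Lemma gam_succ s n : n.+1%:R * gam s n.+1 = s * gam (s + 1) n.
Proof.
elim: n => [|n ih]; first by rewrite gamS !gam0 addr0 divr1 !mul1r mulr1.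
transitivity (n.+1%:R * gam s n.+1 * ((s + n.+1%:R) / n.+1%:R)).
  rewrite (gamS s n.+1) -[n.+2%:R]natr1 -[n.+1%:R]natr1; have n0 := ler0n R n.
  by field; rewrite !gt_eqF//; lra.
rewrite ih gamS -[n.+1%:R]natr1; field.
by rewrite natr1 pnatr_eq0.
Qed.

(** Pascal's rule: the coefficients of (1 - x) (1 - x)^(-s-1) = (1 - x)^(-s). *)
Lemma gam_diff s n : gam (s + 1) n.+1 - gam (s + 1) n = gam s n.+1.
Proof.
apply: (@mulfI _ (n.+1%:R)); rewrite ?pnatr_eq0// gam_succ mulrBr (gamS (s + 1)).
by field; rewrite nat1r pnatr_eq0.
Qed.

Lemma gam_bounded s r : 0 < s -> 0 < r < 1 -> exists2 M, 0 < M & forall n, gam s n * r ^+ n <= M.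
Proof.
move=> s0 /andP[r0 r1]; pose a n := gam s n * r ^+ n.
have a0 n : 0 < a n by rewrite mulr_gt0 ?gam_gt0 ?exprn_gt0.
(* The ratio of consecutive terms is r (s + n) / (n + 1), which is at most 1 once n (1 - r) >= s
   r. *)
have [N NP] : exists N : nat, s * r / (1 - r) < N%:R.
  exists (Num.bound (s * r / (1 - r))); apply: archi_boundP.
  by rewrite divr_ge0 ?subr_ge0 ?mulr_ge0 ?ltW.
have dec n : (N <= n)%N -> a n.+1 <= a n.
  move=> Nn; rewrite /a gamS exprSr mulrACA ler_piMr ?(ltW (a0 n))//.
  rewrite mulrAC ler_pdivrMr// mul1r -natr1 mulrDl.
  rewrite ltr_pdivrMr ?subr_gt0// in NP.
  have : N%:R * (1 - r) <= n%:R * (1 - r) by rewrite ler_wpM2r ?ler_nat ?subr_ge0 ?ltW.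
  by nra.
exists (\sum_(i < N.+1) a i) => [|n].
  by rewrite big_ord_recr/= ltr_wpDl ?sumr_ge0// => i _; exact: ltW.
have ai (i : nat) : (i <= N)%N -> a i <= \sum_(i < N.+1) a i.
  move=> iN; rewrite (bigD1 (Ordinal (iN : (i < N.+1)%N)))//= lerDl.
  by rewrite sumr_ge0// => j _; exact: ltW.
have [nN|/ltnW Nn] := leqP n N; first exact: ai.
rewrite -(subnKC Nn); elim: (n - N)%N => [|m ih]; first by rewrite addn0 ai.
by rewrite addnS (le_trans (dec _ _))// leq_addr.
Qed.

End binomial_coefficients.

(** * The binomial series along a segment *)

Section binomial_series.
Variable R : realType.
Implicit Types (s x r q : R) (y k : R[i]).

Lemma geometric_bound_cvgn (c : nat -> R) (M q : R) : 0 <= q < 1 ->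
  (forall n, `|c n| <= M * q ^+ n) -> cvgn (series (c : nat -> R^o)).
Proof.
move=> /andP[q0 q1] cM.
apply: normed_cvg; apply: (series_le_cvg (v_ := geometric M q)) => [n|n|n|].
- exact: normr_ge0.
- exact: le_trans (normr_ge0 _) (cM n).
- exact: cM.
- by apply: is_cvg_geometric_series; rewrite ger0_norm.
Qed.

Lemma cvgn_cvgC (t : nat -> R[i]) (a b : R) :
  (fun n => complex.Re (t n) : R^o) @ \oo --> (a : R^o) ->
  (fun n => complex.Im (t n) : R^o) @ \oo --> (b : R^o) -> cvgC t (a +i* b).
Proof.
move=> /cvgrPdist_lt ta /cvgrPdist_lt tb e e0.
have e20 : 0 < e / 2 by rewrite divr_gt0.
have [N _ NP] := ta _ e20; have [M _ MP] := tb _ e20.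
exists (maxn N M) => n; rewrite geq_max => /andP[Nn Mn].
apply: le_lt_trans (le_normc_ReIm _) _; rewrite !raddfB /=.
rewrite [ltRHS]splitr ltrD// distrC; [exact: NP|exact: MP].
Qed.

Lemma psum_exists (a : nat -> R[i]) y (M r : R) : normc y < r ->
  (forall n, normc (a n) * r ^+ n <= M) -> exists l, cvgC (psum a y) l.
Proof.
move=> yr aM; have r0 : 0 < r := le_lt_trans (normc_ge0 y) yr.
have q1 : 0 <= normc y / r < 1 by rewrite divr_ge0 ?normc_ge0 ?ltW//= ltr_pdivrMr// mul1r.
have B n : normc (a n * y ^+ n) <= M * (normc y / r) ^+ n.
  rewrite normcM normcX expr_div_n mulrA ler_pdivlMr ?exprn_gt0// mulrAC.
  by apply: ler_wpM2r; rewrite ?exprn_ge0 ?normc_ge0.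
have cR := geometric_bound_cvgn q1 (fun n => le_trans (le_Re_normc _) (B n)).
have cI := geometric_bound_cvgn q1 (fun n => le_trans (le_Im_normc _) (B n)).
eexists; apply: cvgn_cvgC.
  rewrite (_ : (fun n => _) = series (fun n => complex.Re (a n * y ^+ n) : R^o)); first exact: cR.
  by apply/funext => n; rewrite /psum /series/= big_mkord raddf_sum.
rewrite (_ : (fun n => _) = series (fun n => complex.Im (a n * y ^+ n) : R^o)); first exact: cI.
by apply/funext => n; rewrite /psum /series/= big_mkord raddf_sum.
Qed.

(* The real part of k (1 - t y) ^ (- s), expanded in powers of t. *)
Definition binc s k y (n : nat) : R := complex.Re (k * ((gam s n)%:C * y ^+ n)).

Lemma binc_diffs s k y : pseries_diffs (binc s k y) = binc (s + 1) (s%:C * (y * k)) y.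
Proof.
apply/funext => n; rewrite /pseries_diffs /binc.
have E (u : R) (v : R[i]) : u * complex.Re v = complex.Re (u%:C * v).
  by case: v => p q /=; rewrite mul0r subr0.
rewrite E; congr complex.Re.
transitivity ((n.+1%:R * gam s n.+1)%:C * (y * k * y ^+ n)).
  by rewrite rmorphM exprS; ring.
by rewrite gam_succ rmorphM; ring.
Qed.

Lemma binc_cvgn s k y (t : R) : 0 < s -> `|t| * normc y < 1 ->
  cvgn (series (fun n => binc s k y n * t ^+ n : R^o)).
Proof.
move=> s0 ty; pose r := (`|t| * normc y + 1) / 2.
have h0 : 0 <= `|t| * normc y by rewrite mulr_ge0 ?normc_ge0.
have r01 : 0 < r < 1 by rewrite /r; apply/andP; split; lra.
have r0 : 0 < r by case/andP: r01.
have tr : `|t| * normc y < r by rewrite /r; lra.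
have [M M0 MP] := gam_bounded s0 r01.
apply: (@geometric_bound_cvgn _ (normc k * M) ((`|t| * normc y) / r)).
  by rewrite divr_ge0 ?(ltW r0)//= ltr_pdivrMr// mul1r.
move=> n; rewrite normrM normrX.
apply: (@le_trans _ _ (normc (k * ((gam s n)%:C * y ^+ n)) * `|t| ^+ n)).
  by apply: ler_wpM2r; rewrite ?exprn_ge0// le_Re_normc.
rewrite !normcM normcX normc_real (gtr0_norm (gam_gt0 n s0)) -mulrA -[leRHS]mulrA.
apply: (ler_wpM2l (normc_ge0 k)).
rewrite expr_div_n exprMn mulrA ler_pdivlMr ?exprn_gt0// mulrAC.
rewrite mulrA mulrAC; have := MP n => /(ler_wpM2r (x := normc y ^+ n * `|t| ^+ n)).
rewrite mulr_ge0 ?exprn_ge0 ?normc_ge0// => /(_ isT).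
by congr (_ <= _); ring.
Qed.

Definition binsum s k y (t : R) : R := limn (pseries (binc s k y) t).

Lemma is_derive_binsum s k y (t : R) : 0 < s -> normc y < 1 -> `|t| <= 1 ->
  is_derive t 1 (binsum s k y) (binsum (s + 1) (s%:C * (y * k)) y t).
Proof.
move=> s0 y1 t1.
pose K := 2 / (1 + normc y).
have n0 := normc_ge0 y.
have K1 : 1 < K by rewrite ltr_pdivlMr; lra.
have Ky : `|K| * normc y < 1.
  rewrite ger0_norm ?ltW ?(lt_trans _ K1)// /K mulrAC ltr_pdivrMr; lra.
rewrite /binsum -binc_diffs; apply: (@pseries_snd_diffs _ _ K).
- exact: binc_cvgn.
- by rewrite binc_diffs; apply: binc_cvgn => //; lra.
- by rewrite !binc_diffs; apply: binc_cvgn => //; lra.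
- by rewrite (le_lt_trans t1)// ger0_norm// ltW// (lt_trans _ K1).
Qed.

Lemma cvg_binsum s k y (t : R) : 0 < s -> normc y < 1 -> `|t| <= 1 ->
  pseries (binc s k y) t @ \oo --> (binsum s k y t : R^o).
Proof.
move=> s0 y1 t1; apply: (@binc_cvgn s k y t s0).
by rewrite (le_lt_trans _ y1)// ler_piMl ?normc_ge0.
Qed.

(** The real part of k (1 - t y) (1 - t y)^(-s-1) = k (1 - t y)^(-s), at the level of the series by
    [gam_diff]. *)
Lemma binsum_recl s k y (t : R) : 0 < s -> normc y < 1 -> `|t| <= 1 ->
  binsum (s + 1) k y t - t * binsum (s + 1) (y * k) y t = binsum s k y t.
Proof.
move=> s0 y1 t1.
have ty : `|t| * normc y < 1.
  by rewrite (le_lt_trans _ y1)// ler_piMl ?normc_ge0.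
have s1 : 0 < s + 1 by lra.
pose S s' k' := pseries (binc s' k' y) t.
have e n : S s k n.+1 = S (s + 1) k n.+1 - t * S (s + 1) (y * k) n.
  rewrite /S /pseries; elim: n => [|n ih].
    by rewrite /series/= !big_nat1 big_geq// mulr0 subr0 /binc !gam0.
  rewrite seriesSr ih [in RHS]seriesSr [X in _ = _ - t * X]seriesSr mulrDr opprD addrACA.
  congr (_ + _).
  have q : binc s k y n.+1 * t ^+ n.+1 =
      binc (s + 1) k y n.+1 * t ^+ n.+1 - t * (binc (s + 1) (y * k) y n * t ^+ n).
    suff -> : binc s k y n.+1 = binc (s + 1) k y n.+1 - binc (s + 1) (y * k) y n.
      by rewrite exprS; ring.
    rewrite /binc -raddfB -gam_diff; congr complex.Re.
    by rewrite exprS rmorphB; ring.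
  exact: q.
have l (s' : R) k' : 0 < s' -> S s' k' @ \oo --> (binsum s' k' y t : R^o).
  by move=> s'0; exact: cvg_binsum.
have l1 : (fun n => S s k n.+1) @ \oo --> (binsum s k y t : R^o).
  by rewrite cvg_shiftS; exact: l.
have l2 : (fun n => S s k n.+1) @ \oo -->
    (binsum (s + 1) k y t - t * binsum (s + 1) (y * k) y t : R^o).
  rewrite (funext e); apply: cvgB; first by rewrite cvg_shiftS; exact: l.
  by apply: cvgMr; exact: l.
exact: (cvg_unique _ l2 l1).
Qed.

(** Im X = Re (- i X), so the sums with factor [- 'i] carry the imaginary parts and complex
    multiplication can be written with real sums only. *)
Lemma binsumZ s k y (t : R) a b : 0 < s -> normc y < 1 -> `|t| <= 1 ->
  binsum s ((a +i* b) * k) y t = a * binsum s k y t - b * binsum s (- 'i%C * k) y t.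
Proof.
move=> s0 y1 t1; have l1 := @cvg_binsum s ((a +i* b) * k) y t s0 y1 t1.
have l2 : pseries (binc s ((a +i* b) * k) y) t @ \oo -->
  (a * binsum s k y t - b * binsum s (- 'i%C * k) y t : R^o); last exact: (cvg_unique _ l1 l2).
have e : pseries (binc s ((a +i* b) * k) y) t =
  (fun n => a * pseries (binc s k y) t n - b * pseries (binc s (- 'i%C * k) y) t n).
  apply/funext => n; rewrite /pseries /series/= !mulr_sumr -sumrB.
  apply: eq_bigr => i _; rewrite !mulrA -mulrBl; congr (_ * _); rewrite /binc.
  rewrite -!mulrA; case: (k * _) => p q /=; ring.
rewrite e; apply: cvgB; apply: cvgMr; exact: cvg_binsum.
Qed.

End binomial_series.

(** * The binomial theorem by a differential equation *)

Section binomial_theorem.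
Variable R : realType.
Implicit Types (s x r q : R) (y k : R[i]).

Lemma is_derive_rotation (A B Q C S : R -> R) (t a' b' q' c' s' : R) :
  is_derive t (1 : R) A a' -> is_derive t (1 : R) B b' -> is_derive t (1 : R) Q q' ->
  is_derive t (1 : R) C c' -> is_derive t (1 : R) S s' ->
  is_derive t (1 : R) (fun t => A t * (Q t * C t) - B t * (Q t * S t))
    (a' * (Q t * C t) + A t * (q' * C t + Q t * c')
     - (b' * (Q t * S t) + B t * (q' * S t + Q t * s'))).
Proof.
move=> h1 h2 h3 h4 h5; apply: is_derive_eq.
rewrite /GRing.scale/=; ring.
Qed.

Lemma derive0_const01 (f : R -> R) :
  (forall t : R, `|t| <= 1 -> is_derive t (1 : R) f 0) -> f 1 = f 0.
Proof.
move=> df; have df' (t : R) : t \in `[0, 1]%R -> is_derive t (1 : R) f ((fun=> 0) t).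
  by rewrite in_itv/= => /andP[? ?]; apply: df; rewrite ger0_norm.
have cf : {within `[0, 1], continuous f}.
  apply: derivable_within_continuous => t t01.
  by have [] := df' t t01.
have [c _ e] := @MVT_segment R f (fun=> 0) 0 1 ler01 (fun t h => df' t (subset_itv_oo_cc h)) cf.
by apply/eqP; rewrite -subr_eq0 e mul0r.
Qed.

(* The common factor of both sides is 1 - q / q. *)
Lemma ode_cancel (s a b t q Q A B C S : R) : q = (1 - t * a) ^+ 2 + (t * b) ^+ 2 -> q != 0 ->
  s * (a * A - b * B) * (Q * C) + (A - t * (a * A - b * B)) *
    (s / 2 * Q / q * (- (2 * a * (1 - t * a)) + 2 * b * (t * b)) * C
     + Q * (- S * (s * (- b / q)))) -
  (s * (a * B + b * A) * (Q * S) + (B - t * (a * B + b * A)) *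
    (s / 2 * Q / q * (- (2 * a * (1 - t * a)) + 2 * b * (t * b)) * S
     + Q * (C * (s * (- b / q))))) = 0.
Proof.
move=> qE q0; set v := (- (2 * a * (1 - t * a)) + 2 * b * (t * b)).
have -> : s / 2 * Q / q * v = s * Q * (- (a * (1 - t * a)) + b * (t * b)) * q^-1.
  by rewrite /v; field.
have qq : 1 - q * q^-1 = 0 by rewrite divff// subrr.
transitivity ((1 - q * q^-1) * (s * ((a * A - b * B) * (Q * C) - (a * B + b * A) * (Q * S)))).
  by move: q^-1 => I; rewrite qE; ring.
by rewrite qq mul0r.
Qed.

Section ode.
Variables (s a b : R).
Hypotheses (s0 : 0 < s) (y1 : normc (a +i* b) < 1).
Local Notation y := (a +i* b).
(** A + i B is the series for exponent s at the point t y, A1 + i B1 the one for s + 1; below, q is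
    |1 - t y|^2 and th is the argument of 1 - t y. *)
Let A := binsum s 1 y.
Let B := binsum s (- 'i%C) y.
Let A1 := binsum (s + 1) 1 y.
Let B1 := binsum (s + 1) (- 'i%C) y.
Let q (t : R) := (1 - t * a) ^+ 2 + (t * b) ^+ 2.
Let th (t : R) := atan (- (t * b) / (1 - t * a)).

Let s10 : 0 < s + 1. Proof. by rewrite addr_gt0. Qed.

Let binsumN t : `|t| <= 1 -> binsum (s + 1) (- 'i%C * - 'i%C) y t = - A1 t.
Proof.
move=> t1; rewrite (_ : - 'i%C * - 'i%C = ((-1) +i* 0) * 1 :> R[i]); last first.
  by rewrite mulr1 mulrNN -expr2 sqr_i; apply/eqP; rewrite eq_complex/= oppr0 !eqxx.
by rewrite binsumZ// mulN1r mul0r subr0.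
Qed.

Let dA t : `|t| <= 1 -> is_derive t (1 : R) A (s * (a * A1 t - b * B1 t)).
Proof.
move=> t1; have := is_derive_binsum 1 s0 y1 t1.
rewrite mulrA (_ : s%:C * y = (s * a) +i* (s * b)); last first.
  by apply/eqP; rewrite eq_complex/= !mul0r subr0 addr0 !eqxx.
by rewrite binsumZ// mulr1 mulrBr !mulrA.
Qed.

Let dB t : `|t| <= 1 -> is_derive t (1 : R) B (s * (a * B1 t + b * A1 t)).
Proof.
move=> t1; have := is_derive_binsum (- 'i%C) s0 y1 t1.
rewrite mulrA (_ : s%:C * y = (s * a) +i* (s * b)); last first.
  by apply/eqP; rewrite eq_complex/= !mul0r subr0 addr0 !eqxx.
by rewrite binsumZ// binsumN// mulrN opprK mulrDr !mulrA.
Qed.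

Let AE t : `|t| <= 1 -> A t = A1 t - t * (a * A1 t - b * B1 t).
Proof.
move=> t1; rewrite /A -(binsum_recl _ s0 y1 t1) -/A1; congr (_ - _ * _).
by rewrite binsumZ// mulr1.
Qed.

Let BE t : `|t| <= 1 -> B t = B1 t - t * (a * B1 t + b * A1 t).
Proof.
move=> t1; rewrite /B -(binsum_recl _ s0 y1 t1) -/B1; congr (_ - _ * _).
by rewrite binsumZ// binsumN// mulrN opprK.
Qed.

Let Re_pos t : `|t| <= 1 -> 0 < 1 - t * a.
Proof.
move=> t1; rewrite subr_gt0 (le_lt_trans (ler_norm _))// normrM.
rewrite (le_lt_trans _ y1)// (le_trans _ (le_Re_normc y))//.
by rewrite ler_piMl.
Qed.

Let q_gt0 t : `|t| <= 1 -> 0 < q t.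
Proof. by move=> t1; rewrite ltr_pwDl ?sqr_ge0// exprn_gt0// Re_pos. Qed.

Let dq t : is_derive t (1 : R) q (- (2 * a * (1 - t * a)) + 2 * b * (t * b)).
Proof.
rewrite /q; apply: is_derive_eq.
rewrite /GRing.scale/=; ring.
Qed.

Let dth t : `|t| <= 1 -> is_derive t (1 : R) th (- b / q t).
Proof.
move=> t1; have h := Re_pos t1; have hq := q_gt0 t1.
have hn : 1 - t * a != 0 by rewrite gt_eqF.
have d1 : is_derive t (1 : R) (fun t => - (t * b) / (1 - t * a)) (- b / (1 - t * a) ^+ 2).
  apply: is_derive_eq; rewrite /GRing.scale/=; field.
  exact: hn.
apply: (@is_derive_eq _ _ _ _ _ _ _ _ (is_derive1_comp (is_derive1_atan _) d1)).
rewrite /q; field; rewrite hn/= andbT.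
by rewrite (gt_eqF hq).
Qed.

Let Q t := q t `^ (s / 2).

Let dQ t : `|t| <= 1 -> is_derive t (1 : R) Q
  (s / 2 * Q t / q t * (- (2 * a * (1 - t * a)) + 2 * b * (t * b))).
Proof.
move=> t1; have hq := q_gt0 t1.
have d1 := is_derive1_powR (s / 2) hq.
apply: (@is_derive_eq _ _ _ _ _ _ _ _ (is_derive1_comp d1 (dq t))).
congr (_ * _); rewrite -[RHS]mulrA; congr (_ * _).
by rewrite powRD ?powR_inv1 ?(ltW hq)// (gt_eqF hq) implybT.
Qed.

(** F and G are the real and imaginary parts of (A + i B) (1 - t y)^s; both turn out to be constant
    in t. *)
Let F t := A t * (Q t * cos (s * th t)) - B t * (Q t * sin (s * th t)).
Let G t := A t * (Q t * sin (s * th t)) + B t * (Q t * cos (s * th t)).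

Let dsth t : `|t| <= 1 -> is_derive t (1 : R) (fun t => s * th t) (s * (- b / q t)).
Proof. by move=> t1; have := dth t1 => h; apply: is_derive_eq. Qed.

Let dF t : `|t| <= 1 -> is_derive t (1 : R) F 0.
Proof.
move=> t1; have h1 := dA t1; have h2 := dB t1; have h3 := dQ t1.
have h4 := is_derive1_comp (is_derive_cos _) (dsth t1).
have h5 := is_derive1_comp (is_derive_sin _) (dsth t1).
apply: (@is_derive_eq _ _ _ _ _ _ _ _ (is_derive_rotation h1 h2 h3 h4 h5)).
rewrite AE// BE//=; have /lt0r_neq0 q0 := q_gt0 t1.
exact: ode_cancel.
Qed.

Let dG t : `|t| <= 1 -> is_derive t (1 : R) G 0.
Proof.
move=> t1; have h1 := dA t1; have h2 := dB t1; have h3 := dQ t1.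
have h4 := is_derive1_comp (is_derive_cos _) (dsth t1).
have h5 := is_derive1_comp (is_derive_sin _) (dsth t1).
rewrite (_ : G = fun t => A t * (Q t * sin (s * th t)) - B t * (Q t * (- cos (s * th t))));
  last first.
  by apply/funext => u; rewrite /G !mulrN opprK.
have h6 := is_deriveN h4.
apply: (@is_derive_eq _ _ _ _ _ _ _ _ (is_derive_rotation h1 h2 h3 h5 h6)).
rewrite AE// BE//; have /lt0r_neq0 q0 := q_gt0 t1.
rewrite -[RHS](@ode_cancel s a b t (q t) (Q t) (A1 t) (B1 t)
  (sin (s * th t)) (- cos (s * th t)) erefl q0).
by rewrite !mulNr !opprK.
Qed.

Let binsum0 k : binsum s k y 0 = complex.Re k.
Proof.
have l1 : pseries (binc s k y) 0 @ \oo --> (binsum s k y 0 : R^o).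
  by apply: cvg_binsum => //; rewrite normr0 ler01.
have l2 : pseries (binc s k y) 0 @ \oo --> (complex.Re k : R^o).
  rewrite -(cvg_shiftS (pseries _ _)) (_ : (fun n => _) = fun=> complex.Re k); first exact: cvg_cst.
  apply/funext => n; rewrite /pseries /series/= big_nat_recl// big1 ?addr0 => [|i _].
    by rewrite expr0 /binc gam0 expr0 !mulr1.
  by rewrite expr0n mulr0.
exact: (cvg_unique _ l1 l2).
Qed.

Lemma binomial_ode : cvgC (psum (fun n => (gam s n)%:C) y) (cpow (1 - y) s)^-1.
Proof.
have n1 : `|1| <= 1 :> R by rewrite normr1.
have F1 : F 1 = 1.
  rewrite (derive0_const01 dF) /F /A /B !binsum0 /Q /q /th !mul0r oppr0 mul0r atan0/=.
  by rewrite mulr0 cos0 sin0 !addr0 expr1n expr0n/= addr0 powR1 !mulr0 subr0 !mulr1.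
have G1 : G 1 = 0.
  rewrite (derive0_const01 dG) /G /A /B !binsum0 /Q /q /th !mul0r oppr0 mul0r atan0/=.
  by rewrite mulr0 cos0 sin0 !mulr0 oppr0 mul0r !addr0.
have Re0 : 0 < complex.Re (1 - y) by rewrite /=; have := Re_pos n1; rewrite mul1r.
have PE : cpow (1 - y) s = (Q 1 * cos (s * th 1)) +i* (Q 1 * sin (s * th 1)).
  rewrite /cpow (Arg_atan Re0) /= /th !mul1r sub0r.
  have -> : normc (1 - y) `^ s = Q 1.
    rewrite /Q (_ : q 1 = normc (1 - y) ^+ 2).
      by rewrite -powR_mulrn ?normc_ge0// -powRrM mulrCA divff ?mulr1.
    by rewrite sqr_normcE/= /q !mul1r sub0r sqrrN.
  by rewrite /expi; apply/eqP; rewrite eq_complex/= !mul0r subr0 addr0 !eqxx.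
have -> : (cpow (1 - y) s)^-1 = A 1 +i* B 1.
  apply: (mulfI (cpow_neq0 s Re0)); rewrite divff ?cpow_neq0// PE; apply/eqP; rewrite eq_complex/=.
  move: F1 G1; rewrite /F /G => F1 G1; apply/andP; split; apply/eqP.
    by rewrite -[LHS]F1; ring.
  by rewrite -[LHS]G1; ring.
have e k n : complex.Re (k * psum (fun n => (gam s n)%:C) y n) = pseries (binc s k y) 1 n.
  rewrite /psum mulr_sumr raddf_sum /pseries /series/= big_mkord; apply: eq_bigr => i _.
  by rewrite expr1n mulr1.
apply: cvgn_cvgC.
  rewrite (_ : (fun n => _) = pseries (binc s 1 y) 1); first exact: cvg_binsum.
  by apply/funext => n; rewrite -e mul1r.
rewrite (_ : (fun n => _) = pseries (binc s (- 'i%C) y) 1); first exact: cvg_binsum.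
apply/funext => n; rewrite -e; case: psum => u v /=.
by rewrite oppr0 mul0r sub0r mulN1r opprK.
Qed.

End ode.

(* The binomial series is integrated along the segment from 0 to y: its product with
   cpow (1 - t y) s has vanishing derivative in t. *)
Lemma binomial_series s y : 0 < s -> normc y < 1 ->
  cvgC (psum (fun n => (gam s n)%:C) y) (cpow (1 - y) s)^-1.
Proof. by case: y => a b; exact: binomial_ode. Qed.

End binomial_theorem.

(** * Beta and Gamma integrals *)

Section gamma.
Variable R : realType.
Implicit Types (x t a M : R).
Local Notation leb := (@lebesgue_measure R).

Lemma powR_le_expR a : 0 <= a -> exists2 M : R, 0 < M &
  forall t, 0 <= t -> t `^ a <= M * expR (t / 2).
Proof.
move=> a0; set n := Num.bound a; have an : a < n%:R by exact: archi_boundP.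
exists (1 + 2 ^+ n.+1 * n.+1`!%:R) => [|t t0].
  by rewrite ltr_pwDl// mulr_ge0// exprn_ge0.
have t20 : 0 <= t / 2 by rewrite divr_ge0.
have e1 : 1 <= expR (t / 2) by rewrite -[leLHS]expR0 ler_expR.
have tn : t ^+ n.+1 <= 2 ^+ n.+1 * n.+1`!%:R * expR (t / 2).
  have f0 : 0 < n.+1`!%:R :> R by rewrite ltr0n fact_gt0.
  set c := 2 ^+ n.+1 * _; have h : 1 + t ^+ n.+1 / c <= expR (t / 2).
    by apply: le_trans (expR_ge1Dxn n t20); rewrite expr_div_n invfM mulrA.
  have c0 : 0 < c by rewrite mulr_gt0// exprn_gt0.
  by rewrite mulrC -ler_pdivrMr// (le_trans _ h)// lerDr.
rewrite mulrDl mul1r; have [t1|t1] := leP t 1.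
  rewrite (@le_trans _ _ 1)//; last by rewrite ler_wpDr// (le_trans _ tn)// exprn_ge0.
  by rewrite (_ : 1 = 1 `^ a) ?ge0_ler_powR ?nnegrE// powR1.
rewrite (@le_trans _ _ (t ^+ n.+1))//; last by rewrite ler_wpDl ?(le_trans _ e1).
rewrite -powR_mulrn//; apply: ler_powR; first exact: ltW.
by rewrite (le_trans (ltW an))// ler_nat.
Qed.

Let q x t : R := t `^ (x - 1) * expR (- t).
Let E t : R := expR (- (t / 2)).

Let qE_bound x : 1 <= x -> exists2 M : R, 0 < M & forall t, 0 <= t -> q x t <= M * E t.
Proof.
move=> x1; have [M M0 MP] := @powR_le_expR (x - 1) ltac:(lra); exists M => // t t0.
rewrite /q /E (_ : - t = - (t / 2) + - (t / 2)); last by field.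
rewrite expRD mulrA; apply: ler_wpM2r; first exact: expR_ge0.
by rewrite expRN ler_pdivrMr ?expR_gt0// MP.
Qed.

Let q_ge0 x t : 0 <= q x t. Proof. by rewrite mulr_ge0 ?powR_ge0 ?expR_ge0. Qed.

Let cvg_E0 : E x @[x --> +oo] --> (0 : R).
Proof.
rewrite /E; apply: (@cvg_comp _ _ _ (fun t : R => t / 2) (fun t : R => expR (- t)) _ +oo);
  last exact: cvgr_expR.
apply: gt0_cvgMly; last exact: cvg_id.
by rewrite invr_gt0.
Qed.

Let dE t : is_derive t (1 : R) E (- 2^-1 * E t).
Proof.
rewrite /E; apply: is_derive_eq; rewrite /GRing.scale/=; ring.
Qed.

Let q_right x : 1 < x -> q x t @[t --> 0^'+] --> q x 0.
Proof.
move=> x1; rewrite {2}/q powR0 ?mul0r ?gt_eqF ?subr_gt0//.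
rewrite -[X in _ --> X](mul0r (expR (- 0)));
  apply: (@cvgM _ _ _ _ (fun t => t `^ (x - 1)) (fun t => expR (- t))).
  by apply: powR_cvg0; rewrite subr_gt0.
apply: cvg_at_right_filter; apply: continuous_comp; first exact: opp_continuous.
exact: continuous_expR.
Qed.

Let dq x t : 0 < t -> is_derive t (1 : R) (q (x + 1)) (x * q x t - q (x + 1) t).
Proof.
move=> t0; rewrite /q addrK.
have h := is_derive1_powR x t0.
by apply: is_derive_eq; rewrite /GRing.scale/=; ring.
Qed.

Let cont_q x t : 0 < t -> {for t, continuous (q x)}.
Proof.
move=> t0; rewrite (_ : x = x - 1 + 1); last by ring.
apply/differentiable_continuous/derivable1_diffP.
by have [] := dq (x - 1) t0.
Qed.

Let E_right t : E x @[x --> t^'+] --> E t.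
Proof.
apply: cvg_at_right_filter; apply/differentiable_continuous/derivable1_diffP.
by have [] := dE t.
Qed.

Local Open Scope ereal_scope.

Let Iq x := \int[leb]_(t in `[0%R, +oo[) (q x t)%:E.

Let IE M : (0 <= M)%R -> \int[leb]_(t in `[0%R, +oo[) (M * E t)%:E = (2 * M)%:E.
Proof.
move=> M0.
have dF t : is_derive t (1%R : R) (fun t => - (2 * M) * E t)%R (M * E t)%R.
  have h := dE t; apply: is_derive_eq; rewrite /GRing.scale/=.
  by field.
rewrite (@ge0_continuous_FTC2y R _ (fun t => - (2 * M) * E t)%R 0%R 0%R).
- by rewrite /E mul0r oppr0 expR0 mulr1 EFinN oppeK add0e.
- by move=> t _; rewrite mulr_ge0 ?expR_ge0.
- rewrite continuous_within_itvcyP; split => [t _|].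
    apply: cvgMr; apply/differentiable_continuous/derivable1_diffP; by have [] := dE t.
  by apply: cvgMr; exact: E_right.
- by rewrite -[X in _ --> X](mulr0 (- (2 * M))%R); apply: cvgMr; exact: cvg_E0.
- by move=> t _; have [] := dF t.
- by apply: cvgMr; exact: E_right.
- by move=> t _; rewrite derive1E; have [_ ->] := dF t.
Qed.

Let mq x : measurable_fun (`[0%R, +oo[ : set R) (fun t => (q x t)%:E).
Proof.
apply/measurable_EFinP; rewrite /q; apply: measurable_funM.
  by apply: measurable_funTS; exact: measurable_powR.
by apply: measurable_funTS; apply: measurableT_comp.
Qed.

Let mE M : measurable_fun (`[0%R, +oo[ : set R) (fun t => (M * E t)%:E).
Proof.
apply/measurable_EFinP; rewrite /E; apply: measurable_funM => //.
apply: measurable_funTS; apply: measurableT_comp => //.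
by apply: measurableT_comp => //; exact: measurable_funM.
Qed.

Let Iq_lty x : (1 <= x)%R -> Iq x < +oo.
Proof.
move=> x1; have [M M0 MP] := qE_bound x1.
apply: (@le_lt_trans _ _ (2 * M)%:E); last by rewrite ltry.
rewrite -(IE (ltW M0)) /Iq; apply: ge0_le_integral => //.
- by move=> t _; rewrite lee_fin q_ge0.
- exact: mq.
- exact: mE.
- by move=> t /=; rewrite in_itv/= andbT => t0; rewrite lee_fin MP.
Qed.

Let Iq_gt0 x : (1 <= x)%R -> 0 < Iq x.
Proof.
move=> x1; apply: (@lt_le_trans _ _ (expR (- 2))%:E); first by rewrite lte_fin expR_gt0.
apply: (@le_trans _ _ (\int[leb]_(t in `[1%R, 2%R]) (expR (- 2))%:E)).
  rewrite integral_cst//= lebesgue_measure_itv/= lte_fin ltr1n -EFinB.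
  by rewrite (_ : (2 - 1)%R = 1%R :> R) ?mule1//; ring.
have sub : `[1%R, 2%R]%classic `<=` (`[0%R, +oo[%classic : set R).
  move=> t /=; rewrite !in_itv/= andbT => /andP[t1 _]; exact: le_trans t1.
apply: (@le_trans _ _ (\int[leb]_(t in `[1%R, 2%R]) (q x t)%:E)).
  apply: ge0_le_integral => //.
  - by apply: measurable_funS (mq x).
  - move=> t /=; rewrite in_itv/= => /andP[t1 t2]; rewrite lee_fin /q.
    rewrite -[leLHS]mul1r ler_pM ?expR_ge0 ?ler_expR ?lerN2//.
    by rewrite -[leLHS](powRr0 t) ler_powR// subr_ge0.
by apply: ge0_subset_integral => //; [exact: mq|move=> t _; rewrite lee_fin q_ge0].
Qed.

(* Adding M exp (- t / 2) makes the derivative of t ^ x exp (- t) nonnegative, so that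
   the improper fundamental theorem of calculus applies. *)
Let Iq_succ x : (2 <= x)%R -> Iq (x + 1) = x%:E * Iq x.
Proof.
move=> x2; have [M M0 MP] := @qE_bound (x + 1) ltac:(lra).
have x0 : (0 <= x)%R by lra.
pose f t : R := (x * q x t - q (x + 1) t + M * E t)%R.
have f_ge0 t : (0 <= t)%R -> (0 <= f t)%R.
  by move=> /MP h2; have h1 := mulr_ge0 x0 (q_ge0 x t); rewrite /f; lra.
pose F t : R := (q (x + 1) t + (- (2 * M)) * E t)%R.
have If : \int[leb]_(t in `[0%R, +oo[) (f t)%:E = (2 * M)%:E.
  have dF t : (0 < t)%R -> is_derive t (1%R : R) F (f t).
    move=> t0; have h1 := dq x t0; have h2 := dE t.
    rewrite /F; apply: is_derive_eq; rewrite /GRing.scale/= /f.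
    by field.
  have Fr : F x @[x --> (0 : R)^'+] --> F 0%R.
    apply: cvgD; first by apply: q_right; lra.
    by apply: cvgMr; exact: E_right.
  rewrite (@ge0_continuous_FTC2y R f F 0%R 0%R)//.
  - rewrite /F /q powR0 ?gt_eqF//; last by lra.
    by rewrite -EFinB; congr EFin; rewrite /E !mul0r oppr0 expR0; ring.
  - rewrite continuous_within_itvcyP; split => [t|].
      rewrite in_itv/= andbT => t0; apply: cvgD.
        apply: cvgB; last exact: cont_q.
        by apply: cvgMr; exact: cont_q.
      apply: cvgMr; apply/differentiable_continuous/derivable1_diffP; by have [] := dE t.
    apply: cvgD; last by apply: cvgMr; exact: E_right.
    by apply: cvgB; [apply: cvgMr|]; apply: q_right; lra.
  - rewrite -[X in _ --> X](addr0 0%R); apply: cvgD; last first.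
      by rewrite -[X in _ --> X](mulr0 (- (2 * M))%R); apply: cvgMr; exact: cvg_E0.
    apply: (squeeze_cvgr (f := fun=> 0%R) (h := fun t => M * E t)%R).
    + near=> t; rewrite q_ge0/= MP//; near: t; exact: nbhs_pinfty_ge.
    + exact: cvg_cst.
    + by rewrite -[X in _ --> X](mulr0 M); apply: cvgMr; exact: cvg_E0.
  - by move=> t t0; have [] := dF t t0.
  - move=> t; rewrite in_itv/= andbT => t0; rewrite derive1E; by have [_ ->] := dF t t0.
have D1 : \int[leb]_(t in `[0%R, +oo[) (x * q x t + M * E t)%:E = x%:E * Iq x + (2 * M)%:E.
  under eq_integral do rewrite EFinD EFinM.
  rewrite ge0_integralD//; last 4 first.
  - by move=> t _; rewrite mule_ge0 ?lee_fin ?q_ge0.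
  - by apply: measurable_funeM; exact: mq.
  - by move=> t _; rewrite lee_fin mulr_ge0 ?expR_ge0 ?ltW.
  - exact: mE.
  rewrite IE ?ltW// ge0_integralZl//; last by move=> t _; rewrite lee_fin ?q_ge0.
  exact: mq.
have D2 : \int[leb]_(t in `[0%R, +oo[) (x * q x t + M * E t)%:E = Iq (x + 1) + (2 * M)%:E.
  have mf : measurable_fun (`[0%R, +oo[ : set R) (fun t => (f t)%:E).
    rewrite (_ : (fun t => _) = fun t => x%:E * (q x t)%:E - (q (x + 1) t)%:E + (M * E t)%:E)//.
    apply: emeasurable_funD; last exact: mE.
    by apply: emeasurable_funB; [apply: measurable_funeM|]; exact: mq.
  have f0 t : (`[0%R, +oo[%classic : set R) t -> 0 <= (f t)%:E.
    by rewrite /= in_itv/= andbT => t0; rewrite lee_fin f_ge0.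
  have q0 t : (`[0%R, +oo[%classic : set R) t -> 0 <= (q (x + 1) t)%:E.
    by rewrite lee_fin q_ge0.
  have e := ge0_integralD leb (measurable_itv _) q0 (mq (x + 1)) f0 mf.
  rewrite -If -[RHS]e.
  by apply: eq_integral => t _; rewrite -EFinD /f; congr (_%:E); ring.
by rewrite -[LHS](@addeK _ (2 * M)%:E)// -D2 D1 addeK.
Unshelve. all: by end_near. Qed.

Let GammaE x : (1 <= x)%R -> (Gamma x)%:E = Iq x.
Proof.
move=> x1; rewrite /Gamma /Rintegral integral_itv_obnd_cbnd//; last first.
  by apply: measurable_funS (mq x) => // t /=; rewrite !in_itv/= !andbT; exact: ltW.
rewrite -/(q x) -/(Iq x) fineK// ge0_fin_numE ?Iq_lty//.
by apply: integral_ge0 => t _; rewrite lee_fin ?q_ge0.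
Qed.

Lemma Gamma_succ x : (2 <= x)%R -> Gamma (x + 1) = (x * Gamma x)%R.
Proof.
move=> x2; apply: EFin_inj; rewrite EFinM !GammaE ?Iq_succ//; lra.
Qed.

Lemma Gamma_gt0 x : (1 <= x)%R -> (0 < Gamma x)%R.
Proof. by move=> x1; rewrite -lte_fin GammaE// Iq_gt0. Qed.

End gamma.

(** * The multipliers of V in terms of binomial coefficients *)

Section V_multiplier.
Variable R : realType.

Lemma Gamma_gam (s : R) n : 2 <= s -> Gamma (n%:R + s) = gam s n * n`!%:R * Gamma s.
Proof.
move=> s2; elim: n => [|n ih]; first by rewrite gam0 fact0 add0r !mul1r.
have n0 := ler0n R n.
rewrite -natr1 addrAC Gamma_succ; last by lra.
rewrite ih gamS factS natrM -natr1; field.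
by rewrite gt_eqF//; lra.
Qed.

(** By this formula V^alpha sends sqrt(n + 1) z^n to sqrt(gam_n) z^n. The range alpha >= 0,
    sufficient for a limit at infinity, keeps the arguments of Gamma above 2. *)
Lemma V_multiplierE (alpha : R) n : 0 <= alpha ->
  V_multiplier alpha n = Num.sqrt (gam (alpha + 2) n) / Num.sqrt n.+1%:R.
Proof.
move=> a0; rewrite /V_multiplier mulrC -addrA Gamma_gam; last by lra.
have G0 : Gamma (alpha + 2) != 0 by rewrite gt_eqF// Gamma_gt0//; lra.
rewrite -[X in Num.sqrt (X / _)]mulrA mulfK// mulf_neq0// pnatr_eq0 -lt0n fact_gt0.
Qed.

End V_multiplier.

(** * Square integrable functions *)

Section complex_integral.
Context d (T : measurableType d) (R : realType) (mu : {measure set T -> \bar R}).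
Implicit Types (f g : T -> R[i]) (k : R[i]).
Local Open Scope ereal_scope.

Definition Cintegrable f :=
  Cmeasurable_fun setT f /\ \int[mu]_x (normc (f x))%:E < +oo.

Lemma measurable_normcE f : Cmeasurable_fun setT f ->
  measurable_fun setT (fun x => (normc (f x))%:E).
Proof. by move=> mf; apply/measurable_EFinP; exact: measurable_normc. Qed.

Lemma measurable_normc_sqrE f : Cmeasurable_fun setT f ->
  measurable_fun setT (fun x => (normc (f x) ^+ 2)%:E).
Proof. by move=> mf; apply/measurable_EFinP; exact: measurable_normc_sqr. Qed.

Let integrable_part f (h : T -> R) : measurable_fun setT h -> (forall x, `|h x| <= normc (f x))%R ->
  Cintegrable f -> mu.-integrable setT (EFin \o h).
Proof.
move=> mh hf [mf foo]; apply/integrableP; split; first exact/measurable_EFinP.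
apply: le_lt_trans foo; apply: ge0_le_integral => //.
- by apply: measurableT_comp => //; exact/measurable_EFinP.
- exact: measurable_normcE.
- by move=> x _; rewrite lee_fin.
Qed.

Lemma Cintegrable_Re f : Cintegrable f -> mu.-integrable setT (EFin \o (fun x => complex.Re (f x))).
Proof.
by move=> If; apply: (integrable_part _ _ If) => [|x]; [exact: If.1.1|exact: le_Re_normc].
Qed.

Lemma Cintegrable_Im f : Cintegrable f -> mu.-integrable setT (EFin \o (fun x => complex.Im (f x))).
Proof.
by move=> If; apply: (integrable_part _ _ If) => [|x]; [exact: If.1.2|exact: le_Im_normc].
Qed.

Lemma CintegrableZ k f : Cintegrable f -> Cintegrable (fun x => k * f x)%R.
Proof.
move=> [mf foo]; split; first by apply: CmeasurableM => //; exact: Cmeasurable_cst.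
under eq_integral do rewrite normcM EFinM.
rewrite ge0_integralZl//; [|exact: measurable_normcE|by move=> x _; rewrite lee_fin normc_ge0
  |by rewrite lee_fin normc_ge0].
by rewrite lte_mul_pinfty// ?lee_fin ?normc_ge0.
Qed.

Local Open Scope ring_scope.

Lemma CintegralD f g : Cintegrable f -> Cintegrable g ->
  Cintegral mu setT (fun x => f x + g x) = Cintegral mu setT f + Cintegral mu setT g.
Proof.
move=> If Ig; have If' := Cintegrable_Re If; have Ig' := Cintegrable_Re Ig.
have If2 := Cintegrable_Im If; have Ig2 := Cintegrable_Im Ig.
rewrite /Cintegral; under eq_Rintegral do rewrite raddfD/=.
rewrite RintegralD//; under [X in _ +i* X]eq_Rintegral do rewrite raddfD/=.
by rewrite RintegralD.
Qed.

Lemma CintegralZ k f : Cintegrable f ->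
  Cintegral mu setT (fun x => k * f x) = k * Cintegral mu setT f.
Proof.
move=> If; have If1 := Cintegrable_Re If; have If2 := Cintegrable_Im If.
case: k => a b; rewrite /Cintegral.
have Z (r : R) h : mu.-integrable setT (EFin \o h) -> mu.-integrable setT (EFin \o (fun x =>
  r * h x)).
  by move=> ih; rewrite (_ : _ \o _ = (fun x => r%:E * (EFin \o h) x)%E)//; exact: integrableZl.
rewrite (_ : (fun x => complex.Re _) = fun x => a * complex.Re (f x) - b * complex.Im (f x));
  last first.
  by apply/funext => x; case: (f x).
rewrite (_ : (fun x => complex.Im _) = fun x => a * complex.Im (f x) + b * complex.Re (f x));
  last first.
  by apply/funext => x; case: (f x).
rewrite RintegralB//; [|exact: Z..]; rewrite RintegralD//; [|exact: Z..].
by rewrite !RintegralZl.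
Qed.

Lemma Cintegral_conj f : Cintegrable f ->
  Cintegral mu setT (fun x => (f x)^*%C) = (Cintegral mu setT f)^*%C.
Proof.
move=> If; rewrite /Cintegral/=; congr (_ +i* _).
  by apply: eq_Rintegral => x _; case: (f x).
rewrite -[RHS]mulN1r -RintegralZl//; last exact: Cintegrable_Im.
by apply: eq_Rintegral => x _; case: (f x) => a b /=; rewrite mulN1r.
Qed.

Lemma eq_Cintegral f g : f =1 g -> Cintegral mu setT f = Cintegral mu setT g.
Proof. by move=> /funext ->. Qed.

Lemma Cintegral_mkcond (D : set T) f :
  Cintegral mu D f = Cintegral mu setT (fun x => if x \in D then f x else 0).
Proof.
rewrite /Cintegral; congr (_ +i* _); rewrite /Rintegral integral_mkcond; congr fine;
  apply: eq_integral => x _; rewrite patchE; by case: ifP.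
Qed.

(** The factor 2 comes from bounding the real and the imaginary part separately. *)
Lemma normc_Cintegral f (B : R) : Cintegrable f ->
  (\int[mu]_x (normc (f x))%:E <= B%:E)%E -> normc (Cintegral mu setT f) <= 2 * B.
Proof.
move=> If fB; apply: le_trans (le_normc_ReIm _) _.
have H h : (forall x, `|h x| <= normc (f x)) -> mu.-integrable setT (EFin \o h) ->
    `|Rintegral mu setT h| <= B.
  move=> hf ih; apply: le_trans (le_normr_Rintegral _ ih) _ => //.
  have [mh hoo] := integrableP _ _ _ ih.
  have e : (\int[mu]_x (`|h x|)%:E <= \int[mu]_x (normc (f x))%:E)%E.
    apply: ge0_le_integral => //.
    - apply/measurable_EFinP; apply: measurableT_comp => //; exact/measurable_EFinP.
    - exact: measurable_normcE If.1.
    by move=> x _; rewrite lee_fin.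
  rewrite -lee_fin /Rintegral fineK ?(le_trans e)// ge0_fin_numE; last exact: integral_ge0.
  by apply: le_lt_trans e _; apply: le_lt_trans fB _; rewrite ltry.
rewrite mulr_natl mulr2n lerD//= H//.
- by move=> x; exact: le_Re_normc.
- exact: Cintegrable_Re.
- by move=> x; exact: le_Im_normc.
- exact: Cintegrable_Im.
Qed.

End complex_integral.

(** * Norms and inner products in L^2 *)

Section square_integrable.
Context d (T : measurableType d) (R : realType) (mu : {measure set T -> \bar R}).
Implicit Types (F G H : T -> R[i]).
Local Open Scope ereal_scope.

Definition sq F : \bar R := \int[mu]_x (normc (F x) ^+ 2)%:E.

Definition L2 F := Cmeasurable_fun setT F /\ sq F < +oo.

Definition ip F G : R[i] := Cintegral mu setT (fun x => F x * (G x)^*%C)%R.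

Lemma sq_ge0 F : 0 <= sq F. Proof. by apply: integral_ge0 => x _; rewrite lee_fin sqr_ge0. Qed.

Lemma sqZ (k : R[i]) F : Cmeasurable_fun setT F -> sq (fun x =>
  k * F x)%R = (normc k ^+ 2)%:E * sq F.
Proof.
move=> mF; rewrite /sq; under eq_integral do rewrite normcM exprMn EFinM.
rewrite ge0_integralZl//; try exact: measurable_normc_sqrE;
  try (by move=> x _; rewrite lee_fin sqr_ge0).
by rewrite lee_fin sqr_ge0.
Qed.

Lemma sq_le F G : Cmeasurable_fun setT F -> Cmeasurable_fun setT G ->
  (forall x, normc (F x) <= normc (G x))%R -> sq F <= sq G.
Proof.
move=> mF mG FG; apply: ge0_le_integral => //; try exact: measurable_normc_sqrE;
  try (by move=> x _; rewrite lee_fin sqr_ge0).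
by move=> x _; rewrite lee_fin lerXn2r ?nnegrE ?normc_ge0.
Qed.

(** After the triangle inequality the two sides differ by the square e^(-1) (e x - y)^2. A small
    weight e brings the factor of the main term close to 1, as the proofs of [bessel] and
    [kernel_mass] require. *)
Lemma normc_sqrD (e : R) (a b : R[i]) : (0 < e)%R ->
  (normc (a + b) ^+ 2 <= (1 + e) * normc a ^+ 2 + (1 + e^-1) * normc b ^+ 2)%R.
Proof.
move=> e0; apply: (@le_trans _ _ ((normc a + normc b) ^+ 2)%R).
  by rewrite lerXn2r ?nnegrE ?addr_ge0 ?normc_ge0// le_normcD.
move: (normc a) (normc b) => x y.
have -> : ((1 + e) * x ^+ 2 + (1 + e^-1) * y ^+ 2 = (x + y) ^+ 2 + e^-1 * (e * x - y) ^+ 2)%R.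
  by field; rewrite gt_eqF.
by rewrite lerDl mulr_ge0 ?sqr_ge0// invr_ge0 ltW.
Qed.

Lemma sqD (e : R) F G : (0 < e)%R -> Cmeasurable_fun setT F -> Cmeasurable_fun setT G ->
  sq (fun x => F x + G x)%R <= (1 + e)%:E * sq F + (1 + e^-1)%:E * sq G.
Proof.
move=> e0 mF mG; have e1 : (0 <= 1 + e)%R by rewrite addr_ge0// ltW.
have e2 : (0 <= 1 + e^-1)%R by rewrite addr_ge0// invr_ge0 ltW.
rewrite /sq -!ge0_integralZl//; try exact: measurable_normc_sqrE;
  try (by move=> x _; rewrite lee_fin sqr_ge0).
rewrite -ge0_integralD//; try (by move=> x _; rewrite mule_ge0 ?lee_fin ?sqr_ge0// ltW);
  try (by apply: measurable_funeM; exact: measurable_normc_sqrE).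
apply: ge0_le_integral => //.
- by move=> x _; rewrite lee_fin sqr_ge0.
- by apply: measurable_normc_sqrE; exact: CmeasurableD.
- by apply: emeasurable_funD; apply: measurable_funeM; exact: measurable_normc_sqrE.
- by move=> x _; rewrite -!EFinM -EFinD lee_fin normc_sqrD.
Qed.

Lemma L2Z (k : R[i]) F : L2 F -> L2 (fun x => k * F x)%R.
Proof.
move=> [mF Foo]; split; first by apply: CmeasurableM => //; exact: Cmeasurable_cst.
by rewrite sqZ// lte_mul_pinfty// lee_fin sqr_ge0.
Qed.

Lemma L2D F G : L2 F -> L2 G -> L2 (fun x => F x + G x)%R.
Proof.
move=> [mF Foo] [mG Goo]; split; first exact: CmeasurableD.
apply: le_lt_trans (sqD ltr01 mF mG) _; apply: lte_add_pinfty; apply: lte_mul_pinfty => //;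
  by rewrite lee_fin addr_ge0// invr_ge0.
Qed.

Lemma L2N F : L2 F -> L2 (fun x => - F x)%R.
Proof. by move=> /(L2Z (-1)%R); under eq_fun do rewrite mulN1r. Qed.

Lemma L20 : L2 (fun=> 0%R).
Proof.
split; first exact: Cmeasurable_cst.
by rewrite /sq; under eq_integral do rewrite normc0 expr0n/=; rewrite integral0.
Qed.

Lemma L2_sum n (F : nat -> T -> R[i]) : (forall k, L2 (F k)) ->
  L2 (fun x => \sum_(k < n) F k x)%R.
Proof.
move=> LF; elim: n => [|n ih]; first by under eq_fun do rewrite big_ord0; exact: L20.
by under eq_fun do rewrite big_ord_recr/=; exact: L2D.
Qed.

Lemma normcM_le (e : R) (a b : R[i]) : (0 < e)%R ->
  (normc (a * b^*%C) <= e * normc a ^+ 2 + e^-1 * normc b ^+ 2)%R.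
Proof.
move=> e0; rewrite normcM normc_conj.
move: (normc a) (normc b) (normc_ge0 a) (normc_ge0 b) => x y x0 y0.
rewrite -subr_ge0.
have -> : (e * x ^+ 2 + e^-1 * y ^+ 2 - x * y = e^-1 * ((e * x - y) ^+ 2 + e * (x * y)))%R.
  by field; rewrite gt_eqF.
by rewrite mulr_ge0 ?invr_ge0 ?addr_ge0 ?sqr_ge0 ?mulr_ge0// ltW.
Qed.

Let ip_int (e A B : R) F G : (0 < e)%R -> Cmeasurable_fun setT F -> Cmeasurable_fun setT G ->
  sq F <= A%:E -> sq G <= B%:E ->
  \int[mu]_x (normc (F x * (G x)^*%C))%:E <= (e * A + e^-1 * B)%:E.
Proof.
move=> e0 mF mG FA GB; have ei : (0 <= e^-1)%R by rewrite invr_ge0 ltW.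
apply: (@le_trans _ _ (e%:E * sq F + (e^-1)%:E * sq G)); last first.
  by rewrite EFinD !EFinM; apply: leeD; apply: lee_wpmul2l => //; rewrite lee_fin// ltW.
have e0' := ltW e0.
rewrite /sq -!ge0_integralZl//; try exact: measurable_normc_sqrE;
  try (by move=> x _; rewrite lee_fin sqr_ge0).
rewrite -ge0_integralD//; try (by move=> x _; rewrite mule_ge0 ?lee_fin ?sqr_ge0// ltW);
  try (by apply: measurable_funeM; exact: measurable_normc_sqrE).
apply: ge0_le_integral => //.
- by move=> x _; rewrite lee_fin normc_ge0.
- by apply: measurable_normcE; apply: CmeasurableM => //; exact: Cmeasurable_conj.
- by apply: emeasurable_funD; apply: measurable_funeM; exact: measurable_normc_sqrE.
- by move=> x _; rewrite -!EFinM -EFinD lee_fin normcM_le.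
Qed.

Let fin_sq F : sq F < +oo -> exists A : R, sq F <= A%:E.
Proof. by move=> Foo; exists (fine (sq F)); rewrite fineK// ge0_fin_numE// sq_ge0. Qed.

Lemma ip_integrable F G : L2 F -> L2 G -> Cintegrable mu (fun x => F x * (G x)^*%C)%R.
Proof.
move=> [mF /fin_sq[A FA]] [mG /fin_sq[B GB]]; split.
  by apply: CmeasurableM => //; exact: Cmeasurable_conj.
by apply: le_lt_trans (ip_int ltr01 mF mG FA GB) _; rewrite ltry.
Qed.

(** An arithmetic-geometric bound with a free weight; optimizing e would give the Cauchy-Schwarz
    inequality up to a constant. *)
Lemma normc_ip (e A B : R) F G : (0 < e)%R -> L2 F -> L2 G ->
  sq F <= A%:E -> sq G <= B%:E -> (normc (ip F G) <= 2 * (e * A + e^-1 * B))%R.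
Proof.
move=> e0 LF LG FA GB; apply: normc_Cintegral; first exact: ip_integrable.
by apply: ip_int => //; [exact: LF.1|exact: LG.1].
Qed.

Local Open Scope ring_scope.

Lemma ipDl F G H : L2 F -> L2 G -> L2 H ->
  ip (fun x => F x + G x) H = ip F H + ip G H.
Proof.
move=> LF LG LH; rewrite /ip -CintegralD; try exact: ip_integrable.
by apply: eq_Cintegral => x; rewrite mulrDl.
Qed.

Lemma ipZl (k : R[i]) F G : L2 F -> L2 G -> ip (fun x => k * F x) G = k * ip F G.
Proof.
move=> LF LG; rewrite /ip -CintegralZ; last exact: ip_integrable.
by apply: eq_Cintegral => x; rewrite mulrA.
Qed.

Lemma ipC F G : L2 F -> L2 G -> ip G F = (ip F G)^*%C.
Proof.
move=> LF LG; rewrite /ip -Cintegral_conj; last exact: ip_integrable.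
by apply: eq_Cintegral => x; rewrite conjcM conjcK mulrC.
Qed.

Lemma ipDr F G H : L2 F -> L2 G -> L2 H ->
  ip F (fun x => G x + H x) = ip F G + ip F H.
Proof.
move=> LF LG LH; rewrite (ipC _ LF); last exact: L2D.
by rewrite ipDl// conjcD -!ipC.
Qed.

Lemma ipZr (k : R[i]) F G : L2 F -> L2 G -> ip F (fun x => k * G x) = k^*%C * ip F G.
Proof.
move=> LF LG; rewrite (ipC _ LF); last exact: L2Z.
by rewrite ipZl// conjcM -!ipC.
Qed.

Lemma ip_suml n (a : nat -> R[i]) (F : nat -> T -> R[i]) G : (forall k, L2 (F k)) -> L2 G ->
  ip (fun x => \sum_(k < n) a k * F k x) G = \sum_(k < n) a k * ip (F k) G.
Proof.
move=> LF LG; elim: n => [|n ih].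
  rewrite big_ord0 /ip (@eq_Cintegral _ _ _ _ _ (fun=> 0)); last by move=> x;
    rewrite big_ord0 mul0r.
  by rewrite /Cintegral/= Rintegral_cst// mul0r.
under eq_fun do rewrite big_ord_recr/=.
rewrite ipDl//; last exact: L2Z.
  by rewrite ih ipZl// big_ord_recr.
by apply: (@L2_sum n (fun k x => a k * F k x)) => k; exact: L2Z.
Qed.

Lemma ip_sumr n (a : nat -> R[i]) (F : nat -> T -> R[i]) G : (forall k, L2 (F k)) -> L2 G ->
  ip G (fun x => \sum_(k < n) a k * F k x) = \sum_(k < n) (a k)^*%C * ip G (F k).
Proof.
move=> LF LG; rewrite ipC//; last by apply: (@L2_sum n (fun k x => a k * F k x)) => k; exact: L2Z.
rewrite ip_suml//; rewrite raddf_sum; apply: eq_bigr => k _.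
by rewrite /= conjcM -ipC.
Qed.

(** The index N is chosen before G, so the convergence is uniform over balls of L^2. *)
Lemma sq_cvg0_ip (F : nat -> T -> R[i]) (s : nat -> R) (B : R) : (forall n, L2 (F n)) ->
  (forall n, sq (F n) <= (s n)%:E)%E ->
  (forall e, 0 < e -> exists N : nat, forall n, (N <= n)%N -> s n < e) ->
  forall e, 0 < e -> exists N : nat, forall n G, (N <= n)%N -> L2 G -> (sq G <= B%:E)%E ->
    normc (ip (F n) G) < e.
Proof.
move=> LF Fs s0 e e0.
pose B' := `|B| + 1; have B0 : 0 < B' by rewrite ltr_wpDl.
(* This weight makes the second term of [normc_ip] equal to e / 8, and s_n < e / (8 t) makes the
   first one smaller than e / 8. *)
pose t := 8 * B' / e; have t0 : 0 < t by rewrite divr_gt0// mulr_gt0.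
have [N NP] := s0 (e / (8 * t)) ltac:(by rewrite divr_gt0// mulr_gt0).
exists N => n G /NP sn LG GB.
have GB' : (sq G <= B'%:E)%E.
  by rewrite (le_trans GB)// lee_fin (le_trans (ler_norm B))// lerDl.
apply: le_lt_trans (normc_ip t0 (LF n) LG (Fs n) GB') _.
have h1 : t * s n < e / 8.
  by rewrite mulrC -ltr_pdivlMr// (lt_le_trans sn)// invfM mulrA.
have h2 : t^-1 * B' = e / 8 by rewrite /t; field; rewrite !gt_eqF.
lra.
Qed.

End square_integrable.

(** * Parseval identities by averaging over roots of unity *)

Section finite_parseval.
Context d (T : measurableType d) (R : realType) (mu : {measure set T -> \bar R}).

Lemma discrete_parseval n (w : R[i]) (a : nat -> R[i]) : n.-primitive_root w ->
  \sum_(j < n) normc (\sum_(k < n) (w ^+ j) ^+ k * a k) ^+ 2 =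
  n%:R * \sum_(k < n) normc (a k) ^+ 2.
Proof.
move=> pw; have n0 := prim_order_gt0 pw.
have nw : normc w = 1.
  apply: (@pexpIrn _ n); rewrite ?nnegrE ?normc_ge0//.
  by rewrite expr1n -normcX (prim_expr_order pw) normc1.
have conjw (j l : nat) : ((w ^+ j) ^+ l)^*%C = (w ^+ j) ^- l.
  have h : (w ^+ j) ^+ l * ((w ^+ j) ^+ l)^*%C = 1.
    by rewrite mul_conjc !normcX nw !expr1n.
  have h0 : (w ^+ j) ^+ l != 0 by apply: contra_eqN h => /eqP ->; rewrite mul0r eq_sym oner_eq0.
  by apply: (mulfI h0); rewrite h divff.
apply: complexI; rewrite rmorphM rmorph_nat !rmorph_sum mulr_sumr.
transitivity (\sum_(j < n) \sum_(k < n) \sum_(l < n)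
    (a k * (a l)^*%C) * ((w ^+ j) ^+ k * (w ^+ j) ^- l)).
  apply: eq_bigr => j _; set S := \sum_(k < n) (w ^+ j) ^+ k * a k.
  transitivity (S * S^*%C); first by rewrite mul_conjc.
  rewrite {2}/S rmorph_sum mulr_suml; apply: eq_bigr => k _.
  rewrite mulr_sumr; apply: eq_bigr => l _; rewrite /= conjcM conjw; ring.
rewrite exchange_big; apply: eq_bigr => k _;
  rewrite exchange_big (bigD1 k)//= [X in _ + X]big1 ?addr0 => [|l lk].
  transitivity (n%:R * (a k * (a k)^*%C)); last by rewrite mul_conjc.
  by rewrite -mulr_sumr sum_prim_root// eqxx mul1r mulrC.
rewrite -mulr_sumr sum_prim_root// (_ : (k == l :> nat) = false) ?mul0r ?mulr0//.
by apply/negbTE; rewrite eq_sym.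
Qed.

(** sigma preserves mu and multiplies the g k by distinct characters, up to the common phase chi.
    Averaging |sum g k|^2 over the first n iterates of sigma cancels the cross terms. The phase
    accommodates matrix coefficients, which carry a factor independent of k. *)
Lemma finite_parseval n (g : nat -> T -> R[i]) (sigma : T -> T) (chi : T -> R[i]) :
  (0 < n)%N -> (forall k, Cmeasurable_fun setT (g k)) ->
  (forall F : T -> \bar R, (forall x, 0 <= F x)%E -> measurable_fun setT F ->
     \int[mu]_x F (sigma x) = \int[mu]_x F x)%E ->
  measurable_fun setT sigma ->
  (forall x, normc (chi x) = 1) ->
  (forall k x, (k < n)%N -> g k (sigma x) = chi x * expi (2 * pi / n%:R) ^+ k * g k x) ->
  (sq mu (fun x => \sum_(k < n) g k x)%R = \sum_(k < n) sq mu (g k))%E.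
Proof.
move=> n0 mg sig msig chi1 gs; set w := expi (2 * pi / n%:R) in gs *.
have pw : n.-primitive_root w := prim_expi R n0.
have miter j : measurable_fun setT (iter j sigma).
  by elim: j => [|j ih]; [exact: measurable_id|exact: measurableT_comp].
have sigj j (F : T -> \bar R) : (forall x, 0 <= F x)%E -> measurable_fun setT F ->
    (\int[mu]_x F (iter j sigma x) = \int[mu]_x F x)%E.
  move=> F0 mF; elim: j => [//|j ih]; rewrite -ih -[RHS]sig//.
    by apply: eq_integral => x _; rewrite -iterSr.
  exact: measurableT_comp.
have gj j x : exists2 X : R[i], normc X = 1 &
    forall k, (k < n)%N -> g k (iter j sigma x) = X * (w ^+ j) ^+ k * g k x.
  elim: j => [|j [X X1 XP]].
    by exists 1 => [|k _]; rewrite ?normc1// expr0 expr1n !mul1r.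
  exists (chi (iter j sigma x) * X) => [|k kn]; first by rewrite normcM chi1 X1 mulr1.
  by rewrite /= gs// XP// exprSr exprMn -!exprM; ring.
have mS : measurable_fun setT (fun x => (normc (\sum_(k < n) g k x) ^+ 2)%:E).
  by apply: measurable_normc_sqrE; exact: Cmeasurable_sum.
have S0 x : (0 <= (normc (\sum_(k < n) g k x) ^+ 2)%:E)%E by rewrite lee_fin sqr_ge0.
have mj (j : nat) : measurable_fun setT (fun x =>
  (normc (\sum_(k < n) (w ^+ j) ^+ k * g k x) ^+ 2)%:E).
  apply: measurable_normc_sqrE.
  apply: (@Cmeasurable_sum _ _ _ _ n (fun k x => (w ^+ j) ^+ k * g k x)) => k.
  by apply: CmeasurableM => //; exact: Cmeasurable_cst.
have sqj (j : nat) : (sq mu (fun x => \sum_(k < n) g k x)%R =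
    \int[mu]_x (normc (\sum_(k < n) (w ^+ j) ^+ k * g k x) ^+ 2)%:E)%E.
  rewrite /sq -(sigj j _ S0 mS); apply: eq_integral => x _; congr (_%:E).
  have [X X1 XP] := gj j x.
  rewrite (eq_bigr (fun k : 'I_n => X * ((w ^+ j) ^+ k * g k x))); last first.
    by move=> k _; rewrite XP// mulrA.
  by rewrite -mulr_sumr normcM X1 mul1r.
have H : (n%:R%:E * sq mu (fun x => \sum_(k < n) g k x)%R =
          n%:R%:E * \sum_(k < n) sq mu (g k))%E.
  transitivity (\sum_(j < n) sq mu (fun x => \sum_(k < n) g k x)%R)%E.
    by rewrite sumr_const card_ord mule_natl.
  transitivity (\sum_(j < n) \int[mu]_x (normc (\sum_(k < n) (w ^+ j) ^+ k * g k x)%R ^+ 2)%:E)%E.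
    by apply: eq_bigr => j _; exact: sqj.
  rewrite -ge0_integral_sum//; last first.
    by move=> j x _; rewrite lee_fin sqr_ge0.
  rewrite /sq -ge0_integral_sum//; last 2 first.
  - by move=> k; exact: measurable_normc_sqrE.
  - by move=> k x _; rewrite lee_fin sqr_ge0.
  rewrite -ge0_integralZl//; last 2 first.
  - by apply: emeasurable_sum => k; exact: measurable_normc_sqrE.
  - by move=> x _; apply: sume_ge0 => k _; rewrite lee_fin sqr_ge0.
  apply: eq_integral => x _; rewrite !sumEFin -EFinM; congr (_%:E).
  exact: (discrete_parseval (fun k => g k x)).
have n0R : n%:R != 0 :> R by rewrite pnatr_eq0 -lt0n.
by rewrite -[LHS]mul1e -[RHS]mul1e -(mulVf n0R) EFinM -!muleA H.
Qed.

End finite_parseval.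

(** * Beta integrals *)

Section beta_integral.
Variable R : realType.
Implicit Types (a t : R).
Local Notation leb := (@lebesgue_measure R).

Lemma is_derive_powR1B a t : t < 1 ->
  is_derive t (1 : R) (fun t => (1 - t) `^ (a + 1)) (- ((a + 1) * (1 - t) `^ a)).
Proof.
move=> t1; have t0 : 0 < 1 - t by rewrite subr_gt0.
have d1 := is_derive1_powR (a + 1) t0; rewrite addrK in d1.
have d2 : is_derive t (1 : R) (fun t => 1 - t) (-1).
  by apply: is_derive_eq; ring.
have d3 : is_derive t (1 : R) (fun t => (1 - t) `^ (a + 1)) ((a + 1) * (1 - t) `^ a * -1).
  exact: (@is_derive1_comp R (fun x => x `^ (a + 1)) (fun t => 1 - t) t _ _ d1 d2).
by rewrite mulrN1 in d3.
Qed.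

Lemma powR1B_left a : 0 <= a -> (1 - t) `^ a @[t --> 1^'-] --> (1 - 1 : R) `^ a.
Proof.
(* The exponent 0 is treated apart because 0 to the power 0 is 1. *)
rewrite le_eqVlt => /predU1P[<-|a0].
  by under eq_fun do rewrite powRr0; rewrite powRr0; exact: cvg_cst.
rewrite subrr powR0 ?gt_eqF//; apply/cvg_at_leftP => u [u1 ul].
have /cvg_at_rightP/(_ (fun n => 1 - u n)) := powR_cvg0 a0; apply; split.
  by move=> n; rewrite subr_gt0.
by rewrite -[X in _ --> X](subrr (1 : R)); apply: cvgB => //; exact: cvg_cst.
Qed.

Lemma continuous_powR1B a t : t < 1 -> {for t, continuous (fun t => (1 - t) `^ a)}.
Proof.
move=> t1; apply/differentiable_continuous/derivable1_diffP.
by have [] := is_derive_powR1B (a - 1) t1; rewrite subrK.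
Qed.

Lemma within_continuous_powR1B a : 0 <= a ->
  {within `[0, 1], continuous (fun t => (1 - t) `^ a)}.
Proof.
move=> a0; apply/continuous_within_itvP => //; split.
- by move=> t; rewrite in_itv/= => /andP[_ t1]; exact: continuous_powR1B.
- by apply: cvg_at_right_filter; exact: continuous_powR1B.
- exact: powR1B_left.
Qed.

Let dG a t : 0 <= a -> t < 1 ->
  is_derive t (1 : R) (fun t => - ((1 - t) `^ (a + 1) / (a + 1))) ((1 - t) `^ a).
Proof.
move=> a0 t1; have d := is_derive_powR1B a t1.
apply: is_derive_eq; rewrite /GRing.scale/=; field.
by rewrite gt_eqF// ltr_wpDl.
Qed.

Lemma LRcontinuous_powR1B a : 0 <= a ->
  derivable_oo_LRcontinuous (fun t : R => - ((1 - t) `^ (a + 1) / (a + 1))) 0 1.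
Proof.
move=> a0; split.
- move=> t; rewrite in_itv/= => /andP[_ t1].
  by have [] := dG a0 t1.
- apply: cvgN; apply: cvgMl.
  by apply: cvg_at_right_filter; exact: continuous_powR1B.
- by apply: cvgN; apply: cvgMl; apply: powR1B_left; rewrite addr_ge0.
Qed.

Let derive_powR1B a : 0 <= a ->
  {in `]0, 1[, derive1 (fun t : R => - ((1 - t) `^ (a + 1) / (a + 1)) : R^o) =1 (fun t =>
    (1 - t) `^ a)}.
Proof.
move=> a0 t; rewrite in_itv/= => /andP[_ t1].
by rewrite derive1E; have [_ ->] := dG a0 t1.
Qed.

(** Integration by parts trades one factor t for an increase of a by 1; [gam_succ] is the matching
    recursion on the right-hand side. *)
Lemma beta_integral a m : 0 <= a ->
  (\int[leb]_(t in `[0%R, 1%R]) (t ^+ m * (1 - t) `^ a)%:E = (((a + 1) * gam (a + 2) m)^-1)%:E)%E.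
Proof.
elim: m a => [|m ih] a a0; have a1 : a + 1 != 0 by rewrite gt_eqF// ltr_wpDl.
  under eq_integral do rewrite expr0 mul1r.
  rewrite (continuous_FTC2 ltr01 (within_continuous_powR1B a0) (LRcontinuous_powR1B a0)
    (derive_powR1B a0)).
  rewrite subrr subr0 powR1 powR0// mul0r oppr0 mul1r gam0 mulr1.
  by rewrite -EFinB sub0r opprK.
have dX t : is_derive t (1 : R) (fun t : R => t ^+ m.+1) (m.+1%:R * t ^+ m).
  split; first exact: exprn_derivable.
  by rewrite exp_derive /GRing.scale/= mulr1.
have cX (n : nat) : continuous (fun t : R => t ^+ n) by move=> t; exact: exprn_continuous.
rewrite (@integration_by_parts R (fun t => t ^+ m.+1) _ (fun t => m.+1%:R * t ^+ m)
  (fun t => (1 - t) `^ a) _ _ ltr01 _ _ _ (within_continuous_powR1B a0)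
  (LRcontinuous_powR1B a0) (derive_powR1B a0)); last 3 first.
- by apply: continuous_subspaceT => t; apply: cvgM; [exact: cvg_cst|exact: cX].
- split.
  + by move=> t _; have [] := dX t.
  + by apply: cvg_at_right_filter; exact: cX.
  + by apply: cvg_at_left_filter; exact: cX.
- by move=> t _; rewrite derive1E; have [_ ->] := dX t.
rewrite subrr powR0 ?mul0r ?oppr0 ?mulr0 ?expr0n/= ?mul0r ?subrr ?sub0e//; last first.
rewrite (_ : (fun t => _) = fun t => (- (m.+1%:R / (a + 1)))%:E * (t ^+ m * (1 - t) `^ (a +
  1))%:E)%E; last first.
  by apply/funext => t; rewrite -EFinM; congr (_%:E); ring.
rewrite integralZl//; last first.
  apply: continuous_compact_integrable; first exact: segment_compact.
  apply/subspace_continuousP => x x01; apply: cvgM.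
    apply: cvg_within_filter; exact: cX.
  have /subspace_continuousP := within_continuous_powR1B (addr_ge0 a0 ler01); exact.
rewrite ih ?addr_ge0// -EFinM -EFinN; congr (_%:E).
have n0 := ler0n R m; have g0 := gam_gt0 m (ltr_wpDl a0 (ltr0n R 2)).
have := gam_succ (a + 2) m; rewrite (_ : a + 2 + 1 = a + 1 + 2); last by ring.
move: (gam_gt0 m.+1 (ltr_wpDl a0 (ltr0n R 2))) (gam_gt0 m (ltr_wpDl (addr_ge0 a0 ler01) (ltr0n R
  2))).
rewrite -[m.+1%:R]natr1; move: (gam _ m.+1) (gam _ m) => g g' g0' g'0 e.
have {e} -> : g' = (m%:R + 1) * g / (a + 2) by rewrite e mulrC mulKf// gt_eqF// ltr_wpDl.
field.
by rewrite !gt_eqF//; lra.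
Qed.

End beta_integral.

(** * Weighted Bergman spaces and their translations *)

Section bergman_embedding.
Variables (R : realType) (alpha : R).
Hypothesis alpha0 : 0 <= alpha.
Implicit Types (u v : R[i] -> R[i]) (z w : R[i]).
Local Notation c := (@complex_of_pair R).
Local Notation pr := (@pair_of_complex R).
Local Notation area := (@area R).
Local Notation leb := (@lebesgue_measure R).

(** Elements of the Bergman spaces are constrained only on the disc. Extending them by 0 lets all
    integrals be taken over the plane, where the substitutions are stated. *)
Definition cut u z : R[i] := if normc z < 1 then u z else 0.

Definition disc_measurable u := Cmeasurable_fun setT (cut u \o c).

(* The isometric embedding of the weighted Bergman space into L^2 of the plane. *)
Definition emb u (p : R * R) : R[i] := cut u (c p) * (Num.sqrt (bergman_weight alpha (c p)))%:C.

Lemma embE u p : emb u p = cut u (c p) * (Num.sqrt (bergman_weight alpha (c p)))%:C.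
Proof. by []. Qed.

Lemma in_discE (p : R * R) : (p \in @disc R) = (normc (c p) < 1).
Proof. by apply/idP/idP; rewrite inE. Qed.

Lemma bergman_weight_ge0 z : 0 <= bergman_weight alpha z.
Proof. by rewrite mulr_ge0 ?powR_ge0// divr_ge0 ?pi_ge0// addr_ge0. Qed.

Lemma bergman_innerE u v : bergman_inner alpha u v = ip area (emb u) (emb v).
Proof.
rewrite /bergman_inner Cintegral_mkcond /ip; apply: eq_Cintegral => p.
rewrite in_discE /emb /cut; case: ifP => _; last by rewrite !mul0r.
rewrite conj_conjc conjcM conjc_real mulrACA -rmorphM.
by rewrite -expr2 sqr_sqrtr// bergman_weight_ge0.
Qed.

Lemma normc_emb u p : normc (emb u p) ^+ 2 = normc (cut u (c p)) ^+ 2 * bergman_weight alpha (c p).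
Proof.
by rewrite normcM exprMn normc_real real_normK ?num_real// sqr_sqrtr// bergman_weight_ge0.
Qed.

Lemma bergman_normE u : bergman_norm alpha u = (sq area (emb u) `^ 2^-1)%E.
Proof.
rewrite /bergman_norm integral_mkcond; congr (_ `^ _)%E; apply: eq_integral => p _.
rewrite patchE in_discE normc_emb /cut; case: ifP => //= _.
by rewrite normc0 expr0n/= mul0r.
Qed.

Lemma measurable_bergman_weight : measurable_fun setT (fun p => bergman_weight alpha (c p)).
Proof.
rewrite /bergman_weight; apply: measurable_funM => //.
apply: (@measurableT_comp _ _ _ _ _ _ (@powR R ^~ alpha)); first exact: measurable_powR.
apply: measurable_funB => //; apply: measurable_normc_sqr; exact: Cmeasurable_of_pair.
Qed.

Lemma Cmeasurable_emb u : disc_measurable u -> Cmeasurable_fun setT (emb u).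
Proof.
move=> mu; apply: CmeasurableM => //; apply: Cmeasurable_real.
apply: measurableT_comp; last exact: measurable_bergman_weight.
by apply: continuous_measurable_fun; exact: sqrt_continuous.
Qed.

Lemma Cmeasurable_if d (T : measurableType d) (A : set T) (b : T -> bool) (f : T -> R[i]) :
  measurable A -> (forall x, b x <-> A x) -> Cmeasurable_fun setT f ->
  Cmeasurable_fun setT (fun x => if b x then f x else 0).
Proof.
move=> mA bA [f1 f2].
have mb : measurable_fun setT b.
  apply: (measurable_fun_bool true); rewrite setTI (_ : _ @^-1` _ = A)//.
  by apply/seteqP; split => x /=; [move=> /bA|move=> /bA].
split.
  rewrite (_ : (fun x => _) = fun x => if b x then complex.Re (f x) else 0).
    exact: measurable_fun_ifT.
  by apply/funext => x; case: ifP.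
rewrite (_ : (fun x => _) = fun x => if b x then complex.Im (f x) else 0).
  exact: measurable_fun_ifT.
by apply/funext => x; case: ifP.
Qed.

Lemma Cmeasurable_cut u : Cmeasurable_fun setT (u \o c) -> disc_measurable u.
Proof.
move=> mu; apply: (@Cmeasurable_if _ _ (@disc R)) => //; exact: measurable_disc.
Qed.

Lemma embD u v : emb (fun z => u z + v z) = fun p => emb u p + emb v p.
Proof.
apply/funext => p; rewrite /emb -mulrDl /cut; congr (_ * _).
by case: ifP => // _; rewrite addr0.
Qed.

Lemma embZ k u : emb (fun z => k * u z) = fun p => k * emb u p.
Proof.
apply/funext => p; rewrite /emb mulrA /cut; congr (_ * _).
by case: ifP => // _; rewrite mulr0.
Qed.

Lemma emb_sum n (u : nat -> R[i] -> R[i]) :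
  emb (fun z => \sum_(k < n) u k z) = fun p => \sum_(k < n) emb (u k) p.
Proof.
apply/funext => p; rewrite /emb -mulr_suml /cut; congr (_ * _).
by case: ifP => // _; rewrite big1.
Qed.

Definition mono m : R[i] -> R[i] := fun z => z ^+ m.

Lemma monoE m z : mono m z = z ^+ m. Proof. by []. Qed.

Lemma disc_measurable_mono m : disc_measurable (mono m).
Proof. by apply: Cmeasurable_cut; apply: CmeasurableX; exact: Cmeasurable_of_pair. Qed.

Lemma sq_mono m : sq area (emb (mono m)) = ((gam (alpha + 2) m)^-1)%:E.
Proof.
pose F (s : R) : \bar R :=
  (if s < 1 then s ^+ m * ((alpha + 1) / pi * (1 - s) `^ alpha) else 0)%:E.
have mF' : measurable_fun setT (fun s : R => s ^+ m * ((alpha + 1) / pi * (1 - s) `^ alpha)).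
  apply: measurable_funM; first exact: measurable_funX.
  apply: measurable_funM => //.
  apply: (@measurableT_comp _ _ _ _ _ _ (@powR R ^~ alpha)); first exact: measurable_powR.
  exact: measurable_funB.
have mF : measurable_fun setT (fun s : R =>
    if s < 1 then s ^+ m * ((alpha + 1) / pi * (1 - s) `^ alpha) else 0).
  by apply: measurable_fun_ifT => //; exact: measurable_fun_ltr.
(* [area_radial] asks for a function that is nonnegative on the whole line, which s^m is not for odd
   m. *)
pose G (s : R) := F `|s|.
have mG : measurable_fun setT G.
  apply/measurable_EFinP.
  by apply: (measurableT_comp mF); exact: normr_measurable.
have a1 : 0 <= (alpha + 1) / pi by rewrite divr_ge0 ?pi_ge0// addr_ge0.
have G0 s : (0 <= G s)%E.
  rewrite /G /F; case: ifP => // _; rewrite lee_fin.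
  by apply: mulr_ge0; [exact: exprn_ge0|exact: mulr_ge0 a1 (powR_ge0 _ _)].
rewrite /sq; transitivity (\int[area]_p G (normc (c p) ^+ 2)%R)%E.
  apply: eq_integral => p _; rewrite /G ger0_norm ?sqr_ge0// /F normc_emb /cut /mono.
  rewrite expr_lt1 ?normc_ge0//; congr (_%:E); case: ifP => _.
    by rewrite normcX -!exprM mulnC.
  by rewrite normc0 expr0n/= mul0r.
rewrite area_radial//.
pose H (s : R) : R := s ^+ m * (1 - s) `^ alpha.
have mH : measurable_fun setT H.
  apply: measurable_funM; first exact: measurable_funX.
  apply: (@measurableT_comp _ _ _ _ _ _ (@powR R ^~ alpha)); first exact: measurable_powR.
  exact: measurable_funB.
have e : (\int[leb]_(s in `[0%R, +oo[) G s =
    \int[leb]_(s in `[0%R, 1%R]) (((alpha + 1) / pi)%:E * (H s)%:E))%E.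
  rewrite -integral_itv_bndo_bndc; last first.
    apply: measurable_funTS; apply: measurable_funeM; exact/measurable_EFinP.
  rewrite integral_mkcond [RHS]integral_mkcond; apply: eq_integral => s _.
  rewrite !patchE /G /F; have e1 : (s \in `[0, +oo[%classic) = (0 <= s).
    by apply/idP/idP; rewrite inE/= in_itv/= andbT.
  have e2 : (s \in `[0, 1[%classic) = (0 <= s) && (s < 1).
    by apply/idP/idP; rewrite inE/= in_itv/=.
  rewrite e1 e2; case: ifPn => s0 //=; rewrite ger0_norm//.
  by case: ifP => // _; rewrite -EFinM; congr (_%:E); rewrite /H; ring.
rewrite e ge0_integralZl//; last 2 first.
- by apply: measurable_funTS; exact/measurable_EFinP.
- by move=> s /=; rewrite in_itv/= => /andP[s0 _]; rewrite lee_fin mulr_ge0 ?powR_ge0 ?exprn_ge0.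
rewrite beta_integral// -!EFinM; congr (_%:E).
have g0 : 0 < gam (alpha + 2) m by apply: gam_gt0; rewrite ltr_wpDl.
have p0 := pi_gt0 R; have a2 : 0 < alpha + 1 by rewrite ltr_wpDl.
move: (pi : R) p0 => q q0; field.
by rewrite !gt_eqF.
Qed.

Lemma L2_mono m : L2 area (emb (mono m)).
Proof.
by split; [apply: Cmeasurable_emb; exact: disc_measurable_mono|rewrite sq_mono ltry].
Qed.

End bergman_embedding.

(** * The translations U_z and their composition law *)

Section bergman_translation.
Variables (R : realType) (alpha : R).
Hypothesis alpha0 : 0 <= alpha.
Implicit Types (u v : R[i] -> R[i]) (z w xi t : R[i]) (p : R * R).
Local Notation c := (@complex_of_pair R).
Local Notation pr := (@pair_of_complex R).
Local Notation area := (@area R).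
Local Notation emb := (emb alpha).
Local Notation U := (U alpha).
Local Notation s := (2 + alpha).

Lemma powR_sqr (x a : R) : 0 < x -> (x ^+ 2) `^ a = (x `^ a) ^+ 2.
Proof. by move=> x0; rewrite !expr2 powRM// ltW. Qed.

Lemma powRV (x a : R) : 0 < x -> (x^-1) `^ a = (x `^ a)^-1.
Proof. by move=> x0; rewrite -powRN -(powR_inv1 (ltW x0)) -powRrM mulN1r. Qed.

Lemma powR_half_sqr (x a : R) : 0 <= x -> (x `^ (a / 2)) ^+ 2 = x `^ a.
Proof.
by move=> x0; rewrite -powR_mulrn ?powR_ge0// -powRrM divfK.
Qed.

Lemma powR_2D (x : R) : 0 < x -> x `^ s = x ^+ 2 * x `^ alpha.
Proof.
move=> x0; rewrite powRD; last by rewrite (gt_eqF x0) implybT.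
by rewrite powR_mulrn// ltW.
Qed.

(** The identity behind the unitarity of U_z: the last factor is the squared modulus of its
    multiplier. *)
Lemma bergman_weight_mobius z w : unit_disc z -> unit_disc w ->
  bergman_weight alpha (mobius z w) * mobius_jacobian z w =
  bergman_weight alpha w * ((1 - normc z ^+ 2) `^ s / (normc (1 - z^*%C * w) `^ s) ^+ 2).
Proof.
move=> z1 w1; have d0 := denom_neq0 z1 w1.
rewrite /bergman_weight /mobius_jacobian one_sub_normc_mobius//.
have := sub_sqr_normc_gt0 z1; have := sub_sqr_normc_gt0 w1.
have : 0 < normc (1 - z^*%C * w) by rewrite normc_gt0.
move: (normc (1 - _ * w)) (1 - normc z ^+ 2) (1 - normc w ^+ 2) => D x y D0 y0 x0.
have xy := mulr_gt0 x0 y0.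
rewrite powRM ?(ltW xy) ?invr_ge0 ?sqr_ge0// powRM ?ltW// !powR_2D//.
have -> : ((D ^+ 2)^-1) `^ alpha = ((D `^ alpha) ^+ 2)^-1.
  by rewrite powRV ?exprn_gt0// powR_sqr.
have := powR_gt0 alpha D0; move: (D `^ alpha) (x `^ alpha) (y `^ alpha) => a b e a0.
have p0 := pi_gt0 R; move: (pi : R) p0 => q q0.
by field; rewrite !gt_eqF.
Qed.

Lemma U_E z u w : U z u w =
  u (mobius z w) * ((1 - normc z ^+ 2) `^ (s / 2))%:C / cpow (1 - z^*%C * w) s.
Proof. by []. Qed.

(** Used to see that the substituted integrand also vanishes outside the disc: at the pole of phi_z
    the Jacobian is 0 because 1 / 0 = 0, elsewhere phi_z preserves the exterior. *)
Lemma jacobian_out z p : unit_disc z -> ~~ (normc (c p) < 1) -> 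
  mobius_jacobian z (c p) = 0 \/ ~~ (normc (mobius z (c p)) < 1).
Proof.
move=> z1 p1; have [d0|d0] := eqVneq (1 - z^*%C * c p) 0.
  by left; rewrite /mobius_jacobian d0 normc0 expr0n/= invr0 mulr0 expr0n.
by right; apply: contra p1 => /(mobius_disc_iff z1 d0).1.
Qed.

Lemma normc_emb_U z u p : unit_disc z ->
  normc (emb (U z u) p) ^+ 2 =
  normc (emb u (pr (mobius z (c p)))) ^+ 2 * mobius_jacobian z (c p).
Proof.
move=> z1; apply: etrans (normc_emb alpha0 (U z u) p) _; apply: esym.
apply: etrans (congr1 ( *%R^~ _) (normc_emb alpha0 u _)) _; apply: esym.
rewrite (pair_of_complexK (mobius z (c p))) /cut.
case: ifPn => p1; last first.
  have [->|h] := jacobian_out z1 p1; first by rewrite normc0 expr0n/= !mulr0 mul0r.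
  by rewrite (negPf h) normc0 expr0n/= !mul0r.
have z0 := sub_sqr_normc_gt0 z1; have d1 := normc_conjM_lt1 z1 p1.
have m1 : normc (mobius z (c p)) < 1 := mobius_disc z1 p1.
rewrite m1 -[RHS]mulrA bergman_weight_mobius// U_E !normcM !exprMn normc_real.
rewrite real_normK ?num_real// powR_half_sqr ?ltW// normcV normc_cpow exprVn.
ring.
Qed.

Lemma sq_emb_U z u : unit_disc z -> disc_measurable u ->
  sq area (emb (U z u)) = sq area (emb u).
Proof.
move=> z1 mu; have [_ _ _ H] := area_cv_mobius z1.
rewrite /sq -[RHS]H; last 2 first.
- by move=> p; rewrite lee_fin sqr_ge0.
- by apply: measurable_normc_sqrE; exact: Cmeasurable_emb.
by apply: eq_integral => p _; rewrite -EFinM; congr (_%:E); exact: normc_emb_U.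
Qed.

Lemma emb_rotate xi u p : normc xi = 1 -> emb (rotate xi u) p = emb u (pr (xi * c p)).
Proof.
by move=> xi1; rewrite /emb pair_of_complexK /cut /bergman_weight normcM xi1 mul1r.
Qed.

Lemma sq_emb_rotate xi u : normc xi = 1 -> disc_measurable u ->
  sq area (emb (rotate xi u)) = sq area (emb u).
Proof.
move=> xi1 mu; rewrite /sq -[RHS](area_rotate xi1); last 2 first.
- by move=> p; rewrite lee_fin sqr_ge0.
- by apply: measurable_normc_sqrE; exact: Cmeasurable_emb.
by apply: eq_integral => p _; rewrite emb_rotate.
Qed.

(** Written as a product of two factors on the left and two on the right (the real factor joined to
    the inverse), so that [cpow_mul4] applies to it. *)
Lemma mobius_mobius_denom z w x xi : normc xi = 1 -> unit_disc z -> unit_disc w -> unit_disc x ->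
  (1 - (xi * mobius z w)^*%C * (xi * mobius z x)) * (1 - z^*%C * x) =
  (1 - normc z ^+ 2)%:C * (1 - z * w^*%C)^-1 * (1 - w^*%C * x).
Proof.
move=> xi1 z1 w1 x1; rewrite one_sub_sqr_complex !mobiusE.
have h1 := denom_neq0 z1 x1; have h2 := denom_neq0 z1 w1.
have h2' : 1 - z * w^*%C != 0 by rewrite -conjc_eq0 conjcB conjcM conjcK conjc1.
have e : xi * xi^*%C = 1 by rewrite mul_conjc xi1 expr1n.
rewrite conjcM mulrACA [xi^*%C * xi]mulrC e mul1r.
rewrite !(conjcB, conjcM, conjcK, conjc1, conjc_inv).
by field; rewrite h1 h2'.
Qed.

(** The composition law: phi_x' o (xi phi_z) with x' = xi phi_z(w) is phi_w up to a unimodular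
    constant. *)
Lemma mobius_mobius z w x xi t : normc xi = 1 -> unit_disc z -> unit_disc w -> unit_disc x ->
  t * xi^*%C * ((1 - z^*%C * w) / (1 - z * w^*%C)) *
    mobius (xi * mobius z w) (xi * mobius z x) = t * mobius w x.
Proof.
move=> xi1 z1 w1 x1.
have h1 := denom_neq0 z1 x1; have h2 := denom_neq0 z1 w1; have h3 := denom_neq0 w1 x1.
have h2' : 1 - z * w^*%C != 0 by rewrite -conjc_eq0 conjcB conjcM conjcK conjc1.
have z0 : 1 - z * z^*%C != 0.
  rewrite -one_sub_sqr_complex; apply/eqP => /(congr1 (@complex.Re R))/= /eqP.
  by rewrite gt_eqF// sub_sqr_normc_gt0.
have e : xi * xi^*%C = 1 by rewrite mul_conjc xi1 expr1n.
have := mobius_mobius_denom xi1 z1 w1 x1; rewrite one_sub_sqr_complex => E.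
rewrite [in LHS]mobiusE.
have -> : 1 - (xi * mobius z w)^*%C * (xi * mobius z x) =
    (1 - z * z^*%C) * (1 - z * w^*%C)^-1 * (1 - w^*%C * x) / (1 - z^*%C * x).
  by rewrite -E mulfK.
rewrite -mulrBr !mobiusE.
transitivity (t * (xi * xi^*%C) * ((x - w) / (1 - w^*%C * x))); last by rewrite e mulr1.
by field; rewrite h1 h2 h3 h2' z0.
Qed.

(** The unimodular cocycle by which U, for non-integer alpha, fails to be multiplicative. *)
Definition phase z w := (normc (1 - z * w^*%C) `^ s)%:C / (cpow (1 - z * w^*%C) s)^*%C.

Lemma one_subC_gt0 z w : unit_disc z -> unit_disc w -> 0 < complex.Re (1 - z * w^*%C).
Proof.
by move=> z1 w1; apply: Re1B_gt0; rewrite mulrC; exact: normc_conjM_lt1.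
Qed.

Lemma normc_phase z w : unit_disc z -> unit_disc w -> normc (phase z w) = 1.
Proof.
move=> z1 w1; have h := one_subC_gt0 z1 w1; have h0 := Re_gt0_neq0 h.
rewrite /phase normcM normcV normc_conj normc_cpow normc_real ger0_norm ?powR_ge0//.
by rewrite divff// gt_eqF// powR_gt0// normc_gt0.
Qed.

Definition translate xi z w := xi * mobius z w.

(** The rotation of the window left over when t phi_w is factored through xi phi_z by
    [mobius_mobius]. *)
Definition twist xi z t w := t * xi^*%C * ((1 - z^*%C * w) / (1 - z * w^*%C)).

Lemma translate_disc xi z w : normc xi = 1 -> unit_disc z -> unit_disc w ->
  unit_disc (translate xi z w).
Proof.
by move=> xi1 z1 w1; rewrite /unit_disc/= /translate normcM xi1 mul1r; exact: mobius_disc.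
Qed.

Lemma normc_twist xi z t w : normc xi = 1 -> normc t = 1 -> unit_disc z -> unit_disc w ->
  normc (twist xi z t w) = 1.
Proof.
move=> xi1 t1 z1 w1; rewrite /twist !normcM normc_conj xi1 t1 !mul1r normcV.
have -> : normc (1 - z * w^*%C) = normc (1 - z^*%C * w).
  by rewrite -[RHS]normc_conj conjcB conjcM conjcK conjc1.
by rewrite divff// normc_eq0 denom_neq0.
Qed.

Lemma emb_mul_conj u v p :
  emb u p * (emb v p)^*%C = cut u (c p) * (cut v (c p))^*%C * (bergman_weight alpha (c p))%:C.
Proof.
rewrite /emb conjcM conjc_real mulrACA -rmorphM.
by rewrite -expr2 sqr_sqrtr// bergman_weight_ge0.
Qed.

(** Covariance before integration. The four principal powers are compared by [cpow_mul4], and what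
    remains is the constant [phase z w]; outside the disc both sides vanish. *)
Lemma emb_U_covariance u v xi t z w p : normc xi = 1 -> normc t = 1 ->
  unit_disc z -> unit_disc w ->
  emb (U z (rotate xi u)) p * (emb (U w (rotate t v)) p)^*%C =
  let q := pr (xi * mobius z (c p)) in
  phase z w * (emb u q * (emb (U (translate xi z w) (rotate (twist xi z t w) v)) q)^*%C
               * (mobius_jacobian z (c p))%:C).
Proof.
move=> xi1 t1 z1 w1 /=; apply: etrans (emb_mul_conj _ _ p) _; apply: esym.
apply: etrans (congr1 (fun x => _ * (x * _)) (emb_mul_conj u _ _)) _; apply: esym.
rewrite (pair_of_complexK (xi * mobius z (c p))) /cut.
have nq : normc (xi * mobius z (c p)) = normc (mobius z (c p)) by rewrite normcM xi1 mul1r.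
rewrite nq; case: ifPn => p1; last first.
  have [->|h] := jacobian_out z1 p1; first by rewrite !mulr0 !mul0r.
  by rewrite (negPf h) !mul0r mulr0.
have m1 : normc (mobius z (c p)) < 1 := mobius_disc z1 p1.
rewrite m1; set x := c p in p1 m1 nq *.
have wE : bergman_weight alpha (xi * mobius z x) = bergman_weight alpha (mobius z x).
  by rewrite /bergman_weight nq.
have w'1 := translate_disc xi1 z1 w1.
have q1 : unit_disc (xi * mobius z x) by rewrite /unit_disc/= nq.
have z0 := sub_sqr_normc_gt0 z1; have w0 := sub_sqr_normc_gt0 w1.
rewrite !U_E /rotate.
have -> : twist xi z t w * mobius (translate xi z w) (xi * mobius z x) = t * mobius w x.
  exact: mobius_mobius.
rewrite wE.
have Rd : 0 < complex.Re (1 - z^*%C * x) by apply: Re1B_gt0; exact: normc_conjM_lt1.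
have Re_ : 0 < complex.Re (1 - w^*%C * x) by apply: Re1B_gt0; exact: normc_conjM_lt1.
have Rg := one_subC_gt0 z1 w1.
have Rh : 0 < complex.Re (1 - (translate xi z w)^*%C * (xi * mobius z x)).
  by apply: Re1B_gt0; exact: normc_conjM_lt1.
have E := mobius_mobius_denom xi1 z1 w1 p1.
have Rgi := Re_inv_gt0 Rg.
have := cpow_mul4 s Rh Rd (Re_mulr_gt0 z0 Rgi) Re_ E.
rewrite cpow_realM// cpowV//.
have A' : (1 - normc (translate xi z w) ^+ 2) `^ (s / 2) =
    (1 - normc z ^+ 2) `^ (s / 2) * (1 - normc w ^+ 2) `^ (s / 2) / normc (1 - z * w^*%C) `^ s.
  have g0 : 0 < normc (1 - z * w^*%C) by rewrite normc_gt0 Re_gt0_neq0.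
  have gE : normc (1 - z^*%C * w) = normc (1 - z * w^*%C).
    by rewrite -[LHS]normc_conj conjcB conjcM conjcK conjc1.
  rewrite /translate normcM xi1 mul1r one_sub_normc_mobius ?denom_neq0// gE.
  rewrite powRM ?mulr_ge0 ?invr_ge0 ?sqr_ge0 ?ltW// powRM ?ltW//; congr (_ * _).
  rewrite powRV ?exprn_gt0//; congr (_^-1).
  by rewrite powR_sqr// powR_half_sqr// ltW.
rewrite A' real_complex_mul_div /phase.
have -> : forall a b k : R[i], k * (a * b * (bergman_weight alpha (mobius z x))%:C *
  (mobius_jacobian z x)%:C) =
    k * (a * b * ((bergman_weight alpha x)%:C * (((1 - normc z ^+ 2) `^ s)%:C /
      (cpow (1 - z^*%C * x) s * (cpow (1 - z^*%C * x) s)^*%C)))).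
  move=> a b k; congr (_ * _); rewrite -mulrA; congr (_ * _).
  by rewrite mul_conjc normc_cpow -rmorphM bergman_weight_mobius// rmorphM fmorph_div.
have := cpow_neq0 s Rd; have := cpow_neq0 s Re_; have := cpow_neq0 s Rg; have := cpow_neq0 s Rh.
have : ((1 - normc z ^+ 2) `^ s)%:C != 0 :> R[i].
  by rewrite eq_complex/= eqxx andbT gt_eqF// powR_gt0.
have : (normc (1 - z * w^*%C) `^ s)%:C != 0 :> R[i].
  by rewrite eq_complex/= eqxx andbT gt_eqF// powR_gt0// normc_gt0 Re_gt0_neq0.
move: (cpow (1 - z^*%C * x) s) (cpow (1 - w^*%C * x) s) (cpow (1 - z * w^*%C) s)
  (cpow (1 - (translate xi z w)^*%C * (xi * mobius z x)) s).
move: (v (t * mobius w x)) (u (xi * mobius z x)) (bergman_weight alpha x).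
move: ((1 - normc z ^+ 2) `^ s) (normc (1 - z * w^*%C) `^ s).
move: ((1 - normc z ^+ 2) `^ (s / 2)) ((1 - normc w ^+ 2) `^ (s / 2)).
move=> az aw N G b a wt d e g h G0 N0 h0 g0 e0 d0 /(congr1 (@conjc R)).
rewrite -conjc_eq0 in h0; rewrite -conjc_eq0 in g0; rewrite -conjc_eq0 in e0.
have d0' := d0; rewrite -conjc_eq0 in d0'.
rewrite !(conjcM, conjc_inv, conjc_real) => hE.
have -> : h^*%C = N%:C / g^*%C * e^*%C / d^*%C by rewrite -hE mulfK.
move: (d^*%C) (e^*%C) (g^*%C) (b^*%C) d0' e0 g0 {hE h0} => d' e' g' b' d'0 e'0 g'0.
move: (N%:C)%C (G%:C)%C (az%:C)%C (aw%:C)%C (wt%:C)%C N0 G0 => {}N {}G {}az {}aw {}wt N0 G0.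
by field; rewrite d0 e'0 g'0 d'0 N0 G0.
Qed.

End bergman_translation.

(** * Measurability of translates and covariance of inner products *)

Section bergman_translation_measurability.
Variables (R : realType) (alpha : R).
Hypothesis alpha0 : 0 <= alpha.
Implicit Types (u v : R[i] -> R[i]) (p : R * R).
Local Notation c := (@complex_of_pair R).
Local Notation pr := (@pair_of_complex R).
Local Notation area := (@area R).
Local Notation emb := (emb alpha).
Local Notation U := (U alpha).
Local Notation s := (2 + alpha).

(** A substitute for [cpow] that is measurable on the whole plane and equal to it on the right
    half-plane. *)
Let cpow_atan (w : R[i]) : R[i] :=
  (normc w `^ s)%:C * expi (s * atan (complex.Im w / complex.Re w)).

Let cpow_atanE w : 0 < complex.Re w -> cpow_atan w = cpow w s.
Proof. by move=> w0; rewrite /cpow Arg_atan. Qed.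

Let Cmeasurable_cpow_atan d (T : measurableType d) (f : T -> R[i]) :
  Cmeasurable_fun setT f -> Cmeasurable_fun setT (fun x => cpow_atan (f x)).
Proof.
move=> mf; apply: CmeasurableM.
  apply: Cmeasurable_real.
  apply: (@measurableT_comp _ _ _ _ _ _ (@powR R ^~ s)); first exact: measurable_powR.
  exact: measurable_normc.
apply: (Cmeasurable_precomp (Cmeasurable_expi R)); apply: measurable_funM => //.
apply: measurableT_comp.
  by apply: continuous_measurable_fun; exact: continuous_atan.
apply: measurable_funM; first exact: mf.2.
by apply: (measurableT_comp (@measurable_invr R)); exact: mf.1.
Qed.

Lemma Cmeasurable_U d (T : measurableType d) u (z xi y : T -> R[i]) :
  disc_measurable u -> Cmeasurable_fun setT z -> Cmeasurable_fun setT xi ->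
  Cmeasurable_fun setT y -> (forall x, unit_disc (z x)) -> (forall x, normc (xi x) = 1) ->
  Cmeasurable_fun setT (fun x => cut (U (z x) (rotate (xi x) u)) (y x)).
Proof.
move=> mu mz mxi my z1 xi1.
pose G x := cut u (xi x * mobius (z x) (y x)) * ((1 - normc (z x) ^+ 2) `^ (s / 2))%:C
  / cpow_atan (1 - (z x)^*%C * y x).
have mG : Cmeasurable_fun setT G.
  apply: Cmeasurable_div; first apply: CmeasurableM.
  - apply: (Cmeasurable_comp mu); apply: CmeasurableM => //; exact: Cmeasurable_mobius.
  - apply: Cmeasurable_real.
    apply: (@measurableT_comp _ _ _ _ _ _ (@powR R ^~ (s / 2))); first exact: measurable_powR.
    by apply: measurable_funB => //; exact: measurable_normc_sqr.
  - apply: Cmeasurable_cpow_atan; apply: CmeasurableB; first exact: Cmeasurable_cst.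
    by apply: CmeasurableM => //; exact: Cmeasurable_conj.
rewrite (_ : (fun x => _) = fun x => if normc (y x) < 1 then G x else 0); last first.
  apply/funext => x; rewrite /cut; case: ifP => // y1.
  have d1 := normc_conjM_lt1 (z1 x) y1.
  rewrite U_E /G cpow_atanE; last exact: Re1B_gt0.
  by rewrite /cut /rotate normcM xi1 mul1r (mobius_disc (z1 x) y1).
apply: (@Cmeasurable_if _ _ _ (y @^-1` [set w | normc w < 1])) => //.
have := measurable_normc my => mny.
rewrite (_ : _ @^-1` _ = (fun x => normc (y x)) @^-1` `]-oo, 1[%classic).
  by rewrite -[X in measurable X]setTI; exact: mny.
by apply/seteqP; split => x /=; rewrite in_itv.
Qed.

Lemma disc_measurable_U u z xi : disc_measurable u -> unit_disc z -> normc xi = 1 ->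
  disc_measurable (U z (rotate xi u)).
Proof.
move=> mu z1 xi1.
apply: (@Cmeasurable_U _ _ u (fun=> z) (fun=> xi) c) => //; try exact: Cmeasurable_cst.
exact: Cmeasurable_of_pair.
Qed.

Lemma rotate1 u : rotate 1 u = u.
Proof. by apply/funext => x; rewrite /rotate mul1r. Qed.

Lemma disc_measurable_rotate u xi : disc_measurable u -> normc xi = 1 ->
  disc_measurable (rotate xi u).
Proof.
move=> mu xi1; rewrite /disc_measurable.
rewrite (_ : _ \o _ = (cut u \o (fun p => xi * c p))).
  apply: (Cmeasurable_comp mu); apply: CmeasurableM; first exact: Cmeasurable_cst.
  exact: Cmeasurable_of_pair.
by apply/funext => p; rewrite /= /cut normcM xi1 mul1r.
Qed.

Lemma sq_U u z xi : disc_measurable u -> unit_disc z -> normc xi = 1 ->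
  sq area (emb (U z (rotate xi u))) = sq area (emb u).
Proof.
move=> mu z1 xi1; rewrite sq_emb_U// ?sq_emb_rotate//.
exact: disc_measurable_rotate.
Qed.

Lemma L2_U u z xi : disc_measurable u -> unit_disc z -> normc xi = 1 ->
  L2 area (emb u) -> L2 area (emb (U z (rotate xi u))).
Proof.
move=> mu z1 xi1 [_ uoo]; split; last by rewrite sq_U.
by apply: Cmeasurable_emb; exact: disc_measurable_U.
Qed.

Lemma area_cv_translate xi z : normc xi = 1 -> unit_disc z ->
  area_cv (fun p => pr (xi * mobius z (c p))) (fun p => mobius_jacobian z (c p)).
Proof.
move=> xi1 z1; have xi0 : xi != 0 by rewrite -normc_eq0 xi1 oner_eq0.
have := area_cv_comp (area_cv_mobius z1) (area_cv_mul xi0); apply: area_cv_ext => p /=.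
  by rewrite (pair_of_complexK (mobius z (c p))).
by rewrite xi1 expr1n mul1r.
Qed.

Lemma bergman_inner_U u v xi t z w :
  disc_measurable u -> disc_measurable v -> L2 area (emb u) -> L2 area (emb v) ->
  normc xi = 1 -> normc t = 1 -> unit_disc z -> unit_disc w ->
  normc (bergman_inner alpha (U z (rotate xi u)) (U w (rotate t v))) =
  normc (bergman_inner alpha u (U (translate xi z w) (rotate (twist xi z t w) v))).
Proof.
move=> mu mv Lu Lv xi1 t1 z1 w1; rewrite (bergman_innerE alpha0 (U z _)) (bergman_innerE alpha0 u).
have w'1 := translate_disc xi1 z1 w1; have t'1 := normc_twist xi1 t1 z1 w1.
have k1 := normc_phase alpha z1 w1.
have LU1 := L2_U mu z1 xi1 Lu; have LU2 := L2_U mv w1 t1 Lv; have LU3 := L2_U mv w'1 t'1 Lv.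
pose g p := emb u p * (emb (U (translate xi z w) (rotate (twist xi z t w) v)) p)^*%C.
pose F p := g (pr (xi * mobius z (c p))) * (mobius_jacobian z (c p))%:C.
have E p : emb (U z (rotate xi u)) p * (emb (U w (rotate t v)) p)^*%C = phase alpha z w * F p.
  exact: emb_U_covariance.
have k0 : phase alpha z w != 0 by rewrite -normc_eq0 k1 oner_eq0.
(* Integrability after the substitution is obtained by dividing the phase out of an integrable
   product. *)
have IF : Cintegrable area F.
  rewrite (_ : F = fun p => (phase alpha z w)^-1 *
      (emb (U z (rotate xi u)) p * (emb (U w (rotate t v)) p)^*%C)).
    by apply: CintegrableZ; exact: ip_integrable.
  by apply/funext => p; rewrite E mulKf.
transitivity (normc (phase alpha z w * Cintegral area setT F)).
  by rewrite -CintegralZ//; congr normc; exact: eq_Cintegral.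
rewrite normcM k1 mul1r; congr normc.
apply: (area_cv_Cintegral (area_cv_translate xi1 z1)).
by apply: CmeasurableM; [exact: Lu.1|apply: Cmeasurable_conj; exact: LU3.1].
Qed.

Lemma measurable_Rintegral_area d (X : measurableType d) (f : X * (R * R) -> R) :
  measurable_fun setT f -> measurable_fun setT (fun x => \int[area]_p f (x, p)).
Proof.
move=> mf; have mf' : measurable_fun setT (EFin \o f) by exact/measurable_EFinP.
rewrite (_ : (fun x => _) = fun x => fine (\int[area]_p ((EFin \o f)^\+%E (x, p)) -
    \int[area]_p ((EFin \o f)^\-%E (x, p)))); last first.
  apply/funext => x; rewrite /Rintegral integralE; congr fine; congr (_ - _)%E.
    by apply: eq_integral => p _; rewrite !funeposE.
  by apply: eq_integral => p _; rewrite !funenegE.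
apply: (measurableT_comp (fine_measurable measurableT)) => //.
apply: emeasurable_funB.
  apply: (@measurable_fun_fubini_tonelli_F _ _ _ _ _ area) => //.
  exact: measurable_funepos.
apply: (@measurable_fun_fubini_tonelli_F _ _ _ _ _ area) => //.
exact: measurable_funeneg.
Qed.

End bergman_translation_measurability.

(** * Fatou's lemma and Bessel's inequality *)

Section fatou_bessel.
Context d (T : measurableType d) (R : realType) (mu : {measure set T -> \bar R}).
Local Open Scope ereal_scope.

Lemma fatou_le (f : nat -> T -> R) (g : T -> R) (C : \bar R) N0 :
  (forall n, measurable_fun setT (f n)) -> (forall n x, 0 <= f n x)%R ->
  (forall x (e : R), (0 < e)%R -> exists N : nat, forall n, (N <= n)%N -> (`|f n x - g x| < e)%R) ->
  (forall n, (N0 <= n)%N -> \int[mu]_x (f n x)%:E <= C) -> \int[mu]_x (g x)%:E <= C.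
Proof.
move=> mf f0 fg fC; pose h n x := (f (n + N0)%N x)%:E.
have mh n : measurable_fun setT (h n) by apply/measurable_EFinP; exact: mf.
have h0 n x : setT x -> 0 <= h n x by rewrite lee_fin.
have hg x : limn_einf (h^~ x) = (g x)%:E.
  have hx : h^~ x @ \oo --> (g x)%:E.
    apply: cvg_EFin; first by apply: nearW => n.
    apply/cvgrPdist_lt => e e0; have [N NP] := fg x e e0.
    exists N => // n /= Nn; rewrite distrC; apply: NP.
    by rewrite (leq_trans Nn)// leq_addr.
  rewrite is_cvg_limn_einfE; first exact/cvg_lim.
  by apply/cvg_ex; exists (g x)%:E.
have := fatou mu measurableT mh h0; under eq_integral do rewrite hg.
move=> /le_trans; apply; rewrite limn_einf_lim; apply: lime_le.
  exact: is_cvg_einfs.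
apply: nearW => n; apply: (@le_trans _ _ (\int[mu]_x h n x)).
  by apply: ereal_inf_lbound; exists n => /=.
by apply: fC; rewrite leq_addl.
Qed.

Lemma sq_fatou (F : nat -> T -> R[i]) (G : T -> R[i]) (C : \bar R) N0 :
  (forall n, Cmeasurable_fun setT (F n)) -> (forall x, cvgC (F^~ x) (G x)) ->
  (forall n, (N0 <= n)%N -> sq mu (F n) <= C) -> sq mu G <= C.
Proof.
move=> mF FG FC; apply: (@fatou_le (fun n x => normc (F n x) ^+ 2)%R _ _ N0) => //.
- by move=> n; exact: measurable_normc_sqr.
- by move=> n x; exact: sqr_ge0.
move=> x e e0; pose b := normc (G x).
have b0 : (0 <= b)%R := normc_ge0 _.
pose t := Num.min 1%R (e / (2 * b + 1))%R.
have t0 : (0 < t)%R by rewrite lt_min ltr01 divr_gt0// ltr_wpDl// mulr_ge0.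
have [N NP] := FG x t t0; exists N => n /NP h.
have h1 := ler_dist_normc (F n x) (G x).
have a0 := normc_ge0 (F n x).
have {h} : (`|normc (F n x) - b| < t)%R by exact: le_lt_trans h1 h.
rewrite lt_min => /andP[h2 h3].
rewrite subr_sqr normrM [X in (_ * X)%R]ger0_norm ?addr_ge0//.
have c0 : (0 < 2 * b + 1)%R by rewrite ltr_wpDl// mulr_ge0.
rewrite ltr_pdivlMr// in h3; apply: le_lt_trans h3; apply: ler_wpM2l => //.
move: h2; rewrite ltr_norml => /andP[_ h2]; rewrite /b in h2 *.
by move: (normc (F n x)) (normc (G x)) h2 => x1 x2 h2; lra.
Qed.

(** Orthogonality is assumed on the truncations W j, which have finite measure and on which the
    series converges uniformly to F, hence in L^2. Fatou's lemma then removes the truncation. *)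
Lemma bessel (g : nat -> T -> R[i]) (F : T -> R[i]) (W : nat -> T -> bool) M :
  (forall k, Cmeasurable_fun setT (g k)) -> Cmeasurable_fun setT F ->
  (forall j, measurable_fun setT (W j)) ->
  (forall j, mu [set x | W j x] < +oo) ->
  (forall x, exists j : nat, forall i, (j <= i)%N -> W i x) ->
  (forall j n, (0 < n)%N -> sq mu (fun x => \sum_(k < n) if W j x then g k x else 0)%R =
      \sum_(k < n) sq mu (fun x => if W j x then g k x else 0%R)) ->
  (forall j (e : R), (0 < e)%R -> exists N : nat, forall n x, (N <= n)%N -> W j x ->
     (normc (F x - \sum_(k < n) g k x) <= e)%R) ->
  \sum_(k < M) sq mu (g k) <= sq mu F.
Proof.
move=> mg mF mW Woo Wx PW unif.
have mset j : measurable [set x | W j x].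
  by rewrite (_ : [set x | W j x] = W j @^-1` [set true])// -[X in measurable X]setTI; exact: mW.
have mif (G : T -> R[i]) j : Cmeasurable_fun setT G ->
    Cmeasurable_fun setT (fun x => if W j x then G x else 0%R).
  move=> [G1 G2]; split.
    rewrite (_ : (fun x => _) = fun x => if W j x then complex.Re (G x) else 0%R).
      exact: measurable_fun_ifT.
    by apply/funext => x; case: ifP.
  rewrite (_ : (fun x => _) = fun x => if W j x then complex.Im (G x) else 0%R).
    exact: measurable_fun_ifT.
  by apply/funext => x; case: ifP.
have [Foo|] := ltP (sq mu F) +oo; last by rewrite leye_eq => /eqP ->; rewrite leey.
have Ffin : sq mu F = (fine (sq mu F))%:E by rewrite fineK// ge0_fin_numE// sq_ge0.
set B := fine (sq mu F) in Ffin.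
have B0 : (0 <= B)%R by rewrite -lee_fin -Ffin sq_ge0.
have step j : \sum_(k < M) sq mu (fun x => if W j x then g k x else 0%R) <= B%:E.
  apply/lee_addgt0Pr => e e0.
  pose m := fine (mu [set x | W j x]).
  have mE : mu [set x | W j x] = m%:E by rewrite fineK// ge0_fin_numE.
  have m0 : (0 <= m)%R by rewrite -lee_fin -mE.
  pose eta := (e / (B + 1))%R; have eta0 : (0 < eta)%R by rewrite divr_gt0// ltr_wpDl.
  (* Chosen so that the error term (1 + 1/eta) t^2 m of [sqD] is at most eta. *)
  pose t := Num.sqrt (eta / ((1 + eta^-1) * m + 1))%R.
  have q0 : (0 < 1 + eta^-1)%R by rewrite addr_gt0// invr_gt0.
  have d0 : (0 < (1 + eta^-1) * m + 1)%R by rewrite ltr_wpDl// mulr_ge0// ltW.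
  have t0 : (0 < t)%R by rewrite sqrtr_gt0 divr_gt0.
  have [N NP] := unif j t t0; pose n := maxn M N.+1.
  have n0 : (0 < n)%N by rewrite (leq_trans _ (leq_maxr _ _)).
  apply: (@le_trans _ _ (\sum_(k < n) sq mu (fun x => if W j x then g k x else 0%R))).
    rewrite -!(big_mkord xpredT (fun k => sq mu (fun x => if W j x then g k x else 0%R))).
    rewrite [leRHS](@big_cat_nat _ _ _ M)//=; last exact: leq_maxl.
    by rewrite leeDl//; apply: sume_ge0 => k _; exact: sq_ge0.
  rewrite -PW//.
  pose P x := (if W j x then F x else 0)%R.
  pose D x := (if W j x then \sum_(k < n) g k x - F x else 0)%R.
  have mP : Cmeasurable_fun setT P by exact: mif.
  have mD : Cmeasurable_fun setT D.
    by apply: mif; apply: CmeasurableB => //; exact: Cmeasurable_sum.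
  have -> : (fun x => \sum_(k < n) if W j x then g k x else 0)%R = (fun x => P x + D x)%R.
    apply/funext => x; rewrite /P /D; case: ifP => _; last by rewrite big1// addr0.
    by rewrite addrC subrK.
  apply: le_trans (sqD mu eta0 mP mD) _.
  have PB : sq mu P <= B%:E.
    rewrite -Ffin; apply: sq_le => // x; rewrite /P; case: ifP => // _.
    by rewrite normc0 normc_ge0.
  have DB : sq mu D <= (t ^+ 2 * m)%:E.
    apply: (@le_trans _ _ (\int[mu]_(x in [set x | W j x]) (t ^+ 2)%:E)); last first.
      by rewrite integral_cst// mE EFinM.
    rewrite /sq [leRHS]integral_mkcond; apply: ge0_le_integral => //.
    - by move=> x _; rewrite lee_fin sqr_ge0.
    - exact: measurable_normc_sqrE.
    - by apply/(measurable_restrictT _ _).1 => //; exact: measurable_cst.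
    move=> x _; rewrite patchE /D.
    have -> : (x \in [set x | W j x]) = W j x by apply/idP/idP; rewrite inE.
    case: ifP => Wjx; last by rewrite normc0 expr0n.
    rewrite lee_fin lerXn2r ?nnegrE ?normc_ge0 ?(ltW t0)// normcB; apply: NP => //.
    by rewrite (leq_trans _ (leq_maxr _ _)).
  apply: (@le_trans _ _ ((1 + eta)%:E * B%:E + (1 + eta^-1)%:E * (t ^+ 2 * m)%:E)).
    by apply: leeD; apply: lee_wpmul2l => //; rewrite lee_fin ltW// addr_gt0.
  rewrite -!EFinM -!EFinD lee_fin.
  have tE : (t ^+ 2 = eta / ((1 + eta^-1) * m + 1))%R by rewrite sqr_sqrtr// ltW// divr_gt0.
  have h1 : ((1 + eta^-1) * (t ^+ 2 * m) <= eta)%R.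
    rewrite tE; move: (1 + eta^-1)%R d0 => Q d0.
    have -> : (Q * (eta / (Q * m + 1) * m) = eta * (Q * m / (Q * m + 1)))%R by ring.
    apply: ler_piMr; first exact: ltW.
    by rewrite ler_pdivrMr// mul1r lerDl.
  have h2 : (eta * (B + 1) = e)%R by rewrite divfK// gt_eqF// ltr_wpDl.
  by move: h1 h2; move: ((1 + eta^-1) * (t ^+ 2 * m))%R => y h1 h2; nra.
rewrite /sq -ge0_integral_sum//; last 2 first.
- by move=> k; exact: measurable_normc_sqrE.
- by move=> k x _; rewrite lee_fin sqr_ge0.
under eq_integral do rewrite sumEFin.
rewrite -[leRHS]/(sq mu F) Ffin.
apply: (@fatou_le (fun j x => \sum_(k < M) normc (if W j x then g k x else 0) ^+ 2)%R _ _ 0%N).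
- by move=> j; apply: measurable_sum => k; apply: measurable_normc_sqr; exact: mif.
- by move=> j x; apply: sumr_ge0 => k _; exact: sqr_ge0.
- move=> x e e0; have [j jP] := Wx x; exists j => n /jP ->.
  by rewrite subrr normr0.
move=> j _; apply: le_trans (step j); rewrite /sq -ge0_integral_sum//; last 2 first.
- by move=> k; apply: measurable_normc_sqrE; exact: mif.
- by move=> k x _; rewrite lee_fin sqr_ge0.
by under [leRHS]eq_integral do rewrite sumEFin.
Qed.

End fatou_bessel.

Section uniform_tail.
Variable R : realType.

(** The telescoping estimate of [psum_tail] for an arbitrary ratio r / rho < 1, uniform on |x| <=
    r. *)
Lemma psum_unif_tail (a : nat -> R[i]) (r rho C : R) : 0 <= r < rho ->
  (forall k, normc (a k) * rho ^+ k <= C) ->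
  forall x l m, normc x <= r -> cvgC (psum a x) l ->
  normc (l - psum a x m) <= C / (1 - r / rho) * (r / rho) ^+ m.
Proof.
move=> /andP[r0 rrho] aC x l m xr al; have rho0 : 0 < rho := le_lt_trans r0 rrho.
set q := r / rho; have q0 : 0 <= q by rewrite divr_ge0// ltW.
have q1 : q < 1 by rewrite ltr_pdivrMr// mul1r.
have q1' : 0 < 1 - q by rewrite subr_gt0.
have C0 : 0 <= C by apply: le_trans (aC 0%N); rewrite mulr_ge0 ?exprn_ge0 ?normc_ge0// ltW.
pose K := C / (1 - q); have K0 : 0 <= K by rewrite divr_ge0// ltW.
have bnd d : normc (psum a x (m + d) - psum a x m) <= K * (q ^+ m - q ^+ (m + d)).
  elim: d => [|d ih]; first by rewrite addn0 !subrr normc0 mulr0.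
  rewrite addnS psumS addrAC (le_trans (le_normcD _ _))//.
  have -> : K * (q ^+ m - q ^+ (m + d).+1) = K * (q ^+ m - q ^+ (m + d)) + C * q ^+ (m + d).
    by rewrite exprS /K; field; rewrite gt_eqF.
  apply: lerD => //; rewrite normcM normcX /q expr_div_n mulrA.
  rewrite ler_pdivlMr ?exprn_gt0// mulrAC.
  apply: ler_pM; rewrite ?mulr_ge0 ?exprn_ge0 ?normc_ge0 ?(ltW rho0)//.
  by rewrite lerXn2r ?nnegrE ?normc_ge0.
apply: (@cvgC_le _ (fun n => psum a x n - psum a x m) _ _ m).
  move=> n mn; rewrite -(subnKC mn); apply: le_trans (bnd _) _.
  by apply: ler_wpM2l => //; rewrite gerBl exprn_ge0.
by apply: cvgCD => //; apply: (@cvgC_cst _ _ _ 0%N).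
Qed.

End uniform_tail.

Lemma Cmeasurable_cvgC d (T : measurableType d) (R : realType) (h : nat -> T -> R[i]) f :
  (forall n, Cmeasurable_fun setT (h n)) -> (forall x, cvgC (h ^~ x) (f x)) ->
  Cmeasurable_fun setT f.
Proof.
move=> mh hf; have lim x (pi : R[i] -> R) : (forall z w, `|pi z - pi w| <= normc (z - w)) ->
    (fun n => pi (h n x)) @ \oo --> pi (f x).
  move=> ppi; apply/cvgrPdist_lt => e e0; have [N NP] := hf x e e0.
  by exists N => // n /NP; rewrite distrC; apply: le_lt_trans.
split.
  apply: (@measurable_fun_cvg _ _ _ _ (fun n x => complex.Re (h n x))) => [n|x _];
    first exact: (mh n).1.
  by apply: (lim x (@complex.Re R)) => z w; rewrite -raddfB; exact: le_Re_normc.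
apply: (@measurable_fun_cvg _ _ _ _ (fun n x => complex.Im (h n x))) => [n|x _];
  first exact: (mh n).2.
by apply: (lim x (@complex.Im R)) => z w; rewrite -raddfB; exact: le_Im_normc.
Qed.

Lemma sum_truncated (M : nmodType) (F G : nat -> M) J n : (J <= n)%N ->
  (forall k, (k < J)%N -> G k = 0) -> (forall k, (J <= k)%N -> G k = F k) ->
  \sum_(k < n) F k = \sum_(k < J) F k + \sum_(k < n) G k.
Proof.
move=> Jn GJ GF; rewrite -!(big_mkord xpredT F) -(big_mkord xpredT G).
rewrite (@big_cat_nat _ _ _ J 0 n xpredT F)//= (@big_cat_nat _ _ _ J 0 n xpredT G)//=;
  congr (_ + _).
rewrite [X in _ = X + _]big_nat [X in _ = X + _]big1 ?add0r => [|k /andP[_ kJ]]; last exact: GJ.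
by rewrite !big_nat; apply: eq_bigr => k /andP[Jk _]; rewrite GF.
Qed.

(** * Norms of power series in the weighted spaces *)

Section bergman_power_series.
Variables (R : realType) (alpha : R).
Hypothesis alpha0 : 0 <= alpha.
Implicit Types (f : R[i] -> R[i]) (a : nat -> R[i]) (p : R * R).
Local Notation c := (@complex_of_pair R).
Local Notation pr := (@pair_of_complex R).
Local Notation area := (@area R).
Local Notation emb := (emb alpha).
Local Notation g := (gam (alpha + 2)).

Lemma emb_psum a n p : emb (fun z => psum a z n) p = \sum_(k < n) a k * emb (@mono R k) p.
Proof.
rewrite (emb_sum alpha n (fun k z => a k * z ^+ k)); apply: eq_bigr => k _.
by rewrite (embZ alpha (a k) (@mono R k)).
Qed.

Let mem k : Cmeasurable_fun setT (emb (@mono R k)) := (L2_mono alpha0 k).1.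

Lemma mono_rotate (w : R[i]) k p : normc w = 1 ->
  emb (@mono R k) (pr (w * c p)) = w ^+ k * emb (@mono R k) p.
Proof.
move=> w1; rewrite /emb pair_of_complexK /cut /bergman_weight normcM w1 mul1r.
by case: ifP => _; rewrite ?mul0r ?mulr0// /mono exprMn mulrA.
Qed.

Lemma parseval_mono a (W : R * R -> bool) n : measurable_fun setT W ->
  (forall w p, normc w = 1 -> W (pr (w * c p)) = W p) -> (0 < n)%N ->
  (sq area (fun p => \sum_(k < n) if W p then a k * emb (@mono R k) p else 0)%R =
   \sum_(k < n) sq area (fun p => if W p then (a k * emb (@mono R k) p)%R else 0%R))%E.
Proof.
move=> mW Wrot n0.
have w1 : normc (expi (2 * pi / n%:R) : R[i]) = 1 := normc_expi _.
have w0 : expi (2 * pi / n%:R) != 0 :> R[i] := expi_neq0 _.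
have [msig _ _ _] := area_cv_mul w0.
apply: (@finite_parseval _ _ _ area n (fun k p => if W p then a k * emb (@mono R k) p else 0)
  (fun p => pr (expi (2 * pi / n%:R) * c p)) (fun=> 1)) => //.
- move=> k; apply: (@Cmeasurable_if _ _ _ (W @^-1` [set true])) => //.
    by rewrite -[X in measurable X]setTI; exact: mW.
  by apply: CmeasurableM; [exact: Cmeasurable_cst|exact: mem].
- by move=> F F0 mF; exact: area_rotate.
- by move=> p; rewrite normc1.
- move=> k p _; rewrite Wrot// mono_rotate// mul1r; case: ifP => _; last by rewrite mulr0.
  ring.
Qed.

Lemma sq_mono_coef (x : R[i]) k :
  sq area (fun p => x * emb (@mono R k) p) = (normc x ^+ 2 / g k)%:E.
Proof.
transitivity ((normc x ^+ 2)%:E * sq area (emb (@mono R k)))%E.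
  by apply: sqZ; exact: mem.
by rewrite sq_mono// EFinM.
Qed.

Lemma sq_psum a n :
  sq area (emb (fun z => psum a z n)) = (\sum_(k < n) normc (a k) ^+ 2 / g k)%:E.
Proof.
rewrite (funext (emb_psum a n)); case: n => [|n].
  rewrite big_ord0 /sq (eq_integral (fun=> 0%E)) ?integral0// => p _.
  by rewrite big_ord0 normc0 expr0n.
have /= := @parseval_mono a (fun=> true) n.+1; rewrite -sumEFin => -> //.
by apply: eq_bigr => k _; exact: sq_mono_coef.
Qed.

Section limit.
Variables (f : R[i] -> R[i]) (a : nat -> R[i]).
Hypothesis af : forall z, normc z < 1 -> cvgC (psum a z) (f z).

Let cut_cvg (z : R[i]) : cvgC (fun n => cut (fun z => psum a z n) z) (cut f z).
Proof.
rewrite /cut; case: ifPn => z1; first exact: af.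
exact: (@cvgC_cst _ _ _ 0%N).
Qed.

Lemma disc_measurable_psum n : disc_measurable (fun z : R[i] => psum a z n).
Proof.
apply: Cmeasurable_cut.
apply: (@Cmeasurable_sum _ _ _ _ n (fun k p => a k * c p ^+ k)) => k.
apply: CmeasurableM; first exact: Cmeasurable_cst.
by apply: CmeasurableX; exact: Cmeasurable_of_pair.
Qed.

Lemma disc_measurable_lim : disc_measurable f.
Proof.
apply: (@Cmeasurable_cvgC _ _ _ (fun n => cut (fun z => psum a z n) \o c)) => [n|p].
  exact: disc_measurable_psum.
exact: cut_cvg.
Qed.

Let emb_cvg p : cvgC (fun n => emb (fun z => psum a z n) p) (emb f p).
Proof.
rewrite /emb (_ : (fun n => _) = (fun n => (Num.sqrt (bergman_weight alpha (c p)))%:C * cut (fun z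
  => psum a z n) (c p))).
  by rewrite mulrC; apply: cvgCZ; exact: cut_cvg.
by apply/funext => n; rewrite mulrC.
Qed.

Lemma bergman_bessel M : ((\sum_(k < M) normc (a k) ^+ 2 / g k)%:E <= sq area (emb f))%E.
Proof.
(* A closed disc inside the unit disc together with a bounded annulus outside it. All embedded
   functions vanish on the annulus; it is added so that the W j exhaust the plane while keeping
   finite area. *)
pose W j p := (normc (c p) <= 1 - j.+1%:R^-1) || (1 <= normc (c p) <= j%:R).
have mn : measurable_fun setT (fun p : R * R => normc (c p)).
  by apply: measurable_normc; exact: Cmeasurable_of_pair.
have mW j : measurable_fun setT (W j).
  apply: measurable_or; first exact: measurable_fun_ler.
  by apply: measurable_and; exact: measurable_fun_ler.
have -> : (\sum_(k < M) normc (a k) ^+ 2 / g k)%:E =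
    (\sum_(k < M) sq area (fun p => (a k * emb (@mono R k) p)%R))%E.
  by rewrite -sumEFin; apply: eq_bigr => k _; rewrite sq_mono_coef.
apply: (@bessel _ _ _ area (fun k p => a k * emb (@mono R k) p) (emb f) W) => //.
- by move=> k; apply: CmeasurableM; [exact: Cmeasurable_cst|exact: mem].
- by apply: Cmeasurable_emb; exact: disc_measurable_lim.
- move=> j; have mset : measurable [set p | W j p].
    rewrite (_ : [set p | W j p] = W j @^-1` [set true])//.
    by rewrite -[X in measurable X]setTI; exact: mW.
  apply: (@le_lt_trans _ _ (area [set p | (normc (c p) ^+ 2 < j.+1%:R ^+ 2)%R])%E).
    apply: le_measure; rewrite ?inE//.
      have mn2 : measurable_fun setT (fun p : R * R => normc (c p) ^+ 2) by exact: measurable_funX.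
      rewrite (_ : [set p | _] = (fun p : R * R =>
        normc (c p) ^+ 2) @^-1` `]-oo, j.+1%:R ^+ 2[%classic).
        by rewrite -[X in measurable X]setTI; exact: mn2.
      by apply/seteqP; split => p /=; rewrite in_itv.
    move=> p /= h; rewrite ltrXn2r ?nnegrE ?normc_ge0//.
    case/orP: h => [h|/andP[_ h]]; last by rewrite (le_lt_trans h)// ltr_nat.
    rewrite (le_lt_trans h)// (@lt_le_trans _ _ 1)// ?ler1n// gtrBl invr_gt0 ltr0n//.
  rewrite area_rho_lt ?exprn_gt0// lte_mul_pinfty// ?lee_fin ?sqr_ge0//.
  exact: area_disc_lty.
- move=> p; have [p1|p1] := ltP (normc (c p)) 1.
    have d0 : 0 < 1 - normc (c p) by rewrite subr_gt0.
    exists (Num.bound (1 - normc (c p))^-1) => j hj; apply/orP; left.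
    rewrite lerBrDl -lerBrDr -[leRHS]invrK lef_pV2 ?posrE ?invr_gt0//.
    rewrite ltW// (lt_le_trans (archi_boundP _)) ?invr_ge0 ?(ltW d0)//.
    by rewrite ler_nat (leq_trans hj).
  exists (Num.bound (normc (c p))) => j hj; apply/orP; right; rewrite p1/= ltW//.
  by rewrite (lt_le_trans (archi_boundP _)) ?normc_ge0// ler_nat.
- move=> j n n0; apply: parseval_mono => // w p w1.
  by rewrite /W pair_of_complexK normcM w1 mul1r.
- move=> j e e0; pose r := 1 - j.+1%:R^-1 : R; pose rho := 1 - j.+2%:R^-1 : R.
  have r0 : 0 <= r by rewrite subr_ge0 invf_le1// ler1n.
  have rrho : r < rho by rewrite ltrD2l ltrN2 ltf_pV2 ?posrE// ltr_nat.
  have rho1 : rho < 1 by rewrite gtrBl invr_gt0.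
  have rho0 := le_lt_trans r0 rrho.
  have nrho : normc (rho%:C : R[i]) = rho by rewrite normc_real ger0_norm// ltW.
  have [|C C0 CP] := psum_term_bounded (@af rho%:C _); first by rewrite nrho.
  rewrite nrho in CP.
  have r01 : 0 <= r < rho by rewrite r0.
  have q01 : 0 <= r / rho < 1 by rewrite (divr_ge0 r0 (ltW rho0))/= ltr_pdivrMr// mul1r.
  pose K := C / (1 - r / rho) * Num.sqrt ((alpha + 1) / pi).
  have [N NP] := @geometric_small _ (r / rho) K e q01 e0.
  exists N => n p Nn /orP[pr'|/andP[p1 _]]; last first.
    have h (u : R[i] -> R[i]) : emb u p = 0 by rewrite /emb /cut ltNge p1/= mul0r.
    by rewrite h sub0r normcN -emb_psum h normc0 ltW.
  have p1 : normc (c p) < 1 by rewrite (le_lt_trans pr')// (lt_trans rrho).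
  rewrite -emb_psum /emb /cut p1 -mulrBl normcM normc_real (ger0_norm (sqrtr_ge0 _)).
  apply: (le_trans _ (ltW (NP n Nn))); rewrite /K mulrAC.
  apply: ler_pM; rewrite ?normc_ge0 ?sqrtr_ge0//; first exact: psum_unif_tail (af p1).
  rewrite ler_sqrt ?divr_ge0 ?pi_ge0 ?addr_ge0// /bergman_weight.
  apply: ler_piMr; first by rewrite divr_ge0 ?pi_ge0 ?addr_ge0.
  rewrite -[leRHS](powRr0 (1 - normc (c p) ^+ 2)) ger_powR//.
  have := normc_ge0 (c p); move: (normc (c p)) p1 => y y1 y0; apply/andP; split; nra.
Qed.

(** f minus its J-th partial sum is the limit of polynomials whose first J coefficients are 0, and
    their squared norms are at most B minus the first J terms. *)
Lemma bergman_fatou (B : R) J :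
  (forall M, \sum_(k < M) normc (a k) ^+ 2 / g k <= B) ->
  (sq area (fun p => (emb f p - emb (fun z => psum a z J) p)%R) <=
   (B - \sum_(k < J) normc (a k) ^+ 2 / g k)%:E)%E.
Proof.
move=> aB.
have E n p : (J <= n)%N -> emb (fun z => psum a z n) p - emb (fun z => psum a z J) p =
    emb (fun z => psum (fun k => if (k < J)%N then 0 else a k) z n) p.
  move=> Jn; rewrite !emb_psum.
  rewrite (@sum_truncated _ (fun k => a k * emb (@mono R k) p)
    (fun k => (if (k < J)%N then 0 else a k) * emb (@mono R k) p) J)//.
  - by rewrite addrC addKr.
  - by move=> k ->; rewrite mul0r.
  - by move=> k; rewrite leqNgt => /negPf ->.
apply: (@sq_fatou _ _ _ area (fun n p => emb (fun z => psum a z n) p - emb (fun z => psum a z J) p)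
  (fun p => emb f p - emb (fun z => psum a z J) p) _ J).
- by move=> n; apply: CmeasurableB; apply: Cmeasurable_emb; exact: disc_measurable_psum.
- move=> p; apply: cvgCD; first exact: emb_cvg.
  exact: (@cvgC_cst _ _ _ 0%N).
move=> n Jn; rewrite (_ : (fun p => _) = emb (fun z => psum (fun k =>
  if (k < J)%N then 0 else a k) z n)); last first.
  by apply/funext => p; exact: E.
rewrite sq_psum lee_fin lerBrDl; apply: le_trans (aB n).
rewrite [leRHS](@sum_truncated _ (fun k => normc (a k) ^+ 2 / g k)
    (fun k => normc (if (k < J)%N then 0 else a k) ^+ 2 / g k) J)//.
- by move=> k ->; rewrite normc0 expr0n/= mul0r.
- by move=> k; rewrite leqNgt => /negPf ->.
Qed.

Lemma bergman_L2 (B : R) : (forall M, \sum_(k < M) normc (a k) ^+ 2 / g k <= B) ->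
  L2 area (emb f) /\ (sq area (emb f) <= B%:E)%E.
Proof.
move=> /bergman_fatou-/(_ 0%N); rewrite big_ord0 subr0.
rewrite (_ : (fun p => _) = emb f) => [h|].
  split=> //; split; first by apply: Cmeasurable_emb; exact: disc_measurable_lim.
  by rewrite (le_lt_trans h)// ltry.
by apply/funext => p; rewrite emb_psum big_ord0 subr0.
Qed.

End limit.

End bergman_power_series.

(** * The binomial series on the real axis *)

Section gam_series.
Variable R : realType.
Implicit Types (s x : R).

Lemma psum_real (a : nat -> R) x n :
  psum (fun k => (a k)%:C) x%:C n = (\sum_(k < n) a k * x ^+ k)%:C :> R[i].
Proof.
rewrite rmorph_sum; apply: eq_bigr => k _.
by rewrite /= rmorphM rmorphXn.
Qed.

Lemma gam_series s x : 0 < s -> 0 <= x < 1 -> forall e, 0 < e -> exists N : nat,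
  forall n, (N <= n)%N -> `|\sum_(k < n) gam s k * x ^+ k - ((1 - x) `^ s)^-1| < e.
Proof.
move=> s0 /andP[x0 x1] e e0.
have nx : normc (x%:C : R[i]) < 1 by rewrite normc_real ger0_norm.
have [N NP] := binomial_series s0 nx e0; exists N => n /NP.
have -> : cpow (1 - x%:C) s = ((1 - x) `^ s)%:C :> R[i].
  have x10 : 0 < 1 - x by rewrite subr_gt0.
  rewrite (_ : 1 - x%:C = (1 - x)%:C * 1); last by rewrite mulr1 rmorphB.
  by rewrite cpow_realM ?cpow1 ?mulr1//= ltr01.
by rewrite psum_real -fmorphV -rmorphB normc_real.
Qed.

Lemma gam_sum_le s x n : 0 < s -> 0 <= x < 1 ->
  \sum_(k < n) gam s k * x ^+ k <= ((1 - x) `^ s)^-1.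
Proof.
move=> s0 x01; have x0 : 0 <= x by case/andP: x01.
apply/ler_addgt0Pr => e e0; have [N NP] := gam_series s0 x01 e0.
have mono_ m : (n <= m)%N -> \sum_(k < n) gam s k * x ^+ k <= \sum_(k < m) gam s k * x ^+ k.
  move=> nm; rewrite -!(big_mkord xpredT (fun k => gam s k * x ^+ k)).
  rewrite [leRHS](@big_cat_nat _ _ _ n)//= lerDl sumr_ge0// => k _.
  by rewrite mulr_ge0 ?exprn_ge0// ltW// gam_gt0.
apply: le_trans (mono_ _ (leq_maxl n N)) _.
by have := NP _ (leq_maxr n N); rewrite ltr_norml => /andP[_ /ltW]; rewrite lerBlDl addrC.
Qed.

Lemma gam_ge1 s n : 1 <= s -> 1 <= gam s n.
Proof.
move=> s1; elim: n => [|n ih]; first by rewrite gam0.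
rewrite gamS; apply: le_trans ih _; rewrite ler_peMr ?(le_trans _ ih)//.
  by rewrite ltW// gam_gt0// (lt_le_trans _ s1).
by rewrite ler_pdivlMr// mul1r -natr1 addrC lerD2r.
Qed.

(** One term of a series with nonnegative terms; the free x will be the |z|^2 of [qcoef_tail]. *)
Lemma gam_le s x n : 0 < s -> 0 < x < 1 -> gam s n <= x ^- n * ((1 - x) `^ s)^-1.
Proof.
move=> s0 /andP[x0 x1]; rewrite mulrC ler_pdivlMr ?exprn_gt0//.
have x01 : 0 <= x < 1 by rewrite ltW.
apply: le_trans (gam_sum_le n.+1 s0 x01); rewrite big_ord_recr/= lerDr.
by rewrite sumr_ge0// => k _; rewrite mulr_ge0 ?exprn_ge0 ?ltW// gam_gt0.
Qed.

End gam_series.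

(** * Inner products with translated monomials *)

Section matrix_coefficients.
Variables (R : realType) (alpha : R).
Hypothesis alpha0 : 0 <= alpha.
Implicit Types (u v : R[i] -> R[i]) (z w : R[i]) (p : R * R).
Local Notation c := (@complex_of_pair R).
Local Notation pr := (@pair_of_complex R).
Local Notation area := (@area R).
Local Notation emb := (emb alpha).
Local Notation U := (U alpha).
Local Notation g := (gam (alpha + 2)).
Local Notation mono := (@mono R).

Let s0 : 0 < alpha + 2. Proof. by rewrite ltr_wpDl. Qed.

Lemma ip_self d (T : measurableType d) (mu : {measure set T -> \bar R}) (F : T -> R[i]) :
  ip mu F F = (fine (sq mu F))%:C.
Proof.
rewrite /ip /Cintegral; congr (_ +i* _).
  by apply: eq_Rintegral => x _; rewrite mul_conjc.
rewrite (@eq_Rintegral _ _ _ _ _ (fun=> 0)); last by move=> x _; rewrite mul_conjc.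
by rewrite /Rintegral integral0.
Qed.

Lemma ip_rotate u v w : normc w = 1 -> disc_measurable u -> disc_measurable v ->
  ip area (emb (rotate w u)) (emb (rotate w v)) = ip area (emb u) (emb v).
Proof.
move=> w1 mu mv; have w0 : w != 0 by rewrite -normc_eq0 w1 oner_eq0.
pose G p := emb u p * (emb v p)^*%C.
rewrite /ip -[RHS](@area_cv_Cintegral R _ _ G (area_cv_mul w0)); last first.
  by apply: CmeasurableM; [|apply: Cmeasurable_conj]; exact: Cmeasurable_emb.
by apply: eq_Cintegral => p; rewrite /G !emb_rotate// w1 expr1n mulr1.
Qed.

Lemma rotate_mono w n : rotate w (mono n) = fun z => w ^+ n * mono n z.
Proof. by apply/funext => z; rewrite /rotate /mono exprMn. Qed.

(** Rotation by a root of unity of order N > k, n multiplies the inner product by w^k conj(w^n),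
    which differs from 1 if k != n. *)
Lemma ip_mono k n : ip area (emb (mono k)) (emb (mono n)) = (k == n)%:R * ((g n)^-1)%:C.
Proof.
have [->|kn] := eqVneq k n; first by rewrite ip_self sq_mono// mul1r.
pose N := (maxn k n).+1; pose w : R[i] := expi (2 * pi / N%:R).
have pw : N.-primitive_root w by exact: prim_expi.
have w1 : normc w = 1 := normc_expi _.
have := ip_rotate w1 (disc_measurable_mono R k) (disc_measurable_mono R n).
rewrite !rotate_mono !embZ ipZl; [|exact: L2_mono|by apply: L2Z; exact: L2_mono].
rewrite ipZr; [|exact: L2_mono..].
rewrite mulrA => /eqP; rewrite -subr_eq0 -{2}[ip _ _ _]mul1r -mulrBl mulf_eq0 => /orP[|/eqP ->];
  last by rewrite mul0r.
rewrite subr_eq0 => /eqP h; exfalso; move/eqP: kn; apply.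
have wn0 : w ^+ n != 0 by rewrite expf_neq0// expi_neq0.
have h2 : w ^+ k = w ^+ n.
  rewrite -[LHS]mulr1 -(_ : (w ^+ n)^*%C * w ^+ n = 1); first by rewrite mulrA h mul1r.
  by rewrite mulrC mul_conjc normcX w1 !expr1n.
have /eqP := h2; rewrite (eq_prim_root_expr pw) !modn_small => [/eqP//||]; rewrite ltnS.
  exact: leq_maxr.
exact: leq_maxl.
Qed.

Lemma L2_psum (a : nat -> R[i]) M : L2 area (emb (fun z => psum a z M)).
Proof.
rewrite (funext (emb_psum alpha a M)).
by apply: (@L2_sum _ _ _ area M (fun k p => a k * emb (mono k) p)) => k; apply: L2Z; exact: L2_mono.
Qed.

Lemma ip_psum (a : nat -> R[i]) M G : L2 area G ->
  ip area (emb (fun z => psum a z M)) G = \sum_(k < M) a k * ip area (emb (mono k)) G.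
Proof.
move=> LG; rewrite (funext (emb_psum alpha a M)).
exact: (@ip_suml _ _ _ area M a (fun k => emb (mono k)) G (L2_mono alpha0) LG).
Qed.

Section expansion.
Variables (f : R[i] -> R[i]) (a : nat -> R[i]) (B : R).
Hypothesis af : forall z, normc z < 1 -> cvgC (psum a z) (f z).
Hypothesis aB : forall M, \sum_(k < M) normc (a k) ^+ 2 / g k <= B.

Let Lf : L2 area (emb f). Proof. by have [] := bergman_L2 alpha0 af aB. Qed.

(** Uniformity in G matters: G will be a translate U_w v of fixed norm, with w arbitrary in the
    disc. *)
Lemma ip_expansion (C e : R) : 0 < e -> exists N : nat, forall M G, (N <= M)%N ->
  L2 area G -> (sq area G <= C%:E)%E ->
  normc (ip area (emb f) G - \sum_(k < M) a k * ip area (emb (mono k)) G) < e.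
Proof.
move=> e0; pose t M := \sum_(k < M) normc (a k) ^+ 2 / g k.
have t_mono M M' : (M <= M')%N -> t M <= t M'.
  move=> MM'; rewrite /t -!(big_mkord xpredT (fun k => normc (a k) ^+ 2 / g k)).
  rewrite [leRHS](@big_cat_nat _ _ _ M)//= lerDl sumr_ge0// => k _.
  by rewrite divr_ge0 ?sqr_ge0// (ltW (gam_gt0 k s0)).
have hs : has_sup (range t) by split; [exists (t 0%N); exists 0%N|exists B => _ [M _ <-];
  exact: aB].
(* With the supremum S in the role of B, the bound S - t M of [bergman_fatou] tends to 0. *)
pose S := sup (range t).
have tS M : t M <= S by apply: ub_le_sup; [exact: hs.2|exists M].
have LD M : L2 area (fun p => emb f p - emb (fun z => psum a z M) p).
  by apply: L2D => //; apply: L2N; exact: L2_psum.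
have sD M : (sq area (fun p => emb f p - emb (fun z => psum a z M) p)%R <= (S - t M)%:E)%E.
  exact: bergman_fatou.
have lim0 (h : R) : 0 < h -> exists N : nat, forall n, (N <= n)%N -> S - t n < h.
  move=> h0; have [_ [N _ <-] h'] := sup_adherent h0 hs; exists N => n /t_mono NM.
  by rewrite -/S in h'; lra.
have [N NP] := @sq_cvg0_ip _ _ _ area _ _ C LD sD lim0 e e0.
exists N => M G NM LG GC; have := NP M G NM LG GC; congr (normc _ < _).
have LN : L2 area (fun p => -1 * emb (fun z => psum a z M) p) by apply: L2Z; exact: L2_psum.
rewrite -ip_psum// -mulN1r -ipZl//; last exact: L2_psum.
rewrite -(@ipDl _ _ _ area)//.
by congr (ip _ _ _); apply/funext => p; rewrite mulN1r.
Qed.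

Lemma ip_coef n : ip area (emb f) (emb (mono n)) = a n * ((g n)^-1)%:C.
Proof.
have ipP M : (n < M)%N -> \sum_(k < M) a k * ip area (emb (mono k)) (emb (mono n)) =
    a n * ((g n)^-1)%:C.
  move=> nM; rewrite (bigD1 (Ordinal nM))//= [X in _ + X]big1 ?addr0 => [|k kn].
    by rewrite ip_mono eqxx mul1r.
  rewrite ip_mono (_ : (k == n :> nat) = false) ?mul0r ?mulr0//.
  by apply/negbTE; apply: contra kn => /eqP kn; apply/eqP; apply: val_inj.
have Lm := L2_mono alpha0 n.
have sm : (sq area (emb (mono n)) <= ((g n)^-1)%:E)%E by rewrite sq_mono.
apply: (@cvgC_uniq _ (fun=> ip area (emb f) (emb (mono n)))).
  exact: (@cvgC_cst _ _ _ 0%N).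
move=> e e0; have [N NP] := ip_expansion ((g n)^-1) e0.
exists N => M _; have := NP (maxn N n.+1) _ (leq_maxl _ _) Lm sm.
by rewrite ipP// leq_maxr.
Qed.

End expansion.

Lemma U0 u : U 0 u = u.
Proof.
apply/funext => x; rewrite U_E mobiusE conjc0 !mul0r !subr0 divr1.
by rewrite normc0 expr0n/= subr0 powR1 cpow1 mulr1 divr1.
Qed.

(** The adjoint of U_z is U_(-z) up to a phase: covariance at w = 0. *)
Lemma normc_ip_U u v z : disc_measurable u -> disc_measurable v ->
  L2 area (emb u) -> L2 area (emb v) -> unit_disc z ->
  normc (ip area (emb (U z u)) (emb v)) = normc (ip area (emb u) (emb (U (- z) v))).
Proof.
move=> mu mv Lu Lv z1; have d0 : unit_disc (0 : R[i]) by rewrite /unit_disc/= normc0.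
have := bergman_inner_U alpha0 mu mv Lu Lv (normc1 R) (normc1 R) z1 d0.
have -> : translate 1 z 0 = - z.
  by rewrite /translate mobiusE mulr0 subr0 divr1 mul1r sub0r.
have -> : twist 1 z 1 0 = 1.
  by rewrite /twist mulr0 conjc0 mulr0 !subr0 divr1 conjc1 !mulr1.
by rewrite !rotate1 U0 (bergman_innerE alpha0 (U z u) v) (bergman_innerE alpha0 u).
Qed.

(** The Taylor coefficients of U_z 1. *)
Definition translate_coef z (k : nat) : R[i] :=
  ((1 - normc z ^+ 2) `^ ((2 + alpha) / 2))%:C * ((g k)%:C * z^*%C ^+ k).

Lemma U_mono0_series z x : unit_disc z -> normc x < 1 ->
  cvgC (psum (translate_coef z) x) (U z (mono 0) x).
Proof.
move=> z1 x1; have d1 := normc_conjM_lt1 z1 x1.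
have h : cvgC (psum (fun k => (g k)%:C) (z^*%C * x)) (cpow (1 - z^*%C * x) (2 + alpha))^-1.
  by rewrite (addrC 2 alpha); exact: (binomial_series s0 d1).
rewrite U_E /mono expr0 mul1r.
apply: (@cvgC_ext _ (fun n => ((1 - normc z ^+ 2) `^ ((2 + alpha) / 2))%:C *
   psum (fun k => (g k)%:C) (z^*%C * x) n)); last exact: cvgCZ.
move=> n; rewrite /psum mulr_sumr; apply: eq_bigr => k _.
by rewrite /translate_coef exprMn; ring.
Qed.

Lemma normc_translate_coef z k : unit_disc z ->
  normc (translate_coef z k) ^+ 2 / g k =
  (1 - normc z ^+ 2) `^ (2 + alpha) * (g k * (normc z ^+ 2) ^+ k).
Proof.
move=> z1; have z0 := ltW (sub_sqr_normc_gt0 z1); have g0 := gam_gt0 k s0.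
rewrite /translate_coef !normcM normcX normc_conj !normc_real !exprMn.
rewrite (ger0_norm (powR_ge0 _ _)) powR_half_sqr// (gtr0_norm g0).
have -> : (normc z ^+ k) ^+ 2 = (normc z ^+ 2) ^+ k by rewrite -!exprM mulnC.
have -> : normc z ^+ k * normc z ^+ k = (normc z ^+ 2) ^+ k by rewrite -expr2 -!exprM mulnC.
by move: (_ ^+ k) (_ `^ _) => y b; field; rewrite gt_eqF.
Qed.

Lemma normc_sqr_lt1 z : unit_disc z -> 0 <= normc z ^+ 2 < 1.
Proof. by move=> z1; rewrite sqr_ge0/= expr_lt1// normc_ge0. Qed.

Lemma translate_coef_sum z M : unit_disc z ->
  \sum_(k < M) normc (translate_coef z k) ^+ 2 / g k <= 1.
Proof.
move=> z1; have z0 := sub_sqr_normc_gt0 z1.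
under eq_bigr do rewrite normc_translate_coef//.
rewrite -mulr_sumr.
have := gam_sum_le M s0 (normc_sqr_lt1 z1); rewrite addrC.
by rewrite -[X in _ -> _ <= X](divff (lt0r_neq0 (powR_gt0 (2 + alpha) z0))) ler_pM2l ?powR_gt0.
Qed.

(** The translation is moved to the constant function, whose n-th Taylor coefficient [ip_coef] then
    reads off. *)
Lemma normc_ip_mono0 z n : unit_disc z ->
  normc (ip area (emb (mono 0)) (emb (U z (mono n)))) =
  (1 - normc z ^+ 2) `^ ((2 + alpha) / 2) * normc z ^+ n.
Proof.
move=> z1; have z1' : unit_disc (- z) by rewrite /unit_disc/= normcN.
have mm := disc_measurable_mono R; have Lm := L2_mono alpha0.
rewrite -{1}(opprK z) -normc_ip_U//.
rewrite (@ip_coef _ (translate_coef (- z)) 1); last 2 first.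
- by move=> x x1; exact: U_mono0_series.
- by move=> M; exact: translate_coef_sum.
have g0 := gam_gt0 n s0.
rewrite /translate_coef !normcM normcX normc_conj !normc_real normcN.
rewrite ger0_norm ?powR_ge0// !gtr0_norm ?invr_gt0//.
by field; rewrite gt_eqF.
Qed.

End matrix_coefficients.

(** * Matrix coefficients of monomials *)

Section hyperbolic_integrals.
Variable R : realType.
Implicit Types (p : R * R).
Local Notation c := (@complex_of_pair R).
Local Notation pr := (@pair_of_complex R).
Local Notation area := (@area R).
Local Notation hyp := (@hyperbolic_measure R).
Local Open Scope ereal_scope.

Lemma hyperbolic_areaE (F : R * R -> \bar R) : measurable_fun setT F -> (forall p, 0 <= F p) ->
  \int[hyp]_p F p = \int[area]_p (F p * (hyperbolic_density p)%:E).
Proof. by move=> mF F0; exact: ge0_integral_hyperbolic. Qed.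

Lemma hyperbolic_density_out p : ~~ (normc (c p) < 1)%R -> hyperbolic_density p = 0%R.
Proof. by move=> p1; rewrite /hyperbolic_density in_discE (negPf p1). Qed.

Lemma le_hyperbolic (F G : R * R -> \bar R) : measurable_fun setT F -> measurable_fun setT G ->
  (forall p, 0 <= F p) -> (forall p, 0 <= G p) ->
  (forall p, (normc (c p) < 1)%R -> F p <= G p) -> \int[hyp]_p F p <= \int[hyp]_p G p.
Proof.
move=> mF mG F0 G0 FG; rewrite !hyperbolic_areaE//; apply: ge0_le_integral => //.
- by move=> p _; rewrite mule_ge0// lee_fin hyperbolic_density_ge0.
- apply: emeasurable_funM => //; apply/measurable_EFinP; exact: measurable_hyperbolic_density.
- apply: emeasurable_funM => //; apply/measurable_EFinP; exact: measurable_hyperbolic_density.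
move=> p _; have [p1|p1] := boolP (normc (c p) < 1)%R.
  by apply: lee_wpmul2r; [rewrite lee_fin hyperbolic_density_ge0|exact: FG].
by rewrite hyperbolic_density_out// !mule0.
Qed.

Lemma eq_hyperbolic (F G : R * R -> \bar R) : measurable_fun setT F -> measurable_fun setT G ->
  (forall p, 0 <= F p) -> (forall p, 0 <= G p) ->
  (forall p, (normc (c p) < 1)%R -> F p = G p) -> \int[hyp]_p F p = \int[hyp]_p G p.
Proof.
move=> mF mG F0 G0 FG; apply/eqP; rewrite eq_le; apply/andP; split;
  by apply: le_hyperbolic => // p /FG ->.
Qed.

Lemma measurable_disc_cst (K : R) : measurable_fun setT ((fun=> K%:E) \_ (@disc R)).
Proof.
have mc : measurable_fun (@disc R) (fun=> K%:E) by exact: measurable_cst.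
by apply/(measurable_restrictT _ _).1 => //; exact: measurable_disc.
Qed.

(** The exterior of the disc, where the density is 0, is included so that these sets exhaust the
    plane as [bessel] requires. *)
Lemma hyperbolic_ball_lty (r : R) : (0 <= r < 1)%R ->
  hyp [set p | ((normc (c p) <= r) || (1 <= normc (c p)))%R] < +oo.
Proof.
move=> /andP[r0 r1]; have mn : measurable_fun setT (fun p : R * R => normc (c p)).
  by apply: measurable_normc; exact: Cmeasurable_of_pair.
have mset : measurable [set p | ((normc (c p) <= r) || (1 <= normc (c p)))%R].
  rewrite (_ : [set p | _] = (fun p => ((normc (c p) <= r) || (1 <= normc (c p)))%R) @^-1` [set
    true])//.
  rewrite -[X in measurable X]setTI; apply: measurable_or => //; exact: measurable_fun_ler.
pose K := ((pi * (1 - r ^+ 2) ^+ 2)^-1)%R : R.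
have r2 : (0 < 1 - r ^+ 2)%R by rewrite subr_gt0 expr_lt1.
have K0 : (0 <= K)%R by rewrite invr_ge0 mulr_ge0 ?pi_ge0// sqr_ge0.
rewrite /hyperbolic_measure.
apply: (@le_lt_trans _ _ (\int[area]_(p in @disc R) K%:E)).
  rewrite integral_mkcond [leRHS]integral_mkcond; apply: ge0_le_integral => //.
  - by move=> p _; rewrite patchE; case: ifP => // _; rewrite lee_fin hyperbolic_density_ge0.
  - have mh : measurable_fun [set p | ((normc (c p) <= r) || (1 <= normc (c p)))%R]
        (fun p => (hyperbolic_density p)%:E).
      apply: measurable_funTS; apply/measurable_EFinP; exact: measurable_hyperbolic_density.
    exact: ((measurable_restrictT _ mset).1 mh).
  - exact: measurable_disc_cst.
  move=> p _; rewrite !patchE in_discE.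
  have [p1|p1] := boolP (normc (c p) < 1)%R; last first.
    by rewrite hyperbolic_density_out//; case: ifP.
  case: ifP; last by rewrite lee_fin.
  rewrite inE/= [X in _ || X]leNgt p1/= orbF => pr'.
  rewrite lee_fin /hyperbolic_density in_discE p1 /K.
  have q0 := sub_sqr_normc_gt0 (p1 : unit_disc (c p)).
  rewrite lef_pV2 ?posrE ?mulr_gt0 ?pi_gt0 ?exprn_gt0//.
  rewrite ler_pM2l ?pi_gt0// lerXn2r ?nnegrE ?(ltW r2) ?(ltW q0)//.
  by rewrite lerD2l lerN2 lerXn2r ?nnegrE ?normc_ge0.
by rewrite integral_cst//=; [rewrite lte_mul_pinfty// area_disc_lty|exact: measurable_disc].
Qed.

End hyperbolic_integrals.

(** * Matrix coefficients and their integrals over annuli *)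

Section schur.
Variables (R : realType) (alpha : R).
Hypothesis alpha0 : 0 <= alpha.
Implicit Types (u v : R[i] -> R[i]) (z w : R[i]) (p : R * R).
Local Notation c := (@complex_of_pair R).
Local Notation pr := (@pair_of_complex R).
Local Notation area := (@area R).
Local Notation hyp := (@hyperbolic_measure R).
Local Notation emb := (emb alpha).
Local Notation U := (U alpha).
Local Notation g := (gam (alpha + 2)).
Local Notation mono := (@mono R).

Definition coef u v w : R[i] := if normc w < 1 then ip area (emb u) (emb (U w v)) else 0.

Lemma coef_in u v w : normc w < 1 -> coef u v w = ip area (emb u) (emb (U w v)).
Proof. by rewrite /coef => ->. Qed.

Lemma coef_out u v w : ~~ (normc w < 1) -> coef u v w = 0.
Proof. by rewrite /coef => /negPf ->. Qed.

Lemma Cmeasurable_coef d (T : measurableType d) u v (w t : T -> R[i]) :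
  disc_measurable u -> disc_measurable v -> Cmeasurable_fun setT w -> Cmeasurable_fun setT t ->
  (forall x, normc (t x) = 1) -> Cmeasurable_fun setT (fun x => coef u (rotate (t x) v) (w x)).
Proof.
move=> mu mv mw mt t1; have mnw := measurable_normc mw.
have mset : measurable [set x | normc (w x) < 1].
  rewrite (_ : [set x | _] = (fun x => normc (w x)) @^-1` `]-oo, 1[%classic).
    by rewrite -[X in measurable X]setTI; exact: mnw.
  by apply/seteqP; split => x /=; rewrite in_itv.
(* Points outside the disc are moved to 0, so that U is only taken at admissible centres. *)
pose w' x := if normc (w x) < 1 then w x else 0.
have mw' : Cmeasurable_fun setT w' by apply: (Cmeasurable_if mset).
have w'1 x : unit_disc (w' x).
  by rewrite /w' /unit_disc/=; case: ifP => //; rewrite normc0.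
pose Phi (q : T * (R * R)) := emb u q.2 * (emb (U (w' q.1) (rotate (t q.1) v)) q.2)^*%C.
have mPhi : Cmeasurable_fun setT Phi.
  apply: CmeasurableM.
    exact: (Cmeasurable_precomp (Cmeasurable_emb alpha mu) measurable_snd).
  apply: Cmeasurable_conj; apply: CmeasurableM.
    apply: (@Cmeasurable_U R alpha _ _ v (fun q => w' q.1) (fun q => t q.1) (fun q => c q.2)) => //.
    - exact: (Cmeasurable_precomp mw' measurable_fst).
    - exact: (Cmeasurable_precomp mt measurable_fst).
    - exact: (Cmeasurable_precomp (Cmeasurable_of_pair R) measurable_snd).
  apply: Cmeasurable_real; apply: (@measurableT_comp _ _ _ _ _ _ (@Num.sqrt R)).
    by apply: continuous_measurable_fun; exact: sqrt_continuous.
  exact: (measurableT_comp (measurable_bergman_weight alpha) measurable_snd).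
rewrite (_ : (fun x => _) = fun x => if normc (w x) < 1 then Cintegral area setT (fun p =>
  Phi (x, p)) else 0).
  apply: (Cmeasurable_if mset) => //.
  split; [exact: (measurable_Rintegral_area mPhi.1)|exact: (measurable_Rintegral_area mPhi.2)].
apply/funext => x; have [wx|wx] := boolP (normc (w x) < 1); last by rewrite coef_out.
rewrite coef_in//; have e : w x = w' x by rewrite /w' wx.
by rewrite e.
Qed.

Lemma Cmeasurable_coef1 u v : disc_measurable u -> disc_measurable v ->
  Cmeasurable_fun setT (fun p => coef u v (c p)).
Proof.
move=> mu mv; have := @Cmeasurable_coef _ _ u v c (fun=> 1) mu mv (Cmeasurable_of_pair R).
rewrite /= rotate1; apply; first exact: Cmeasurable_cst.
by move=> p; rewrite normc1.
Qed.

Lemma UZ k v w : U w (fun z => k * v z) = fun z => k * U w v z.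
Proof. by apply/funext => z; rewrite /U /Defs.U; rewrite -!mulrA. Qed.

Lemma coef_rotate_mono u n t w : L2 area (emb u) ->
  coef u (rotate t (mono n)) w = t^*%C ^+ n * coef u (mono n) w.
Proof.
move=> Lu; have [w1|w1] := boolP (normc w < 1); last by rewrite !coef_out// mulr0.
rewrite !coef_in// rotate_mono UZ embZ ipZr ?conjcX//.
have /= := @L2_U R alpha alpha0 (mono n) w 1; rewrite rotate1; apply => //.
- exact: disc_measurable_mono.
- exact: normc1.
- exact: L2_mono.
Qed.

Lemma U_rotate_comm v w eta z : normc eta = 1 ->
  U (eta * w) v (eta * z) = U w (rotate eta v) z.
Proof.
move=> e1; have e : eta^*%C * eta = 1 by rewrite mulrC mul_conjc e1 expr1n.
have de : 1 - (eta * w)^*%C * (eta * z) = 1 - w^*%C * z.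
  by rewrite conjcM mulrACA e mul1r.
rewrite !U_E de normcM e1 mul1r /rotate !mobiusE de; congr (v _ * _ / _).
by rewrite -mulrBr mulrA.
Qed.

Lemma coef_rotate k n eta w : normc eta = 1 ->
  coef (mono k) (mono n) (eta * w) = eta^*%C ^+ n * eta ^+ k * coef (mono k) (mono n) w.
Proof.
move=> e1; have ne : normc (eta * w) = normc w by rewrite normcM e1 mul1r.
have [w1|w1] := boolP (normc w < 1); last by rewrite !coef_out ?ne// mulr0.
rewrite !coef_in ?ne//.
have mm := disc_measurable_mono R; have Lm := L2_mono alpha0.
have ew1 : unit_disc (eta * w) by rewrite /unit_disc/= normcM e1 mul1r.
have mU : disc_measurable (U (eta * w) (mono n)).
  by rewrite -(rotate1 (mono n)); apply: disc_measurable_U => //; exact: normc1.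
have LU : L2 area (emb (U w (mono n))).
  by have /= := @L2_U R alpha alpha0 (mono n) w 1; rewrite rotate1; apply => //; exact: normc1.
rewrite -(ip_rotate alpha e1 (mm k) mU).
have -> : rotate eta (U (eta * w) (mono n)) = fun z => eta ^+ n * U w (mono n) z.
  by apply/funext => z; rewrite /rotate U_rotate_comm// rotate_mono UZ.
rewrite rotate_mono !embZ ipZl//; last exact: L2Z.
by rewrite ipZr// conjcX; ring.
Qed.

(** For the monomials z^m and z^n this is q_mn(rho) / (gam_m gam_n), as they are not normalized. *)
Definition qcoef u v (rho : R) : \bar R :=
  \int[hyp]_p (if rho <= normc (c p) then (alpha + 1) * normc (coef u v (c p)) ^+ 2 else 0)%:E.

Lemma measurable_annulus (rho : R) (f : R * R -> R) : measurable_fun setT f ->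
  measurable_fun setT (fun p => (if rho <= normc (c p) then f p else 0)%:E).
Proof.
move=> mf; apply/measurable_EFinP; apply: measurable_fun_ifT => //.
apply: measurable_fun_ler => //; apply: measurable_normc; exact: Cmeasurable_of_pair.
Qed.

Lemma measurable_coef_sqr u v : disc_measurable u -> disc_measurable v ->
  measurable_fun setT (fun p => (alpha + 1) * normc (coef u v (c p)) ^+ 2).
Proof.
move=> mu mv; apply: measurable_funM => //; apply: measurable_normc_sqr.
exact: Cmeasurable_coef1.
Qed.

Lemma qcoef_int_ge0 u v (rho : R) p :
  (0 <= (if (rho <= normc (c p))%R then ((alpha + 1) * normc (coef u v (c p)) ^+ 2)%R else
    0%R)%:E)%E.
Proof. by rewrite lee_fin; case: ifP => // _; rewrite mulr_ge0 ?sqr_ge0// addr_ge0. Qed.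

(** |<1, U_x z^n>|^2 = (1 - |x|^2)^s |x|^(2n), and the hyperbolic density turns the factor (1 -
    |x|^2)^s into the weight of dA_alpha. *)
Lemma qcoef_mono0 n (rho : R) :
  (qcoef (mono 0) (mono n) rho =
   \int[area]_p (if (rho <= normc (c p))%R then (normc (emb (mono n) p) ^+ 2)%R else 0%R)%:E)%E.
Proof.
have mm := disc_measurable_mono R.
rewrite /qcoef hyperbolic_areaE; last 2 first.
- by apply: measurable_annulus; exact: measurable_coef_sqr.
- by move=> p; exact: qcoef_int_ge0.
apply: eq_integral => p _; rewrite -EFinM; congr (_%:E); case: ifP => _; last by rewrite mul0r.
rewrite normc_emb//; have [p1|p1] := boolP (normc (c p) < 1); last first.
  by rewrite hyperbolic_density_out// mulr0 /cut (negPf p1) normc0 expr0n/= mul0r.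
rewrite coef_in// /cut /hyperbolic_density in_discE p1 normc_ip_mono0// exprMn powR_half_sqr;
  last first.
  by rewrite ltW// sub_sqr_normc_gt0.
rewrite powR_2D; last exact: sub_sqr_normc_gt0.
rewrite /bergman_weight /mono normcX.
have := sub_sqr_normc_gt0 p1; move: (1 - normc (c p) ^+ 2) => y y0.
have := pi_gt0 R; move: (pi : R) (_ ^+ n) (y `^ alpha) => b x a b0.
by field; rewrite !gt_eqF.
Qed.

Lemma qcoef_mono0_total n : (qcoef (mono 0) (mono n) 0 = ((g n)^-1)%:E)%E.
Proof.
rewrite qcoef_mono0 -sq_mono//; apply: eq_integral => p _.
by rewrite normc_ge0.
Qed.

Definition tail_const : R := fine (area (@disc R)) / pi.

Lemma tail_const_ge0 : 0 <= tail_const.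
Proof. by rewrite divr_ge0 ?pi_ge0// fine_ge0. Qed.

Lemma qcoef_mono0_tail n (rho : R) : 0 <= rho < 1 ->
  (qcoef (mono 0) (mono n) rho <= (tail_const * ((alpha + 1) * (1 - rho ^+ 2) `^ alpha))%:E)%E.
Proof.
move=> /andP[r0 r1]; rewrite qcoef_mono0.
pose K := (alpha + 1) / pi * (1 - rho ^+ 2) `^ alpha.
have K0 : 0 <= K by rewrite mulr_ge0 ?powR_ge0// divr_ge0 ?pi_ge0// addr_ge0.
apply: (@le_trans _ _ (\int[area]_(p in @disc R) K%:E)%E); last first.
  rewrite integral_cst; last exact: measurable_disc.
  rewrite -[X in (_ * X)%E]fineK; last by rewrite ge0_fin_numE// area_disc_lty.
  rewrite -EFinM lee_fin /K /tail_const le_eqVlt; apply/orP; left; apply/eqP.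
  by have := pi_gt0 R; move: (pi : R) => b b0; field; rewrite gt_eqF.
rewrite [leRHS]integral_mkcond; apply: ge0_le_integral => //.
- by move=> p _; rewrite lee_fin; case: ifP => // _; rewrite sqr_ge0.
- apply: measurable_annulus; apply: measurable_normc_sqr.
  by apply: Cmeasurable_emb; exact: disc_measurable_mono.
- exact: measurable_disc_cst.
move=> p _; rewrite patchE in_discE normc_emb// /cut.
have [p1|p1] := boolP (normc (c p) < 1); last first.
  by rewrite normc0 expr0n/= mul0r; case: ifP.
case: ifP => pr'; last by rewrite lee_fin.
have n0 := normc_ge0 (c p).
rewrite lee_fin /mono normcX -exprM -[leRHS]mul1r; apply: ler_pM.
- exact: exprn_ge0.
- exact: bergman_weight_ge0.
- by rewrite exprn_ile1// ltW.
rewrite /bergman_weight /K; apply: ler_wpM2l; first by rewrite divr_ge0 ?pi_ge0// addr_ge0.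
rewrite ge0_ler_powR ?nnegrE//.
- by rewrite ltW// sub_sqr_normc_gt0.
- by rewrite subr_ge0 ltW// expr_lt1.
- by rewrite lerD2l lerN2 lerXn2r ?nnegrE.
Qed.

(** This function is evaluated in two ways: up to modulus it is [coef (mono 0) (mono n)] at
    phi_z(w), while expanding U_z 1 involves [coef (mono k) (mono n)] for every k. *)
Definition trans_coef n z w : R[i] :=
  if normc w < 1 then ip area (emb (U z (mono 0))) (emb (U w (mono n))) else 0.

Definition qtrans n z (rho : R) : \bar R :=
  \int[hyp]_p (if rho <= normc (c p) then (alpha + 1) * normc (trans_coef n z (c p)) ^+ 2 else
    0)%:E.

Lemma trans_coefE n z w : unit_disc z -> unit_disc w ->
  normc (trans_coef n z w) = normc (coef (mono 0) (mono n) (mobius z w)).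
Proof.
move=> z1 w1; rewrite /trans_coef (w1 : normc w < 1).
have mm := disc_measurable_mono R; have Lm := L2_mono alpha0.
have := bergman_inner_U alpha0 (mm 0%N) (mm n) (Lm 0%N) (Lm n) (normc1 R) (normc1 R) z1 w1.
rewrite !rotate1 (bergman_innerE alpha0 (U z _) _) (bergman_innerE alpha0 (mono 0) _) => ->.
have t1 : normc (twist 1 z 1 w) = 1 by apply: normc_twist => //; exact: normc1.
have := coef_rotate_mono n (twist 1 z 1 w) (mobius z w) (Lm 0%N).
have m1 : normc (mobius z w) < 1 := mobius_disc z1 w1.
rewrite /translate mul1r coef_in// => ->.
by rewrite normcM normcX normc_conj t1 expr1n mul1r.
Qed.

End schur.

(** * Uniqueness of the coefficients of nonnegative power series *)

Section series_uniqueness.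
Variable R : realType.
Implicit Types (a b : nat -> R) (x C : R).

(** The sums are compared through their upper bounds, so that no limit has to be named. As the
    coefficients below m agree, division by x^m and x --> 0 leave a_m <= b_m. *)
Let series_coef_le a b m : (forall k, 0 <= a k) -> (forall k, 0 <= b k) ->
  (forall k, (k < m)%N -> a k = b k) ->
  (forall x, 0 < x < 1 -> exists C, forall M, \sum_(k < M) b k * x ^+ k <= C) ->
  (forall x C, 0 < x < 1 -> (forall M, \sum_(k < M) b k * x ^+ k <= C) ->
    forall M, \sum_(k < M) a k * x ^+ k <= C) ->
  a m <= b m.
Proof.
move=> a0 b0 ab bB dom; have h01 : 0 < (2^-1 : R) < 1 by rewrite invr_gt0 ltr0n/= invf_lt1// ltr1n.
have [C0 C0P] := bB _ h01.
have C00 : 0 <= C0 by have := C0P 0%N; rewrite big_ord0.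
(* C0 bounds the series at 1/2. For x < 1/2 and k > m one has b_k x^k <= b_k 2^(-k) (2 x)^(m+1), so
   the terms beyond m add up to at most K x x^m. *)
pose K := C0 * 2 ^+ m.+1; have K0 : 0 <= K by rewrite mulr_ge0// exprn_ge0.
suff main x : 0 < x < 2^-1 -> a m <= b m + K * x.
  apply/ler_addgt0Pr => e e0; pose x := Num.min (4^-1) (e / (K + 1)).
  have K1 : 0 < K + 1 by rewrite ltr_wpDl.
  have x0 : 0 < x by rewrite lt_min invr_gt0 ltr0n/= divr_gt0.
  have x1 : x < 2^-1.
    rewrite (le_lt_trans (_ : _ <= 4^-1)) ?ge_min ?lexx//.
    by rewrite ltf_pV2 ?posrE// ltr_nat.
  apply: le_trans (main x _) _; first by rewrite x0.
  rewrite lerD2l (le_trans (_ : _ <= K * (e / (K + 1))))//.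
    by apply: ler_wpM2l => //; rewrite ge_min lexx orbT.
  by rewrite mulrCA ger_pMr// ler_pdivrMr// mul1r lerDl.
move=> /andP[x0 x1]; have x01 : 0 < x < 1.
  by rewrite x0/=; case/andP: h01 => _; exact: lt_trans.
have bd M : \sum_(k < M) b k * x ^+ k <=
    \sum_(k < m.+1) b k * x ^+ k + K * x * x ^+ m.
  apply: (@le_trans _ _ (\sum_(k < m.+1 + M) b k * x ^+ k)).
    rewrite addnC -!(big_mkord xpredT (fun k => b k * x ^+ k)).
    rewrite [leRHS](@big_cat_nat _ _ _ M)//= ?leq_addr// lerDl sumr_ge0// => k _.
    by rewrite mulr_ge0// exprn_ge0// ltW.
  rewrite big_split_ord/= lerD2l.
  apply: (@le_trans _ _ (\sum_(j < M) (b (m.+1 + j)%N * 2^-1 ^+ (m.+1 + j)) * (2 ^+ m.+1 * x ^+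
    m.+1))).
    apply: ler_sum => j _; rewrite -mulrA; apply: ler_wpM2l => //.
    rewrite exprD mulrC [leRHS](_ : _ = 2^-1 ^+ j * x ^+ m.+1); last first.
      by rewrite exprD mulrACA -exprMn mulVf// expr1n mul1r.
    apply: ler_wpM2r; first by rewrite exprn_ge0// ltW.
    by apply: lerXn2r; rewrite ?nnegrE ?invr_ge0 ?ltW.
  rewrite -mulr_suml -mulrA -exprS mulrA; apply: ler_wpM2r; first by rewrite exprn_ge0// ltW.
  rewrite /K; apply: ler_wpM2r; first by rewrite exprn_ge0.
  apply: le_trans (C0P (m.+1 + M)%N); rewrite big_split_ord/= lerDr sumr_ge0// => j _.
  by rewrite mulr_ge0// exprn_ge0// invr_ge0.
have := dom _ _ x01 bd m.+1; rewrite !big_ord_recr/=.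
under eq_bigr do rewrite ab//.
by rewrite -addrA lerD2l -mulrDl ler_pM2r// exprn_gt0.
Qed.

Lemma series_coef_eq a b : (forall k, 0 <= a k) -> (forall k, 0 <= b k) ->
  (forall x, 0 < x < 1 -> exists C, forall M, \sum_(k < M) a k * x ^+ k <= C) ->
  (forall x C, 0 < x < 1 -> (forall M, \sum_(k < M) a k * x ^+ k <= C) ->
    forall M, \sum_(k < M) b k * x ^+ k <= C) ->
  (forall x C, 0 < x < 1 -> (forall M, \sum_(k < M) b k * x ^+ k <= C) ->
    forall M, \sum_(k < M) a k * x ^+ k <= C) ->
  forall k, a k = b k.
Proof.
move=> a0 b0 aB ab ba; elim/ltn_ind => m ih; apply/eqP; rewrite eq_le; apply/andP; split.
  apply: series_coef_le => // x x01; have [C CP] := aB x x01.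
  by exists C; exact: ab.
by apply: series_coef_le => // k km; rewrite ih.
Qed.

End series_uniqueness.

(** * Orthogonality relations for the matrix coefficients *)

Section schur_orthogonality.
Variables (R : realType) (alpha : R).
Hypothesis alpha0 : 0 <= alpha.
Implicit Types (u v : R[i] -> R[i]) (z w : R[i]) (p : R * R).
Local Notation c := (@complex_of_pair R).
Local Notation pr := (@pair_of_complex R).
Local Notation area := (@area R).
Local Notation hyp := (@hyperbolic_measure R).
Local Notation emb := (emb alpha).
Local Notation U := (U alpha).
Local Notation g := (gam (alpha + 2)).
Local Notation mono := (@mono R).
Local Notation coef := (coef alpha).
Local Notation qcoef := (qcoef alpha).
Local Notation trans_coef := (trans_coef alpha).
Local Notation qtrans := (qtrans alpha).
Local Notation translate_coef := (translate_coef alpha).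

Let s0 : 0 < alpha + 2. Proof. by rewrite ltr_wpDl. Qed.

Let a1 : 0 <= alpha + 1. Proof. by rewrite addr_ge0. Qed.

(* The square root accounts for the factor alpha + 1 of the Berezin transform. *)
Definition ann (rho : R) (f : R[i] -> R[i]) (p : R * R) : R[i] :=
  if rho <= normc (c p) then (Num.sqrt (alpha + 1))%:C * f (c p) else 0.

Lemma Cmeasurable_ann rho f : Cmeasurable_fun setT (fun p => f (c p)) ->
  Cmeasurable_fun setT (ann rho f).
Proof.
move=> mf; have mn : measurable_fun setT (fun p : R * R => normc (c p)).
  by apply: measurable_normc; exact: Cmeasurable_of_pair.
apply: (@Cmeasurable_if _ _ _ [set p | rho <= normc (c p)]) => //.
  rewrite (_ : [set p | _] = (fun p => rho <= normc (c p)) @^-1` [set true])//.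
  by rewrite -[X in measurable X]setTI; apply: measurable_fun_ler.
by apply: CmeasurableM => //; exact: Cmeasurable_cst.
Qed.

Lemma sq_ann rho f : (sq hyp (ann rho f) =
  \int[hyp]_p (if (rho <= normc (c p))%R then ((alpha + 1) * normc (f (c p)) ^+ 2)%R else
    0%R)%:E)%E.
Proof.
apply: eq_integral => p _; congr (_%:E); rewrite /ann; case: ifP => _.
  by rewrite normcM exprMn normc_real ger0_norm ?sqrtr_ge0// (sqr_sqrtr a1).
by rewrite normc0 expr0n.
Qed.

Lemma qcoefE u v rho : qcoef u v rho = sq hyp (ann rho (coef u v)).
Proof. by rewrite sq_ann. Qed.

Lemma qtransE n z rho : qtrans n z rho = sq hyp (ann rho (trans_coef n z)).
Proof. by rewrite sq_ann. Qed.

Lemma Cmeasurable_coef_mono k n : Cmeasurable_fun setT (fun p => coef (mono k) (mono n) (c p)).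
Proof. by apply: Cmeasurable_coef1; exact: disc_measurable_mono. Qed.

Section coefficient_terms.
Variables (n : nat) (A : nat -> R[i]).

Definition coef_term rho (k : nat) := ann rho (fun w => A k * coef (mono k) (mono n) w).

Lemma Cmeasurable_coef_term rho k : Cmeasurable_fun setT (coef_term rho k).
Proof.
apply: Cmeasurable_ann.
by apply: CmeasurableM; [exact: Cmeasurable_cst|exact: Cmeasurable_coef_mono].
Qed.

Lemma sq_coef_term rho k : (sq hyp (coef_term rho k) =
  (normc (A k) ^+ 2)%:E * qcoef (mono k) (mono n) rho)%E.
Proof.
rewrite qcoefE -sqZ; last by apply: Cmeasurable_ann; exact: Cmeasurable_coef_mono.
congr sq; apply/funext => p; rewrite /coef_term /ann; case: ifP => _; rewrite ?mulr0//.
by rewrite mulrCA.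
Qed.

Lemma sum_coef_term rho M p : \sum_(k < M) coef_term rho k p =
  ann rho (fun w => \sum_(k < M) A k * coef (mono k) (mono n) w) p.
Proof.
rewrite /ann; case: ifP => h.
  by rewrite mulr_sumr; apply: eq_bigr => k _; rewrite /coef_term /ann h.
by rewrite big1// => k _; rewrite /coef_term /ann h.
Qed.

Lemma coef_term_rotate rho k eta p : normc eta = 1 ->
  coef_term rho k (pr (eta * c p)) = eta^*%C ^+ n * eta ^+ k * coef_term rho k p.
Proof.
move=> e1; rewrite /coef_term /ann (pair_of_complexK (eta * c p)) normcM e1 mul1r.
have [_|_] := boolP (rho <= normc (c p)); last by rewrite mulr0.
by rewrite (coef_rotate alpha0 k n (c p) e1); ring.
Qed.

Lemma parseval_coef rho M :
  (sq hyp (ann rho (fun w => \sum_(k < M) A k * coef (mono k) (mono n) w)%R) =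
   \sum_(k < M) (normc (A k) ^+ 2)%:E * qcoef (mono k) (mono n) rho)%E.
Proof.
rewrite -(funext (sum_coef_term rho M)); case: M => [|M].
  rewrite big_ord0 /sq (eq_integral (fun=> 0%E)) ?integral0// => p _.
  by rewrite big_ord0 normc0 expr0n.
have e1 : normc (expi (2 * pi / M.+1%:R) : R[i]) = 1 := normc_expi _.
have e0 : expi (2 * pi / M.+1%:R) != 0 :> R[i] := expi_neq0 _.
have [msig _ _ _] := area_cv_mul e0.
rewrite (@finite_parseval _ _ _ hyp M.+1 (coef_term rho)
    (fun p => pr (expi (2 * pi / M.+1%:R) * c p)) (fun=> (expi (2 * pi / M.+1%:R))^*%C ^+ n)).
- by under eq_bigr do rewrite sq_coef_term.
- by [].
- exact: Cmeasurable_coef_term.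
- by move=> F F0 mF; exact: hyperbolic_rotate.
- exact: msig.
- by move=> p; rewrite normcX normc_conj e1 expr1n.
- by move=> k p _; exact: coef_term_rotate.
Qed.

End coefficient_terms.

Section translation_series.
Variables (n : nat) (z : R[i]).
Hypothesis z1 : unit_disc z.

Let mUn (w : R[i]) : unit_disc w -> L2 area (emb (U w (mono n))).
Proof.
move=> w1; have /= := @L2_U R alpha alpha0 (mono n) w 1; rewrite rotate1; apply => //.
- exact: disc_measurable_mono.
- exact: normc1.
- exact: L2_mono.
Qed.

Let sUn (w : R[i]) : unit_disc w -> (sq area (emb (U w (mono n))) <= ((g n)^-1)%:E)%E.
Proof.
move=> w1; have /= := @sq_U R alpha alpha0 (mono n) w 1; rewrite rotate1 => -> //.
- by rewrite sq_mono.
- exact: disc_measurable_mono.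
- exact: normc1.
Qed.

Lemma trans_coef_expansion (e : R) : 0 < e -> exists N : nat, forall M w, (N <= M)%N ->
  normc (trans_coef n z w - \sum_(k < M) translate_coef z k * coef (mono k) (mono n) w) < e.
Proof.
move=> e0; have [N NP] := @ip_expansion R alpha alpha0 (U z (mono 0)) (translate_coef z) 1
  (fun x x1 => U_mono0_series alpha0 z1 x1) (fun M => translate_coef_sum alpha0 M z1)
  ((g n)^-1) e e0.
exists N => M w NM; have [w1|w1] := boolP (normc w < 1); last first.
  rewrite /trans_coef (negPf w1) big1 ?subr0 ?normc0// => k _.
  by rewrite coef_out// mulr0.
have := NP M _ NM (mUn w1) (sUn w1); rewrite /trans_coef w1; congr (normc (_ - _) < _).
by apply: eq_bigr => k _; rewrite coef_in.
Qed.

Lemma Cmeasurable_trans_coef : Cmeasurable_fun setT (fun p => trans_coef n z (c p)).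
Proof.
apply: (@Cmeasurable_cvgC _ _ _
    (fun M p => \sum_(k < M) translate_coef z k * coef (mono k) (mono n) (c p))) => [M|p].
  apply: (@Cmeasurable_sum _ _ _ _ M (fun k p =>
    translate_coef z k * coef (mono k) (mono n) (c p))) => k.
  by apply: CmeasurableM; [exact: Cmeasurable_cst|exact: Cmeasurable_coef_mono].
move=> e e0; have [N NP] := trans_coef_expansion e0; exists N => M /NP h.
by rewrite normcB; exact: h.
Qed.

Let gk rho := coef_term n (translate_coef z) rho.

Let ann_expansion rho (e : R) : 0 < e -> exists N : nat, forall M p, (N <= M)%N ->
  normc (ann rho (trans_coef n z) p - \sum_(k < M) gk rho k p) <= e.
Proof.
move=> e0; pose r := Num.sqrt (alpha + 1) + 1.
have r0 : 0 < r by rewrite ltr_wpDl// sqrtr_ge0.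
have [N NP] := trans_coef_expansion (divr_gt0 e0 r0).
exists N => M p NM; rewrite sum_coef_term /ann; case: ifP => _; last by rewrite subrr normc0 ltW.
rewrite -mulrBr normcM normc_real (ger0_norm (sqrtr_ge0 _)).
apply: (@le_trans _ _ (r * (e / r))); last by rewrite mulrC divfK// gt_eqF.
apply: ler_pM; rewrite ?sqrtr_ge0 ?normc_ge0//; first by rewrite lerDl.
by rewrite ltW// NP.
Qed.

(** One half of Parseval's identity over the rotations of x, on every annulus; [fatou_trans] is the
    other half, on the whole disc. *)
Lemma bessel_trans rho M :
  (\sum_(k < M) (normc (translate_coef z k) ^+ 2)%:E * qcoef (mono k) (mono n) rho
   <= qtrans n z rho)%E.
Proof.
under eq_bigr do rewrite -(sq_coef_term n (translate_coef z)); rewrite qtransE.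
pose W (j : nat) p := (normc (c p) <= 1 - j.+1%:R^-1) || (1 <= normc (c p)).
have mn : measurable_fun setT (fun p : R * R => normc (c p)).
  by apply: measurable_normc; exact: Cmeasurable_of_pair.
have mW j : measurable_fun setT (W j).
  by apply: measurable_or; exact: measurable_fun_ler.
have Wrot j w p : normc w = 1 -> W j (pr (w * c p)) = W j p.
  by move=> w1; rewrite /W pair_of_complexK normcM w1 mul1r.
apply: (@bessel _ _ _ hyp (gk rho) (ann rho (trans_coef n z)) W).
- by move=> k; exact: Cmeasurable_coef_term.
- by apply: Cmeasurable_ann; exact: Cmeasurable_trans_coef.
- exact: mW.
- move=> j; apply: hyperbolic_ball_lty; apply/andP; split.
    by rewrite subr_ge0 invf_le1// ler1n.
  by rewrite gtrBl invr_gt0.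
- move=> p; have [p1|p1] := ltP (normc (c p)) 1; last by exists 0%N => j _; rewrite /W p1 orbT.
  have d0 : 0 < 1 - normc (c p) by rewrite subr_gt0.
  exists (Num.bound (1 - normc (c p))^-1) => j hj; apply/orP; left.
  rewrite lerBrDl -lerBrDr -[leRHS]invrK lef_pV2 ?posrE ?invr_gt0//.
  rewrite ltW// (lt_le_trans (archi_boundP _)) ?invr_ge0 ?(ltW d0)//.
  by rewrite ler_nat (leq_trans hj).
- move=> j N N0; have e1 : normc (expi (2 * pi / N%:R) : R[i]) = 1 := normc_expi _.
  have e0 : expi (2 * pi / N%:R) != 0 :> R[i] := expi_neq0 _.
  have [msig _ _ _] := area_cv_mul e0.
  apply: (@finite_parseval _ _ _ hyp N (fun k p => if W j p then gk rho k p else 0)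
    (fun p => pr (expi (2 * pi / N%:R) * c p)) (fun=> (expi (2 * pi / N%:R))^*%C ^+ n)).
  + exact: N0.
  + move=> k; apply: (@Cmeasurable_if _ _ _ (W j @^-1` [set true])).
    + by rewrite -[X in measurable X]setTI; exact: mW.
    + by [].
    + exact: Cmeasurable_coef_term.
  + by move=> F F0 mF; exact: hyperbolic_rotate.
  + exact: msig.
  + by move=> p; rewrite normcX normc_conj e1 expr1n.
  + move=> k p _; rewrite (Wrot j _ p e1).
    by have [_|_] := boolP (W j p); [exact: coef_term_rotate|rewrite mulr0].
- move=> j e /ann_expansion-/(_ rho)[N NP]; exists N => M' p NM _; exact: NP.
Qed.

Lemma fatou_trans (B : \bar R) :
  (forall M, (\sum_(k < M) (normc (translate_coef z k) ^+ 2)%:E * qcoef (mono k) (mono n) 0 <=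
    B)%E) ->
  (qtrans n z 0 <= B)%E.
Proof.
move=> H; rewrite qtransE.
apply: (@sq_fatou _ _ _ hyp (fun M p => \sum_(k < M) gk 0 k p) _ _ 1%N).
- by move=> M; apply: (@Cmeasurable_sum _ _ _ _ M (gk 0)) => k; exact: Cmeasurable_coef_term.
- move=> p e e0; have [N NP] := @ann_expansion 0 (e / 2) ltac:(by rewrite divr_gt0).
  exists N => M /NP h; rewrite normcB (le_lt_trans (h p))//.
  by rewrite ltr_pdivrMr// ltr_pMr// ltr1n.
move=> M M0; rewrite (funext (sum_coef_term n (translate_coef z) 0 M)) parseval_coef.
exact: H.
Qed.

Let msqr (f : R[i] -> R[i]) (rho : R) : Cmeasurable_fun setT (fun p => f (c p)) ->
  measurable_fun setT (fun p => (if rho <= normc (c p) then (alpha + 1) * normc (f (c p)) ^+ 2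
    else 0)%:E).
Proof.
move=> mf; apply: measurable_annulus; apply: measurable_funM => //.
exact: measurable_normc_sqr.
Qed.

Let sqr0 (f : R[i] -> R[i]) (rho : R) p :
  (0 <= (if (rho <= normc (c p))%R then ((alpha + 1) * normc (f (c p)) ^+ 2)%R else 0%R)%:E)%E.
Proof. by rewrite lee_fin; case: ifP => // _; rewrite (mulr_ge0 a1 (sqr_ge0 _)). Qed.

Let mmob : measurable_fun setT (fun p : R * R => pr (mobius z (c p))).
Proof. by have [] := area_cv_mobius z1. Qed.

Lemma qtrans_total : (qtrans n z 0 = ((g n)^-1)%:E)%E.
Proof.
rewrite -(qcoef_mono0_total alpha0 n) /qcoef.
pose F p := (if (0 : R) <= normc (c p) then
  (alpha + 1) * normc (coef (mono 0) (mono n) (c p)) ^+ 2 else 0)%:E : \bar R.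
have mF : measurable_fun setT F by apply: msqr; exact: Cmeasurable_coef_mono.
have F0 p : (0 <= F p)%E by exact: sqr0.
rewrite -[RHS](hyperbolic_mobius z1 F0 mF); apply: eq_hyperbolic.
- by apply: msqr; exact: Cmeasurable_trans_coef.
- exact: (measurableT_comp mF mmob).
- by move=> p; exact: sqr0.
- by move=> p; exact: F0.
move=> p p1; rewrite /F (pair_of_complexK (mobius z (c p))) !normc_ge0.
by rewrite (trans_coefE alpha0 n z1 p1).
Qed.

(** If |w| >= rho and |z| <= rho / 4, then |phi_z(w)| >= (|w| - |z|) / (1 + |z| |w|) >= (3 rho / 4)
    / (5 / 4) >= rho / 2, so translation keeps the annulus inside a slightly larger one. *)
Lemma qtrans_tail rho : 0 < rho < 1 -> normc z <= rho / 4 ->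
  (qtrans n z rho <= qcoef (mono 0) (mono n) (rho / 2))%E.
Proof.
move=> /andP[r0 r1] zr.
pose F p := (if rho / 2 <= normc (c p) then
  (alpha + 1) * normc (coef (mono 0) (mono n) (c p)) ^+ 2 else 0)%:E : \bar R.
have mF : measurable_fun setT F by apply: msqr; exact: Cmeasurable_coef_mono.
have F0 p : (0 <= F p)%E by exact: sqr0.
rewrite -[leRHS](hyperbolic_mobius z1 F0 mF); apply: le_hyperbolic.
- by apply: msqr; exact: Cmeasurable_trans_coef.
- exact: (measurableT_comp mF mmob).
- by move=> p; exact: sqr0.
- by move=> p; exact: F0.
move=> p p1; have [pr'|pr'] := boolP (rho <= normc (c p)); last exact: F0.
have h : rho / 2 <= normc (mobius z (c p)).
  rewrite mobiusE normcM normcV ler_pdivlMr ?normc_gt0 ?(denom_neq0 z1 p1)//.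
  have h1 : normc (1 - z^*%C * c p) <= 1 + normc z * normc (c p).
    by rewrite (le_trans (le_normcD _ _))// normc1 normcN normcM normc_conj.
  have h2 : normc (c p) - normc z <= normc (c p - z).
    by rewrite lerBlDr -[X in normc X <= _](subrK z) le_normcD.
  have n1 := normc_ge0 z; have n2 := normc_ge0 (c p).
  apply: le_trans (_ : rho / 2 * (1 + normc z * normc (c p)) <= _).
    by apply: ler_wpM2l => //; lra.
  apply: le_trans h2; have p1' : normc (c p) < 1 by exact: p1.
  have : normc z * normc (c p) <= normc z by rewrite ler_piMr// ltW.
  move: (normc z * _) => x xz.
  apply: le_trans (_ : rho / 2 * (1 + 1 / 4) <= _); last by lra.
  by apply: ler_wpM2l => //; lra.
by rewrite /F (pair_of_complexK (mobius z (c p))) h (trans_coefE alpha0 n z1 p1).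
Qed.

End translation_series.

Lemma normc_translate_coef_sqr z k : unit_disc z ->
  normc (translate_coef z k) ^+ 2 =
  (1 - normc z ^+ 2) `^ (2 + alpha) * (g k ^+ 2 * (normc z ^+ 2) ^+ k).
Proof.
move=> z1; have g0 := gam_gt0 k s0; apply: (mulIf (lt0r_neq0 (_ : 0 < (g k)^-1))).
  by rewrite invr_gt0.
rewrite normc_translate_coef//; move: (_ `^ _) (_ ^+ k) => y b.
by field; rewrite gt_eqF.
Qed.

Lemma qcoef_ge0 u v rho : (0 <= qcoef u v rho)%E.
Proof. by apply: integral_ge0 => p _; exact: (qcoef_int_ge0 alpha0). Qed.

Section schur_relation.
Variable n : nat.

Let q k := qcoef (mono k) (mono n) 0.

Let real_pt (x : R) : 0 < x < 1 ->
  exists2 z : R[i], unit_disc z & normc z ^+ 2 = x.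
Proof.
move=> /andP[x0 x1]; exists (Num.sqrt x)%:C.
  by rewrite /unit_disc/= (normc_real (Num.sqrt x)) ger0_norm ?sqrtr_ge0// -(sqrtr1 R) ltr_sqrt.
by rewrite normc_real ger0_norm ?sqrtr_ge0// sqr_sqrtr// ltW.
Qed.

Let sum_trans z M : unit_disc z ->
  (\sum_(k < M) (normc (translate_coef z k) ^+ 2)%:E * q k =
   ((1 - normc z ^+ 2) `^ (alpha + 2))%:E *
     \sum_(k < M) (g k ^+ 2 * (normc z ^+ 2) ^+ k)%:E * q k)%E.
Proof.
move=> z1; rewrite ge0_sume_distrr => [|k _]; last first.
  by rewrite mule_ge0 ?qcoef_ge0// lee_fin mulr_ge0 ?sqr_ge0// exprn_ge0// sqr_ge0.
by apply: eq_bigr => k _; rewrite (normc_translate_coef_sqr k z1) (addrC 2) EFinM muleA.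
Qed.

Let bessel_q (x : R) M : 0 < x < 1 ->
  (\sum_(k < M) (g k ^+ 2 * x ^+ k)%:E * q k <= ((g n)^-1 * ((1 - x) `^ (alpha + 2))^-1)%:E)%E.
Proof.
move=> x01; have [z z1 zE] := real_pt x01; have /andP[x0 x1] := x01.
have y0 : 0 < (1 - x) `^ (alpha + 2) by rewrite powR_gt0// subr_gt0.
have := bessel_trans n z1 0 M; rewrite (qtrans_total n z1) sum_trans// zE => h.
by rewrite EFinM lee_pdivlMr// muleC.
Qed.

Let fatou_q (x C : R) : 0 < x < 1 ->
  (forall M, \sum_(k < M) (g k ^+ 2 * x ^+ k)%:E * q k <= C%:E)%E ->
  (g n)^-1 <= (1 - x) `^ (alpha + 2) * C.
Proof.
move=> x01 h; have [z z1 zE] := real_pt x01; have /andP[x0 x1] := x01.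
have y0 : 0 < (1 - x) `^ (alpha + 2) by rewrite powR_gt0// subr_gt0.
have := @fatou_trans n z z1 ((1 - x) `^ (alpha + 2) * C)%:E.
rewrite (qtrans_total n z1) lee_fin; apply => M.
by rewrite sum_trans// zE EFinM lee_pmul2l.
Qed.

Let q_fin k : q k \is a fin_num.
Proof.
have h : 0 < (2^-1 : R) < 1 by rewrite invr_gt0 ltr0n/= invf_lt1// ltr1n.
have := bessel_q k.+1 h; rewrite big_ord_recr/= => hk.
have : ((g k ^+ 2 * 2^-1 ^+ k)%:E * q k < +oo)%E.
  apply: le_lt_trans (ltry ((g n)^-1 * ((1 - 2^-1) `^ (alpha + 2))^-1)).
  apply: le_trans hk; rewrite leeDr// sume_ge0// => i _.
  by rewrite mule_ge0 ?qcoef_ge0// lee_fin mulr_ge0 ?sqr_ge0// exprn_ge0// invr_ge0.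
rewrite ge0_fin_numE; last exact: qcoef_ge0.
have c0 : 0 < g k ^+ 2 * 2^-1 ^+ k by rewrite mulr_gt0 ?exprn_gt0 ?(gam_gt0 k s0)// invr_gt0.
have := qcoef_ge0 (mono k) (mono n) 0; rewrite -/(q k).
move: (q k) => y; case: y => [r _ _|_|//]; first exact: ltry.
by rewrite gt0_muley.
Qed.

Let sum_fine (x : R) M : (\sum_(k < M) (g k ^+ 2 * x ^+ k)%:E * q k =
  (\sum_(k < M) (g k ^+ 2 * fine (q k)) * x ^+ k)%:E)%E.
Proof.
rewrite -sumEFin; apply: eq_bigr => k _.
by rewrite -[q k in LHS](fineK (q_fin k)) -EFinM mulrAC.
Qed.

(** Both sides are coefficients of power series in x = |z|^2 with the common sum (gam_n)^(-1) (1 -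
    x)^(-s): for the left-hand side by [qtrans_total] with the Bessel and Fatou bounds, for the
    right-hand side by the binomial series. *)
Lemma schur_fine k : g k ^+ 2 * fine (q k) = g k * (g n)^-1.
Proof.
have gn0 := gam_gt0 n s0.
apply: (@series_coef_eq R (fun k => g k ^+ 2 * fine (q k)) (fun k => g k * (g n)^-1)).
- by move=> j; rewrite mulr_ge0 ?sqr_ge0// fine_ge0// qcoef_ge0.
- by move=> j; apply: divr_ge0; apply: ltW; rewrite ?gn0// (gam_gt0 j s0).
- move=> x x01; exists ((g n)^-1 * ((1 - x) `^ (alpha + 2))^-1) => M.
  by rewrite -lee_fin -sum_fine bessel_q.
- move=> x C x01 h M; have /andP[x0 x1] := x01.
  have y0 : 0 < (1 - x) `^ (alpha + 2) by rewrite powR_gt0// subr_gt0.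
  have : (g n)^-1 <= (1 - x) `^ (alpha + 2) * C.
    by apply: fatou_q => // M'; rewrite sum_fine lee_fin.
  rewrite mulrC -ler_pdivrMr// => /(le_trans _); apply.
  under eq_bigr do rewrite mulrAC; rewrite -mulr_suml mulrC.
  apply: ler_wpM2l; first by rewrite invr_ge0 ltW.
  by apply: (gam_sum_le M s0); apply/andP; split => //; exact: ltW.
move=> x C x01 h M; have /andP[x0 x1] := x01.
have x01' : 0 <= x < 1 by rewrite (ltW x0).
rewrite -lee_fin -sum_fine; apply: le_trans (bessel_q M x01) _; rewrite lee_fin.
apply/ler_addgt0Pr => e e0; have e1 : 0 < e * g n by rewrite mulr_gt0.
have [N NP] := gam_series s0 x01' e1.
apply: le_trans (lerD (h N) (lexx e)).
have := NP N (leqnn N); rewrite distrC => /ltW/ler_normlW; rewrite lerBlDl => hN.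
rewrite mulrC ler_pdivrMr// mulrDl; apply: le_trans hN _.
rewrite lerD2r mulr_suml; apply: ler_sum => j _.
by rewrite mulrAC divfK// gt_eqF.
Qed.

Lemma schur k : (qcoef (mono k) (mono n) 0 = ((g k * g n)^-1)%:E)%E.
Proof.
rewrite -[LHS](fineK (q_fin k)); congr (_%:E).
have gk0 := lt0r_neq0 (gam_gt0 k s0); have gn0 := lt0r_neq0 (gam_gt0 n s0).
apply: (mulfI (expf_neq0 2 gk0)); rewrite schur_fine.
by rewrite expr2 invfM mulrACA divff// mul1r.
Qed.

(** Only the term k = m of [bessel_trans] at |z| = rho / 4 is kept. The factor (1 - 4 x)^alpha is
    the tail for the monomial 1 beyond rho / 2; of the two factors (1 - x)^(-s), one is the
    normalization of U_z 1 and the other the bound [gam_le] for gam_n. *)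
Lemma qcoef_tail m (rho x : R) : 0 < rho < 1 -> x = rho ^+ 2 / 16 ->
  ((g m * g n)%:E * qcoef (mono m) (mono n) rho <=
   (tail_const R * x ^- m * x ^- n * ((1 - x) ^- 4) *
     ((alpha + 1) * ((1 - 4 * x) / (1 - x) ^+ 2) `^ alpha))%:E)%E.
Proof.
move=> r01 xE; have /andP[r0 r1] := r01.
have r21 : rho ^+ 2 < 1 by rewrite expr_lt1// ltW.
have r20 : 0 < rho ^+ 2 by rewrite exprn_gt0.
have x0 : 0 < x by lra.
have x1 : 4 * x < 1 by lra.
have x1' : x < 1 by lra.
pose z : R[i] := (rho / 4)%:C.
have nz : normc z = rho / 4 by rewrite normc_real ger0_norm//; lra.
have nz2 : normc z ^+ 2 = x by rewrite nz xE; field.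
have z1 : unit_disc z by rewrite /unit_disc /mkset nz; lra.
have y0 : 0 < (1 - x) `^ (alpha + 2) by rewrite powR_gt0// subr_gt0.
have h1 := bessel_trans n z1 rho m.+1.
have /(le_trans h1) {h1} : (qtrans n z rho <= (tail_const R * ((alpha + 1) * (1 - 4 * x) `^
  alpha))%:E)%E.
  apply: le_trans (qtrans_tail n z1 r01 _) _; first by rewrite nz.
  apply: le_trans (qcoef_mono0_tail alpha0 n _) _; first by apply/andP; split; lra.
  by rewrite (_ : 1 - (rho / 2) ^+ 2 = 1 - 4 * x)// xE; field.
rewrite big_ord_recr/= => h.
have {h} : ((normc (translate_coef z m) ^+ 2)%:E * qcoef (mono m) (mono n) rho <=
    (tail_const R * ((alpha + 1) * (1 - 4 * x) `^ alpha))%:E)%E.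
  apply: le_trans h; rewrite leeDr// sume_ge0// => i _.
  by rewrite mule_ge0 ?qcoef_ge0// lee_fin sqr_ge0.
rewrite (normc_translate_coef_sqr m z1) nz2 (addrC 2).
have gm1 : 1 <= g m by apply: gam_ge1; rewrite ler_wpDl// ler1n.
have gn := @gam_le R (alpha + 2) x n s0.
have {gn} := gn; rewrite x0 x1' => /(_ isT) gn.
have gn0 := gam_gt0 n s0; have xm : 0 < x ^+ m by rewrite exprn_gt0.
set T := tail_const R * _; set Q := qcoef _ _ _ => h.
have T0 : 0 <= T by rewrite (mulr_ge0 (tail_const_ge0 R))// (mulr_ge0 a1)// powR_ge0.
(* The coefficient of U_z 1 brings gam_m^2, of which one factor is given up because gam_m >= 1. *)
have h2 : ((g m)%:E * Q <= (T * (((1 - x) `^ (alpha + 2))^-1 * x ^- m))%:E)%E.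
  apply: (@le_trans _ _ ((g m ^+ 2)%:E * Q)%E).
    apply: lee_wpmul2r; first exact: qcoef_ge0.
    by rewrite lee_fin expr2 ler_peMl// (le_trans _ gm1).
  rewrite -(invfM ((1 - x) `^ (alpha + 2)) (x ^+ m)) (EFinM T) lee_pdivlMr ?mulr_gt0//.
  apply: le_trans h; rewrite muleAC -EFinM.
  by rewrite [X in X%:E](_ : _ = (1 - x) `^ (alpha + 2) * (g m ^+ 2 * x ^+ m))//; ring.
rewrite (mulrC (g m)) EFinM -muleA.
apply: (@le_trans _ _ ((g n)%:E * (T * (((1 - x) `^ (alpha + 2))^-1 * x ^- m))%:E)%E).
  by apply: lee_wpmul2l => //; rewrite lee_fin ltW.
rewrite -EFinM lee_fin.
apply: (@le_trans _ _ ((x ^- n * ((1 - x) `^ (alpha + 2))^-1) * (T * (((1 - x) `^ (alpha + 2))^-1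
  * x ^- m)))).
  apply: ler_wpM2r => //; rewrite mulr_ge0// mulr_ge0// invr_ge0 ltW// exprn_gt0//.
have d0 : 0 < 1 - x by lra.
have e1 : (1 - x) `^ (alpha + 2) = (1 - x) `^ alpha * (1 - x) ^+ 2.
  by rewrite powRD ?(lt0r_neq0 d0) ?implybT// (powR_mulrn 2 (ltW d0)).
have e2 : ((1 - 4 * x) / (1 - x) ^+ 2) `^ alpha = (1 - 4 * x) `^ alpha / ((1 - x) `^ alpha) ^+ 2.
  rewrite powRM ?invr_ge0 ?sqr_ge0//; last by lra.
  by rewrite powRV ?exprn_gt0// powR_sqr// ltW.
rewrite e1 e2 /T; have p0 : 0 < (1 - x) `^ alpha by rewrite powR_gt0.
move: d0 p0 xm (exprn_gt0 n x0); move: ((1 - x) `^ alpha) ((1 - 4 * x) `^ alpha) (x ^+ m) (x ^+ n)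
  (tail_const R) (1 - x) => P1 P2 y1 y2 t d.
move=> d0 p0 y10 y20; rewrite le_eqVlt; apply/orP; left; apply/eqP.
by field; rewrite !gt_eqF.
Qed.

End schur_relation.
End schur_orthogonality.

Lemma sum_ord_cut (M : nmodType) (F : nat -> M) J L : (J <= L)%N ->
  \sum_(k < L) (if (k < J)%N then F k else 0) = \sum_(k < J) F k.
Proof. by move=> JL; rewrite [RHS](big_ord_widen _ F JL) [RHS]big_mkcond. Qed.

(** * The windowed kernel *)

Section circle_parseval.
Variable R : realType.
Local Notation circ := (@circle_measure R).
Local Notation c := (@complex_of_pair R).
Local Notation pr := (@pair_of_complex R).

Let mexp : measurable_fun setT (fun t : R => pr (expi t)).
Proof. by apply: measurable_pair_of_complex; exact: Cmeasurable_expi. Qed.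

(** The circle measure carried to the plane, where a rotation acts by multiplication with a root of
    unity as [finite_parseval] needs. *)
Let circ2 := image_measure circ mexp.

Let circ2E (F : R * R -> \bar R) : measurable_fun setT F -> (forall p, 0 <= F p)%E ->
  (\int[circ2]_p F p = \int[circ]_t F (pr (expi t)))%E.
Proof. by move=> mF F0; rewrite ge0_integral_image_measure. Qed.

Lemma integral_circ_cst (B : R) : (\int[circ]_t B%:E = B%:E)%E.
Proof. by rewrite (integral_cst _ measurableT) [X in (_ * X)%E](probability_setT circ) mule1. Qed.

Lemma circle_parseval (d : nat -> R[i]) L :
  (\int[circ]_t (normc (\sum_(n < L) (expi t)^*%C ^+ n * d n) ^+ 2)%:E =
   \sum_(n < L) (normc (d n) ^+ 2)%:E)%E.
Proof.
case: L => [|L].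
  rewrite big_ord0 (eq_integral (fun=> 0%E)) ?integral0// => p _.
  by rewrite big_ord0 normc0 expr0n.
pose g n p := (c p)^*%C ^+ n * d n.
have mg n : Cmeasurable_fun setT (g n).
  apply: CmeasurableM; last exact: Cmeasurable_cst.
  by apply: CmeasurableX; apply: Cmeasurable_conj; exact: Cmeasurable_of_pair.
have e1 : normc ((expi (2 * pi / L.+1%:R))^*%C : R[i]) = 1 by rewrite normc_conj normc_expi.
have e0 : (expi (2 * pi / L.+1%:R))^*%C != 0 :> R[i] by rewrite -normc_eq0 e1 oner_eq0.
have [msig _ _ _] := area_cv_mul e0.
have sqE G : Cmeasurable_fun setT G ->
    (sq circ2 G = \int[circ]_t (normc (G (pr (expi t))) ^+ 2)%:E)%E.
  move=> mG; rewrite /sq circ2E//; first exact: measurable_normc_sqrE.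
  by move=> p; rewrite lee_fin sqr_ge0.
transitivity (sq circ2 (fun p => \sum_(n < L.+1) g n p)).
  rewrite sqE; last exact: Cmeasurable_sum.
  by apply: eq_integral => t _; under [in RHS]eq_bigr do rewrite /g pair_of_complexK.
rewrite (@finite_parseval _ _ _ circ2 L.+1 g
    (fun p => pr ((expi (2 * pi / L.+1%:R))^*%C * c p)) (fun=> 1)).
- apply: eq_bigr => n _; rewrite sqE// -[RHS]integral_circ_cst; apply: eq_integral => t _.
  by rewrite /g pair_of_complexK normcM normcX normc_conj normc_expi expr1n mul1r.
- by [].
- exact: mg.
- move=> F F0 mF; rewrite !circ2E//; last by exact: (measurableT_comp mF msig).
  under eq_integral do rewrite pair_of_complexK.
  apply: (@circle_rotate R (F \o pr)) => //; first by move=> z; exact: F0.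
  exact: (measurableT_comp mF (measurable_pair_of_complex (Cmeasurable_of_pair R))).
- exact: msig.
- by move=> p; rewrite normc1.
- move=> k p _; rewrite /g pair_of_complexK conjcM conjcK exprMn mul1r mulrA.
  by [].
Qed.

End circle_parseval.

(** * The kernel of a window and its truncations *)

Section windowed_kernel.
Variables (R : realType) (alpha : R).
Hypothesis alpha0 : 0 <= alpha.
Implicit Types (v : R[i] -> R[i]) (z w : R[i]) (p : R * R) (q : R * (R * R)).
Local Notation c := (@complex_of_pair R).
Local Notation pr := (@pair_of_complex R).
Local Notation area := (@area R).
Local Notation circ := (@circle_measure R).
Local Notation hyp := (@hyperbolic_measure R).
Local Notation emb := (emb alpha).
Local Notation U := (U alpha).
Local Notation g := (gam (alpha + 2)).
Local Notation mono := (@mono R).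
Local Notation coef := (coef alpha).
Local Notation qcoef := (qcoef alpha).

Let s0 : 0 < alpha + 2. Proof. by rewrite ltr_wpDl. Qed.

Definition ann2 (rho : R) (F : R[i] -> R[i] -> R[i]) q : R[i] := ann alpha rho (F (expi q.1)) q.2.

Lemma Cmeasurable_ann2 rho F : Cmeasurable_fun setT (fun q => F (expi q.1) (c q.2)) ->
  Cmeasurable_fun setT (ann2 rho F).
Proof.
move=> mF; have mn : measurable_fun setT (fun q => normc (c q.2)).
  apply: measurable_normc.
  by apply: (Cmeasurable_precomp (Cmeasurable_of_pair R)); exact: measurable_snd.
apply: (@Cmeasurable_if _ _ _ [set q | rho <= normc (c q.2)]) => //.
  rewrite (_ : [set q | _] = (fun q => rho <= normc (c q.2)) @^-1` [set true])//.
  by rewrite -[X in measurable X]setTI; apply: measurable_fun_ler.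
by apply: CmeasurableM => //; exact: Cmeasurable_cst.
Qed.

(** For A m n = a_m conj(a_n) this is the kernel of the truncated window. General coefficients also
    cover differences of two truncations. *)
Definition coef_poly (A : nat -> nat -> R[i]) L t w : R[i] :=
  \sum_(n < L) t^*%C ^+ n * \sum_(m < L) A m n * coef (mono m) (mono n) w.

Lemma Cmeasurable_coef_poly A L :
  Cmeasurable_fun setT (fun q => coef_poly A L (expi q.1) (c q.2)).
Proof.
apply: (@Cmeasurable_sum _ _ _ _ L (fun n q => (expi q.1)^*%C ^+ n *
  \sum_(m < L) A m n * coef (mono m) (mono n) (c q.2))) => n.
apply: CmeasurableM.
  apply: CmeasurableX; apply: Cmeasurable_conj.
  by apply: (Cmeasurable_precomp (Cmeasurable_expi R)); exact: measurable_fst.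
apply: (@Cmeasurable_sum _ _ _ _ L (fun m q => A m n * coef (mono m) (mono n) (c q.2))) => m.
apply: CmeasurableM; first exact: Cmeasurable_cst.
apply: (@Cmeasurable_precomp _ _ _ _ _ (fun p => coef (mono m) (mono n) (c p)) snd).
  exact: Cmeasurable_coef_mono.
exact: measurable_snd.
Qed.

(** Parseval in the window angle separates the indices n, then Parseval over the rotations of w
    separates the m. *)
Lemma sq_coef_poly A L rho :
  (sq (circ \x hyp) (ann2 rho (coef_poly A L)) =
   \sum_(n < L) \sum_(m < L) (normc (A m n) ^+ 2)%:E * qcoef (mono m) (mono n) rho)%E.
Proof.
pose d n := ann alpha rho (fun w => \sum_(m < L) A m n * coef (mono m) (mono n) w).
have md n : Cmeasurable_fun setT (d n).
  apply: Cmeasurable_ann.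
  apply: (@Cmeasurable_sum _ _ _ _ L (fun m p => A m n * coef (mono m) (mono n) (c p))) => m.
  apply: CmeasurableM; first exact: Cmeasurable_cst.
  exact: Cmeasurable_coef_mono.
have E q : ann2 rho (coef_poly A L) q = \sum_(n < L) (expi q.1)^*%C ^+ n * d n q.2.
  rewrite /ann2 /d /ann /coef_poly; case: ifP => _.
    by rewrite mulr_sumr; apply: eq_bigr => n _; rewrite mulrCA.
  by rewrite big1// => n _; rewrite mulr0.
have msq := measurable_normc_sqrE (Cmeasurable_ann2 rho (Cmeasurable_coef_poly A L)).
rewrite /sq (@fubini_tonelli2 _ _ _ _ _ circ hyp _ msq); last first.
  by move=> q; rewrite lee_fin sqr_ge0.
rewrite (eq_integral (fun p => \sum_(n < L) (normc (d n p) ^+ 2)%:E)%E); last first.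
  move=> p _; rewrite /fubini_G -(circle_parseval (fun n => d n p)); apply: eq_integral => t _.
  by rewrite E.
rewrite (@ge0_integral_sum _ _ _ hyp _ measurableT 'I_L (fun n p =>
  (normc (d n p) ^+ 2)%:E) _ _ (index_enum 'I_L)).
- by apply: eq_bigr => n _; exact: (parseval_coef alpha0 n (A^~ n) rho L).
- by move=> n; exact: measurable_normc_sqrE.
- by move=> n p _; rewrite lee_fin sqr_ge0.
Qed.

Section window.
Variables (b : nat -> R[i]) (u : R[i] -> R[i]).
Hypothesis b_le1 : forall M, \sum_(k < M) normc (b k) ^+ 2 <= 1.
Hypothesis b_sup1 : forall e, 0 < e -> exists J : nat, 1 - e < \sum_(k < J) normc (b k) ^+ 2.

Let a k := b k * (Num.sqrt (g k))%:C.

Hypothesis au : forall z, normc z < 1 -> cvgC (psum a z) (u z).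

Let normc_a k : normc (a k) ^+ 2 = normc (b k) ^+ 2 * g k.
Proof.
rewrite /a normcM exprMn normc_real (ger0_norm (sqrtr_ge0 _)).
by rewrite (sqr_sqrtr (ltW (gam_gt0 k s0))).
Qed.

Let normc_ag k : normc (a k) ^+ 2 / g k = normc (b k) ^+ 2.
Proof. by rewrite normc_a mulfK// gt_eqF// (gam_gt0 k s0). Qed.

Let S M := \sum_(k < M) normc (b k) ^+ 2.

Let SE M : \sum_(k < M) normc (a k) ^+ 2 / g k = S M.
Proof. by apply: eq_bigr => k _; rewrite normc_ag. Qed.

Let a_le1 M : \sum_(k < M) normc (a k) ^+ 2 / g k <= 1.
Proof. by rewrite SE; exact: b_le1. Qed.

Let S_mono M M' : (M <= M')%N -> S M <= S M'.
Proof.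
move=> MM; rewrite /S -!(big_mkord xpredT (fun k => normc (b k) ^+ 2)).
rewrite [leRHS](@big_cat_nat _ _ _ M)//= lerDl sumr_ge0// => k _.
exact: sqr_ge0.
Qed.

Let S_ge0 M : 0 <= S M.
Proof. by rewrite sumr_ge0// => k _; exact: sqr_ge0. Qed.

Let S_tail e : 0 < e -> exists N : nat, forall n, (N <= n)%N -> 1 - S n < e.
Proof.
move=> e0; have [N NP] := b_sup1 e0; exists N => n Nn.
by rewrite ltrBlDl -ltrBlDr (lt_le_trans NP)//; exact: S_mono.
Qed.

Lemma window_measurable : disc_measurable u.
Proof. exact: (disc_measurable_lim au). Qed.

Lemma window_L2 : L2 area (emb u) /\ (sq area (emb u) <= 1%:E)%E.
Proof. exact: (bergman_L2 alpha0 au a_le1). Qed.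

Let uJ J z := psum a z J.

Let muJ J : disc_measurable (uJ J). Proof. exact: disc_measurable_psum. Qed.

Let LuJ J : L2 area (emb (uJ J)). Proof. exact: L2_psum. Qed.

Let suJ J : (sq area (emb (uJ J)) <= 1%:E)%E.
Proof. by rewrite (sq_psum alpha0) lee_fin; exact: a_le1. Qed.

Let dJ J z := u z - uJ J z.

Let mdJ J : disc_measurable (dJ J).
Proof.
rewrite /disc_measurable (_ : _ \o _ = fun p => (cut u \o c) p - (cut (uJ J) \o c) p).
  by apply: CmeasurableB; [exact: window_measurable|exact: muJ].
by apply/funext => p; rewrite /= /cut; case: ifP => // _; rewrite subr0.
Qed.

Let emb_dJ J : emb (dJ J) = fun p => emb u p - emb (uJ J) p.
Proof.
apply/funext => p; rewrite !embE -mulrBl /cut; congr (_ * _).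
by case: ifP => // _; rewrite subr0.
Qed.

Let sdJ J : (sq area (emb (dJ J)) <= (1 - S J)%:E)%E.
Proof. by rewrite emb_dJ -SE; exact: (bergman_fatou alpha0 au J a_le1). Qed.

Let LdJ J : L2 area (emb (dJ J)).
Proof.
split; first by apply: Cmeasurable_emb; exact: mdJ.
exact: le_lt_trans (sdJ J) (ltry _).
Qed.

Let U_psum t w J : U w (rotate t (uJ J)) =
  fun z => \sum_(n < J) (a n * t ^+ n) * U w (mono n) z.
Proof.
apply/funext => z; rewrite U_E /uJ /rotate /psum !mulr_suml; apply: eq_bigr => n _.
by rewrite U_E monoE exprMn !mulrA.
Qed.

Let L2Umono w n : unit_disc w -> L2 area (emb (U w (mono n))).
Proof.
move=> w1; have /= := @L2_U R alpha alpha0 (mono n) w 1; rewrite rotate1; apply => //.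
- exact: disc_measurable_mono.
- exact: normc1.
- exact: L2_mono.
Qed.

Let ip_trunc t w J : unit_disc w ->
  ip area (emb (uJ J)) (emb (U w (rotate t (uJ J)))) =
  coef_poly (fun m n => a m * (a n)^*%C) J t w.
Proof.
move=> w1; rewrite U_psum (emb_sum alpha J (fun n z => (a n * t ^+ n) * U w (mono n) z)).
have -> : (fun p => \sum_(n < J) emb (fun z => (a n * t ^+ n) * U w (mono n) z) p) =
    fun p => \sum_(n < J) (a n * t ^+ n) * emb (U w (mono n)) p.
  by apply/funext => p; apply: eq_bigr => n _; rewrite embZ.
rewrite (@ip_sumr _ _ R area J (fun n => a n * t ^+ n) (fun n => emb (U w (mono n)))
  (emb (uJ J)) (fun n => L2Umono n w1) (LuJ J)); apply: eq_bigr => n _.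
rewrite ip_psum//; last exact: L2Umono.
rewrite !mulr_sumr; apply: eq_bigr => m _.
rewrite (coef_in alpha (mono m) (mono n) w1) conjcM conjcX.
by move: (ip _ _ _) (t^*%C ^+ n) => x y; ring.
Qed.

(** The window is truncated in one slot at a time: in the first by [ip_expansion], in the second by
    [sq_cvg0_ip], which is uniform over the truncations in the first. *)
Lemma kernel_cvg t w : normc t = 1 ->
  cvgC (coef_poly (fun m n => a m * (a n)^*%C) ^~ t ^~ w) (coef u (rotate t u) w).
Proof.
move=> t1; have [w1|w1] := boolP (normc w < 1); last first.
  rewrite coef_out// => e e0; exists 0%N => n _.
  rewrite /coef_poly big1 ?subrr ?normc0// => k _.
  by rewrite big1 ?mulr0// => m _; rewrite coef_out// mulr0.
move=> e e0; have e20 : 0 < e / 2 by rewrite divr_gt0.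
have mu := window_measurable; have [Lu su] := window_L2.
have [N1 NP1] := ip_expansion alpha0 au a_le1 1 e20.
have sU J : (sq area (emb (U w (rotate t (dJ J)))) <= (1 - S J)%:E)%E.
  by rewrite (sq_U alpha0 (mdJ J) w1 t1); exact: sdJ.
have [N2 NP2] := @sq_cvg0_ip _ _ R area
  (fun J => emb (U w (rotate t (dJ J)))) (fun J => 1 - S J) 1
  (fun J => L2_U alpha0 (mdJ J) w1 t1 (LdJ J))
  sU S_tail _ e20.
exists (maxn N1 N2) => J; rewrite geq_max => /andP[J1 J2].
have LU := L2_U alpha0 mu w1 t1 Lu.
rewrite coef_in// -ip_trunc//.
have h1 := NP1 J _ J1 LU ltac:(by rewrite sq_U).
rewrite -(ip_psum alpha0) in h1; last exact: LU.
have h2 := NP2 J _ J2 (LuJ J) (suJ J).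
have LUd := L2_U alpha0 (mdJ J) w1 t1 (LdJ J).
have LUJ := L2_U alpha0 (muJ J) w1 t1 (LuJ J).
have E : emb (U w (rotate t u)) = fun p => emb (U w (rotate t (uJ J))) p + emb (U w (rotate t (dJ
  J))) p.
  rewrite -embD; congr emb; apply/funext => z.
  by rewrite !U_E -!mulrDl /rotate /dJ addrCA subrr addr0.
have E2 : ip area (emb (uJ J)) (emb (U w (rotate t u))) =
    ip area (emb (uJ J)) (emb (U w (rotate t (uJ J)))) +
    (ip area (emb (U w (rotate t (dJ J)))) (emb (uJ J)))^*%C.
  by rewrite {1}E (ipDr (LuJ J) LUJ LUd) -(ipC LUd (LuJ J)).
have {h2} h2 : normc ((ip area (emb (U w (rotate t (dJ J)))) (emb (uJ J)))^*%C) < e / 2.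
  by rewrite normc_conj.
move: h1 h2; rewrite -/(uJ J) E2.
move: (ip _ _ _) (ip _ _ _) (ip _ _ _)^*%C => x y z h1 h2.
rewrite normcB (_ : y - x = (y - (x + z)) + z); last by ring.
by rewrite (le_lt_trans (le_normcD _ _))// (splitr e) ltrD.
Qed.

Let A m n := a m * (a n)^*%C.

Let normc_A m n : normc (A m n) ^+ 2 * (g m * g n)^-1 = normc (b m) ^+ 2 * normc (b n) ^+ 2.
Proof.
rewrite /A normcM exprMn normc_conj !normc_a.
have gm := lt0r_neq0 (gam_gt0 m s0); have gn := lt0r_neq0 (gam_gt0 n s0).
by rewrite mulrACA mulfK// mulf_neq0.
Qed.

Let A' J m n := if (m < J)%N && (n < J)%N then 0 else A m n.

(** By the orthogonality relations a pair (m, n) contributes |b_m|^2 |b_n|^2, and the pairs run over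
    the L-square without the J-square. *)
Let sq_A' J L : (J <= L)%N ->
  (sq (circ \x hyp) (ann2 0 (coef_poly (A' J) L)) = (S L ^+ 2 - S J ^+ 2)%:E)%E.
Proof.
move=> JL; rewrite sq_coef_poly.
pose X m n := normc (b m) ^+ 2 * normc (b n) ^+ 2.
have SX M : S M ^+ 2 = \sum_(n < M) \sum_(m < M) X m n.
  rewrite expr2 {2}/S mulr_sumr; apply: eq_bigr => n _.
  by rewrite /S mulr_suml.
transitivity (\sum_(n < L) \sum_(m < L)
   (X m n - if (n < J)%N then (if (m < J)%N then X m n else 0) else 0))%:E.
  rewrite -sumEFin; apply: eq_bigr => n _; rewrite -sumEFin; apply: eq_bigr => m _.
  rewrite (schur alpha0 n m) -EFinM; congr (_%:E); rewrite /A' /X.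
  case: (ltnP m J) => _ /=; case: (ltnP n J) => _ /=; rewrite ?subr0 ?normc_A//.
  by rewrite normc0 expr0n mul0r subrr.
congr (_%:E); rewrite !SX; under eq_bigr do rewrite sumrB.
rewrite sumrB; congr (_ - _).
rewrite -[RHS](sum_ord_cut (fun n => \sum_(m < J) X m n) JL).
apply: eq_bigr => n _; case: (ltnP n J) => _; last by rewrite big1.
by rewrite (sum_ord_cut (fun m => X m n) JL).
Qed.

Let coef_poly_cut J L t w : (J <= L)%N ->
  coef_poly (A' J) L t w = coef_poly A L t w - coef_poly A J t w.
Proof.
move=> JL; rewrite /coef_poly.
rewrite -[X in _ - X](sum_ord_cut (fun n =>
  t^*%C ^+ n * \sum_(m < J) A m n * coef (mono m) (mono n) w) JL).
rewrite -sumrB; apply: eq_bigr => n _; case: (ltnP n J) => nJ; last first.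
  rewrite subr0; congr (_ * _); apply: eq_bigr => m _.
  by rewrite /A' (ltnNge n J) nJ andbF.
rewrite -mulrBr; congr (_ * _).
rewrite -[X in _ - X](sum_ord_cut (fun m => A m n * coef (mono m) (mono n) w) JL).
rewrite -sumrB; apply: eq_bigr => m _; rewrite /A' nJ andbT.
by case: ifP => _; rewrite ?subrr ?mul0r ?subr0.
Qed.

Definition window_kernel t w := coef u (rotate t u) w.

Lemma Cmeasurable_window_kernel d (T : measurableType d) (w t : T -> R[i]) :
  Cmeasurable_fun setT w -> Cmeasurable_fun setT t -> (forall x, normc (t x) = 1) ->
  Cmeasurable_fun setT (fun x => window_kernel (t x) (w x)).
Proof.
by move=> mw mt t1; apply: Cmeasurable_coef => //; exact: window_measurable.
Qed.

Let mK : Cmeasurable_fun setT (fun q => window_kernel (expi q.1) (c q.2)).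
Proof.
apply: Cmeasurable_window_kernel; last by move=> q; exact: normc_expi.
  by apply: (Cmeasurable_precomp (Cmeasurable_of_pair R)); exact: measurable_snd.
by apply: (Cmeasurable_precomp (Cmeasurable_expi R)); exact: measurable_fst.
Qed.

Let D J t w := window_kernel t w - coef_poly A J t w.

Let mD J : Cmeasurable_fun setT (fun q => D J (expi q.1) (c q.2)).
Proof. by apply: CmeasurableB; [exact: mK|exact: Cmeasurable_coef_poly]. Qed.

Let sq_D J : (sq (circ \x hyp) (ann2 0 (D J)) <= (1 - S J ^+ 2)%:E)%E.
Proof.
apply: (@sq_fatou _ _ R (circ \x hyp)%E (fun L => ann2 0 (coef_poly (A' J) L)) _ _ J).
- by move=> L; apply: Cmeasurable_ann2; exact: Cmeasurable_coef_poly.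
- move=> q; rewrite /ann2 /ann; case: ifP => _; last exact: (@cvgC_cst _ _ _ 0%N).
  apply: cvgCZ => e e0; have [N NP] := kernel_cvg (c q.2) (normc_expi q.1) e0.
  exists (maxn N J) => L; rewrite geq_max => /andP[/NP h JL].
  rewrite coef_poly_cut// /D /window_kernel.
  by rewrite (_ : _ - _ = coef_poly A L (expi q.1) (c q.2) - coef u (rotate (expi q.1) u) (c
    q.2))//; ring.
move=> L JL; rewrite (sq_A' JL) lee_fin lerD2r (expr_le1 _ (S_ge0 L))//; exact: b_le1.
Qed.

Let sq_P J : (sq (circ \x hyp) (ann2 0 (coef_poly A J)) = (S J ^+ 2)%:E)%E.
Proof.
have := @sq_A' 0%N J (leq0n J); rewrite /S big_ord0 expr0n/= subr0 => <-.
by congr sq; apply/funext => q; rewrite /ann2 /coef_poly.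
Qed.

Let split_kernel rho J : ann2 rho window_kernel =
  fun q => ann2 rho (coef_poly A J) q + ann2 rho (D J) q.
Proof.
apply/funext => q; rewrite /ann2 /ann; case: ifP => _; last by rewrite addr0.
by rewrite -mulrDr /D addrCA subrr addr0.
Qed.

Let mann F : Cmeasurable_fun setT (fun q => F (expi q.1) (c q.2)) ->
  forall rho, Cmeasurable_fun setT (ann2 rho F).
Proof. by move=> mF rho; exact: Cmeasurable_ann2. Qed.

(** The upper bound is Fatou's lemma. For the lower one, the truncated kernel has mass S_J^2, close
    to 1, and its squared distance to the full kernel is at most 1 - S_J^2. *)
Lemma kernel_mass : (sq (circ \x hyp) (ann2 0 window_kernel) = 1)%E.
Proof.
have K1 : (sq (circ \x hyp) (ann2 0 window_kernel) <= 1)%E.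
  have := sq_D 0; rewrite /S big_ord0 expr0n/= subr0; rewrite (_ : D 0 = window_kernel)//.
  by apply/funext => t; apply/funext => w; rewrite /D /coef_poly big_ord0 subr0.
apply/eqP; rewrite eq_le K1 andTb.
have [X X0 XE] : exists2 X : R, 0 <= X & sq (circ \x hyp)%E (ann2 0 window_kernel) = X%:E.
  have K0 : (0 <= sq (circ \x hyp)%E (ann2 0 window_kernel))%E.
    by apply: integral_ge0 => q _; rewrite lee_fin sqr_ge0.
  have Kf : sq (circ \x hyp)%E (ann2 0 window_kernel) \is a fin_num.
    by rewrite ge0_fin_numE// (le_lt_trans K1)// ltry.
  by exists (fine (sq (circ \x hyp)%E (ann2 0 window_kernel))); rewrite ?fine_ge0// fineK.
rewrite XE lee_fin; apply/ler_addgt0Pr => e' e'0.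
pose e := Num.min 1 (e' / 3).
have e0 : 0 < e by rewrite lt_min ltr01 divr_gt0.
have e1 : e <= 1 by rewrite ge_min lexx.
have e3 : 3 * e <= e' by rewrite mulrC -ler_pdivlMr// ge_min lexx orbT.
have e24 : 0 < e ^+ 2 / 4 by rewrite divr_gt0// exprn_gt0.
(* Then 1 - S_J^2 <= e^2 / 2, and the error (1 + 1/e) e^2 / 2 = (e^2 + e) / 2 is at most e; the
   total loss stays below 3 e <= e'. *)
have [J JP] := S_tail e24.
have hS := JP J (leqnn J).
have mDn : Cmeasurable_fun setT (fun q => - ann2 0 (D J) q).
  exact: (CmeasurableN (mann (mD J) 0)).
have := @sqD _ _ R (circ \x hyp)%E e _ _ e0 (mann mK 0) mDn.
rewrite (_ : (fun q => ann2 0 window_kernel q + _) = ann2 0 (coef_poly A J)); last first.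
  by apply/funext => q; rewrite (split_kernel 0 J) addrK.
have sqN : sq (circ \x hyp)%E (fun q => - ann2 0 (D J) q) = sq (circ \x hyp)%E (ann2 0 (D J)).
  by apply: eq_integral => q _; rewrite normcN.
move=> h; have {h sqN} : ((S J ^+ 2)%:E <= (1 + e)%:E * X%:E + (1 + e^-1)%:E * (1 - S J ^+ 2)%:E)%E.
  rewrite -sq_P; apply: le_trans h _; apply: leeD; first by rewrite XE.
  apply: lee_wpmul2l; last by apply: le_trans (sq_D J); rewrite -sqN.
  by rewrite lee_fin addr_ge0// invr_ge0 ltW.
rewrite -!EFinM -EFinD lee_fin => h.
have S0 := S_ge0 J; have S1 : S J <= 1 := b_le1 J.
have eX : X <= 1 by rewrite -lee_fin -XE.
have hS2 : 1 - S J ^+ 2 <= e ^+ 2 / 2 by nra.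
have : (1 + e^-1) * (1 - S J ^+ 2) <= (1 + e^-1) * (e ^+ 2 / 2).
  by apply: ler_wpM2l => //; rewrite addr_ge0// invr_ge0 ltW.
rewrite (_ : (1 + e^-1) * (e ^+ 2 / 2) = (e ^+ 2 + e) / 2); last first.
  by field; rewrite gt_eqF.
move: h; move: (_ * (1 - _)) => y h1 h2; nra.
Qed.

Lemma kernel_tail (rho : R) J : 0 <= rho ->
  (sq (circ \x hyp) (ann2 rho window_kernel) <=
   2%:E * \sum_(n < J) \sum_(m < J) (normc (b m) ^+ 2 * normc (b n) ^+ 2)%:E *
     ((g m * g n)%:E * qcoef (mono m) (mono n) rho) + (2 * (1 - S J ^+ 2))%:E)%E.
Proof.
move=> rho0; rewrite (split_kernel rho J).
have h := (@sqD _ _ R (circ \x hyp)%E 1 _ _ ltr01 (mann (Cmeasurable_coef_poly A J) rho) (mann (mD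
  J) rho)).
apply: le_trans h _.
rewrite invr1; apply: leeD.
  rewrite sq_coef_poly; apply: lee_wpmul2l => //; rewrite le_eqVlt; apply/orP; left; apply/eqP.
  apply: eq_bigr => n _; apply: eq_bigr => m _.
  rewrite muleA -EFinM -normc_A mulfVK// mulf_neq0// gt_eqF//.
    exact: (gam_gt0 m s0).
  exact: (gam_gt0 n s0).
rewrite EFinM; apply: lee_wpmul2l => //; apply: le_trans (sq_D J).
apply: (@sq_le _ _ R (circ \x hyp)%E _ _ (mann (mD J) rho) (mann (mD J) 0)).
move=> q; rewrite /ann2 /ann normc_ge0; case: ifP => // _; rewrite normc0; exact: normc_ge0.
Qed.

End window.

End windowed_kernel.

(** * The rotation average of the kernel *)

Section radial_kernel.
Variables (R : realType) (alpha : R).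
Hypothesis alpha0 : 0 <= alpha.
Local Notation c := (@complex_of_pair R).
Local Notation pr := (@pair_of_complex R).
Local Notation circ := (@circle_measure R).
Local Notation hyp := (@hyperbolic_measure R).
Variable u : R[i] -> R[i].
Hypothesis mu : disc_measurable u.
Local Open Scope ereal_scope.

Definition kernel_sqr (t w : R[i]) : R := ((alpha + 1) * normc (window_kernel alpha u t w) ^+ 2)%R.

Definition angular_mean (p : R * R) : \bar R := \int[circ]_t (kernel_sqr (expi t) (c p))%:E.

(** Averaged over the window angle and over the rotations of the point, the kernel depends on
    |phi_z(w)| only, hence becomes symmetric in z and w. *)
Definition radial_kernel := circle_average angular_mean.

Lemma kernel_sqr_ge0 t w : (0 <= kernel_sqr t w)%R.
Proof. by rewrite mulr_ge0 ?sqr_ge0// addr_ge0. Qed.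

Lemma measurable_kernel_sqr d (T : measurableType d) (w t : T -> R[i]) :
  Cmeasurable_fun setT w -> Cmeasurable_fun setT t -> (forall x, normc (t x) = 1%R) ->
  measurable_fun setT (fun x => kernel_sqr (t x) (w x)).
Proof.
move=> mw mt t1; apply: measurable_funM => //; apply: measurable_normc_sqr.
by apply: Cmeasurable_coef.
Qed.

Let mkq : measurable_fun [set: R * (R * R)] (fun q => (kernel_sqr (expi q.1) (c q.2))%:E).
Proof.
apply/measurable_EFinP; apply: measurable_kernel_sqr; last by move=> q; exact: normc_expi.
  by apply: (Cmeasurable_precomp (Cmeasurable_of_pair R)); exact: measurable_snd.
by apply: (Cmeasurable_precomp (Cmeasurable_expi R)); exact: measurable_fst.
Qed.

Lemma angular_mean_ge0 p : 0 <= angular_mean p.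
Proof. by apply: integral_ge0 => t _; rewrite lee_fin kernel_sqr_ge0. Qed.

Lemma measurable_angular_mean : measurable_fun setT angular_mean.
Proof.
apply: (@measurable_fun_fubini_tonelli_G _ _ _ _ _ circ _ mkq) => q.
by rewrite lee_fin kernel_sqr_ge0.
Qed.

Lemma radial_kernel_ge0 p : 0 <= radial_kernel p.
Proof. by apply: circle_average_ge0 => q; exact: angular_mean_ge0. Qed.

Lemma measurable_radial_kernel : measurable_fun setT radial_kernel.
Proof.
apply: measurable_circle_average; [exact: angular_mean_ge0|exact: measurable_angular_mean].
Qed.

Lemma radial_kernelE p : radial_kernel p = radial_kernel (pr (normc (c p))%:C%C).
Proof.
apply: circle_average_radial; [exact: angular_mean_ge0|exact: measurable_angular_mean].
Qed.

Lemma hyperbolic_circle_average (F : R * R -> \bar R) : (forall p, 0 <= F p) ->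
  measurable_fun setT F -> \int[hyp]_p circle_average F p = \int[hyp]_p F p.
Proof.
move=> F0 mF; have mF2 : measurable_fun [set: (R * R) * R] (fun q => F (pr (expi q.2 * c q.1)%R)).
  apply: (measurableT_comp mF); apply: measurable_pair_of_complex.
  apply: CmeasurableM.
    exact: (Cmeasurable_precomp (Cmeasurable_expi R) measurable_snd).
  exact: (Cmeasurable_precomp (Cmeasurable_of_pair R) measurable_fst).
rewrite /circle_average (@fubini_tonelli _ _ _ _ _ hyp circ (fun q =>
  F (pr (expi q.2 * c q.1)%R)) mF2)//.
rewrite (eq_integral (fun=> \int[hyp]_p F p)); last first.
  by move=> t _; exact: (hyperbolic_rotate (normc_expi t) F0 mF).
by rewrite (integral_cst _ measurableT) [X in _ * X](probability_setT circ) mule1.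
Qed.

Lemma radial_kernel_annulus rho :
  \int[hyp]_p (if (rho <= normc (c p))%R then radial_kernel p else 0) =
  sq (circ \x hyp) (ann2 alpha rho (window_kernel alpha u)).
Proof.
pose H p := if (rho <= normc (c p))%R then angular_mean p else 0.
have mn : measurable_fun setT (fun p : R * R => normc (c p)).
  by apply: measurable_normc; exact: Cmeasurable_of_pair.
have H0 p : 0 <= H p by rewrite /H; case: ifP => // _; exact: angular_mean_ge0.
have mH : measurable_fun setT H.
  apply: measurable_fun_ifT => //; first exact: measurable_fun_ler.
  exact: measurable_angular_mean.
transitivity (\int[hyp]_p circle_average H p).
  apply: eq_integral => p _; rewrite /radial_kernel /circle_average /H.
  have e t : normc (c (pr (expi t * c p)%R)) = normc (c p).
    by rewrite pair_of_complexK normcM normc_expi mul1r.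
  case: ifP => h; first by apply: eq_integral => t _; rewrite e h.
  by rewrite (eq_integral (fun=> 0)) ?integral0// => t _; rewrite e h.
rewrite hyperbolic_circle_average//.
pose G (q : R * (R * R)) := if (rho <= normc (c q.2))%R then (kernel_sqr (expi q.1) (c q.2))%:E
  else 0.
have G0 q : 0 <= G q by rewrite /G; case: ifP => // _; rewrite lee_fin kernel_sqr_ge0.
have mG : measurable_fun setT G.
  have mn2 : measurable_fun setT (fun q : R * (R * R) => normc (c q.2)).
    exact: (measurableT_comp mn measurable_snd).
  by apply: (measurable_fun_ifT _ mkq) => //; exact: measurable_fun_ler.
transitivity (\int[circ \x hyp]_q G q).
  rewrite (@fubini_tonelli2 _ _ _ _ _ circ hyp _ mG)//; apply: eq_integral => p _.
  rewrite /H /fubini_G /G /=; case: ifP => // _.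
  by rewrite integral0.
apply: eq_integral => q _; rewrite /G /ann2 /ann; case: ifP => _; last by rewrite normc0 expr0n.
rewrite normcM exprMn normc_real (ger0_norm (sqrtr_ge0 _)) sqr_sqrtr//.
by rewrite addr_ge0.
Qed.

End radial_kernel.

(** * Concentration of the kernel as alpha grows *)

Section kernel_concentration.
Variable R : realType.
Local Notation circ := (@circle_measure R).
Local Notation hyp := (@hyperbolic_measure R).
Implicit Types (alpha r e : R).

Lemma exp_decay r e : 0 < r < 1 -> 0 < e ->
  exists A, forall alpha, A <= alpha -> (alpha + 1) * r `^ alpha <= e.
Proof.
move=> /andP[r0 r1] e0; pose k := - ln r.
have k0 : 0 < k by rewrite oppr_gt0 ln_lt0// r0.
(* With y = k alpha / 2 one has r^alpha = exp(-2 y) and exp(y)^2 >= y^2; the bound on alpha gives e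
   y^2 >= 2 alpha >= alpha + 1. *)
exists (Num.max 1 (8 / (e * k ^+ 2))) => al; rewrite ge_max => /andP[a1 a8].
have a0 : 0 < al by lra.
have -> : r `^ al = (expR (k * al / 2) ^+ 2)^-1.
  rewrite -expRM_natl -expRN /powR gt_eqF//; congr expR.
  by rewrite /k; field.
rewrite ler_pdivrMr ?exprn_gt0 ?expR_gt0//.
have h1 : 1 + k * al / 2 <= expR (k * al / 2) by exact: expR_ge1Dx.
have y0 : 0 < k * al / 2 by rewrite divr_gt0// mulr_gt0.
have h2 : (k * al / 2) ^+ 2 <= expR (k * al / 2) ^+ 2.
  by rewrite lerXn2r ?nnegrE ?(ltW y0) ?(ltW (expR_gt0 _))//; lra.
apply: le_trans (ler_wpM2l (ltW e0) h2).
rewrite ler_pdivrMr ?mulr_gt0 ?exprn_gt0// in a8.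
rewrite (_ : e * _ = al * (e * k ^+ 2) * al / 4); last by field.
nra.
Qed.

Variable b : nat -> R[i].
Hypothesis b_le1 : forall M, \sum_(k < M) normc (b k) ^+ 2 <= 1.
Hypothesis b_sup1 : forall e, 0 < e -> exists J : nat, 1 - e < \sum_(k < J) normc (b k) ^+ 2.

(** J is fixed from b and e before alpha; what remains is a finite sum of tails with one common
    exponential rate. *)
Lemma radial_kernel_tail (rho e : R) : 0 < rho < 1 -> 0 < e -> exists A, forall alpha u,
  A <= alpha -> 0 <= alpha ->
  (forall z, normc z < 1 ->
     cvgC (psum (fun k => b k * (Num.sqrt (gam (alpha + 2) k))%:C) z) (u z)) ->
  (sq (circ \x hyp) (ann2 alpha rho (window_kernel alpha u)) <= e%:E)%E.
Proof.
move=> r01 e0; pose S M := \sum_(k < M) normc (b k) ^+ 2.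
(* This makes the truncation error 2 (1 - S_J^2) <= 4 (1 - S_J) at most e / 2. *)
have [J hJ] : exists J : nat, 1 - e / 8 < S J by apply: b_sup1; rewrite divr_gt0.
have S1 : S J <= 1 := b_le1 J.
have S0 : 0 <= S J by rewrite sumr_ge0// => k _; exact: sqr_ge0.
have hS : 2 * (1 - S J ^+ 2) <= e / 2 by nra.
pose x := rho ^+ 2 / 16; have /andP[r0 r1] := r01.
have r21 : rho ^+ 2 < 1 by rewrite expr_lt1// ltW.
have r20 : 0 < rho ^+ 2 by rewrite exprn_gt0.
have x0 : 0 < x by rewrite /x; lra.
have x1 : 4 * x < 1 by rewrite /x; lra.
pose r := (1 - 4 * x) / (1 - x) ^+ 2.
(* (1 - x)^2 exceeds 1 - 4 x by 2 x + x^2. *)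
have rr : 0 < r < 1.
  have d0 : 0 < (1 - x) ^+ 2 by rewrite exprn_gt0//; lra.
  by rewrite /r divr_gt0//= ?ltr_pdivrMr//; nra.
pose C m n := tail_const R * x ^- m * x ^- n * ((1 - x) ^- 4).
have C0 m n : 0 <= C m n.
  have x00 : 0 <= 1 - x by lra.
  rewrite /C; apply: mulr_ge0; last by rewrite invr_ge0 exprn_ge0.
  by do 2 (apply: mulr_ge0; last by rewrite invr_ge0 exprn_ge0// ltW); exact: tail_const_ge0.
pose Cs := \sum_(n < J) \sum_(m < J) C m n.
have Cs0 : 0 <= Cs by rewrite sumr_ge0// => n _; rewrite sumr_ge0.
have e' : 0 < e / (4 * (Cs + 1)) by rewrite divr_gt0// mulr_gt0// ltr_wpDl.
have [A AP] := exp_decay rr e'.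
exists A => al u Aal al0 au; apply: le_trans (kernel_tail al0 b_le1 b_sup1 au J (ltW r0)) _.
apply: (@le_trans _ _ ((e / 2)%:E + (e / 2)%:E)%E); last by rewrite -EFinD -splitr.
apply: leeD; last by rewrite lee_fin.
have b1 k : (k < J)%N -> normc (b k) ^+ 2 <= 1.
  move=> kJ; apply: le_trans S1; rewrite /S (bigD1 (Ordinal kJ))//= lerDl.
  by rewrite sumr_ge0// => i _; exact: sqr_ge0.
apply: (@le_trans _ _ (2%:E * (\sum_(n < J) \sum_(m < J) C m n * (e / (4 * (Cs + 1))))%:E)%E).
  apply: lee_wpmul2l => //; rewrite -sumEFin; apply: lee_sum => n _.
  rewrite -sumEFin; apply: lee_sum => m _.
  have q0 : (0 <= (gam (al + 2) m * gam (al + 2) n)%:E * qcoef al (@mono R m) (@mono R n) rho)%E.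
    rewrite mule_ge0 ?qcoef_ge0// lee_fin mulr_ge0// ltW// gam_gt0// ltr_wpDl//.
  apply: (@le_trans _ _ (1 * ((gam (al + 2) m * gam (al + 2) n)%:E * qcoef al (@mono R m) (@mono R
    n) rho))%E).
    apply: lee_wpmul2r => //; rewrite lee_fin.
    by apply: mulr_ile1; rewrite ?sqr_ge0 ?b1.
  rewrite mul1e; apply: le_trans (qcoef_tail al0 n m r01 (erefl : x = _)) _.
  by rewrite lee_fin; apply: ler_wpM2l; [exact: C0|exact: AP].
rewrite -EFinM lee_fin; under eq_bigr do rewrite -mulr_suml.
rewrite -mulr_suml -/Cs.
have c1 : 0 < Cs + 1 by rewrite ltr_wpDl.
rewrite (_ : 2 * _ = e / 2 * (Cs / (Cs + 1))); last by field; rewrite gt_eqF.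
by rewrite ler_piMr ?divr_ge0 ?(ltW e0)// ler_pdivrMr// mul1r lerDl.
Qed.

End kernel_concentration.

(** * Radial approximate identities *)

Section power_inequalities.
Variable R : realType.
Implicit Types (p x y : R).

Lemma powR_add_le p x y : 1 <= p -> 0 <= x -> 0 <= y ->
  (x + y) `^ p <= 2 `^ p * (x `^ p + y `^ p).
Proof.
move=> p1 x0 y0; have p0 : 0 <= p by rewrite (le_trans _ p1).
have main (a b : R) : 0 <= a -> 0 <= b -> a <= b -> (a + b) `^ p <= 2 `^ p * (a `^ p + b `^ p).
  move=> a0 b0 ab; apply: (@le_trans _ _ ((2 * b) `^ p)).
    by apply: ge0_ler_powR; rewrite ?nnegrE ?addr_ge0 ?mulr_ge0//; lra.
  by rewrite powRM//; apply: ler_wpM2l; rewrite ?powR_ge0// lerDr powR_ge0.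
have [xy|/ltW yx] := leP x y; first exact: main.
by rewrite addrC [X in _ * X]addrC; exact: main.
Qed.

End power_inequalities.

(** * Averages over pairs of points against a concentrating kernel *)

Section approximate_identity.
Variables (R : realType) (K : R -> R * R -> \bar R).
Local Notation c := (@complex_of_pair R).
Local Notation pr := (@pair_of_complex R).
Local Notation hyp := (@hyperbolic_measure R).
Local Open Scope ereal_scope.
Hypothesis K0 : forall al p, 0 <= K al p.
Hypothesis mK : forall al, measurable_fun setT (K al).
Hypothesis Krad : forall al p, K al p = K al (pr (normc (c p))%:C%C).
Hypothesis K1 : forall al, \int[hyp]_p K al p = 1.
Hypothesis Ktail : forall rho e : R, (0 < rho < 1)%R -> (0 < e)%R ->
  exists A, forall al, (A <= al)%R ->
    \int[hyp]_p (if (rho <= normc (c p))%R then K al p else 0) <= e%:E.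

Local Notation X := ((R * R) * (R * R))%type.
Implicit Types (al p : R) (z w : R * R) (q : X) (G : X -> \bar R).

Definition pair_kernel al q : \bar R := K al (pr (mobius (c q.1) (c q.2))).

Definition pair_mean al G : \bar R := \int[hyp \x hyp]_q (G q * pair_kernel al q).

Lemma Cmeasurable_fst_pair : Cmeasurable_fun setT (fun q : X => c q.1).
Proof. exact: (Cmeasurable_precomp (Cmeasurable_of_pair R) measurable_fst). Qed.

Lemma Cmeasurable_snd_pair : Cmeasurable_fun setT (fun q : X => c q.2).
Proof. exact: (Cmeasurable_precomp (Cmeasurable_of_pair R) measurable_snd). Qed.

Lemma measurable_pair_kernel al : measurable_fun setT (pair_kernel al).
Proof.
apply: (measurableT_comp (mK al)); apply: measurable_pair_of_complex.
by apply: Cmeasurable_mobius; [exact: Cmeasurable_fst_pair|exact: Cmeasurable_snd_pair].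
Qed.

Lemma normc_mobiusC (z w : R[i]) : normc (mobius z w) = normc (mobius w z).
Proof.
rewrite !mobiusE !normcM !normcV; congr (_ * _^-1)%R; first exact: normcB.
by rewrite -[RHS]normc_conj conjcB conjcM conjcK conjc1 mulrC.
Qed.

Lemma pair_kernel_swap al q : pair_kernel al (q.2, q.1) = pair_kernel al q.
Proof.
rewrite /pair_kernel Krad [RHS]Krad !pair_of_complexK; congr (K al (pr _%:C)%C).
exact: normc_mobiusC.
Qed.

Lemma pair_kernel_ge0 al q : 0 <= pair_kernel al q. Proof. exact: K0. Qed.

Let Gk0 al G : (forall q, 0 <= G q) -> forall q, 0 <= G q * pair_kernel al q.
Proof. by move=> G0 q; apply: mule_ge0 => //; exact: pair_kernel_ge0. Qed.

Lemma pair_mean_ge0 al G : (forall q, 0 <= G q) -> 0 <= pair_mean al G.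
Proof. by move=> G0; apply: integral_ge0 => q _; exact: Gk0. Qed.

Let mGk al G : measurable_fun setT G -> measurable_fun setT (fun q => G q * pair_kernel al q).
Proof. by move=> mG; apply: emeasurable_funM => //; exact: measurable_pair_kernel. Qed.

Lemma le_pair_mean al G H : measurable_fun setT G -> measurable_fun setT H ->
  (forall q, 0 <= G q) -> (forall q, G q <= H q) -> pair_mean al G <= pair_mean al H.
Proof.
move=> mG mH G0 GH; apply: ge0_le_integral => //.
- by move=> q _; exact: Gk0.
- exact: mGk.
- exact: mGk.
- by move=> q _; apply: lee_wpmul2r => //; exact: K0.
Qed.

Lemma pair_meanD al G H : measurable_fun setT G -> measurable_fun setT H ->
  (forall q, 0 <= G q) -> (forall q, 0 <= H q) ->
  pair_mean al (fun q => G q + H q) = pair_mean al G + pair_mean al H.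
Proof.
move=> mG mH G0 H0; rewrite /pair_mean -ge0_integralD//; try exact: mGk;
  try by move=> q _; exact: Gk0.
by apply: eq_integral => q _; rewrite ge0_muleDl.
Qed.

Lemma pair_meanZ al (k : R) G : measurable_fun setT G -> (forall q, 0 <= G q) -> (0 <= k)%R ->
  pair_mean al (fun q => k%:E * G q) = k%:E * pair_mean al G.
Proof.
move=> mG G0 k0; rewrite /pair_mean -ge0_integralZl//; try exact: mGk;
  try by move=> q _; exact: Gk0.
by apply: eq_integral => q _; rewrite muleA.
Qed.

Lemma pair_mean_swap al G : measurable_fun setT G -> (forall q, 0 <= G q) ->
  pair_mean al (fun q => G (q.2, q.1)) = pair_mean al G.
Proof.
move=> mG G0; have mGs : measurable_fun setT (fun q => G (q.2, q.1)).
  by apply: (measurableT_comp mG); exact: measurable_swap.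
have k0 := Gk0 al G0.
have k0' := Gk0 al (fun q => G0 (q.2, q.1)).
rewrite /pair_mean (@fubini_tonelli1 _ _ _ _ _ hyp hyp _ (mGk al mGs) k0').
rewrite (@fubini_tonelli2 _ _ _ _ _ hyp hyp _ (mGk al mG) k0).
apply: eq_integral => z _; apply: eq_integral => w _ /=.
by rewrite -(pair_kernel_swap al (z, w)).
Qed.

Lemma pair_mean_iterated al G : measurable_fun setT G -> (forall q, 0 <= G q) ->
  pair_mean al G = \int[hyp]_z \int[hyp]_w (G (z, w) * K al (pr (mobius (c z) (c w)))).
Proof.
move=> mG G0; have k0 := Gk0 al G0.
by rewrite /pair_mean (@fubini_tonelli1 _ _ _ _ _ hyp hyp _ (mGk al mG) k0).
Qed.

(** For fixed z in the disc the substitution w -> phi_z(w) preserves the hyperbolic measure and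
    decouples the two variables. *)
Lemma pair_mean_fst al (h : R * R -> \bar R) (F : R * R -> \bar R) :
  measurable_fun setT h -> (forall z, 0 <= h z) ->
  measurable_fun setT F -> (forall z, 0 <= F z) ->
  \int[hyp \x hyp]_q (h q.1 * F (pr (mobius (c q.1) (c q.2)))) =
  (\int[hyp]_z h z) * \int[hyp]_p F p.
Proof.
move=> mh h0 mF F0.
have mmob : measurable_fun setT (fun q : X => pr (mobius (c q.1) (c q.2))).
  apply: measurable_pair_of_complex.
  by apply: Cmeasurable_mobius; [exact: Cmeasurable_fst_pair|exact: Cmeasurable_snd_pair].
have mT : measurable_fun setT (fun q : X => h q.1 * F (pr (mobius (c q.1) (c q.2)))).
  apply: emeasurable_funM; first exact: (measurableT_comp mh measurable_fst).
  exact: (measurableT_comp mF mmob).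
have T0 q : 0 <= h q.1 * F (pr (mobius (c q.1) (c q.2))) by exact: mule_ge0.
have I0 : 0 <= \int[hyp]_p F p by apply: integral_ge0.
rewrite (@fubini_tonelli1 _ _ _ _ _ hyp hyp _ mT T0).
rewrite -ge0_integralZr//; apply: eq_hyperbolic.
- exact: (@measurable_fun_fubini_tonelli_F _ _ _ _ _ hyp _ mT T0).
- by apply: emeasurable_funM.
- by move=> z; apply: integral_ge0 => w _; exact: mule_ge0.
- by move=> z; exact: mule_ge0.
move=> z z1; rewrite /fubini_F/= -(hyperbolic_mobius (z1 : unit_disc (c z)) F0 mF).
rewrite ge0_integralZl//.
by apply: (measurableT_comp mF); have [] := area_cv_mobius (z1 : unit_disc (c z)).
Qed.

Lemma le_hyperbolic2 G H : measurable_fun setT G -> measurable_fun setT H ->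
  (forall q, 0 <= G q) -> (forall q, 0 <= H q) ->
  (forall q, (normc (c q.1) < 1)%R -> (normc (c q.2) < 1)%R -> G q <= H q) ->
  \int[hyp \x hyp]_q G q <= \int[hyp \x hyp]_q H q.
Proof.
move=> mG mH G0 H0 GH; rewrite (@fubini_tonelli1 _ _ _ _ _ hyp hyp _ mG G0).
rewrite (@fubini_tonelli1 _ _ _ _ _ hyp hyp _ mH H0); apply: le_hyperbolic.
- exact: (@measurable_fun_fubini_tonelli_F _ _ _ _ _ hyp _ mG G0).
- exact: (@measurable_fun_fubini_tonelli_F _ _ _ _ _ hyp _ mH H0).
- by move=> z; apply: integral_ge0.
- by move=> z; apply: integral_ge0.
move=> z z1; apply: le_hyperbolic => //.
- exact: (measurableT_comp mG (pair1_measurable z)).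
- exact: (measurableT_comp mH (pair1_measurable z)).
by move=> w w1; exact: GH.
Qed.

Lemma pair_mean_first al (h : R * R -> \bar R) : measurable_fun setT h -> (forall z, 0 <= h z) ->
  pair_mean al (fun q => h q.1) = \int[hyp]_z h z.
Proof. by move=> mh h0; rewrite /pair_mean pair_mean_fst// K1 mule1. Qed.

Lemma pair_mean_second al (h : R * R -> \bar R) : measurable_fun setT h -> (forall z, 0 <= h z) ->
  pair_mean al (fun q => h q.2) = \int[hyp]_z h z.
Proof.
move=> mh h0; rewrite -(pair_mean_first al)// -pair_mean_swap//.
exact: (measurableT_comp mh measurable_snd).
Qed.

(** * Sets asymptotically not separated by the kernel *)

Section vanishing_sets.
Implicit Types (A B : set (R * R)).

Definition separates A q : bool := (q.1 \in A) != (q.2 \in A).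

Definition indic_pair (b : X -> bool) q : \bar R := (b q)%:R%:E.

Lemma indic_pair_ge0 (b : X -> bool) q : 0 <= indic_pair b q.
Proof. by rewrite lee_fin ler0n. Qed.

Lemma measurable_mem d (T : measurableType d) (A : set T) : measurable A ->
  measurable_fun setT (fun x => x \in A).
Proof.
move=> mA; apply: (measurable_fun_bool true); rewrite setTI (_ : _ @^-1` _ = A)//.
by apply/seteqP; split => x /=; [move=> /set_mem|move=> /mem_set].
Qed.

Lemma measurable_indic_bool d (T : measurableType d) (b : T -> bool) : measurable_fun setT b ->
  measurable_fun setT (fun x => (b x)%:R%:E : \bar R).
Proof.
move=> mb; rewrite (_ : (fun x => _) = fun x => if b x then 1 else 0 : \bar R); last first.
  by apply/funext => x; case: (b x).
exact: measurable_fun_ifT.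
Qed.

Lemma measurable_separates A : measurable A -> measurable_fun setT (separates A).
Proof.
move=> mA; have m1 := measurableT_comp (measurable_mem mA) (@measurable_fst _ _ (R * R)%type (R *
  R)%type).
have m2 := measurableT_comp (measurable_mem mA) (@measurable_snd _ _ (R * R)%type (R * R)%type).
rewrite (_ : separates A = fun q => ((q.1 \in A) && ~~ (q.2 \in A)) || (~~ (q.1 \in A) && (q.2 \in
  A))).
  apply: measurable_or; apply: measurable_and => //; exact: measurable_neg.
by apply/funext => q; rewrite /separates; case: (_ \in _); case: (_ \in _).
Qed.

Let mind (b : X -> bool) : measurable_fun setT b -> measurable_fun setT (indic_pair b).
Proof. exact: measurable_indic_bool. Qed.

Definition vanishing A := forall e : R, (0 < e)%R -> exists a0, forall al, (a0 <= al)%R ->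
  pair_mean al (indic_pair (separates A)) <= e%:E.

Lemma integral_indic_mem A : measurable A -> \int[hyp]_p (p \in A)%:R%:E = hyp A.
Proof.
move=> mA; rewrite -{2}(setIT A) -(@integral_indic _ _ _ hyp _ measurableT _ mA);
  apply: eq_integral => p _.
by rewrite indicE.
Qed.

Lemma vanishingU3 A B C : measurable A -> measurable B -> measurable C ->
  (forall q, (separates A q <= separates B q + separates C q)%N) ->
  vanishing B -> vanishing C -> vanishing A.
Proof.
move=> mA mB mC h vB vC e e0; have e20 : (0 < e / 2)%R by rewrite divr_gt0.
have [A1 A1P] := vB _ e20; have [A2 A2P] := vC _ e20.
exists (Num.max A1 A2) => al; rewrite ge_max => /andP[/A1P hB /A2P hC].
rewrite (splitr e) EFinD; apply: le_trans (leeD hB hC).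
have ms D : measurable D -> measurable_fun setT (indic_pair (separates D)).
  by move=> mD; apply: mind; exact: measurable_separates.
rewrite -pair_meanD//; try exact: ms; try exact: indic_pair_ge0.
apply: le_pair_mean; try exact: ms; try exact: indic_pair_ge0.
  by apply: emeasurable_funD; exact: ms.
by move=> q; rewrite /indic_pair -EFinD lee_fin -natrD ler_nat.
Qed.

Lemma vanishingC_in A D : measurable A -> measurable D -> vanishing (A `&` D) -> vanishing D ->
  vanishing (~` A `&` D).
Proof.
move=> mA mD; apply: vanishingU3 => //; try exact: measurableI.
  by apply: measurableI => //; exact: measurableC.
move=> q; rewrite /separates !in_setI !in_setC.
by case: (_ \in A); case: (_ \in A); case: (_ \in D); case: (_ \in D).
Qed.

Lemma vanishingI_in A B D : measurable A -> measurable B -> measurable D ->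
  vanishing (A `&` D) -> vanishing (B `&` D) -> vanishing ((A `&` B) `&` D).
Proof.
move=> mA mB mD; apply: vanishingU3 => //; try exact: measurableI.
  by apply: measurableI => //; exact: measurableI.
move=> q; rewrite /separates !in_setI.
by case: (_ \in A); case: (_ \in A); case: (_ \in B); case: (_ \in B); case: (_ \in D);
  case: (_ \in D).
Qed.

Lemma bool_xor_le (a1 b1 a2 b2 : bool) : (b1 -> a1) -> (b2 -> a2) ->
  ((a1 != a2) <= (b1 != b2) + ((a1 && ~~ b1) + (a2 && ~~ b2)))%N.
Proof.
move: a1 b1 a2 b2 => [] [] [] [] // h1 h2; first [by move: (h1 isT)|by move: (h2 isT)].
Qed.

(** A pair separated by A but not by B has a point in the difference of A and B, and either
    coordinate lies there with weight at most the hyperbolic measure of the difference. *)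
Lemma vanishing_close A : measurable A ->
  (forall e : R, (0 < e)%R -> exists B, [/\ measurable B, B `<=` A, vanishing B &
     hyp (A `\` B) <= e%:E]) -> vanishing A.
Proof.
move=> mA H e e0; have e20 : (0 < e / 2)%R by rewrite divr_gt0.
have e40 : (0 < e / 4)%R by rewrite divr_gt0.
have [B [mB BA vB AB]] := H _ e40; have [A0 A0P] := vB _ e20.
exists A0 => al /A0P hB; have mD : measurable (A `\` B) by exact: measurableD.
pose f (p : R * R) : \bar R := (p \in A `\` B)%:R%:E.
have mf : measurable_fun setT f by apply: measurable_indic_bool; exact: measurable_mem.
have f0 z : 0 <= f z by rewrite lee_fin ler0n.
have mf1 : measurable_fun setT (fun q : X => f q.1) by exact: (measurableT_comp mf measurable_fst).
have mf2 : measurable_fun setT (fun q : X => f q.2) by exact: (measurableT_comp mf measurable_snd).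
have ms D : measurable D -> measurable_fun setT (indic_pair (separates D)).
  by move=> mD'; apply: mind; exact: measurable_separates.
apply: (@le_trans _ _ (pair_mean al (fun q => indic_pair (separates B) q + (f q.1 + f q.2)))).
  apply: le_pair_mean; try exact: ms; try exact: indic_pair_ge0.
    by apply: emeasurable_funD; [exact: ms|exact: emeasurable_funD].
  move=> q; rewrite /indic_pair /f -!EFinD lee_fin -!natrD ler_nat /separates !in_setD.
  have s1 : q.1 \in B -> q.1 \in A by rewrite !inE; exact: BA.
  have s2 : q.2 \in B -> q.2 \in A by rewrite !inE; exact: BA.
  exact: bool_xor_le.
rewrite pair_meanD//; try exact: ms; try exact: indic_pair_ge0; try exact: emeasurable_funD;
  try by move=> q; exact: adde_ge0.
rewrite pair_meanD// pair_mean_first// pair_mean_second//.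
rewrite (integral_indic_mem mD).
apply: (@le_trans _ _ ((e / 2)%:E + ((e / 4)%:E + (e / 4)%:E))).
  by apply: leeD => //; exact: leeD.
by rewrite -!EFinD lee_fin; lra.
Qed.

Lemma normc_mobius_ge (z w : R[i]) (d : R) : (normc z < 1)%R -> (normc w < 1)%R ->
  (d <= normc (w - z))%R -> (d / 2 <= normc (mobius z w))%R.
Proof.
move=> z1 w1 h; have d0 := denom_neq0 z1 w1.
rewrite mobiusE normcM normcV ler_pdivlMr ?normc_gt0//.
have n2 : (normc (1 - z^*%C * w) <= 2)%R.
  rewrite (le_trans (le_normcD _ _))// normc1 normcN normcM normc_conj.
  have := normc_ge0 z; have := normc_ge0 w; nra.
have [dn|dp] := ltP d 0%R.
  by rewrite (le_trans _ (normc_ge0 _))// mulr_le0_ge0 ?normc_ge0//; lra.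
apply: le_trans h; rewrite mulrAC ler_pdivrMr//.
by apply: ler_wpM2l.
Qed.

Section lipschitz.
Variable phi : R * R -> R.
Hypothesis mphi : measurable_fun setT phi.
Hypothesis lip : forall z w, (`|phi z - phi w| <= normc (c w - c z))%R.

Let O (d : R) : set (R * R) := [set z | (d < phi z)%R].

Let mO d : measurable (O d).
Proof.
rewrite (_ : O d = (fun z => (d < phi z)%R) @^-1` [set true])//.
by rewrite -[X in measurable X]setTI; apply: measurable_fun_ltr.
Qed.

Hypothesis Ofin : hyp [set z | (0 < phi z)%R] < +oo.

Let shrink (e : R) : (0 < e)%R -> exists2 d : R, (0 < d < 1)%R & hyp (O 0 `\` O d) <= e%:E.
Proof.
move=> e0; pose F n := O 0 `\` O (n.+2%:R^-1)%R.
have mF n : measurable (F n) by apply: measurableD; exact: mO.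
have niF : nonincreasing_seq F.
  move=> m n mn; apply/subsetPset => z [z0 zn]; split=> // zm; apply: zn.
  rewrite /O /mkset; apply: le_lt_trans zm; rewrite lef_pV2 ?posrE// ler_nat.
  by rewrite !ltnS.
have F0 : \bigcap_n F n = set0.
  apply/seteqP; split => // z Fz; have [z0 _] := Fz 0%N I.
  have := archi_boundP (ltW (_ : (0 < (phi z)^-1)%R)); rewrite invr_gt0 => /(_ z0) h.
  have [_] := Fz (Num.bound (phi z)^-1) I; apply.
  rewrite /O /mkset -[ltRHS]invrK ltf_pV2 ?posrE ?invr_gt0//.
  by rewrite (lt_le_trans h)// ler_nat -addn2 leq_addr.
have := @nonincreasing_cvg_mu _ _ _ hyp F.
rewrite F0 measure0 => H.
have {}H : hyp \o F @ \oo --> 0.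
  apply: H => //; apply: le_lt_trans Ofin; apply: le_measure; rewrite ?inE//.
    exact: mO.
  by move=> z [].
have [n nP] : exists n, (hyp (F n) <= e%:E).
  apply: contrapT => /forallNP hn; have : e%:E <= limn (hyp \o F).
    apply: lime_ge; first by apply/cvg_ex; exists 0.
    by apply: nearW => n; have /negP := hn n; rewrite -ltNge => /ltW.
  by rewrite (cvg_lim _ H)// lee_fin leNgt e0.
exists (n.+2%:R^-1)%R => //.
by rewrite invr_gt0 ltr0n/= invf_lt1// ltr1n.
Qed.

(** A separated pair either has a point in the thin layer 0 < phi <= d, of small measure, or its
    points are at distance at least d, hence |phi_z(w)| >= d / 2, where the kernel has a small
    tail. *)
Lemma vanishing_lipschitz : vanishing [set z | (0 < phi z)%R].
Proof.
move=> e e0; have e40 : (0 < e / 4)%R by rewrite divr_gt0.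
have [d /andP[d0 d1] hd] := shrink e40.
pose V := fine (hyp (O 0)).
have V0 : (0 <= V)%R by rewrite fine_ge0.
have VE : hyp (O 0) = V%:E by rewrite fineK// ge0_fin_numE.
have t0 : (0 < e / (4 * (V + 1)))%R by rewrite divr_gt0// mulr_gt0// ltr_wpDl.
have d2 : (0 < d / 2 < 1)%R by apply/andP; split; lra.
have [a0 a0P] := Ktail d2 t0.
exists a0 => al /a0P hK.
pose G q : \bar R := ((q.1 \in O 0) && (q.2 \notin O 0))%:R%:E.
have mem0 := measurable_mem (mO 0).
have m1 := measurableT_comp mem0 (@measurable_fst _ _ (R * R)%type (R * R)%type).
have m2 := measurableT_comp mem0 (@measurable_snd _ _ (R * R)%type (R * R)%type).
have mG : measurable_fun setT G.
  by apply: measurable_indic_bool; apply: measurable_and => //; exact: measurable_neg.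
have G0 q : 0 <= G q by rewrite lee_fin ler0n.
have mGs : measurable_fun setT (fun q : X => G (q.2, q.1)).
  by apply: (measurableT_comp mG); exact: measurable_swap.
(* By the symmetry of the kernel it suffices to treat pairs whose first point lies in the set. *)
suff hG : pair_mean al G <= (e / 2)%:E.
  apply: (@le_trans _ _ (pair_mean al (fun q => G q + G (q.2, q.1)))).
    apply: le_pair_mean => //; try exact: indic_pair_ge0.
    - by apply: measurable_indic_bool; apply: measurable_separates; exact: mO.
    - exact: emeasurable_funD.
    move=> q; rewrite /indic_pair /G -EFinD lee_fin -natrD ler_nat /separates /=.
    by rewrite -/(O 0); case: (q.1 \in _); case: (q.2 \in _).
  rewrite pair_meanD// pair_mean_swap//.
  by rewrite (splitr e) EFinD; exact: leeD.
pose D := O 0 `\` O d.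
have mD : measurable D by apply: measurableD; exact: mO.
pose f (z : R * R) : \bar R := (z \in D)%:R%:E.
have mf : measurable_fun setT f by apply: measurable_indic_bool; exact: measurable_mem.
have f0 z : 0 <= f z by rewrite lee_fin ler0n.
pose h (z : R * R) : \bar R := (z \in O 0)%:R%:E.
have mh : measurable_fun setT h by apply: measurable_indic_bool.
have h0 z : 0 <= h z by rewrite lee_fin ler0n.
pose F (z : R * R) := if (d / 2 <= normc (c z))%R then K al z else 0.
have mF : measurable_fun setT F.
  apply: measurable_fun_ifT => //.
  by apply: measurable_fun_ler => //; apply: measurable_normc; exact: Cmeasurable_of_pair.
have F0 z : 0 <= F z by rewrite /F; case: ifP => // _; exact: K0.
have mf1 : measurable_fun setT (fun q : X => f q.1) by exact: (measurableT_comp mf measurable_fst).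
have mhF : measurable_fun setT (fun q : X => h q.1 * F (pr (mobius (c q.1) (c q.2)))).
  apply: emeasurable_funM; first exact: (measurableT_comp mh measurable_fst).
  apply: (measurableT_comp mF); apply: measurable_pair_of_complex.
  by apply: Cmeasurable_mobius; [exact: Cmeasurable_fst_pair|exact: Cmeasurable_snd_pair].
have mfK : measurable_fun setT (fun q : X => f q.1 * pair_kernel al q) by exact: mGk.
have fK0 q : 0 <= f q.1 * pair_kernel al q by exact: (Gk0 al (fun q => f0 q.1)).
have step : pair_mean al G <= \int[hyp \x hyp]_q (f q.1 * pair_kernel al q) +
    \int[hyp \x hyp]_q (h q.1 * F (pr (mobius (c q.1) (c q.2)))).
  rewrite -ge0_integralD//; try (by move=> q _; exact: mule_ge0); try (by move=> q _; exact: fK0).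
  apply: le_hyperbolic2.
  - exact: mGk.
  - exact: emeasurable_funD.
  - exact: Gk0.
  - by move=> q; apply: adde_ge0; [exact: fK0|exact: mule_ge0].
  move=> q q1 q2; rewrite /G /f /h.
  have [qO|qO] := boolP (q.1 \in O 0); last first.
    by rewrite /= mul0e adde_ge0// mule_ge0// ?lee_fin//; exact: pair_kernel_ge0.
  have [qn|qn] := boolP (q.2 \notin O 0); last first.
    by rewrite /= mul0e adde_ge0// mule_ge0// ?lee_fin ?ler0n//; exact: pair_kernel_ge0.
  have [qd|qd] := boolP (q.1 \in O d); last first.
    by rewrite in_setD qO qd/= leeDl// mule_ge0.
  rewrite /= !mul1e (_ : F _ = pair_kernel al q); last first.
    rewrite /F /pair_kernel ifT// pair_of_complexK; apply: normc_mobius_ge => //.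
    apply: le_trans (lip q.1 q.2); apply: le_trans (ler_norm _).
    move: qd qn; rewrite inE notin_setE /O /mkset => qd /negP; rewrite -leNgt => qn; lra.
  by rewrite leeDr// mule_ge0// ?lee_fin ?ler0n//; exact: pair_kernel_ge0.
apply: le_trans step _.
rewrite -/(pair_mean al (fun q => f q.1)) pair_mean_first// (integral_indic_mem mD).
rewrite pair_mean_fst// (integral_indic_mem (mO 0)) VE.
apply: (@le_trans _ _ ((e / 4)%:E + (V * (e / (4 * (V + 1))))%:E)).
  apply: leeD => //; rewrite EFinM; apply: lee_wpmul2l => //.
rewrite -EFinD lee_fin.
have V1 : (0 < V + 1)%R by rewrite ltr_wpDl.
rewrite (_ : V * _ = e / 4 * (V / (V + 1)))%R; last by field; rewrite gt_eqF.
have : (V / (V + 1) <= 1)%R by rewrite ler_pdivrMr// mul1r lerDl.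
move: (V / (V + 1))%R => y y1; nra.
Qed.

End lipschitz.

Definition ball0 (r : R) : set (R * R) := [set z | (normc (c z) < r)%R].

Let mnormc : measurable_fun setT (fun z : R * R => normc (c z)).
Proof. by apply: measurable_normc; exact: Cmeasurable_of_pair. Qed.

Lemma measurable_ball0 r : measurable (ball0 r).
Proof.
have mn := mnormc; rewrite (_ : ball0 r = (fun z => (normc (c z) < r)%R) @^-1` [set true])//.
by rewrite -[X in measurable X]setTI; apply: measurable_fun_ltr.
Qed.

Lemma hyperbolic_ball0_lty r : (0 < r < 1)%R -> hyp (ball0 r) < +oo.
Proof.
move=> /andP[r0 r1]; have mn := mnormc; have r01 : (0 <= r < 1)%R by rewrite (ltW r0).
apply: le_lt_trans (hyperbolic_ball_lty r01); apply: le_measure; rewrite ?inE.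
- exact: measurable_ball0.
- rewrite (_ : [set p | _] = (fun z => (normc (c z) <= r)%R || (1 <= normc (c z))%R) @^-1` [set
  true])//.
  by rewrite -[X in measurable X]setTI; apply: measurable_or => //; exact: measurable_fun_ler.
by move=> z zr; rewrite /mkset (ltW zr).
Qed.

Lemma lipschitz_normc (z w : R * R) : (`|normc (c z) - normc (c w)| <= normc (c w - c z))%R.
Proof.
rewrite normcB ler_norml; apply/andP; split.
  rewrite lerNl opprB lerBlDr -[X in (normc X <= _)%R](subrK (c z)).
  by rewrite [leRHS]addrC [X in (_ <= _ + X)%R]normcB addrC le_normcD.
by rewrite lerBlDr -[X in (normc X <= _)%R](subrK (c w)) le_normcD.
Qed.

Lemma vanishing_ball0 r : (0 < r < 1)%R -> vanishing (ball0 r).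
Proof.
move=> r01; have mn := mnormc; have -> : ball0 r = [set z | (0 < r - normc (c z))%R].
  by apply/seteqP; split => z /=; rewrite /ball0 /mkset subr_gt0.
have e : [set z | (0 < r - normc (c z))%R] = ball0 r.
  by apply/seteqP; split => z /=; rewrite /ball0 /mkset subr_gt0.
apply: vanishing_lipschitz.
- exact: measurable_funB.
- by move=> z w; rewrite opprB addrC subrKA distrC lipschitz_normc.
- by rewrite e hyperbolic_ball0_lty.
Qed.

Lemma vanishing_halfplane (g : R * R -> R) a r : measurable_fun setT g ->
  (forall z w, (`|g z - g w| <= normc (c w - c z))%R) -> (0 < r < 1)%R ->
  vanishing ([set z | (g z < a)%R] `&` ball0 r).
Proof.
(* The minimum of two 1-Lipschitz functions is 1-Lipschitz, and its positivity set is the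
   intersection. *)
move=> mg lip r01; have mn := mnormc; pose phi z := Num.min (a - g z)%R (r - normc (c z))%R.
have e : [set z | (0 < phi z)%R] = [set z | (g z < a)%R] `&` ball0 r.
  apply/seteqP; split => z /=; rewrite /phi lt_min !subr_gt0; first by case/andP.
  by case=> -> ->.
rewrite -e; apply: vanishing_lipschitz.
- by apply: measurable_minr; exact: measurable_funB.
- move=> z w; have h1 := lip z w; have h2 := lipschitz_normc z w.
  rewrite /phi; move: (normc (c w - c z)%R) (g z) (g w) (normc (c z)) (normc (c w)) h1 h2 =>
    k x y x' y'.
  rewrite !ler_norml => /andP[u1 u2] /andP[v1 v2].
  by rewrite /Num.min; do 2 case: ltP => ?; apply/andP; split; lra.
rewrite e; apply: le_lt_trans (hyperbolic_ball0_lty r01); apply: le_measure; rewrite ?inE.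
- apply: measurableI; last exact: measurable_ball0.
  rewrite (_ : [set z | _] = (fun z => (g z < a)%R) @^-1` [set true])//.
  by rewrite -[X in measurable X]setTI; apply: measurable_fun_ltr.
- exact: measurable_ball0.
- by move=> z [].
Qed.

(** Discs of radius r < 1 have finite hyperbolic measure. Intersecting with them makes the class
    stable under complements and countable unions, where continuity of the measure from above is
    used. *)
Definition locally_vanishing A := measurable A /\ forall r, (0 < r < 1)%R ->
  vanishing (A `&` ball0 r).

Lemma locally_vanishingT : locally_vanishing setT.
Proof. by split=> // r r01; rewrite setTI; exact: vanishing_ball0. Qed.

Lemma locally_vanishingC A : locally_vanishing A -> locally_vanishing (~` A).
Proof.
move=> [mA vA]; split=> [|r r01]; first exact: measurableC.
by apply: vanishingC_in; [|exact: measurable_ball0|exact: vA|exact: vanishing_ball0].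
Qed.

Lemma locally_vanishingI A B : locally_vanishing A -> locally_vanishing B ->
  locally_vanishing (A `&` B).
Proof.
move=> [mA vA] [mB vB]; split=> [|r r01]; first exact: measurableI.
by apply: vanishingI_in => //; [exact: measurable_ball0|exact: vA|exact: vB].
Qed.

Lemma locally_vanishingU A B : locally_vanishing A -> locally_vanishing B ->
  locally_vanishing (A `|` B).
Proof.
move=> vA vB; rewrite -(setCK (A `|` B)) setCU.
by apply: locally_vanishingC; apply: locally_vanishingI; exact: locally_vanishingC.
Qed.

Lemma vanishing_limit A (F : nat -> set (R * R)) : measurable A -> hyp A < +oo ->
  (forall n, measurable (F n)) -> (forall n, vanishing (F n)) -> nondecreasing_seq F ->
  (forall n, F n `<=` A) -> hyp (A `\` \bigcup_n F n) = 0 -> vanishing A.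
Proof.
move=> mA Afin mF vF ndF FA A0; apply: vanishing_close => // e e0.
have mU : measurable (\bigcup_n F n) by exact: bigcup_measurable.
pose G n := A `\` F n.
have mG n : measurable (G n) by exact: measurableD.
have capG : \bigcap_n G n = A `\` \bigcup_n F n.
  apply/seteqP; split=> z.
    by move=> h; split=> [|[n _ Fn]]; [by have [] := h 0%N I|have [_] := h n I; exact].
  by move=> [Az nU] n _; split=> // Fn; apply: nU; exists n.
have H : hyp \o G @ \oo --> 0.
  rewrite -[X in _ --> X]A0 -capG; apply: nonincreasing_cvg_mu => //; rewrite ?capG.
  - apply: le_lt_trans Afin; apply: le_measure; rewrite ?inE//.
    by move=> z [].
  - exact: measurableD.
  - move=> m n mn; apply/subsetPset => z [Az nFn]; split=> // Fm; apply: nFn.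
    by have /subsetPset := ndF _ _ mn; exact.
have [n nP] : exists n, hyp (G n) <= e%:E.
  apply: contrapT => /forallNP hn; have : e%:E <= limn (hyp \o G).
    apply: lime_ge; first by apply/cvg_ex; exists 0.
    by apply: nearW => n; have /negP := hn n; rewrite -ltNge => /ltW.
  by rewrite (cvg_lim _ H)// lee_fin leNgt e0.
by exists (F n).
Qed.

Lemma locally_vanishing_bigcup (A : nat -> set (R * R)) :
  (forall n, locally_vanishing (A n)) -> locally_vanishing (\bigcup_n A n).
Proof.
move=> vA; have mA n : measurable (A n) := (vA n).1.
split=> [|r r01]; first exact: bigcup_measurable.
pose U n := \bigcup_(i < n) A i.
have mU n : measurable (U n) by apply: bigcup_measurable.
have vU n : locally_vanishing (U n).
  elim: n => [|n ih].
    by rewrite /U bigcup_mkord big_ord0 -setCT; apply: locally_vanishingC;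
      exact: locally_vanishingT.
  rewrite /U bigcup_mkord big_ord_recr/= -bigcup_mkord.
  exact: locally_vanishingU.
apply: (@vanishing_limit _ (fun n => U n `&` ball0 r)).
- by apply: measurableI; [exact: bigcup_measurable|exact: measurable_ball0].
- apply: le_lt_trans (hyperbolic_ball0_lty r01); apply: le_measure; rewrite ?inE.
  + by apply: measurableI; [exact: bigcup_measurable|exact: measurable_ball0].
  + exact: measurable_ball0.
  + by move=> z [].
- by move=> n; apply: measurableI => //; exact: measurable_ball0.
- by move=> n; exact: (vU n).2.
- move=> m n mn; apply/subsetPset => z [[i /= im Ai] zr]; split=> //.
  by exists i => //=; exact: (leq_trans im).
- by move=> n z [[i _ Ai] zr]; split=> //; exists i.
rewrite (_ : _ `\` _ = set0) ?measure0//; apply/seteqP; split => // z [[[i _ Ai] zr]]; apply.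
by exists i.+1 => //; split=> //; exists i => /=.
Qed.

(** The two coordinates are 1-Lipschitz, and preimages of rays under them generate the measurable
    sets of the plane. *)
Lemma locally_vanishing_measurable A : measurable A -> locally_vanishing A.
Proof.
have strip (f : R * R -> R) : measurable_fun setT f ->
    (forall z w, (`|f z - f w| <= normc (c w - c z))%R) ->
    forall B : set R, measurable B -> locally_vanishing (f @^-1` B).
  move=> mf lip B mB'; have mB : (@RGenInftyO.G R).-sigma.-measurable B.
    by rewrite -RGenInftyO.measurableE; exact: mB'.
  suff H : <<s @RGenInftyO.G R>> `<=` [set B | locally_vanishing (f @^-1` B)] by exact: (H B mB).
  apply: smallest_sub.
  - split.
    + by rewrite /mkset preimage_set0 -setCT; apply: locally_vanishingC; exact: locally_vanishingT.
    + by move=> C vC; rewrite /mkset setTD -preimage_setC; exact: locally_vanishingC.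
    + by move=> C vC; rewrite /mkset preimage_bigcup; exact: locally_vanishing_bigcup.
  - move=> _ [a ->]; rewrite /mkset; have -> : f @^-1` `]-oo, a[%classic = [set z | (f z < a)%R].
      by apply/seteqP; split => z /=; rewrite in_itv.
    split=> [|r r01]; last exact: vanishing_halfplane.
    rewrite (_ : [set z | _] = (fun z => (f z < a)%R) @^-1` [set true])//.
    by rewrite -[X in measurable X]setTI; apply: measurable_fun_ltr.
rewrite measurable_prod_measurableType => mA.
apply: (@smallest_sub _ (sigma_algebra setT) _ locally_vanishing _ _ A mA).
- split.
  + by rewrite -setCT; apply: locally_vanishingC; exact: locally_vanishingT.
  + by move=> C vC; rewrite setTD; exact: locally_vanishingC.
  + exact: locally_vanishing_bigcup.
move=> _ [B mB] [C mC] <-; rewrite (_ : B `*` C = (fst @^-1` B) `&` (snd @^-1` C))//.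
apply: locally_vanishingI.
- apply: strip mB => // z w.
  by rewrite distrC; exact: (le_Re_normc (c w - c z)%R).
- apply: strip mC => // z w.
  by rewrite distrC; exact: (le_Im_normc (c w - c z)%R).
Qed.

Lemma vanishing_finite A : measurable A -> hyp A < +oo -> vanishing A.
Proof.
move=> mA Afin; have vA := locally_vanishing_measurable mA.
(* A is exhausted by its intersections with these discs; the rest lies outside the unit disc and is
   a null set. *)
pose r n := (1 - n.+2%:R^-1)%R : R.
have r01 n : (0 < r n < 1)%R.
  by rewrite /r subr_gt0 gtrBl invr_gt0 ltr0n/= invf_lt1// ltr1n.
apply: (@vanishing_limit _ (fun n => A `&` ball0 (r n))) => //.
- by move=> n; apply: measurableI => //; exact: measurable_ball0.
- by move=> n; exact: vA.2.
- move=> m n mn; apply/subsetPset => z [Az zr]; split=> //; apply: lt_le_trans zr _.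
  by rewrite /r lerD2l lerN2 lef_pV2 ?posrE// ler_nat !ltnS.
have mB : measurable (A `\` \bigcup_n (A `&` ball0 (r n))).
  apply: measurableD => //; apply: bigcup_measurable => n _.
  by apply: measurableI => //; exact: measurable_ball0.
rewrite -(integral_indic_mem mB).
transitivity (\int[hyp]_p (cst 0 p)); last by rewrite integral0.
apply: eq_hyperbolic => //.
- by apply: measurable_indic_bool; exact: measurable_mem.
move=> z z1; rewrite /cst (_ : (z \in _) = false)//; apply/negbTE; rewrite notin_setE => -[Az];
  apply.
have d0 : (0 < 1 - normc (c z))%R by rewrite subr_gt0.
exists (Num.bound (1 - normc (c z))^-1) => //; split=> //.
rewrite /ball0 /mkset /r ltrBrDl -ltrBrDr -[ltRHS]invrK ltf_pV2 ?posrE ?invr_gt0//.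
rewrite (lt_le_trans (archi_boundP _)) ?invr_ge0 ?(ltW d0)// ler_nat -addn2.
exact: leq_addr.
Qed.

End vanishing_sets.

(** * Mean oscillation of p-integrable functions *)

Section vanishing_functions.
Variable p : R.
Hypothesis p1 : (1 <= p)%R.
Implicit Types (f h : R * R -> R[i]).

Let p0 : (0 <= p)%R. Proof. by rewrite (le_trans _ p1). Qed.

Definition power (k : R[i]) : \bar R := (normc k `^ p)%:E.

Definition power_int f : \bar R := \int[hyp]_z power (f z).

Definition oscillation al f : \bar R := pair_mean al (fun q => power (f q.2 - f q.1)%R).

Definition small f := forall e : R, (0 < e)%R -> exists a0, forall al, (a0 <= al)%R ->
  oscillation al f <= e%:E.

Lemma power_ge0 k : 0 <= power k. Proof. by rewrite lee_fin powR_ge0. Qed.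

Lemma powerD k l : power (k + l)%R <= (2 `^ p)%:E * (power k + power l).
Proof.
rewrite /power -EFinD -EFinM lee_fin; apply: (@le_trans _ _ ((normc k + normc l) `^ p)%R).
  by apply: (ge0_ler_powR p0); rewrite ?nnegrE ?addr_ge0 ?normc_ge0// le_normcD.
by apply: powR_add_le => //; exact: normc_ge0.
Qed.

Lemma powerN k : power (- k)%R = power k.
Proof. by rewrite /power normcN. Qed.

Lemma measurable_power d (T : measurableType d) (f : T -> R[i]) : Cmeasurable_fun setT f ->
  measurable_fun setT (fun x => power (f x)).
Proof.
move=> mf; apply/measurable_EFinP.
by apply: (measurableT_comp (measurable_powR _)); exact: measurable_normc.
Qed.

Let mdiff f : Cmeasurable_fun setT f -> Cmeasurable_fun setT (fun q : X => f q.2 - f q.1)%R.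
Proof.
move=> mf; apply: CmeasurableB.
  exact: (Cmeasurable_precomp mf measurable_snd).
exact: (Cmeasurable_precomp mf measurable_fst).
Qed.

Let twop : (0 <= 2 `^ p)%R. Proof. exact: powR_ge0. Qed.

Lemma oscillation_le al f : Cmeasurable_fun setT f ->
  oscillation al f <= (2 `^ p)%:E * (power_int f + power_int f).
Proof.
move=> mf; have mp := measurable_power mf.
have m1 : measurable_fun setT (fun q : X =>
  power (f q.1)) by exact: (measurableT_comp mp measurable_fst).
have m2 : measurable_fun setT (fun q : X =>
  power (f q.2)) by exact: (measurableT_comp mp measurable_snd).
have -> : power_int f + power_int f = pair_mean al (fun q => power (f q.2) + power (f q.1)).
  rewrite pair_meanD//; try (by move=> q; exact: power_ge0).
  rewrite (pair_mean_second al mp); last by move=> z; exact: power_ge0.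
  by rewrite (pair_mean_first al mp)// => z; exact: power_ge0.
rewrite -pair_meanZ//.
- apply: le_pair_mean.
  + by apply: measurable_power; exact: mdiff.
  + by apply: measurable_funeM; exact: emeasurable_funD.
  + by move=> q; exact: power_ge0.
  + by move=> q; rewrite -[power (f q.1)]powerN; exact: powerD.
- exact: emeasurable_funD.
- by move=> q; rewrite adde_ge0 ?power_ge0.
Qed.

Lemma oscillationD al f h : Cmeasurable_fun setT f -> Cmeasurable_fun setT h ->
  oscillation al (fun z => f z + h z)%R <= (2 `^ p)%:E * (oscillation al f + oscillation al h).
Proof.
move=> mf mh; have m1 := measurable_power (mdiff mf); have m2 := measurable_power (mdiff mh).
rewrite /oscillation -pair_meanD//; try (by move=> q; exact: power_ge0).
rewrite -pair_meanZ//.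
- apply: le_pair_mean.
  + by apply: measurable_power; exact: (mdiff (CmeasurableD mf mh)).
  + by apply: measurable_funeM; exact: emeasurable_funD.
  + by move=> q; exact: power_ge0.
  + move=> q; rewrite (_ : f q.2 + h q.2 - (f q.1 + h q.1) = (f q.2 - f q.1) + (h q.2 - h q.1))%R;
    last by ring.
    exact: powerD.
- exact: emeasurable_funD.
- by move=> q; rewrite adde_ge0 ?power_ge0.
Qed.

Lemma oscillationZ al k f : Cmeasurable_fun setT f ->
  oscillation al (fun z => k * f z)%R = power k * oscillation al f.
Proof.
move=> mf; rewrite /oscillation /power -pair_meanZ ?powR_ge0//.
- by congr (pair_mean al _); apply/funext => q; rewrite -mulrBr normcM powRM ?normc_ge0// EFinM.
- by apply: measurable_power; exact: mdiff.
- by move=> q; exact: power_ge0.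
Qed.

Let twop_gt0 : (0 < 2 `^ p)%R. Proof. by rewrite powR_gt0. Qed.

Lemma smallD f h : Cmeasurable_fun setT f -> Cmeasurable_fun setT h ->
  small f -> small h -> small (fun z => f z + h z)%R.
Proof.
move=> mf mh sf sh e e0.
have e20 : (0 < e / (2 * 2 `^ p))%R by rewrite divr_gt0// mulr_gt0.
have [a1 A1] := sf _ e20; have [a2 A2] := sh _ e20.
exists (Num.max a1 a2) => al; rewrite ge_max => /andP[/A1 h1 /A2 h2].
apply: le_trans (oscillationD al mf mh) _.
apply: (@le_trans _ _ ((2 `^ p)%:E * ((e / (2 * 2 `^ p))%:E + (e / (2 * 2 `^ p))%:E))).
  by apply: lee_wpmul2l; [rewrite lee_fin; exact: twop|exact: (leeD h1 h2)].
rewrite -EFinD -EFinM lee_fin le_eqVlt; apply/orP; left; apply/eqP.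
by move: twop_gt0; move: (2 `^ p)%R => y y0; field; rewrite gt_eqF.
Qed.

Lemma smallZ k f : Cmeasurable_fun setT f -> small f -> small (fun z => k * f z)%R.
Proof.
move=> mf sf e e0; have k0 : (0 < normc k `^ p + 1)%R by rewrite ltr_wpDl ?powR_ge0.
have [a1 A1] := sf _ (divr_gt0 e0 k0); exists a1 => al /A1 h.
rewrite oscillationZ//; apply: (@le_trans _ _ ((normc k `^ p)%:E * (e / (normc k `^ p + 1))%:E)).
  by apply: lee_wpmul2l => //; rewrite lee_fin powR_ge0.
rewrite -EFinM lee_fin mulrCA ler_piMr ?(ltW e0)// ler_pdivrMr// mul1r lerDl//.
Qed.

Lemma small0 : small (fun=> 0%R).
Proof.
move=> e e0; exists 0%R => al _; rewrite /oscillation.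
rewrite (_ : pair_mean al _ = 0) ?lee_fin ?ltW//.
rewrite /pair_mean (eq_integral (fun=> 0)) ?integral0// => q _.
by rewrite /power subr0 normc0 powR0 ?mul0e// gt_eqF// (lt_le_trans _ p1).
Qed.

Lemma small_sum n (F : nat -> R * R -> R[i]) : (forall k, Cmeasurable_fun setT (F k)) ->
  (forall k, small (F k)) -> small (fun z => \sum_(k < n) F k z)%R.
Proof.
move=> mF sF; elim: n => [|n ih].
  rewrite (_ : (fun z => _) = fun=> 0%R); first exact: small0.
  by apply/funext => z; rewrite big_ord0.
rewrite (_ : (fun z => _) = fun z => (\sum_(k < n) F k z + F n z)%R); last first.
  by apply/funext => z; rewrite big_ord_recr.
apply: (smallD _ (mF n) ih (sF n)).
by apply: (@Cmeasurable_sum _ _ _ _ n F) => k; exact: mF.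
Qed.

Lemma small_close f : Cmeasurable_fun setT f ->
  (forall e : R, (0 < e)%R -> exists h, [/\ Cmeasurable_fun setT h, small h &
     power_int (fun z => f z - h z)%R <= e%:E]) -> small f.
Proof.
move=> mf H e e0; pose P := (2 `^ p)%R; have P0 : (0 < P)%R := twop_gt0.
have P1 : 0 <= P%:E by rewrite lee_fin ltW.
have e1 : (0 < e / (2 * P))%R by rewrite divr_gt0// mulr_gt0.
have e2 : (0 < e / (4 * P ^+ 2))%R by rewrite divr_gt0// mulr_gt0// exprn_gt0.
have [h [mh sh fh]] := H _ e2; have [a0 A0] := sh _ e1.
have mfh : Cmeasurable_fun setT (fun z => f z - h z)%R by exact: CmeasurableB.
exists a0 => al /A0 hal.
have -> : f = (fun z => (f z - h z) + h z)%R by apply/funext => z; rewrite subrK.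
apply: le_trans (oscillationD al mfh mh) _.
apply: (@le_trans _ _ (P%:E * (P%:E * ((e / (4 * P ^+ 2))%:E + (e / (4 * P ^+ 2))%:E) + (e / (2 *
  P))%:E))).
  apply: lee_wpmul2l => //; apply: leeD => //.
  apply: le_trans (oscillation_le al mfh) _; apply: lee_wpmul2l => //.
  exact: (leeD fh fh).
rewrite -!(EFinD, EFinM) lee_fin le_eqVlt; apply/orP; left; apply/eqP.
by move: (P) P0 => y y0; field; rewrite gt_eqF.
Qed.

Definition Cindic (A : set (R * R)) z : R[i] := (\1_A z)%:C%C.

Lemma Cmeasurable_Cindic A : measurable A -> Cmeasurable_fun setT (Cindic A).
Proof. by move=> mA; apply: Cmeasurable_real; exact: measurable_indic. Qed.

Lemma small_indic A : measurable A -> hyp A < +oo -> small (Cindic A).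
Proof.
move=> mA Afin e e0; have [a0 A0] := vanishing_finite mA Afin e0.
exists a0 => al /A0; congr (pair_mean al _ <= _); apply/funext => q.
rewrite /indic_pair /separates /power /Cindic -rmorphB normc_real !indicE.
have pp : p != 0%R by rewrite gt_eqF// (lt_le_trans _ p1).
by case: (q.1 \in A); case: (q.2 \in A);
  rewrite ?subrr ?subr0 ?sub0r ?normrN ?normr0 ?normr1 ?powR0 ?powR1.
Qed.

Section nonnegative.
Variable h : R * R -> R.
Hypothesis mh : measurable_fun setT h.
Hypothesis h0 : forall z, (0 <= h z)%R.
Hypothesis hfin : \int[hyp]_z (h z `^ p)%:E < +oo.

(** k^p times the measure of A is at most the integral of h^p, so for k > 0 the set A has finite
    measure. *)
Let small_level (k : R) (A : set (R * R)) : measurable A -> (0 <= k)%R ->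
  (forall z, (k * \1_A z <= h z)%R) -> small (fun z => (k%:C)%C * Cindic A z)%R.
Proof.
move=> mA k0 kh; have [->|kn0] := eqVneq k 0%R.
  rewrite (_ : (fun z => _) = fun=> 0%R); first exact: small0.
  by apply/funext => z; rewrite mul0r.
have kp : (0 < k `^ p)%R by rewrite powR_gt0// lt_def kn0.
apply: smallZ; first exact: Cmeasurable_Cindic.
apply: small_indic => //.
have : (k `^ p)%:E * hyp A < +oo.
  apply: le_lt_trans hfin; rewrite -(integral_indic_mem mA).
  have m1 : measurable_fun setT (fun z => (z \in A)%:R%:E : \bar R).
    by apply: measurable_indic_bool; exact: measurable_mem.
  rewrite -ge0_integralZl//; try by rewrite lee_fin ltW.
  apply: ge0_le_integral => //.
  - by move=> z _; rewrite mule_ge0// lee_fin ltW.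
  - exact: measurable_funeM.
  - apply/measurable_EFinP; exact: (measurableT_comp (measurable_powR _)).
  move=> z _; rewrite -EFinM lee_fin; have := kh z; rewrite indicE.
  case: (z \in A); rewrite ?mulr0 ?mulr1 ?powR_ge0// => kz.
  by apply: (ge0_ler_powR p0); rewrite ?nnegrE.
have := measure_ge0 hyp A; move: (hyp A) => y; case: y => [r _ _|_|//]; first exact: ltry.
by rewrite gt0_muley.
Qed.

Let D_ n k := dyadic_approx setT (EFin \o h) n k.
Let mh' : measurable_fun setT (EFin \o h). Proof. exact/measurable_EFinP. Qed.

Let h0' z : [set: R * R] z -> 0 <= (EFin \o h) z.
Proof. by move=> _; rewrite lee_fin. Qed.

Let mD n k : measurable (D_ n k).
Proof.
rewrite /D_ /dyadic_approx; case: ifPn => // kn; rewrite -preimage_comp.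
by apply: mh' => //; apply/measurable_image_EFin; exact: measurable_itv.
Qed.

Let mI n : measurable (integer_approx setT (EFin \o h) n).
Proof. exact: (emeasurable_fun_c_infty measurableT mh'). Qed.

Let s_ n := approx setT (EFin \o h) n.

Let s_le n z : (s_ n z <= h z)%R.
Proof. by rewrite -lee_fin; exact: (@le_approx _ _ _ setT (EFin \o h) n z h0'). Qed.

Let s_ge0 n z : (0 <= s_ n z)%R.
Proof.
rewrite /s_ /approx addr_ge0 ?mulr_ge0 ?sumr_ge0//.
Qed.

Let small_approx n : small (fun z => (s_ n z)%:C%C) /\
  Cmeasurable_fun setT (fun z => (s_ n z)%:C%C).
Proof.
pose F k z := (((k%:R * 2 ^- n)%:C)%C * Cindic (D_ n k) z)%R.
have mF k : Cmeasurable_fun setT (F k).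
  apply: CmeasurableM; first exact: Cmeasurable_cst.
  by apply: Cmeasurable_Cindic; exact: mD.
pose N := (n * 2 ^ n)%N.
pose F' k := if (k < N)%N then F k else fun=> 0%R.
have mF' k : Cmeasurable_fun setT (F' k).
  by rewrite /F'; case: ifP => // _; exact: Cmeasurable_cst.
pose G z := ((n%:R%:C)%C * Cindic (integer_approx setT (EFin \o h) n) z)%R.
have mG : Cmeasurable_fun setT G.
  apply: CmeasurableM; first exact: Cmeasurable_cst.
  by apply: Cmeasurable_Cindic; exact: mI.
have E : (fun z => (s_ n z)%:C%C) = fun z => (\sum_(k < N) F' k z + G z)%R.
  apply/funext => z; rewrite /s_ /approx rmorphD rmorph_sum/=; congr (_ + _)%R; last first.
    by rewrite rmorphM.
  by apply: eq_bigr => k _; rewrite /F' ltn_ord /F rmorphM.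
have sumF z : (\sum_(k < N) (k%:R * 2 ^- n * \1_(D_ n k) z) + n%:R * \1_(integer_approx setT (EFin
  \o h) n) z <= h z)%R.
  exact: s_le.
have t0 k z : (0 <= k%:R * 2 ^- n * \1_(D_ n k) z :> R)%R.
  by rewrite mulr_ge0// mulr_ge0// invr_ge0 exprn_ge0.
have mS : Cmeasurable_fun setT (fun z => \sum_(k < N) F' k z)%R.
  by apply: (@Cmeasurable_sum _ _ _ _ N F').
rewrite E; split; last exact: CmeasurableD.
apply: smallD => //.
  apply: small_sum => // k; rewrite /F'; case: ifP => [kN|_]; last exact: small0.
  apply: small_level; [exact: mD|by rewrite mulr_ge0// invr_ge0 exprn_ge0|move=> z].
  apply: le_trans (sumF z); rewrite (bigD1 (Ordinal kN))//= -addrA lerDl.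
  by rewrite addr_ge0 ?sumr_ge0// mulr_ge0.
apply: small_level; [exact: mI|exact: ler0n|move=> z]; apply: le_trans (sumF z); rewrite lerDr.
by rewrite sumr_ge0.
Qed.

Lemma small_nonnegative : small (fun z => (h z)%:C%C).
Proof.
apply: small_close; first exact: Cmeasurable_real.
move=> e e0; pose f_ n z : \bar R := power ((h z)%:C%C - (s_ n z)%:C%C)%R.
have ms n : Cmeasurable_fun setT (fun z => (h z)%:C%C - (s_ n z)%:C%C)%R.
  by apply: CmeasurableB; [exact: Cmeasurable_real|have [] := small_approx n].
have mf_ n : measurable_fun setT (f_ n) by exact: measurable_power.
have f_le n z : `|f_ n z| <= (h z `^ p)%:E.
  rewrite gee0_abs ?power_ge0// /f_ /power lee_fin -rmorphB normc_real.
  have h1 := s_le n z; have h2 := s_ge0 n z.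
  rewrite ger0_norm ?subr_ge0//; apply: (ge0_ler_powR p0); rewrite ?nnegrE ?subr_ge0//.
  by rewrite lerBlDr lerDl.
(* The distance is eventually below 1, where its p-th power is at most the distance itself because p
   >= 1. *)
have f_cvg z : f_ ^~ z @ \oo --> 0.
  have sc : (s_ ^~ z : nat -> R) @ \oo --> h z.
    by apply: (@cvg_approx _ _ _ setT (EFin \o h) z h0') => //=; exact: ltry.
  apply: cvg_EFin; first by apply: nearW => n.
  apply/cvgrPdist_lt => d d0.
  pose d' := Num.min d 1%R; have d'0 : (0 < d')%R by rewrite lt_min d0 ltr01.
  move/cvgrPdist_lt : sc => /(_ _ d'0) [N _ NP].
  exists N => // n /= /NP; rewrite sub0r normrN => hd.
  rewrite ger0_norm ?powR_ge0// -rmorphB normc_real.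
  move: hd; rewrite lt_min => /andP[hd hd1].
  apply: le_lt_trans hd; have [->|y0] := eqVneq (h z - s_ n z)%R 0%R.
    by rewrite normr0 powR0// gt_eqF// (lt_le_trans _ p1).
  have y1 : (0 < `|h z - s_ n z|)%R by rewrite normr_gt0.
  rewrite -[leRHS](powRr1 (normr_ge0 _)); apply: ger_powR => //.
  by rewrite y1 (ltW hd1).
have ig : hyp.-integrable setT (fun z => (h z `^ p)%:E).
  apply/integrableP; split.
    apply/measurable_EFinP; exact: (measurableT_comp (measurable_powR _)).
  by under eq_integral do rewrite gee0_abs ?lee_fin ?powR_ge0//.
have [_ _] := @dominated_convergence _ _ _ hyp setT measurableT f_ (cst 0) _ mf_
  (@measurable_cst _ _ _ _ _ _) (aeW _ (fun z _ => f_cvg z)) ig (aeW _ (fun z n _ => f_le n z)).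
rewrite integral0 => H.
have [n nP] : exists n, \int[hyp]_z f_ n z <= e%:E.
  apply: contrapT => /forallNP hn; have : e%:E <= limn (fun n => \int[hyp]_z f_ n z).
    apply: lime_ge; first by apply/cvg_ex; exists 0.
    by apply: nearW => n; have /negP := hn n; rewrite -ltNge => /ltW.
  by rewrite (cvg_lim _ H)// lee_fin leNgt e0.
by exists (fun z => (s_ n z)%:C%C); have [] := small_approx n.
Qed.

End nonnegative.

Lemma small_Lp f : Cmeasurable_fun setT f -> power_int f < +oo -> small f.
Proof.
move=> mf ffin.
have part (g : R * R -> R) : measurable_fun setT g -> (forall z, (`|g z| <= normc (f z))%R) ->
    small (fun z => (g z)%:C%C).
  move=> mg gf.
  have half (s : R * R -> R) : measurable_fun setT s -> (forall z, (0 <= s z)%R) ->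
      (forall z, (s z <= normc (f z))%R) -> small (fun z => (s z)%:C%C).
    move=> ms s0 sf; apply: small_nonnegative => //; apply: le_lt_trans ffin.
    apply: ge0_le_integral => //.
    - by move=> z _; rewrite lee_fin powR_ge0.
    - apply/measurable_EFinP; exact: (measurableT_comp (measurable_powR _)).
    - exact: measurable_power.
    move=> z _; rewrite /power lee_fin; apply: (ge0_ler_powR p0); rewrite ?nnegrE ?normc_ge0//.
  pose s1 z := ((`|g z| + g z) / 2)%R; pose s2 z := ((`|g z| - g z) / 2)%R.
  have mn : measurable_fun setT (fun z => `|g z|)%R by exact: measurableT_comp.
  have m1 : measurable_fun setT s1 by apply: measurable_funM => //; exact: measurable_funD.
  have m2 : measurable_fun setT s2 by apply: measurable_funM => //; exact: measurable_funB.
  have b1 z := ler_norm (g z); have b2 z := ler_norm (- g z)%R.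
  have sm1 : small (fun z => (s1 z)%:C%C).
    apply: half => // z; have := gf z; have := b1 z; have := b2 z; rewrite normrN /s1; lra.
  have sm2 : small (fun z => (s2 z)%:C%C).
    apply: half => // z; have := gf z; have := b1 z; have := b2 z; rewrite normrN /s2; lra.
  rewrite (_ : (fun z => (g z)%:C%C) = fun z => ((s1 z)%:C%C + (-1) * (s2 z)%:C%C)%R).
    apply: smallD; [exact: Cmeasurable_real| |exact: sm1|].
      by apply: CmeasurableM; [exact: Cmeasurable_cst|exact: Cmeasurable_real].
    by apply: smallZ => //; exact: Cmeasurable_real.
  apply/funext => z; rewrite mulN1r -rmorphB; congr (_%:C)%C; rewrite /s1 /s2; lra.
have [m1 m2] := mf.
rewrite (_ : f = fun z => ((complex.Re (f z))%:C%C + 'i%C * (complex.Im (f z))%:C%C)%R).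
  apply: smallD; [exact: Cmeasurable_real| | |].
  - by apply: CmeasurableM; [exact: Cmeasurable_cst|exact: Cmeasurable_real].
  - by apply: part => // z; exact: le_Re_normc.
  - apply: smallZ; first exact: Cmeasurable_real.
    by apply: part => // z; exact: le_Im_normc.
by apply/funext => z; exact: complexE.
Qed.

End vanishing_functions.

End approximate_identity.

(** Comes from the definition by suprema over simple functions and involves no measurability, so the
    L^p norm can be bounded although the Berezin transform is not shown to be measurable. *)
Lemma ge0_le_integralT d (T : measurableType d) (R : realType)
    (mu : {measure set T -> \bar R}) (f g : T -> \bar R) :
  (forall x, 0 <= f x)%E -> (forall x, f x <= g x)%E ->
  (\int[mu]_x f x <= \int[mu]_x g x)%E.
Proof.
move=> f0 fg; have g0 x : (0 <= g x)%E := le_trans (f0 x) (fg x).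
rewrite !ge0_integralTE//; apply: ge_ereal_sup => _ [h hf <-].
by apply: ereal_sup_ubound; exists h => // x; exact: le_trans (hf x) (fg x).
Qed.

(** * A Jensen-type inequality for probability densities *)

Section weighted_average.
Context d (T : measurableType d) (R : realType) (mu : {measure set T -> \bar R}).
Variable kappa : T -> R.
Hypothesis mkappa : measurable_fun setT kappa.
Hypothesis kappa0 : forall x, 0 <= kappa x.
Hypothesis kappa1 : (\int[mu]_x (kappa x)%:E = 1)%E.
Variable p : R.
Hypothesis p1 : 1 <= p.

Variable a : T -> R.
Hypothesis ma : measurable_fun setT a.
Hypothesis a0 : forall x, 0 <= a x.

Let I := (\int[mu]_x ((a x `^ p) * kappa x)%:E)%E.

Let map : measurable_fun setT (fun x => a x `^ p).
Proof. exact: (measurableT_comp (measurable_powR _)). Qed.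

Let affine_bound (l m : R) : 0 <= l -> 0 <= m -> (forall x, a x <= l + m * a x `^ p) ->
  (\int[mu]_x (a x * kappa x)%:E <= l%:E + m%:E * I)%E.
Proof.
move=> l0 m0 H.
apply: (@le_trans _ _ (\int[mu]_x (l%:E * (kappa x)%:E + m%:E * ((a x `^ p) * kappa x)%:E))%E).
  apply: ge0_le_integralT => x; first by rewrite lee_fin mulr_ge0.
  by rewrite -!EFinM -EFinD lee_fin mulrA -mulrDl; apply: ler_wpM2r.
have mk : measurable_fun setT (fun x => (kappa x)%:E) by exact/measurable_EFinP.
have mak : measurable_fun setT (fun x => (a x `^ p * kappa x)%:E).
  by apply/measurable_EFinP; apply: measurable_funM => //; exact: map.
rewrite ge0_integralD//=; first last.
- exact: measurable_funeM.
- by move=> x _; rewrite -EFinM lee_fin !mulr_ge0 ?powR_ge0.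
- exact: measurable_funeM.
- by move=> x _; rewrite -EFinM lee_fin mulr_ge0.
rewrite !ge0_integralZl//.
- by rewrite kappa1 mule1.
- by move=> x _; rewrite lee_fin mulr_ge0 ?powR_ge0.
- by move=> x _; rewrite lee_fin.
Qed.

Lemma average_lty : (I < +oo)%E -> (\int[mu]_x (a x * kappa x)%:E < +oo)%E.
Proof.
move=> Ioo; apply: le_lt_trans (affine_bound ler01 ler01 _) _.
  move=> x; rewrite mul1r; have [ax|ax] := leP (a x) 1.
    by rewrite (le_trans ax)// lerDl powR_ge0.
  rewrite ler_wpDl// -[leLHS](powRr1 (a0 x)); apply: ler_powR => //; exact: ltW.
by rewrite mul1e lte_add_pinfty// ltry.
Qed.

(* Whether a <= l or a >= l, one has a <= l + l^(1-p) a^p; take l half of the mean of a. *)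
Lemma average_powR (m : R) : (\int[mu]_x (a x * kappa x)%:E = m%:E)%E ->
  (((m / 2) `^ p)%:E <= I)%E.
Proof.
move=> am; have m0 : 0 <= m.
  by rewrite -lee_fin -am; apply: integral_ge0 => x _; rewrite lee_fin mulr_ge0.
have I0 : (0 <= I)%E by apply: integral_ge0 => x _; rewrite lee_fin mulr_ge0 ?powR_ge0.
have [->|mn0] := eqVneq m 0; first by rewrite mul0r powR0// gt_eqF// (lt_le_trans _ p1).
have l0 : 0 < m / 2 by rewrite divr_gt0// lt_def mn0.
set l := m / 2 in l0 *.
have lp : 0 < l `^ p by rewrite powR_gt0.
have := @affine_bound l (l / l `^ p) (ltW l0) (divr_ge0 (ltW l0) (ltW lp)).
rewrite am => H.
have {H} : (m%:E <= l%:E + (l / l `^ p)%:E * I)%E.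
  apply: H => x; have [ax|ax] := leP (a x) l.
    by rewrite (le_trans ax)// lerDl mulr_ge0 ?powR_ge0// divr_ge0// ltW.
  rewrite ler_wpDl ?(ltW l0)//.
  have ap : 0 < a x := lt_trans l0 ax.
  have e y : 0 < y -> y `^ p = y * y `^ (p - 1).
    move=> y0; rewrite -{2}(powRr1 (ltW y0)) -powRD; last by rewrite (gt_eqF y0) implybT.
    by rewrite addrCA subrr addr0.
  rewrite (e _ ap) (e _ l0).
  have L0 : 0 < l `^ (p - 1) by rewrite powR_gt0.
  rewrite (_ : l / _ * _ = a x * (a x `^ (p - 1) / l `^ (p - 1))); last first.
    by move: (l `^ _) L0 (a x `^ _) => y y0 y'; field; rewrite !gt_eqF.
  rewrite ler_peMr ?(ltW ap)// ler_pdivlMr// mul1r.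
  by apply: ge0_ler_powR; rewrite ?nnegrE ?subr_ge0// ltW.
have mE : m = l + l by rewrite /l -splitr.
rewrite {1}mE EFinD leeD2lE// => h.
have -> : ((l `^ p)%:E = ((l / l `^ p)^-1)%:E * l%:E)%E.
  by rewrite -EFinM invf_div divfK// gt_eqF.
by rewrite lee_pdivrMl// divr_gt0.
Qed.

End weighted_average.

(** * Distance of an iterated average from a constant *)

Section product_average.
Context d1 d2 (T1 : measurableType d1) (T2 : measurableType d2) (R : realType).
Variables (m1 : {sigma_finite_measure set T1 -> \bar R})
  (m2 : {sigma_finite_measure set T2 -> \bar R}).
Variables (k0 : T1 * T2 -> R) (s : R) (g : T2 -> R) (a : R).
Hypothesis s0 : 0 < s.
Hypothesis mk0 : measurable_fun setT k0.
Hypothesis k00 : forall q, 0 <= k0 q.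
Hypothesis mg : measurable_fun setT g.
Hypothesis k1 : (\int[m1 \x m2]_q (s * k0 q)%:E = 1)%E.
Variable m : R.
Hypothesis gm : (\int[m1 \x m2]_q (`|g q.2 - a| * (s * k0 q))%:E = m%:E)%E.

Let kappa q := s * k0 q.

Let mkappa : measurable_fun setT kappa. Proof. exact: measurable_funM. Qed.

Let mg2 : measurable_fun setT (fun q : T1 * T2 => g q.2).
Proof. exact: (measurableT_comp mg measurable_snd). Qed.

Let kappa_int : (m1 \x m2)%E.-integrable setT (EFin \o kappa).
Proof.
apply/integrableP; split; first by apply/measurable_EFinP; exact: mkappa.
under eq_integral do rewrite /= ger0_norm ?mulr_ge0 ?(ltW s0)//.
by rewrite k1 ltry.
Qed.

Let diff_int : (m1 \x m2)%E.-integrable setT (EFin \o (fun q => (g q.2 - a) * kappa q)).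
Proof.
apply/integrableP; split.
  apply/measurable_EFinP; apply: measurable_funM; last exact: mkappa.
  by apply: measurable_funB => //; exact: mg2.
rewrite (eq_integral (fun q => (`|g q.2 - a| * (s * k0 q))%:E)) ?gm ?ltry// => q _ /=.
by rewrite normrM [X in _ * X]ger0_norm// mulr_ge0// ltW.
Qed.

Let scale_int (f : T1 * T2 -> R) (r : R) : (m1 \x m2)%E.-integrable setT (EFin \o f) ->
  (m1 \x m2)%E.-integrable setT (EFin \o (fun q => r * f q)).
Proof.
move=> fi; rewrite (_ : EFin \o _ = (fun q => r%:E * (EFin \o f) q)%E)//.
exact: (@integrableZl _ _ _ _ _ measurableT r _ fi).
Qed.

Let g_int : (m1 \x m2)%E.-integrable setT (EFin \o (fun q => g q.2 * kappa q)).
Proof.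
rewrite (_ : _ \o _ = (EFin \o (fun q => (g q.2 - a) * kappa q)%R) \+ (EFin \o (fun q =>
  a * kappa q)%R))%E.
  exact: (integrableD measurableT diff_int (scale_int a kappa_int)).
by apply/funext => q /=; rewrite -EFinD mulrBl subrK.
Qed.

Let gk0_int : (m1 \x m2)%E.-integrable setT (EFin \o (fun q => g q.2 * k0 q)).
Proof.
rewrite (_ : (fun q => g q.2 * k0 q) = fun q => s^-1 * (g q.2 * kappa q)).
  by apply: scale_int; exact: g_int.
by apply/funext => q; rewrite /kappa mulrCA mulKf// gt_eqF.
Qed.

(** The Berezin transform is an iterated integral with the factor alpha + 1 in front, whence the
    form with s and k0. Integrability on the product, deduced from the finite mean distance, permits
    the passage to one integral. *)
Lemma iterated_average_dist :
  `|s * (\int[m1]_x \int[m2]_y (g y * k0 (x, y))) - a| <= m.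
Proof.
pose F := fubini_F m2 (EFin \o (fun q : T1 * T2 => g q.2 * k0 q)).
have Fint : m1.-integrable setT F := integrable_fubini_F gk0_int.
have mF : measurable_fun setT F by case/integrableP: Fint.
have E : (\int[m1 \x m2]_q (g q.2 * k0 q)%:E =
    (\int[m1]_x \int[m2]_y (g y * k0 (x, y)))%:E)%E.
  have -> : (\int[m1 \x m2]_q (g q.2 * k0 q)%:E = \int[m1]_x F x)%E.
    by rewrite (integral12_prod_meas1 gk0_int).
  (* The inner integral is finite only almost everywhere; elsewhere [fine] changes its value, on a
     null set. *)
  have FE : (\int[m1]_x F x = \int[m1]_x (fine (F x))%:E)%E.
    apply: ae_eq_integral => //; first by apply/measurable_EFinP; exact: measurableT_comp.
    apply: filterS (integrable_ae measurableT Fint) => x h Tx.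
    by rewrite fineK//; exact: h.
  rewrite [X in _ = X%:E]/Rintegral -/(fine (\int[m1]_x (fine (F x))%:E)) -FE fineK//.
  exact: integrable_fin_num.
have kE : \int[(m1 \x m2)%E]_q kappa q = 1 by rewrite /Rintegral k1.
have E2 : \int[(m1 \x m2)%E]_q (g q.2 * kappa q) = s * (\int[m1]_x \int[m2]_y (g y * k0 (x, y))).
  rewrite -[X in s * X]/(fine (_)%:E) -E -(RintegralZl _ measurableT gk0_int).
  by apply: eq_Rintegral => q _; rewrite /kappa mulrCA.
have E3 : s * (\int[m1]_x \int[m2]_y (g y * k0 (x,
  y))) - a = \int[(m1 \x m2)%E]_q ((g q.2 - a) * kappa q).
  rewrite -E2 -[X in _ - X]mulr1 -kE -(RintegralZl _ measurableT kappa_int).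
  rewrite -(RintegralB measurableT g_int (scale_int a kappa_int)).
  by apply: eq_Rintegral => q _; rewrite -mulrBl.
rewrite E3; apply: le_trans (le_normr_Rintegral _ diff_int) _ => //.
rewrite /Rintegral (eq_integral (fun q => (`|g q.2 - a| * (s * k0 q))%:E)) ?gm// => q _.
by rewrite normrM [X in _ * X]ger0_norm// mulr_ge0// ltW.
Qed.

End product_average.

Definition disc_extension (R : realType) (f : R[i] -> R[i]) (w : R * R) : R[i] :=
  if normc (complex_of_pair w) < 1 then f (complex_of_pair w) else 0.

(** * The windowed Berezin transform *)

Section berezin_bound.
Variables (R : realType) (alpha : R).
Hypothesis alpha0 : 0 <= alpha.
Local Notation c := (@complex_of_pair R).
Local Notation pr := (@pair_of_complex R).
Local Notation area := (@area R).
Local Notation circ := (@circle_measure R).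
Local Notation hyp := (@hyperbolic_measure R).
Local Notation emb := (emb alpha).
Variable u : R[i] -> R[i].
Hypothesis mu : disc_measurable u.
Hypothesis Lu : L2 area (emb u).
Hypothesis mass : (\int[hyp]_p angular_mean alpha u p = 1)%E.
Local Notation am := (angular_mean alpha u).
Local Notation ksqr := (kernel_sqr alpha u).
Variable f : R[i] -> R[i].
Local Notation F := (disc_extension f).
Hypothesis mF : Cmeasurable_fun setT F.
Variable p : R.
Hypothesis p1 : 1 <= p.
Implicit Types (xi z x t phi : R[i]).

Lemma exponent_ge0 : 0 <= p. Proof. by rewrite (le_trans _ p1). Qed.

Lemma alpha1_gt0 : 0 < alpha + 1. Proof. by rewrite ltr_wpDl. Qed.

Lemma measurable_normc_pair : measurable_fun setT (fun w : R * R => normc (c w)).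
Proof. by apply: measurable_normc; exact: Cmeasurable_of_pair. Qed.

Lemma Cmeasurable_case d (T : measurableType d) (b : T -> bool) (g : T -> R[i]) (k : R[i]) :
  measurable_fun setT b -> Cmeasurable_fun setT g ->
  Cmeasurable_fun setT (fun q => if b q then g q else k).
Proof.
move=> mb mg; rewrite (_ : (fun q => _) = fun q => (if b q then g q - k else 0) + k).
  apply: CmeasurableD; last exact: Cmeasurable_cst.
  apply: (@Cmeasurable_if _ _ _ (b @^-1` [set true])) => //.
    by rewrite -[X in measurable X]setTI; exact: mb.
  by apply: CmeasurableB => //; exact: Cmeasurable_cst.
by apply/funext => q; case: ifP => _; rewrite ?subrK ?add0r.
Qed.

(** [circle_rotate] deals with functions on the plane, while the kernel is measurable for unimodular
    t; projecting onto the circle extends it. *)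
Let unit_of t : R[i] := if 0 < normc t then t / (normc t)%:C else 1.

Lemma normc_unit_of t : normc (unit_of t) = 1.
Proof.
rewrite /unit_of; case: ifP => t0; last exact: normc1.
by rewrite normcM normcV normc_real ger0_norm ?normc_ge0// divff// gt_eqF.
Qed.

Lemma unit_ofE t : normc t = 1 -> unit_of t = t.
Proof. by move=> t1; rewrite /unit_of t1 ltr01 divr1. Qed.

Lemma circle_kernel phi x : normc phi = 1 ->
  (\int[circ]_t (ksqr (phi * expi t) x)%:E = am (pr x))%E.
Proof.
move=> phi1; rewrite /angular_mean pair_of_complexK.
have mG : measurable_fun setT ((fun t => (ksqr (unit_of t) x)%:E) \o c).
  apply/measurable_EFinP; apply: measurable_kernel_sqr => //.
  - apply: Cmeasurable_case; first by apply: measurable_fun_ltr => //; exact: measurable_normc_pair.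
    apply: Cmeasurable_div; first exact: Cmeasurable_of_pair.
    by apply: Cmeasurable_real; exact: measurable_normc_pair.
  - by move=> q; exact: normc_unit_of.
have G0 t : (0 <= (ksqr (unit_of t) x)%:E)%E by rewrite lee_fin kernel_sqr_ge0.
have u1 (t : R) : unit_of (phi * expi t) = phi * expi t.
  by apply: unit_ofE; rewrite normcM phi1 normc_expi mul1r.
have u2 (t : R) : unit_of (expi t) = expi t by apply: unit_ofE; exact: normc_expi.
transitivity (\int[circ]_t (ksqr (unit_of (phi * expi t)) x)%:E)%E.
  by apply: eq_integral => t _; rewrite u1.
rewrite (circle_rotate phi1 G0 mG).
by apply: eq_integral => t _; rewrite u2.
Qed.

Section fixed_point.
Variables xi z : R[i].
Hypothesis xi1 : normc xi = 1.
Hypothesis z1 : unit_disc z.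

Let tw (q : R * (R * R)) := if normc (c q.2) < 1 then twist xi z (expi q.1) (c q.2) else 1.

Lemma normc_tw q : normc (tw q) = 1.
Proof.
rewrite /tw; case: ifP => h; last exact: normc1.
by apply: normc_twist => //; exact: normc_expi.
Qed.

(** The squared inner product in the definition of the Berezin transform, in its covariant form
    ([bergman_inner_weight]) and extended by 0. *)
Definition berezin_weight (q : R * (R * R)) : R := if normc (c q.2) < 1 then
  normc (window_kernel alpha u (tw q) (translate xi z (c q.2))) ^+ 2 else 0.

Let k0 := berezin_weight.

Lemma kernel_weightE q : (alpha + 1) * k0 q =
  if normc (c q.2) < 1 then ksqr (tw q) (translate xi z (c q.2)) else 0.
Proof. by rewrite /k0 /berezin_weight; case: ifP => // _; rewrite mulr0. Qed.

Lemma berezin_weight_ge0 q : 0 <= k0 q.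
Proof. by rewrite /k0 /berezin_weight; case: ifP => // _; exact: sqr_ge0. Qed.

Lemma Cmeasurable_point : Cmeasurable_fun setT (fun q : R * (R * R) => c q.2).
Proof. exact: (Cmeasurable_precomp (Cmeasurable_of_pair R) measurable_snd). Qed.

Lemma Cmeasurable_angle : Cmeasurable_fun setT (fun q : R * (R * R) => expi q.1 : R[i]).
Proof. exact: (Cmeasurable_precomp (Cmeasurable_expi R) measurable_fst). Qed.

Lemma measurable_in_disc : measurable_fun setT (fun q : R * (R * R) => normc (c q.2) < 1).
Proof. by apply: measurable_fun_ltr => //; exact: (measurable_normc Cmeasurable_point). Qed.

Lemma Cmeasurable_tw : Cmeasurable_fun setT tw.
Proof.
apply: (Cmeasurable_case _ measurable_in_disc); apply: CmeasurableM.
  by apply: CmeasurableM; [exact: Cmeasurable_angle|exact: Cmeasurable_cst].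
apply: Cmeasurable_div; apply: CmeasurableB; try exact: Cmeasurable_cst.
  by apply: CmeasurableM; [exact: Cmeasurable_cst|exact: Cmeasurable_point].
by apply: CmeasurableM; [exact: Cmeasurable_cst|exact: (Cmeasurable_conj Cmeasurable_point)].
Qed.

Lemma Cmeasurable_translate : Cmeasurable_fun setT (fun w : R * R => translate xi z (c w)).
Proof.
apply: CmeasurableM; first exact: Cmeasurable_cst.
by apply: Cmeasurable_mobius; [exact: Cmeasurable_cst|exact: Cmeasurable_of_pair].
Qed.

Lemma Cmeasurable_translate_snd : Cmeasurable_fun setT (fun q : R * (R * R) =>
  translate xi z (c q.2)).
Proof. exact: (Cmeasurable_precomp Cmeasurable_translate measurable_snd). Qed.

Lemma measurable_berezin_weight : measurable_fun setT k0.
Proof.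
apply: (measurable_fun_ifT measurable_in_disc) => //; apply: measurable_normc_sqr.
by apply: Cmeasurable_coef; [exact: mu|exact: mu|exact: Cmeasurable_translate_snd|exact:
  Cmeasurable_tw|exact: normc_tw].
Qed.

(** The twist equals e^(it) times a unimodular factor independent of t; integration over t removes
    that factor and leaves [angular_mean]. *)
Lemma mean_fiber (h : R * R -> \bar R) : measurable_fun setT h -> (forall w, 0 <= h w)%E ->
  (\int[circ \x hyp]_q (h q.2 * ((alpha + 1) * k0 q)%:E) =
   \int[hyp]_w (h w * am (pr (translate xi z (c w)))))%E.
Proof.
move=> mh h0.
have mT : measurable_fun setT (fun q : R * (R * R) => (h q.2 * ((alpha + 1) * k0 q)%:E)%E).
  apply: emeasurable_funM; first exact: (measurableT_comp mh measurable_snd).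
  by apply/measurable_EFinP; apply: measurable_funM => //; exact: measurable_berezin_weight.
have T0 q : (0 <= h q.2 * ((alpha + 1) * k0 q)%:E)%E.
  by rewrite mule_ge0// lee_fin mulr_ge0 ?(ltW alpha1_gt0) ?berezin_weight_ge0.
rewrite (@fubini_tonelli2 _ _ _ _ _ circ hyp _ mT T0); apply: eq_hyperbolic.
- exact: (@measurable_fun_fubini_tonelli_G _ _ _ _ _ circ _ mT T0).
- apply: emeasurable_funM => //.
  apply: (measurableT_comp (measurable_angular_mean alpha0 mu)).
  exact: (measurable_pair_of_complex Cmeasurable_translate).
- by move=> w; apply: integral_ge0 => t _; exact: T0.
- by move=> w; rewrite mule_ge0// angular_mean_ge0.
move=> w w1; rewrite /fubini_G.
pose phi := twist xi z 1 (c w).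
have phi1 : normc phi = 1 by apply: normc_twist => //; exact: normc1.
rewrite -(circle_kernel (translate xi z (c w)) phi1).
rewrite -ge0_integralZl//.
- apply: eq_integral => t _.
  have twE : tw (t, w) = phi * expi t.
    rewrite /tw (w1 : normc (c (t, w).2) < 1) /phi /twist.
    by move: (_ / _) => y; ring.
  by rewrite (kernel_weightE (t, w)) (w1 : normc (c (t, w).2) < 1) twE.
- apply/measurable_EFinP; apply: measurable_kernel_sqr => //.
  + by apply: CmeasurableM; [exact: Cmeasurable_cst|exact: Cmeasurable_expi].
  + by move=> t; rewrite normcM phi1 normc_expi mulr1.
- by move=> t _; rewrite lee_fin kernel_sqr_ge0.
Qed.

Lemma berezin_weight_mass : (\int[circ \x hyp]_q ((alpha + 1) * k0 q)%:E = 1)%E.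
Proof.
have -> : (\int[circ \x hyp]_q ((alpha + 1) * k0 q)%:E =
    \int[circ \x hyp]_q (cst 1 q.2 * ((alpha + 1) * k0 q)%:E))%E.
  by apply: eq_integral => q _; rewrite mul1e.
rewrite (@mean_fiber (cst 1%E) (measurable_cst _) (fun w => lee01)).
under eq_integral do rewrite mul1e.
have mam := measurable_angular_mean alpha0 mu.
have am0 := angular_mean_ge0 alpha0 u.
have mr : measurable_fun setT (fun w => am (pr (xi * c w))).
  apply: (measurableT_comp mam); apply: measurable_pair_of_complex.
  by apply: CmeasurableM; [exact: Cmeasurable_cst|exact: Cmeasurable_of_pair].
apply: etrans mass; apply: etrans (hyperbolic_rotate xi1 am0 mam).
apply: etrans (hyperbolic_mobius z1 (fun w => am0 (pr (xi * c w))) mr).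
by apply: eq_integral => w _; rewrite pair_of_complexK.
Qed.

Lemma bergman_inner_weight (t : R) (w : R * R) : normc (c w) < 1 ->
  normc (bergman_inner alpha (U alpha z (rotate xi u)) (U alpha (c w) (rotate (expi t) u))) ^+ 2
  = k0 (t, w).
Proof.
move=> w1; rewrite /k0 /berezin_weight /= w1 /tw /= w1.
rewrite (bergman_inner_U alpha0 mu mu Lu Lu xi1 (normc_expi t) z1 w1).
rewrite bergman_innerE// /window_kernel coef_in//.
by apply: translate_disc.
Qed.

(** [ReIm] stands for the real or the imaginary part; the hypotheses are what the two have in
    common. *)
Lemma Re_berezin (ReIm : R[i] -> R) :
  (forall (h : R -> R[i]), ReIm (Cintegral circ setT h) = \int[circ]_t ReIm (h t)) ->
  (forall (h : R * R -> R[i]), ReIm (Cintegral hyp (@disc R) h) = \int[hyp]_(w in @disc R) ReIm (h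
    w)) ->
  (forall k x, ReIm (x * k%:C) = ReIm x * k) -> ReIm 0 = 0 ->
  ReIm (windowed_berezin alpha u (fun _ w => f w) xi z) =
  (alpha + 1) * (\int[circ]_t \int[hyp]_w (ReIm (F w) * k0 (t, w))).
Proof.
move=> Hc Hh HM H0; rewrite /windowed_berezin mulrC HM mulrC Hc; congr (_ * _).
apply: eq_Rintegral => t _; rewrite Hh Rintegral_mkcond; apply: eq_Rintegral => w _.
rewrite patchE in_discE /disc_extension; have [w1|w1] := boolP (normc (c w) < 1).
  by rewrite HM bergman_inner_weight.
by rewrite H0 mul0r.
Qed.

(** With m the mean of |F - f(z)|, real and imaginary part of the difference are at most m, so its
    modulus is at most 2 m = 4 (m / 2), and [average_powR] bounds (m / 2)^p by the mean of the p-th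
    power. *)
Lemma berezin_pointwise :
  (power p (windowed_berezin alpha u (fun _ w => f w) xi z - f z)%R <=
   (4 `^ p)%:E * \int[hyp]_w (power p (F w - f z)%R * am (pr (translate xi z (c w)))))%E.
Proof.
have mFz : Cmeasurable_fun setT (fun w => F w - f z).
  by apply: CmeasurableB => //; exact: Cmeasurable_cst.
have mP := measurable_power p mFz.
rewrite -(mean_fiber mP); last by move=> w; exact: power_ge0.
pose a (q : R * (R * R)) := normc (F q.2 - f z).
have ma : measurable_fun setT a.
  by apply: measurable_normc; exact: (Cmeasurable_precomp mFz measurable_snd).
have a0 q : 0 <= a q := normc_ge0 _.
have mk : measurable_fun setT (fun q => (alpha + 1) * k0 q).
  by apply: measurable_funM => //; exact: measurable_berezin_weight.
have kk0 q : 0 <= (alpha + 1) * k0 q by rewrite mulr_ge0 ?(ltW alpha1_gt0) ?berezin_weight_ge0.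
set I := (\int[_]_q _)%E.
have IE : I = (\int[circ \x hyp]_q (a q `^ p * ((alpha + 1) * k0 q))%:E)%E by [].
have I0 : (0 <= I)%E by rewrite IE; apply: integral_ge0 => q _; rewrite lee_fin mulr_ge0 ?powR_ge0.
have P0 : 0 < 4 `^ p :> R by rewrite powR_gt0.
(* If the right-hand side is infinite nothing has to be shown; otherwise the mean m below is
   finite. *)
have [Ioo|] := ltP I +oo%E; last first.
  by rewrite leye_eq => /eqP ->; rewrite gt0_muley// leey.
have moo : (\int[circ \x hyp]_q (a q * ((alpha + 1) * k0 q))%:E < +oo)%E.
  apply: (@average_lty _ _ R (circ \x hyp)%E (fun q =>
    (alpha + 1) * k0 q) mk kk0 berezin_weight_mass p p1 a ma a0).
  by rewrite -IE.
pose m := fine (\int[circ \x hyp]_q (a q * ((alpha + 1) * k0 q))%:E)%E.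
have mE : (\int[circ \x hyp]_q (a q * ((alpha + 1) * k0 q))%:E = m%:E)%E.
  rewrite fineK// ge0_fin_numE//; apply: integral_ge0 => q _; rewrite lee_fin mulr_ge0//.
have mp := @average_powR _ _ R (circ \x hyp)%E (fun q =>
  (alpha + 1) * k0 q) mk kk0 berezin_weight_mass p p1 a ma a0 m mE.
have dist (ReIm : R[i] -> R) : measurable_fun setT (fun w => ReIm (F w)) ->
    (forall x y, `|ReIm x - ReIm y| <= normc (x - y)) ->
    `|(alpha + 1) * (\int[circ]_t \int[hyp]_w (ReIm (F w) * k0 (t, w))) - ReIm (f z)| <= m.
  move=> mR RI.
  have mR2 : measurable_fun setT (fun q : R * (R * R) => `|ReIm (F q.2) - ReIm (f z)|).
    apply: measurableT_comp => //; apply: measurable_funB => //.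
    exact: (measurableT_comp mR measurable_snd).
  have le_m : (\int[circ \x hyp]_q (`|ReIm (F q.2) - ReIm (f z)| * ((alpha + 1) * k0 q))%:E <=
    m%:E)%E.
    rewrite -mE; apply: ge0_le_integralT => q; first by rewrite lee_fin mulr_ge0.
    by rewrite lee_fin; apply: ler_wpM2r.
  have ge_0 : (0 <= \int[circ \x hyp]_q (`|ReIm (F q.2) - ReIm (f z)| * ((alpha + 1) * k0 q))%:E)%E.
    by apply: integral_ge0 => q _; rewrite lee_fin mulr_ge0.
  have fin : (\int[circ \x hyp]_q (`|ReIm (F q.2) - ReIm (f z)| * ((alpha + 1) * k0 q))%:E)%E \is
    a fin_num.
    by rewrite ge0_fin_numE// (le_lt_trans le_m)// ltry.
  apply: le_trans (_ : _ <= fine (\int[circ \x hyp]_q (`|ReIm (F q.2) - ReIm (f z)| * ((alpha + 1)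
    * k0 q))%:E)%E) _.
    apply: (@iterated_average_dist _ _ _ _ R circ hyp k0 (alpha + 1) (fun w =>
      ReIm (F w)) (ReIm (f z)) alpha1_gt0 measurable_berezin_weight berezin_weight_ge0 mR
        berezin_weight_mass).
    by rewrite fineK.
  by rewrite -lee_fin fineK.
have [mR mI] := mF.
have dRe : `|complex.Re (windowed_berezin alpha u (fun _ w => f w) xi z) - complex.Re (f z)| <= m.
  rewrite Re_berezin => //.
    by apply: dist => // x y; rewrite -raddfB; exact: le_Re_normc.
  by move=> k [x y] /=; rewrite mulr0 subr0.
have dIm : `|complex.Im (windowed_berezin alpha u (fun _ w => f w) xi z) - complex.Im (f z)| <= m.
  rewrite Re_berezin => //.
    by apply: dist => // x y; rewrite -raddfB; exact: le_Im_normc.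
  by move=> k [x y] /=; rewrite mulr0 add0r.
apply: (@le_trans _ _ ((4 `^ p)%:E * ((m / 2) `^ p)%:E)%E); last first.
  by apply: lee_wpmul2l; [rewrite lee_fin ltW|exact: mp].
have m0 : 0 <= m by exact: le_trans dRe.
rewrite -EFinM /power lee_fin -powRM//; last by rewrite divr_ge0.
rewrite (_ : 4 * (m / 2) = m + m); last by field.
apply: (ge0_ler_powR exponent_ge0); rewrite ?nnegrE ?addr_ge0 ?normc_ge0//.
apply: le_trans (le_normc_ReIm _) _; rewrite !raddfB; exact: lerD.
Qed.

End fixed_point.

End berezin_bound.

(** * From the pointwise bound to the L^p bound *)

Section berezin_Lp.
Variables (R : realType) (alpha : R).
Hypothesis alpha0 : 0 <= alpha.
Local Notation c := (@complex_of_pair R).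
Local Notation pr := (@pair_of_complex R).
Local Notation area := (@area R).
Local Notation circ := (@circle_measure R).
Local Notation hyp := (@hyperbolic_measure R).
Variable u : R[i] -> R[i].
Hypothesis mu : disc_measurable u.
Hypothesis Lu : L2 area (emb alpha u).
Hypothesis mass : (\int[hyp]_p angular_mean alpha u p = 1)%E.
Local Notation am := (angular_mean alpha u).
Variable f : R[i] -> R[i].
Local Notation F := (disc_extension f).
Hypothesis mF : Cmeasurable_fun setT F.
Variable p : R.
Hypothesis p1 : 1 <= p.
Variables (K : R -> R * R -> \bar R) (al : R).
Hypothesis K0 : forall be w, (0 <= K be w)%E.
Hypothesis mK : forall be, measurable_fun setT (K be).
Hypothesis KE : K al = radial_kernel alpha u.
Local Open Scope ereal_scope.

Let bound (q : R * (R * R)) : \bar R := (4 `^ p)%:E *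
  \int[hyp]_w (power p (F w - F q.2)%R * am (pr (translate (expi q.1) (c q.2) (c w)))).

Let triple (x : (R * (R * R)) * (R * R)) : \bar R :=
  power p (F x.2 - F x.1.2)%R * am (pr (translate (expi x.1.1) (c x.1.2) (c x.2))).

Let triple_ge0 x : 0 <= triple x.
Proof. by rewrite mule_ge0 ?power_ge0 ?angular_mean_ge0. Qed.

Let mtriple : measurable_fun setT triple.
Proof.
have m12 : measurable_fun setT (fun x : (R * (R * R)) * (R * R) => x.1.2).
  exact: (measurableT_comp measurable_snd measurable_fst).
have m11 : measurable_fun setT (fun x : (R * (R * R)) * (R * R) => x.1.1).
  exact: (measurableT_comp measurable_fst measurable_fst).
apply: emeasurable_funM.
  apply: measurable_power; apply: CmeasurableB.
    exact: (Cmeasurable_precomp mF measurable_snd).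
  exact: (Cmeasurable_precomp mF m12).
apply: (measurableT_comp (measurable_angular_mean alpha0 mu)).
apply: measurable_pair_of_complex; apply: CmeasurableM.
  exact: (Cmeasurable_precomp (Cmeasurable_expi R) m11).
apply: Cmeasurable_mobius.
  exact: (Cmeasurable_precomp (Cmeasurable_of_pair R) m12).
exact: (Cmeasurable_precomp (Cmeasurable_of_pair R) measurable_snd).
Qed.

Let four_ge0 : 0 <= (4 `^ p)%:E :> \bar R.
Proof. by rewrite lee_fin powR_ge0. Qed.

Let inner (q : R * (R * R)) : \bar R := \int[hyp]_w triple (q, w).

Let minner : measurable_fun setT inner.
Proof. exact: (@measurable_fun_fubini_tonelli_F _ _ _ _ _ hyp _ mtriple triple_ge0). Qed.

Let inner_ge0 q : 0 <= inner q.
Proof. by apply: integral_ge0 => w _; exact: triple_ge0. Qed.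

(** Integrating over xi rotates xi phi_z(w) through a full circle, which turns [angular_mean] into
    [radial_kernel] and the bound into a mean oscillation. *)
Let integral_bound : \int[circ \x hyp]_q bound q = (4 `^ p)%:E * oscillation K p al F.
Proof.
transitivity (\int[circ \x hyp]_q ((4 `^ p)%:E * inner q)); first by [].
have step : \int[circ \x hyp]_q ((4 `^ p)%:E * inner q) =
    (4 `^ p)%:E * \int[circ \x hyp]_q inner q.
  apply: ge0_integralZl; [exact: measurableT|exact: minner|by move=> q _;
    exact: inner_ge0|exact: four_ge0].
rewrite step; congr (_ * _); rewrite /oscillation.
have mdiff : measurable_fun setT (fun q : (R * R) * (R * R) => power p (F q.2 - F q.1)%R).
  apply: measurable_power; apply: CmeasurableB.
    exact: (Cmeasurable_precomp mF measurable_snd).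
  exact: (Cmeasurable_precomp mF measurable_fst).
rewrite (pair_mean_iterated K0 mK)//; last by move=> q; exact: power_ge0.
rewrite (@fubini_tonelli2 _ _ _ _ _ circ hyp _ minner inner_ge0).
apply: eq_integral => z _; rewrite /fubini_G /inner.
pose g (x : R * (R * R)) := triple ((x.1, z), x.2).
have mg : measurable_fun setT g.
  apply: (measurableT_comp mtriple).
  apply: measurable_fun_pair; last exact: measurable_snd.
  by apply: measurable_fun_pair; [exact: measurable_fst|exact: measurable_cst].
transitivity (\int[circ]_t \int[hyp]_w g (t, w)); first by [].
rewrite (@fubini_tonelli _ _ _ _ _ circ hyp g mg); last by move=> x; exact: triple_ge0.
apply: eq_integral => w _; rewrite KE /radial_kernel /circle_average.
have zl : \int[circ]_t (power p (F w - F z)%R * am (pr (expi t * mobius (c z) (c w))%R)) =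
    power p (F w - F z)%R * \int[circ]_t am (pr (expi t * mobius (c z) (c w))%R).
  apply: ge0_integralZl => //; last exact: power_ge0.
    apply: (measurableT_comp (measurable_angular_mean alpha0 mu)).
    apply: measurable_pair_of_complex; apply: CmeasurableM; last exact: Cmeasurable_cst.
    exact: Cmeasurable_expi.
  by move=> t _; exact: angular_mean_ge0.
transitivity (\int[circ]_t (power p (F w - F z)%R * am (pr (expi t * mobius (c z) (c w))%R))).
  by [].
by rewrite zl pair_of_complexK.
Qed.

Lemma berezin_Lp_bound :
  Lp_norm_TD p (fun xi z => windowed_berezin alpha u (fun _ w => f w) xi z - f z)%R <=
  ((4 `^ p)%:E * oscillation K p al F) `^ p^-1.
Proof.
rewrite /Lp_norm_TD /CLnorm Lnorm.unlock -integral_bound.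
have pv0 : (0 <= p^-1)%R by rewrite invr_ge0 (le_trans _ p1).
apply: (gt0_ler_poweR pv0); rewrite ?in_itv/= ?andbT ?leey ?andbT.
- by apply: integral_ge0 => q _; rewrite poweR_ge0.
- by apply: integral_ge0 => q _; rewrite mule_ge0//; exact: inner_ge0.
apply: ge0_le_integralT => q; first by rewrite poweR_ge0.
rewrite patchE; case: ifPn => [|_]; last first.
  (* Outside the disc the restricted function takes the default value [point] of the extended reals,
     which is 0. *)
  have -> : `|point : \bar R| = 0 by exact: abse0.
  rewrite poweR0r; last by rewrite gt_eqF// (lt_le_trans _ p1).
  by rewrite mule_ge0//; exact: inner_ge0.
rewrite inE => -[_ z1]; rewrite gee0_abs ?lee_fin ?normc_ge0// poweR_EFin.
have zE : f (c q.2) = F q.2 by rewrite /disc_extension ifT.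
rewrite /bound -zE -/(power p _).
exact: (berezin_pointwise alpha0 mu Lu mass mF p1 (normc_expi q.1) z1).
Qed.

End berezin_Lp.

(** * The coordinates of the window *)

Section window_coefficients.
Variable R : realType.
Local Notation area := (@area R).
Variable psi : R[i] -> R[i].
Hypothesis hpsi : analytic_on_disc psi.
Hypothesis hpsi1 : bergman_norm 0 psi = 1%E.

(** The coordinates of psi in the orthonormal basis sqrt(n + 1) z^n of A^2, and at the same time
    those of V^alpha psi in the basis sqrt(gam_n) z^n. *)
Definition window_coef (n : nat) : R[i] := taylor_coef psi n * ((Num.sqrt n.+1%:R)^-1)%:C.

Let gam2 n : gam (0 + 2) n = n.+1%:R :> R.
Proof.
rewrite add0r; elim: n => [|n ih]; first by rewrite gam0.
rewrite gamS ih -[2]/(2%:R) -natrD add2n mulrCA divff ?mulr1// pnatr_eq0.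
Qed.

Let normc_coef n : normc (window_coef n) ^+ 2 = normc (taylor_coef psi n) ^+ 2 / gam (0 + 2) n.
Proof.
rewrite /window_coef normcM exprMn normc_real ger0_norm ?invr_ge0 ?sqrtr_ge0//.
by rewrite exprVn sqr_sqrtr// gam2.
Qed.

Let taylor z : normc z < 1 -> cvgC (psum (taylor_coef psi) z) (psi z).
Proof. exact: taylor_coefP. Qed.

Let sq1 : (sq area (emb 0 psi) = 1)%E.
Proof.
have s0 : (0 <= sq area (emb 0 psi))%E by apply: integral_ge0 => q _; rewrite lee_fin sqr_ge0.
have := hpsi1; rewrite bergman_normE// => h.
have : ((sq area (emb 0 psi) `^ 2^-1) `^ 2 = 1)%E by rewrite h poweR1r.
by rewrite -poweRrM mulVf ?pnatr_eq0// poweRe1.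
Qed.

Lemma window_coef_le1 M : \sum_(k < M) normc (window_coef k) ^+ 2 <= 1.
Proof.
rewrite -lee_fin -sq1; under eq_bigr do rewrite normc_coef.
exact: (bergman_bessel (lexx 0) taylor M).
Qed.

(** If all partial sums were at most 1 - e, then [bergman_L2] would give psi a squared norm at most
    1 - e. *)
Lemma window_coef_sup1 e : 0 < e ->
  exists J : nat, 1 - e < \sum_(k < J) normc (window_coef k) ^+ 2.
Proof.
move=> e0; apply: contrapT => /forallNP h.
have B M : \sum_(k < M) normc (taylor_coef psi k) ^+ 2 / gam (0 + 2) k <= 1 - e.
  under eq_bigr do rewrite -normc_coef.
  by rewrite leNgt; apply/negP; exact: h.
have [_] := bergman_L2 (lexx 0) taylor B.
by rewrite sq1 lee_fin leNgt gtrBl e0.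
Qed.

(** V is defined as a limit, whose existence has to be established first: |b_n| <= 1 and gam_n >= 1
    bound the coefficients by gam_n, and [gam_bounded] applies. *)
Lemma V_series alpha z : 0 <= alpha -> normc z < 1 ->
  cvgC (psum (fun k => window_coef k * (Num.sqrt (gam (alpha + 2) k))%:C) z) (V alpha psi z).
Proof.
move=> a0 z1; set a := fun k => _.
have s0 : 0 < alpha + 2 by rewrite ltr_wpDl.
pose r := (1 + normc z) / 2; have n0 := normc_ge0 z.
have r01 : 0 < r < 1 by rewrite /r; apply/andP; split; lra.
have zr : normc z < r by rewrite /r; lra.
have [M M0 MP] := gam_bounded s0 r01.
have [l hl] : exists l, cvgC (psum a z) l.
  apply: (psum_exists zr (M := M)) => n; apply: le_trans (MP n).
  apply: ler_wpM2r; first by rewrite exprn_ge0//; case/andP: r01 => /ltW.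
  have g1 : 1 <= gam (alpha + 2) n by apply: gam_ge1; rewrite ler_wpDl// ler1n.
  have g0 := gam_gt0 n s0.
  rewrite /a normcM normc_real ger0_norm ?sqrtr_ge0//.
  have b1 : normc (window_coef n) <= 1.
    rewrite -(@expr_le1 _ 2)// ?normc_ge0//.
    have := window_coef_le1 n.+1; rewrite big_ord_recr/=; apply: le_trans.
    by rewrite lerDr sumr_ge0// => k _; exact: sqr_ge0.
  rewrite -[leRHS]mul1r; apply: ler_pM; rewrite ?normc_ge0 ?sqrtr_ge0//.
  rewrite -[leRHS](@sqr_sqrtr _ (gam (alpha + 2) n)) ?(ltW g0)// expr2.
  by rewrite ler_peMr ?sqrtr_ge0// -[leLHS](sqrtr1 R) ler_wsqrtr.
suff -> : V alpha psi z = l by [].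
have aE : (fun n => taylor_coef psi n * (V_multiplier alpha n)%:C) = a.
  apply/funext => n; rewrite V_multiplierE// /a /window_coef -mulrA -rmorphM.
  by congr (_ * _%:C); rewrite mulrC.
rewrite /V aE power_seriesE; apply: (@cvg_lim R[i]^o (@norm_hausdorff _ _)).
exact/cvgCP.
Qed.

End window_coefficients.

(** * Convergence of the windowed Berezin transforms in L^p *)

Theorem theorem1p5 (R : realType) (psi : R[i] -> R[i])
    (hpsi : in_bergman 0 psi) (hpsi1 : bergman_norm 0 psi = 1%E)
    (p : R) (hp : 1 <= p) (f : R[i] -> R[i])
    (hf : in_CLp (@hyperbolic_measure R) (@disc R) p
            (fun w => f (complex_of_pair w))) :
  Lp_norm_TD p (fun xi z =>
      windowed_berezin alpha (V alpha psi) (fun _ w => f w) xi z - f z)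
    @[alpha --> +oo] --> 0%E.
Proof.
have [an _] := hpsi.
pose F := disc_extension f.
have p0 : 0 < p := lt_le_trans ltr01 hp.
have mF : Cmeasurable_fun setT F.
  have [[m1 m2] _] := hf.
  have E (g : R[i] -> R) : g 0 = 0 -> (fun w => g (F w)) = (fun w =>
    g (f (complex_of_pair w))) \_ (@disc R).
    move=> g0; apply/funext => w; rewrite patchE in_discE /F /disc_extension.
    by case: ifP => // _; rewrite g0.
  split.
    rewrite (E (@complex.Re R) erefl).
    exact: ((measurable_restrictT _ (@measurable_disc R)).1 m1).
  rewrite (E (@complex.Im R) erefl).
  exact: ((measurable_restrictT _ (@measurable_disc R)).1 m2).
have Ffin : (power_int p F < +oo)%E.
  have [_] := hf; rewrite /CLnorm Lnorm.unlock => h.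
  have := @lty_poweRy R _ p^-1 _ h; rewrite invr_neq0 ?gt_eqF// => /(_ isT).
  apply: le_lt_trans; apply: ge0_le_integralT => w; first exact: power_ge0.
  rewrite patchE in_discE /power /F /disc_extension; case: ifP => _.
    by rewrite gee0_abs ?lee_fin ?normc_ge0// poweR_EFin.
  by rewrite normc0 powR0 ?gt_eqF// poweR_ge0.
(* The approximate identity is indexed by all reals; replacing be by max(0, be) keeps the parameter
   admissible and changes nothing near +oo. *)
pose u (be : R) := V (Num.max 0 be) psi.
pose K (be : R) := radial_kernel (Num.max 0 be) (u be).
have be0 (be : R) : 0 <= Num.max 0 be by rewrite le_max lexx.
have b_le1 := window_coef_le1 an hpsi1; have b_sup1 := window_coef_sup1 an hpsi1.
have au be z : normc z < 1 -> cvgC (psum (fun k => window_coef psi k *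
    (Num.sqrt (gam (Num.max 0 be + 2) k))%:C) z) (u be z).
  by move=> z1; exact: V_series.
have mu be : disc_measurable (u be) := window_measurable (au be).
have mass be : (\int[@hyperbolic_measure R]_q angular_mean (Num.max 0%R be) (u be) q = 1)%E.
  rewrite -(hyperbolic_circle_average (angular_mean_ge0 (be0 be) (u be))
    (measurable_angular_mean (be0 be) (mu be))).
  rewrite -(kernel_mass (be0 be) b_le1 b_sup1 (au be)) -(radial_kernel_annulus (be0 be) (mu be)).
  by apply: eq_integral => q _; rewrite normc_ge0.
have K0 be w : (0 <= K be w)%E by exact: radial_kernel_ge0.
have mK be : measurable_fun setT (K be) by exact: measurable_radial_kernel.
have Krad be w : K be w = K be (pair_of_complex (normc (complex_of_pair w))%:C).
  exact: radial_kernelE.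
have K1 be : (\int[@hyperbolic_measure R]_w K be w = 1)%E.
  rewrite hyperbolic_circle_average; [exact: mass|exact: angular_mean_ge0|].
  exact: measurable_angular_mean.
have Ktail (rho e : R) : 0 < rho < 1 -> 0 < e -> exists A, forall be, A <= be ->
    (\int[@hyperbolic_measure R]_w (if (rho <= normc (complex_of_pair w))%R then K be w else 0) <=
      e%:E)%E.
  move=> r01 e0; have [A AP] := radial_kernel_tail b_le1 b_sup1 r01 e0.
  exists A => be Abe; rewrite radial_kernel_annulus//; apply: AP => //; last exact: au.
  by rewrite le_max Abe orbT.
have small_F := small_Lp K0 mK Krad K1 Ktail hp mF Ffin.
pose N (be : R) : \bar R := Lp_norm_TD p (fun xi z =>
  windowed_berezin be (V be psi) (fun _ w => f w) xi z - f z).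
rewrite -/N.
have bound be : 0 <= be -> (N be <= ((4 `^ p)%:E * oscillation K p be F) `^ p^-1)%E.
  move=> b0; have mb : Num.max 0 be = be by apply/max_idPr.
  have auB := au be; have muB := mu be; have massB := mass be.
  rewrite /u mb in auB muB massB.
  apply: (@berezin_Lp_bound R be b0 (V be psi) muB _ massB f mF p hp K be K0 mK).
    by have [] := window_L2 b0 b_le1 auB.
  by rewrite /K /u mb.
apply/fine_cvgP.
have key (e : R) : 0 < e -> \forall be \near +oo, (N be <= e%:E)%E.
  (* An oscillation of at most (e / 4)^p makes the bound (4^p (e / 4)^p)^(1/p) equal to e. *)
  move=> e0; have ep : 0 < (e / 4) `^ p by rewrite powR_gt0// divr_gt0.
  have [A AP] := small_F _ ep.
  exists (Num.max 0 A); split; first exact: num_real.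
  move=> be; rewrite gt_max => /andP[b0 Ab]; apply: le_trans (bound be (ltW b0)) _.
  have -> : e%:E = (((4 `^ p) * (e / 4) `^ p)%:E `^ p^-1)%E.
    rewrite poweR_EFin -powRM ?divr_ge0 ?(ltW e0)// -powRrM divff ?gt_eqF// powRr1.
      by congr (_%:E); field.
    by rewrite mulr_ge0// divr_ge0// ltW.
  have osc0 : (0 <= oscillation K p be F)%E.
    by apply: pair_mean_ge0 => // q; exact: power_ge0.
  have P0 : (0 <= (4 `^ p)%:E :> \bar R)%E by rewrite lee_fin powR_ge0.
  have pv0 : (0 <= p^-1)%R by rewrite invr_ge0 ltW.
  apply: (gt0_ler_poweR pv0); rewrite ?in_itv/= ?andbT ?leey ?andbT.
  - exact: mule_ge0.
  - by rewrite lee_fin mulr_ge0 ?powR_ge0.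
  by rewrite EFinM; apply: lee_wpmul2l => //; apply: AP; exact: ltW.
have norm0 be : (0 <= N be)%E by rewrite /N /Lp_norm_TD /CLnorm; exact: Lnorm_ge0.
split.
  near=> be; rewrite ge0_fin_numE//; apply: le_lt_trans (ltry 1).
  by near: be; exact: key.
apply/cvgrPdist_le => e e0; near=> be.
rewrite sub0r normrN ger0_norm ?fine_ge0//= -lee_fin fineK; first by near: be; exact: key.
rewrite ge0_fin_numE//; apply: le_lt_trans (ltry 1).
by near: be; exact: key.
Unshelve. all: by end_near.
Qed.
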